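(* Let $\mathcal{P}$ be a convex polyhedron in $\mathbb{R}^3$. If $\mathcal{P}$ is a universal tiler, then $\mathcal{P}$ is a tetrahedron or a pentahedron.
   Context: A polygon tiles the plane (is a tiler) if the plane can be covered by congruent copies of it without gaps or overlaps. Let $\mathcal{P}$ be a convex polyhedron in $\mathbb{R}^3$. For a plane $\pi$, let $C(\pi)=\pi\cap\mathcal{P}$. The plane $\pi$ intersects $\mathcal{P}$ trivially if $C(\pi)$ is empty, a point, or a line segment; otherwise it intersects (crosses) $\mathcal{P}$ nontrivially, in which case $C(\pi)$ is a polygon with at least $3$ edges and is called a cross-section of $\mathcal{P}$ (in particular, every facet, i.e. two-dimensional face, of $\mathcal{P}$ is a cross-section). A convex polyhedron $\mathcal{P}$ is a universal tiler if every cross-section of $\mathcal{P}$ tiles the plane. A tetrahedron (resp. pentahedron) is a convex polyhedron with exactly $4$ (resp. $5$) facets. *)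

(* Defs.v *)
From HB Require Import structures.
From mathcomp Require Import all_boot all_order all_algebra.
From mathcomp Require Import all_classical all_reals all_analysis.

Set Implicit Arguments.
Unset Strict Implicit.
Unset Printing Implicit Defensive.

Import Order.TTheory GRing.Theory Num.Theory.
Import numFieldNormedType.Exports.

Local Open Scope classical_set_scope.
Local Open Scope ring_scope.
Local Open Scope card_scope.

Definition dot (R : realType) (n : nat) (u v : 'rV[R]_n) : R :=
  \sum_(i < n) u 0 i * v 0 i.

(* The library norm of 'rV[R]_n is the sup norm, hence a separate Euclidean
   distance; both induce the same topology, so the library's [interior] and
   [bounded_set] can be used as they are. *)
Definition edist (R : realType) (n : nat) (x y : 'rV[R]_n) : R :=
  Num.sqrt (dot (x - y) (x - y)).

Definition hyperplane (R : realType) (n : nat) (a : 'rV[R]_n) (b : R)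
  : set 'rV[R]_n := [set x | dot a x = b].

Definition halfspace (R : realType) (n : nat) (a : 'rV[R]_n) (b : R)
  : set 'rV[R]_n := [set x | dot a x <= b].

Definition segment (R : realType) (n : nat) (x y : 'rV[R]_n)
  : set 'rV[R]_n := [set (1 - t) *: x + t *: y | t in `[0, 1]].

Definition flat (R : realType) (n : nat) (p : 'rV[R]_n) (U : 'M[R]_n)
  : set 'rV[R]_n := [set x | (x - p <= U)%MS].

(* The dimension of the affine hull, for nonempty A. *)
Definition has_affine_dim (R : realType) (n : nat) (A : set 'rV[R]_n)
    (d : nat) : Prop :=
  (exists p U, A `<=` flat p U /\ \rank U = d) /\
  (forall p U, A `<=` flat p U -> (d <= \rank U)%N).

(* The ambient dimensions may differ: below, A is a cross-section in space and
   B a tile in the Euclidean plane. Orientation may be reversed. *)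
Definition congruent (R : realType) (m n : nat)
    (A : set 'rV[R]_m) (B : set 'rV[R]_n) : Prop :=
  exists2 f : 'rV[R]_m -> 'rV[R]_n,
    (forall x y, A x -> A y -> edist (f x) (f y) = edist x y) & f @` A = B.

Definition tiles_plane (R : realType) (n : nat) (A : set 'rV[R]_n) : Prop :=
  exists tiling : set (set 'rV[R]_2),
    [/\ forall T, tiling T -> congruent A T,
        \bigcup_(T in tiling) T = setT
      & trivIset tiling (fun T : set 'rV[R]_2 => interior T)].

Definition convex_polyhedron (R : realType) (P : set 'rV[R]_3) : Prop :=
  [/\ exists (k : nat) (a : 'I_k -> 'rV[R]_3) (b : 'I_k -> R),
        (forall i, a i != 0) /\ P = \bigcap_i halfspace (a i) (b i),
      bounded_set P
    & interior P !=set0].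

Definition trivial_section (R : realType) (C : set 'rV[R]_3) : Prop :=
  [\/ C = set0, exists x, C = [set x] | exists x y, C = segment x y].

Definition cross_section (R : realType) (P C : set 'rV[R]_3) : Prop :=
  (exists (a : 'rV[R]_3) (b : R), a != 0 /\ C = hyperplane a b `&` P) /\
  ~ trivial_section C.

Definition universal_tiler (R : realType) (P : set 'rV[R]_3) : Prop :=
  convex_polyhedron P /\ forall C, cross_section P C -> tiles_plane C.

(* a = 0 is allowed, so that P itself and the empty set are faces. *)
Definition face (R : realType) (P F : set 'rV[R]_3) : Prop :=
  exists (a : 'rV[R]_3) (b : R),
    P `<=` halfspace a b /\ F = hyperplane a b `&` P.

Definition facets (R : realType) (P : set 'rV[R]_3) : set (set 'rV[R]_3) :=
  [set F | face P F /\ has_affine_dim F 2].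

Definition tetrahedron (R : realType) (P : set 'rV[R]_3) : Prop :=
  convex_polyhedron P /\ facets P #= `I_4.

Definition pentahedron (R : realType) (P : set 'rV[R]_3) : Prop :=
  convex_polyhedron P /\ facets P #= `I_5.

(* Submission.v *)
From HB Require Import structures.
Require Import Defs.
From mathcomp Require Import all_boot all_order all_algebra.
From mathcomp Require Import all_classical all_reals all_analysis.
From mathcomp Require Import complex.
From mathcomp Require Import ring lra zify.
Set Implicit Arguments.
Unset Strict Implicit.
Unset Printing Implicit Defensive.
Import Order.TTheory GRing.Theory Num.Theory.
Import numFieldNormedType.Exports.
Local Open Scope ring_scope.

(** Let [P] be a universal tiler. A plane section of [P] with [n] sides tiles the
plane, so around every vertex of the tiling some of its corner angles, counted
with multiplicities, sum to [pi] or [2 * pi], and every corner of the section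
occurs in such a sum ([vertex_relation]). Moreover, when no straight angle is such
a sum, the tiling is edge to edge, and the sides that meet around a vertex pair off into
sides of equal length ([tiling_parity]).

For a generic plane these relations are severely restricted. The outer normal of
a side is the projection of the normal of a facet, and its angle is the argument
of a quadratic polynomial in the stereographic parameter [z] of the direction of
the plane. The argument of an integral combination of such polynomials is
constant only if the coefficients cancel within each class of parallel facets,
because near a root of one of the polynomials only the factors of its class turn
([angle_prod_generic]); as there are countably many combinations, a generic plane
satisfies no others ([generic_plane]). Hence the multiplicity does not change
across a side whose facet has no parallel facet in the section, and the changes
at two parallel sides are opposite ([angle_relation]). Counting then shows that
there is no tiling if the section has at least five sides and no two are on
parallel facets ([no_parallel]), nor if it has at least seven sides
([many_sides]). For a hexagon in which only opposite sides can be parallel, the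
parity condition leaves no tiling as soon as certain sides have different lengths
([hexagon_parity]). These differ for generic planes: the length of a side is an
affine function of the level of the plane that vanishes at the level of a vertex
on its three facets, and for two sides to have the same length at a generic level
the two functions must have the same zeros ([good_plane]).

It remains to apply this to planes that cut off a few vertices: one vertex, all
but one of the vertices of a facet ([separable_facet]), or a vertex and its three
neighbours ([separable_star]). They show that a facet has at most five vertices
([facet_cycle]), that there are no pentagons ([no_pentagon]), that all vertices
lie on three facets ([vert_card3]), and that quadrilaterals do not meet in threes
([triangle_at_vertex]). So there is a triangle, all other facets are triangles or
quadrilaterals, and following the edges from the triangle closes up after four
facets, as a tetrahedron, or after five, as a triangular prism. *)

(** * Arcs tiling a circle *)

Section Circle.
Variables (R : realType) (L : R).
Hypothesis L0 : 0 < L.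

(** Membership of the points of the circle [R / L], given by representatives, in
the closed, open and half-open arcs of length [l] from [s]. *)
Definition in_carc (s l x : R) := exists k : int, s <= x + k%:~R * L <= s + l.
Definition in_oarc (s l x : R) := exists k : int, s < x + k%:~R * L < s + l.
Definition in_harc (s l x : R) := exists k : int, s <= x + k%:~R * L < s + l.

Lemma circle_shift (s x : R) : exists k : int, s <= x + k%:~R * L < s + L.
Proof.
exists (- Num.floor ((x - s) / L)).
have e : x = s + (x - s) / L * L by rewrite divfK ?gt_eqF //; ring.
have /andP[] := floor_itv ((x - s) / L).
rewrite intrD mulrNz; set y := (x - s) / L in e *; set f : R := _%:~R.
rewrite -(ler_pM2r L0) -(ltr_pM2r L0) => h1 h2.
by rewrite {1 2}e; apply/andP; split; lra.
Qed.

Lemma circle_int0 (k : int) (x : R) : 0 <= x + k%:~R * L < L -> 0 <= x < L -> k = 0.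
Proof.
move=> h1 h2; case: (ltgtP k 0) => // hk; exfalso.
- have : ((k + 1)%:~R : R) <= 0%:~R by rewrite ler_int; lia.
  by rewrite -(ler_pM2r L0) intrD mulr1z mulr0z => hk'; lra.
- have : (1%:~R : R) <= k%:~R by rewrite ler_int; lia.
  by rewrite -(ler_pM2r L0) => hk'; lra.
Qed.

Lemma not_harc_near (s l x : R) : 0 < l < L -> ~ in_harc s l x ->
  exists2 d : R, 0 < d & forall e, 0 < e < d -> ~ in_carc s l (x + e).
Proof.
move=> hl hn; have [k hk] := circle_shift s x.
have h : s + l <= x + k%:~R * L.
  by rewrite leNgt; apply/negP => h; apply: hn; exists k; lra.
exists (s + L - (x + k%:~R * L)); first by lra.
move=> e he [k' hk']; have : k' - k = 0.
  by apply: (@circle_int0 _ (x + e + k%:~R * L - s)); rewrite ?intrB; lra.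
by move/eqP; rewrite subr_eq0 => /eqP e'; subst k'; lra.
Qed.

Lemma harc_near (s l x : R) : in_harc s l x ->
  exists2 d : R, 0 < d & forall e, 0 < e < d -> in_oarc s l (x + e).
Proof.
move=> [k hk]; exists (s + l - (x + k%:~R * L)); first lra.
by move=> e he; exists k; lra.
Qed.

Lemma finite_pos (I : finType) (P : I -> R -> Prop) :
  (forall i, exists2 d : R, 0 < d & forall e, 0 < e < d -> P i e) ->
  exists2 d : R, 0 < d & forall e, 0 < e < d -> forall i, P i e.
Proof.
move=> h; pose d i := projT1 (cid2 (h i)).
have d0 i : 0 < d i by rewrite /d; case: (cid2 _).
have dP i e : 0 < e < d i -> P i e by rewrite /d; case: (cid2 _) => /= ? ? H /H.
have m0 : 0 < \big[Num.min/1]_i d i.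
  by elim/big_ind: _ => // x y hx hy; rewrite lt_min hx.
exists (\big[Num.min/1]_i d i) => // e /andP[e0 he] i; apply: dP; rewrite e0 /=.
by apply: lt_le_trans he _; apply: bigmin_le_cond.
Qed.

Variables (I : finType) (s l : I -> R).
Hypothesis l_bd : forall i, 0 < l i < L.
Hypothesis cover : forall x, exists i, in_carc (s i) (l i) x.
Hypothesis disj : forall i j x, in_oarc (s i) (l i) x -> in_oarc (s j) (l j) x -> i = j.

Lemma harc_cover x : exists i, in_harc (s i) (l i) x.
Proof.
apply: contrapT => /forallNP h.
have [i|d d0 hd] := @finite_pos I (fun i e => ~ in_carc (s i) (l i) (x + e)).
  exact: not_harc_near.
have [k] := cover (x + d / 2); apply: hd; lra.
Qed.

Lemma harc_uniq i j x : in_harc (s i) (l i) x -> in_harc (s j) (l j) x -> i = j.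
Proof.
move=> /harc_near[d d0 hd] /harc_near[d' d0' hd'].
have m0 : 0 < Num.min d d' by rewrite lt_min d0.
have [m1 m2] : Num.min d d' <= d /\ Num.min d d' <= d' by rewrite !ge_min !lexx orbT.
by apply: (disj (x := x + Num.min d d' / 2)); [apply: hd|apply: hd']; lra.
Qed.

(** The half-open arc that contains the end of [i] must start there, since the
points just before the end lie in the interior of [i]. *)
Lemma circle_next i : exists j, exists k : int, s j = s i + l i + k%:~R * L.
Proof.
have [j [k hk]] := harc_cover (s i + l i); exists j; exists k; apply/eqP.
rewrite eq_le; case/andP: (hk) => -> /= _; rewrite leNgt; apply/negP => h.
have li := l_bd i; have lj := l_bd j.
set x := s i + l i + _ in hk h.
pose d := Num.min (l i) (x - s j).
have m0 : 0 < d by rewrite lt_min; apply/andP; split; lra.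
have [m1 m2] : d <= l i /\ d <= x - s j by rewrite !ge_min !lexx orbT.
have ij : i = j.
  apply: (disj (x := s i + l i - d / 2)).
    by exists 0; rewrite mul0r addr0; lra.
  by exists k; rewrite /x in m2 hk h; lra.
subst j; rewrite /x in hk h.
have k0 : k = 0 by apply: (@circle_int0 _ (l i)); lra.
by subst k; lra.
Qed.

Lemma circle_prev_uniq i i' j (k k' : int) :
  s j = s i + l i + k%:~R * L -> s j = s i' + l i' + k'%:~R * L -> i = i'.
Proof.
move=> h h'; have li := l_bd i; have lj := l_bd i'.
pose d := Num.min (l i) (l i').
have m0 : 0 < d by rewrite lt_min; apply/andP; split; lra.
have [m1 m2] : d <= l i /\ d <= l i' by rewrite !ge_min !lexx orbT.
apply: (disj (x := s j - d / 2)).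
  by exists (- k); rewrite mulrNz; lra.
by exists (- k'); rewrite mulrNz; lra.
Qed.

(** Passing from each arc to the next permutes the representatives of the starting
points in the first turn, so the total length is [L] times the number of arcs that
straddle the origin; these are the arcs that contain the points just before the
origin, and there is exactly one. *)
Theorem circle_tiling :
  \sum_i l i = L /\ exists2 nx : I -> I, injective nx &
    forall i, exists k : int, s (nx i) = s i + l i + k%:~R * L.
Proof.
pose nx i := projT1 (cid (circle_next i)).
have nxP i : exists k : int, s (nx i) = s i + l i + k%:~R * L.
  by rewrite /nx; case: (cid _).
have nxI : injective nx.
  move=> i i' e; have [k hk] := nxP i; have [k'] := nxP i'; rewrite -e => hk'.
  exact: circle_prev_uniq hk hk'.
split; last by exists nx.
pose r i := projT1 (cid (circle_shift 0 (s i))).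
have rP i : 0 <= s i + (r i)%:~R * L < L.
  by rewrite /r; case: (cid _) => k /=; rewrite add0r.
pose t i := s i + (r i)%:~R * L.
pose w i := L <= t i + l i.
have tn i : t (nx i) = t i + l i - (w i)%:R * L.
  have [k hk] := nxP i; have := rP i; have := rP (nx i); have li := l_bd i.
  rewrite /t hk => h1 h2.
  have e : k + r (nx i) - r i = - (w i)%:Z.
    apply/eqP; rewrite -subr_eq0; apply/eqP.
    apply: (@circle_int0 _ (t i + l i - (w i)%:R * L)).
      by rewrite /t !(intrD, intrB, mulrNz) /= -pmulrn; lra.
    by rewrite /w /t; have [h|h] := leP L (s i + (r i)%:~R * L + l i); rewrite /=; lra.
  have -> : k = - (w i)%:Z + r i - r (nx i) by rewrite -e; ring.
  by rewrite !(intrD, intrB, mulrNz) /= -pmulrn; ring.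
have ts : \sum_i t i = \sum_i (t i + l i - (w i)%:R * L).
  rewrite (reindex_inj nxI) /=; exact: eq_bigr.
have {ts} -> : \sum_i l i = (\sum_i (w i)%:R) * L.
  have : \sum_i t i = \sum_i t i + \sum_i l i - (\sum_i (w i)%:R) * L.
    by rewrite {1}ts sumrB big_split mulr_suml.
  by set a := \sum_i t i; set b := \sum_i l i; set e := (_ * L); lra.
suff -> : \sum_i ((w i)%:R : R) = 1 by rewrite mul1r.
have [i|d d0 hd] := @finite_pos I (fun i e => (in_harc (s i) (l i) (L - e) <-> w i)).
  have := rP i; have li := l_bd i; rewrite -/(t i) => ht.
  rewrite /w; have [h|h] := leP L (t i + l i).
    exists (L - t i); first lra.
    move=> e he; split=> // _; exists (- r i); rewrite mulrNz.
    by rewrite /t in ht h he; lra.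
  exists (L - (t i + l i)); first lra.
  move=> e he; split=> // -[k hk].
  have : k + r i = 0.
    apply: (@circle_int0 _ (L - e)); last lra.
    by rewrite intrD; rewrite /t in ht h he; lra.
  move/eqP; rewrite addr_eq0 => /eqP ek; subst k.
  by move: hk; rewrite mulrNz; rewrite /t in ht h he; lra.
have [i hi] := harc_cover (L - d / 2).
rewrite (bigD1 i) //= (_ : w i); last by apply/(hd (d / 2)) => //; lra.
rewrite big1 ?addr0 // => j ji; case: (boolP (w j)) => // hj.
case/eqP: ji; apply: harc_uniq hi; apply/(hd (d / 2)) => //; lra.
Qed.
End Circle.

Local Open Scope classical_set_scope.
Local Open Scope ring_scope.

Lemma eqmodS n a b : a = b %[mod n] -> a.+1 = b.+1 %[mod n].
Proof. by move=> e; rewrite -addn1 -[b.+1]addn1 -modnDml e modnDml. Qed.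

Lemma eqmodSI n a b : a.+1 = b.+1 %[mod n] -> a = b %[mod n].
Proof. by move/eqP; rewrite -addn1 -[b.+1]addn1 eqn_modDr => /eqP. Qed.

Lemma eqmod_small n a k : (0 < k < n)%N -> ~ a = (a + k)%N %[mod n].
Proof.
move=> /andP[k0 kn] /eqP; rewrite -{1}[a]addn0 eqn_modDl mod0n modn_small //.
by case: k k0 {kn}.
Qed.

(** * The scalar product *)

Section Dot.
Variables (R : realType) (n : nat).
Implicit Types (u v w : 'rV[R]_n) (t : R).
Lemma dotC u v : dot u v = dot v u.
Proof. by apply: eq_bigr => i _; rewrite mulrC. Qed.
Lemma dotDr u v w : dot u (v + w) = dot u v + dot u w.
Proof. by rewrite -big_split; apply: eq_bigr => i _; rewrite mxE mulrDr. Qed.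
Lemma dotZr t u v : dot u (t *: v) = t * dot u v.
Proof. by rewrite mulr_sumr; apply: eq_bigr => i _; rewrite mxE; ring. Qed.
Lemma dotNr u v : dot u (- v) = - dot u v.
Proof. by rewrite -scaleN1r dotZr mulN1r. Qed.
Lemma dotBr u v w : dot u (v - w) = dot u v - dot u w.
Proof. by rewrite dotDr dotNr. Qed.
Lemma dotDl u v w : dot (v + w) u = dot v u + dot w u.
Proof. by rewrite !(dotC _ u) dotDr. Qed.
Lemma dotZl t u v : dot (t *: u) v = t * dot u v.
Proof. by rewrite !(dotC _ v) dotZr. Qed.
Lemma dotNl u v : dot (- u) v = - dot u v.
Proof. by rewrite !(dotC _ v) dotNr. Qed.
Lemma dotBl u v w : dot (v - w) u = dot v u - dot w u.
Proof. by rewrite dotDl dotNl. Qed.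
Lemma dot0r u : dot u 0 = 0. Proof. by rewrite -(scale0r 0) dotZr mul0r. Qed.
Lemma dot0l u : dot 0 u = 0. Proof. by rewrite dotC dot0r. Qed.
Lemma dot_sq u : u != 0 -> 0 < dot u u.
Proof.
move=> u0; rewrite lt_neqAle sumr_ge0 ?andbT => [|i _]; last by rewrite -expr2 sqr_ge0.
rewrite eq_sym; apply: contra u0 => /eqP h; apply/eqP/rowP => i; rewrite mxE.
have := psumr_eq0P (fun j _ => sqr_ge0 (u 0 j)) h.
by move=> /(_ i isT)/eqP; rewrite sqrf_eq0 => /eqP.
Qed.
End Dot.

(** * Directions in the plane *)

Section Plane.
Variable R : realType.
Implicit Types (x y : 'rV[R]_2) (s t a b g : R).

Definition turn : R := 2 * pi.
Lemma turn_gt0 : 0 < turn. Proof. by rewrite /turn mulr_gt0 ?pi_gt0. Qed.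

Lemma cos_turn t (k : int) : cos (t + k%:~R * turn) = cos t.
Proof.
have h (n : nat) u : cos (u + n%:R * turn) = cos u.
  elim: n u => [|n IH] u; first by rewrite mul0r addr0.
  rewrite -[RHS]IH -[RHS]cosD2pi; congr cos.
  by rewrite /turn -(natr1 n) mulr2n; ring.
case: k => n; first exact: h.
by rewrite -(h n.+1) NegzE mulrNz; congr cos; rewrite -pmulrn; ring.
Qed.

Lemma sin_turn t (k : int) : sin (t + k%:~R * turn) = sin t.
Proof. by rewrite -!cosBpihalf -[RHS](cos_turn _ k); congr cos; ring. Qed.

Definition vec (u v : R) : 'rV[R]_2 := \row_j (if j == 0 then u else v).
Definition dir t := vec (cos t) (sin t).

Lemma vec0 u v : vec u v 0 0 = u. Proof. by rewrite mxE. Qed.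
Lemma vec1 u v : vec u v 0 1 = v. Proof. by rewrite mxE. Qed.

Lemma vecP x y : x 0 0 = y 0 0 -> x 0 1 = y 0 1 -> x = y.
Proof.
move=> h0 h1; apply/matrixP => i j; rewrite (ord1 i).
by case: j => [[|[|//]]] hj; [rewrite (_ : Ordinal hj = 0) //|rewrite (_ : Ordinal hj = 1) //];
  apply: val_inj.
Qed.

Lemma mxB x y i : (x - y) 0 i = x 0 i - y 0 i. Proof. by rewrite !mxE. Qed.

Lemma dot2 x y : dot x y = x 0 0 * y 0 0 + x 0 1 * y 0 1.
Proof.
rewrite /dot !big_ord_recl big_ord0 addr0; congr (_ + _ * _); congr (_ _ _);
  exact: val_inj.
Qed.

Lemma dir_turn t (k : int) : dir (t + k%:~R * turn) = dir t.
Proof. by rewrite /dir cos_turn sin_turn. Qed.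

Lemma dot_dir s t : dot (dir s) (dir t) = cos (s - t).
Proof. by rewrite dot2 !vec0 !vec1 cosB. Qed.

Lemma cos_le0P t : cos t <= 0 <-> in_carc turn (pi / 2) pi t.
Proof.
have p0 := pi_gt0 R; rewrite /in_carc.
have [k hk] := circle_shift turn_gt0 (- (pi / 2)) t; rewrite -(cos_turn t k).
split.
- move=> h; set y := t + _ in hk h.
  have [e|ne] := eqVneq y (- (pi / 2)).
    exists (k + 1); have -> : t + (k + 1)%:~R * turn = y + turn.
      by rewrite /y intrD mulr1z; ring.
    by rewrite e /turn; lra.
  exists k; rewrite -/y; case: (leP (pi / 2) y) => h2 /=.
    by rewrite /turn in hk *; lra.
  have : 0 < cos y by apply: cos_gt0_pihalf; lra.
  by lra.
- move=> [l hl]; rewrite cos_turn -(cos_turn t l); set y := t + _ in hl *.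
  have -> : y = (y - pi) + pi by ring.
  by rewrite cosDpi oppr_le0; apply: cos_ge0_pihalf; lra.
Qed.

Lemma cos_lt0P t : cos t < 0 <-> in_oarc turn (pi / 2) pi t.
Proof.
have p0 := pi_gt0 R; split.
- move=> h; have /cos_le0P[k hk] := ltW h; exists k.
  have c : cos (t + k%:~R * turn) < 0 by rewrite cos_turn.
  move: hk c; set y := t + _ => hk c.
  rewrite !lt_neqAle; apply/andP; split; apply/andP; split; try lra.
    by apply/negP => /eqP e; rewrite -e cos_pihalf ltxx in c.
  apply/negP => /eqP e; rewrite e (_ : pi / 2 + pi = pi / 2 + pi) // in c.
  by rewrite cosDpi cos_pihalf oppr0 ltxx in c.
- move=> [l hl]; rewrite -(cos_turn t l); set y := t + _ in hl *.
  have -> : y = (y - pi) + pi by ring.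
  by rewrite cosDpi oppr_lt0; apply: cos_gt0_pihalf; lra.
Qed.

(** A convex sector is the intersection of two half-planes with outer normals [a]
and [a + g]. *)
Lemma sector_carcP a g t : 0 < g < pi ->
  cos (t - a) <= 0 /\ cos (t - (a + g)) <= 0 <->
  in_carc turn (a + g + pi / 2) (pi - g) t.
Proof.
move=> hg; have p0 := pi_gt0 R; split.
- move=> [/cos_le0P[k hk] h2]; exists k.
  suff : 0 <= t - (a + g) + k%:~R * turn - pi / 2 by lra.
  rewrite leNgt; apply/negP => h.
  have : 0 < cos (t - (a + g) + k%:~R * turn) by apply: cos_gt0_pihalf; lra.
  by rewrite cos_turn; lra.
- by move=> [k hk]; split; apply/cos_le0P; exists k; lra.
Qed.

Lemma sector_oarcP a g t : 0 < g < pi ->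
  cos (t - a) < 0 /\ cos (t - (a + g)) < 0 <->
  in_oarc turn (a + g + pi / 2) (pi - g) t.
Proof.
move=> hg; have p0 := pi_gt0 R; split.
- move=> [/cos_lt0P[k hk] h2]; exists k.
  suff : 0 < t - (a + g) + k%:~R * turn - pi / 2 by lra.
  rewrite ltNge; apply/negP => h.
  have : 0 <= cos (t - (a + g) + k%:~R * turn) by apply: cos_ge0_pihalf; lra.
  by rewrite cos_turn; lra.
- by move=> [k hk]; split; apply/cos_lt0P; exists k; lra.
Qed.

(** * Isometries of the plane *)

Record placement := Placement { pl_org : 'rV[R]_2; pl_ang : R; pl_ref : bool }.

Implicit Type p : placement.
Definition sg p : R := (-1) ^+ pl_ref p.
Lemma sgE p : sg p = 1 \/ sg p = -1.
Proof. by rewrite /sg; case: (pl_ref p); [right|left]; rewrite ?expr0 ?expr1. Qed.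

(** Here [mv] is the linear part of the isometry [glob]; [mvI] and [loc] are the
inverses. *)
Definition mv p x := x 0 0 *: dir (pl_ang p) + (sg p * x 0 1) *: dir (pl_ang p + pi / 2).
Definition mvI p y : 'rV[R]_2 :=
  vec (dot (dir (pl_ang p)) y) (sg p * dot (dir (pl_ang p + pi / 2)) y).
Definition loc p y := mvI p (y - pl_org p).
Definition glob p x := pl_org p + mv p x.

Let cs t : cos t * cos t + sin t * sin t = 1 :> R.
Proof. by rewrite -!expr2 cos2Dsin2. Qed.

Lemma dir_decomp x t :
  x = dot (dir t) x *: dir t + dot (dir (t + pi / 2)) x *: dir (t + pi / 2).
Proof.
have h := cs t; apply: vecP; rewrite !mxE /= !dot2 !mxE /= !cosDpihalf !sinDpihalf;
  move: h; set c := cos _; set s := sin _ => h.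
all: match goal with |- ?r = _ => transitivity ((c * c + s * s) * r); [by rewrite h mul1r | ring] end.
Qed.

Lemma mvK p : cancel (mv p) (mvI p).
Proof.
move=> x; have h := cs (pl_ang p); apply: vecP; rewrite ?vec0 ?vec1 !dot2 !mxE /= !cosDpihalf !sinDpihalf;
  case: (sgE p) => ->; move: h; set c := cos _; set s := sin _ => h.
all: match goal with |- _ = ?r => transitivity ((c * c + s * s) * r); [ring | by rewrite h mul1r] end.
Qed.

Lemma mvIK p : cancel (mvI p) (mv p).
Proof.
move=> x; have h := cs (pl_ang p); apply: vecP; rewrite !mxE /= !dot2 !mxE /= !cosDpihalf !sinDpihalf;
  case: (sgE p) => ->; move: h; set c := cos _; set s := sin _ => h.
all: match goal with |- _ = ?r => transitivity ((c * c + s * s) * r); [ring | by rewrite h mul1r] end.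
Qed.

Lemma locK p : cancel (loc p) (glob p).
Proof. by move=> y; rewrite /glob /loc mvIK subrKC. Qed.
Lemma globK p : cancel (glob p) (loc p).
Proof. by move=> y; rewrite /glob /loc addrC addKr mvK. Qed.

Lemma mvI_dir p t : mvI p (dir t) = dir (sg p * (t - pl_ang p)).
Proof.
apply: vecP; rewrite ?vec0 ?vec1 !dot_dir.
  case: (sgE p) => ->; first by rewrite mul1r -cosN opprB.
  by rewrite mulN1r opprB.
rewrite (_ : pl_ang p + pi / 2 - t = (pl_ang p - t) + pi / 2); last by ring.
rewrite cosDpihalf; case: (sgE p) => ->; first by rewrite !mul1r -sinN opprB.
by rewrite !mulN1r opprK opprB.
Qed.

Lemma mvID p x y : mvI p (x + y) = mvI p x + mvI p y.
Proof. by apply: vecP; rewrite !mxE /= !dotDr ?mulrDr. Qed.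
Lemma mvIZ p t x : mvI p (t *: x) = t *: mvI p x.
Proof. by apply: vecP; rewrite !mxE /= !dotZr //; ring. Qed.

Lemma loc_ray p y t a : loc p (y + t *: dir a) = loc p y + t *: dir (sg p * (a - pl_ang p)).
Proof. by rewrite /loc addrAC (mvID _ (y - _)) mvIZ mvI_dir. Qed.

Lemma dot_dir_mvI p a d : `|dot (dir a) (mvI p d)| <= `|d 0 0| + `|d 0 1|.
Proof.
have -> : dot (dir a) (mvI p d) = dot (dir (pl_ang p + sg p * a)) d.
  rewrite !dot2 /mvI !vec0 !vec1 !dot2 !vec0 !vec1 cosDpihalf sinDpihalf.
  by case: (sgE p) => ->; rewrite ?mulN1r ?mul1r cosD sinD ?cosN ?sinN; ring.
rewrite dot2 !vec0 !vec1; apply: le_trans (ler_normD _ _) _.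
by rewrite !normrM; apply: lerD; apply: ler_piMl => //; rewrite ?cos_max ?sin_max.
Qed.

(** * Convex polygons given by the outer normal angles of their sides *)

Section Polygon.
Variables (n : nat) (phi beta : nat -> R).

Definition pgset : set 'rV[R]_2 := [set y | forall k, dot (dir (phi k)) y <= beta k].
Definition tight y k := dot (dir (phi k)) y = beta k.
Definition inside y := forall k, dot (dir (phi k)) y < beta k.

(** The sides are indexed by all natural numbers, periodically, and the angles are
lifted so that they increase; side [k] and side [k.+1] meet in a corner, and no
two other sides touch. *)
Record polygon : Prop := Polygon {
  pg_n : (4 < n)%N;
  pg_phi : forall k, phi (k + n)%N = phi k + turn;
  pg_beta : forall k, beta (k + n)%N = beta k;
  pg_gap : forall k, 0 < phi k.+1 - phi k < pi;
  pg_corner : forall k, exists y, [/\ pgset y, tight y k & tight y k.+1];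
  pg_tight : forall y k l, pgset y -> tight y k -> tight y l ->
    [\/ k = l %[mod n], k = l.+1 %[mod n] | k.+1 = l %[mod n]];
  pg_bd : exists D : R, forall y, pgset y -> `|y 0 0| + `|y 0 1| <= D;
  pg_in : exists y, inside y }.

Hypothesis Pg : polygon.
Let n4 := pg_n Pg.
Let n0 : (0 < n)%N. Proof. by apply: leq_trans n4. Qed.

Lemma phi_mod k : exists m : int, phi k = phi (k %% n)%N + m%:~R * turn.
Proof.
rewrite {1}(divn_eq k n) addnC; elim: (k %/ n)%N => [|q [m IH]].
  by exists 0; rewrite mul0n addn0 mul0r addr0.
by exists (m + 1); rewrite mulSn [(n + _)%N]addnC addnA (pg_phi Pg) IH intrD; ring.
Qed.

Lemma beta_mod k : beta k = beta (k %% n)%N.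
Proof.
rewrite {1}(divn_eq k n) addnC; elim: (k %/ n)%N => [|q IH]; first by rewrite addn0.
by rewrite mulSn [(n + _)%N]addnC addnA (pg_beta Pg) IH.
Qed.

Lemma dir_mod k : dir (phi k) = dir (phi (k %% n)%N).
Proof. by have [m ->] := phi_mod k; rewrite dir_turn. Qed.

Lemma tight_mod y k l : k = l %[mod n] -> tight y k -> tight y l.
Proof. by rewrite /tight dir_mod beta_mod => ->; rewrite -dir_mod -beta_mod. Qed.

Lemma phi_eqmod k l : k = l %[mod n] -> exists m : int, phi k = phi l + m%:~R * turn.
Proof.
move=> e; have [m em] := phi_mod k; have [m' em'] := phi_mod l.
by exists (m - m'); rewrite em e em' intrB; ring.
Qed.

Lemma inside_ord y : (forall i : 'I_n, dot (dir (phi i)) y < beta i) -> inside y.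
Proof.
by move=> h k; rewrite dir_mod beta_mod; apply: h (Ordinal (ltn_pmod k n0)).
Qed.

(** Sides that are tight at a common point are neighbours, by [pg_tight]. *)
Lemma tight_cases x : pgset x ->
  [\/ inside x,
     exists k, (k < n)%N /\ tight x k /\ forall l, tight x l -> l = k %[mod n]
   | exists k, (k < n)%N /\ tight x k /\ tight x k.+1].
Proof.
move=> hx; case: (pselect (exists k, tight x k)) => [[k0 h0]|h]; last first.
  constructor 1 => k; rewrite lt_neqAle hx andbT; apply/negP => /eqP e.
  by apply: h; exists k.
pose k := (k0 %% n)%N; have hk : (k < n)%N by rewrite ltn_pmod.
have {h0} h0 : tight x k by apply: tight_mod h0; rewrite modn_mod.
case: (pselect (exists l, tight x l /\ l <> k %[mod n])) => [[l [hl ne]]|h]; last first.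
  constructor 2; exists k; split=> //; split=> // l hl.
  by apply: contrapT => ne; apply: h; exists l.
constructor 3; have [//|e|e] := pg_tight Pg hx hl h0.
  by exists k; split=> //; split=> //; apply: tight_mod hl.
exists (l %% n)%N; split; first by rewrite ltn_pmod.
split; first by apply: tight_mod hl; rewrite modn_mod.
by apply: tight_mod h0; rewrite -e; apply: eqmodS; rewrite modn_mod.
Qed.

Lemma corner_tight x k l : pgset x -> tight x k -> tight x k.+1 -> tight x l ->
  l = k %[mod n] \/ l = k.+1 %[mod n].
Proof.
move=> hx h1 h2 h3.
case: (pg_tight Pg hx h3 h1) => [|e|e]; [by left|by right|].
case: (pg_tight Pg hx h3 h2) => [|/eqmodS e'|/eqmodSI]; [by right| |by left].
have /eqmod_small[] : k = (k + 3)%N %[mod n] by rewrite -e e' addn3.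
by rewrite /=; apply: leq_trans n4.
Qed.

Lemma corner_uniq x y k : tight x k -> tight x k.+1 -> tight y k -> tight y k.+1 -> x = y.
Proof.
have := pg_gap Pg k; rewrite /tight !dot2 !vec0 !vec1 => /sin_gt0_pi.
rewrite sinB => s0 e1 e2 e3 e4.
have s1 : sin (phi k.+1) * cos (phi k) - cos (phi k.+1) * sin (phi k) != 0.
  by rewrite gt_eqF.
apply: vecP; apply: (mulfI s1); move: e1 e2 e3 e4;
  set a := cos _; set b := sin _; set c := cos _; set d := sin _ => e1 e2 e3 e4.
  have : d * (a * x 0 0 + b * x 0 1 - (a * y 0 0 + b * y 0 1)) -
    b * (c * x 0 0 + d * x 0 1 - (c * y 0 0 + d * y 0 1)) = 0.
    by rewrite e1 e2 e3 e4; ring.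
  by move=> h; apply/eqP; rewrite -subr_eq0 -h; apply/eqP; ring.
have : a * (c * x 0 0 + d * x 0 1 - (c * y 0 0 + d * y 0 1)) -
  c * (a * x 0 0 + b * x 0 1 - (a * y 0 0 + b * y 0 1)) = 0.
  by rewrite e1 e2 e3 e4; ring.
by move=> h; apply/eqP; rewrite -subr_eq0 -h; apply/eqP; ring.
Qed.

Lemma dot_ray x t a k : dot (dir (phi k)) (x + t *: dir a) =
  dot (dir (phi k)) x + t * cos (phi k - a).
Proof. by rewrite dotDr dotZr dot_dir. Qed.

(** The finitely many sides that are slack at [x] remain slack for a while. *)
Lemma ray_inside x a : pgset x -> (forall l, tight x l -> cos (a - phi l) < 0) ->
  exists2 d : R, 0 < d & forall t, 0 < t < d -> inside (x + t *: dir a).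
Proof.
move=> hx ha.
have [i|d d0 hd] := @finite_pos R 'I_n (fun i t => dot (dir (phi i)) (x + t *: dir a) < beta i).
  case: (pselect (tight x i)) => [hi|hi].
    exists 1 => // t /andP[t0 _]; rewrite dot_ray hi.
    by have := ha _ hi; rewrite -cosN opprB => h; nra.
  have h : dot (dir (phi i)) x < beta i by rewrite lt_neqAle hx andbT; apply/eqP.
  exists (beta i - dot (dir (phi i)) x); first lra.
  by move=> t /andP[t0 t1]; rewrite dot_ray; have := cos_le1 (phi i - a); nra.
by exists d => // t ht; apply: inside_ord; apply: hd.
Qed.

Lemma ray_outside x a : ~ (pgset x /\ forall l, tight x l -> cos (a - phi l) <= 0) ->
  exists2 d : R, 0 < d & forall t, 0 < t < d -> ~ pgset (x + t *: dir a).
Proof.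
move=> h; case: (pselect (pgset x)) => [hx|].
  have /existsNP[l /not_implyP[hl /negP]] : ~ forall l, tight x l -> cos (a - phi l) <= 0.
    by move=> h'; apply: h.
  rewrite -ltNge -cosN opprB => c0; exists 1 => // t /andP[t0 _] /(_ l).
  by rewrite dot_ray hl; nra.
move=> /existsNP[l /negP]; rewrite -ltNge => hl.
exists (dot (dir (phi l)) x - beta l); first lra.
move=> t /andP[t0 t1] /(_ l); rewrite dot_ray; have := cos_geN1 (phi l - a); nra.
Qed.

(** * Tiles *)

Definition tile p : set 'rV[R]_2 := [set y | pgset (loc p y)].

Lemma inside_margin x : inside x -> exists2 r : R, 0 < r &
  forall p (d : 'rV[R]_2), `|d 0 0| + `|d 0 1| < r -> inside (x + mvI p d).
Proof.
move=> hx.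
have [i|r r0 hr] := @finite_pos R 'I_n (fun i t => dot (dir (phi i)) x + t < beta i).
  exists (beta i - dot (dir (phi i)) x) => [|t ht]; last lra.
  by have := hx i; lra.
exists (r / 2) => [|p d hd]; first lra.
apply: inside_ord => k; rewrite dotDr; have := hr (r / 2) _ k.
have := dot_dir_mvI p (phi k) d; have := ler_norm (dot (dir (phi k)) (mvI p d)).
by move=> h1 h2 h3; have := h3 ltac:(lra); lra.
Qed.

Lemma inside_interior p y : inside (loc p y) -> interior (tile p) y.
Proof.
move=> /inside_margin[r r0 hr]; apply/nbhs_ballP; exists (r / 2) => /=; first lra.
move=> z [_ hz]; rewrite /tile /=.
have -> : loc p z = loc p y + mvI p (z - y).
  by rewrite /loc -mvID; congr mvI; rewrite [RHS]addrC addrA subrK.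
move=> k; apply/ltW/hr; have := hz 0 0; have := hz 0 1; rewrite /ball /= !mxE.
by rewrite ![`|y _ _ - _|]distrC; lra.
Qed.

Lemma glob_bd p x y : `|(glob p x - glob p y) 0 0| <= `|(x - y) 0 0| + `|(x - y) 0 1| /\
  `|(glob p x - glob p y) 0 1| <= `|(x - y) 0 0| + `|(x - y) 0 1|.
Proof.
have h (a b u v : R) : `|a| <= 1 -> `|b| <= 1 -> `|u * a + v * b| <= `|u| + `|v|.
  move=> ha hb; apply: le_trans (ler_normD _ _) _.
  by rewrite !normrM; apply: lerD; apply: ler_piMr.
have hs (u : R) : `|u| <= 1 -> `|sg p * u| <= 1.
  by case: (sgE p) => ->; rewrite ?mul1r // mulN1r normrN.
rewrite !mxE /=; split.
- set u := _ - _; have -> : u = (x 0 0 - y 0 0) * cos (pl_ang p) +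
    (x 0 1 - y 0 1) * (sg p * cos (pl_ang p + pi / 2)) by rewrite /u; ring.
  by apply: h; rewrite ?hs // cos_max.
- set u := _ - _; have -> : u = (x 0 0 - y 0 0) * sin (pl_ang p) +
    (x 0 1 - y 0 1) * (sg p * sin (pl_ang p + pi / 2)) by rewrite /u; ring.
  by apply: h; rewrite ?hs // sin_max.
Qed.

(** * Tilings by one polygon *)

Section Tiling.
Variable TT : set (set 'rV[R]_2).
Variable pl : set 'rV[R]_2 -> placement.
Hypothesis plE : forall T, TT T -> tile (pl T) = T.
Hypothesis cover : \bigcup_(T in TT) T = setT.
Hypothesis triv : trivIset TT (fun T : set 'rV[R]_2 => interior T).

Lemma tile_uniq T T' y : TT T -> TT T' ->
  inside (loc (pl T) y) -> inside (loc (pl T') y) -> T = T'.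
Proof.
move=> h h' /inside_interior i /inside_interior i'; apply: triv => //.
by exists y; split; [rewrite -(plE h)|rewrite -(plE h')].
Qed.

Lemma finite_int_bd (X : R) : finite_set [set k : int | `|k%:~R| <= X].
Proof.
pose N := Num.bound `|X|.
apply: (@sub_finite_set _ _ ((fun i : nat => i%:Z - N%:Z) @` `I_(N + N))).
  move=> k /= hk; have hX : `|X| < N%:R by apply: Num.Theory.archi_boundP.
  have : `|k%:~R| < N%:R :> R by apply: le_lt_trans hX; apply: le_trans hk (ler_norm _).
  rewrite -intr_norm -[N%:R]/(N%:Z%:~R) ltr_int => h.
  exists (absz (k + N%:Z : int)); move: h; rewrite /=; lia.
exact/finite_image/finite_II.
Qed.

Lemma floor_dist (a b : R) : Num.floor a = Num.floor b -> `|a - b| < 1.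
Proof.
by move=> e; have := floor_itv a; have := floor_itv b; rewrite -e intrD ltr_norml; lra.
Qed.

(** The images of a fixed inner point in different tiles have a minimal distance,
as each tile contains a disc of fixed size around it, so the cells of a fine grid
contain at most one of them each. *)
Lemma tiles_near_finite V : exists (m : nat) (F : 'I_m -> set 'rV[R]_2),
  [/\ forall i, TT (F i), injective F &
    forall T y, TT T -> T y -> `|(y - V) 0 0| <= 1 -> `|(y - V) 0 1| <= 1 ->
      exists i, F i = T].
Proof.
have [z hz] := pg_in Pg; have [r r0 hr] := inside_margin hz; have [D hD] := pg_bd Pg.
pose S := [set T | TT T /\ exists2 y, T y & `|(y - V) 0 0| <= 1 /\ `|(y - V) 0 1| <= 1].
pose c T := (Num.floor (glob (pl T) z 0 0 / (r / 2)), Num.floor (glob (pl T) z 0 1 / (r / 2))).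
have r2 : 0 < r / 2 by lra.
have c_inj : {in S &, injective c}.
  move=> T T' /set_mem[hT _] /set_mem[hT' _] [/floor_dist e0 /floor_dist e1].
  apply: (@tile_uniq _ _ (glob (pl T) z)) => //; first by rewrite globK.
  have -> : loc (pl T') (glob (pl T) z) =
      z + mvI (pl T') (glob (pl T) z - glob (pl T') z).
    by rewrite -{2}[z](globK (pl T')) /loc -mvID; congr mvI; rewrite [RHS]addrC addrA subrK.
  apply: hr; rewrite !mxE.
  have h (a b : R) : `|a / (r / 2) - b / (r / 2)| < 1 -> `|a - b| < r / 2.
    by rewrite -mulrBl normrM [`|_^-1|]gtr0_norm ?invr_gt0 // ltr_pdivrMr // mul1r.
  by have := h _ _ e0; have := h _ _ e1; rewrite /glob !mxE; lra.
have finS : finite_set S.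
  pose K := `|V 0 0| + `|V 0 1| + 1 + (`|z 0 0| + `|z 0 1| + D).
  have hB : finite_set (([set k : int | `|k%:~R| <= K / (r / 2) + 1 :> R] `*`
      [set k : int | `|k%:~R| <= K / (r / 2) + 1 :> R])).
    by apply: finite_setX; apply: finite_int_bd.
  rewrite -(eq_finite_set (inj_card_eq c_inj)).
  apply: sub_finite_set hB => _ [T [hT [y Ty [hy0 hy1]]] <-].
  have hl : pgset (loc (pl T) y) by move: Ty; rewrite -{1}(plE hT).
  have hb := hD _ hl; have [g0 g1] := glob_bd (pl T) z (loc (pl T) y).
  have n0' : `|(z - loc (pl T) y) 0 0| <= `|z 0 0| + `|loc (pl T) y 0 0|.
    by rewrite !mxE; apply: ler_normB.
  have n1' : `|(z - loc (pl T) y) 0 1| <= `|z 0 1| + `|loc (pl T) y 0 1|.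
    by rewrite !mxE; apply: ler_normB.
  have fl (a : R) : `|a| <= K -> `|(Num.floor (a / (r / 2)))%:~R : R| <= K / (r / 2) + 1.
    move=> ha; have := floor_itv (a / (r / 2)); rewrite intrD => hf.
    have : `|a / (r / 2)| <= K / (r / 2).
      by rewrite normrM [`|_^-1|]gtr0_norm ?invr_gt0 // ler_pM2r ?invr_gt0.
    by rewrite !ler_norml; lra.
  have aux (a b v : R) B : `|a - b| <= B -> `|b - v| <= 1 -> `|a| <= `|v| + 1 + B.
    move=> h1 h2; have -> : a = v + (b - v) + (a - b) by ring.
    apply: le_trans (ler_normD _ _) _; apply: lerD => //.
    by apply: le_trans (ler_normD _ _) _; apply: lerD.
  have V0 := normr_ge0 (V 0 0); have V1 := normr_ge0 (V 0 1).
  rewrite [(glob _ _ - _) 0 _]mxB locK in g0; rewrite [(glob _ _ - _) 0 _]mxB locK in g1.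
  rewrite mxB in hy0; rewrite mxB in hy1.
  by split; apply: fl; rewrite /K; [have := aux _ _ _ _ g0 hy0|have := aux _ _ _ _ g1 hy1]; lra.
have [m /card_esym /card_set_bijP[f [f1 f2 f3]]] := (finite_setP _).1 finS.
have fS (i : 'I_m) : S (f i) by apply: f1 => /=.
have fT i : TT (f (nat_of_ord i)) := (fS i).1.
exists m, (fun i => f i); split => //.
- by move=> i j /= e; apply: val_inj; apply: f2 => //; rewrite inE /=.
- move=> T y hT Ty h0 h1; have [|i /= im e] := f3 T; first by split=> //; exists y.
  by exists (Ordinal im).
Qed.

(** The shape of the polygon near a boundary point [x]: a half-plane when only side
[k] is tight, and the sector at the corner between the sides [k] and [k.+1] when
[c] holds. *)
Definition has_type x (c : bool) k := [/\ (k < n)%N, pgset x, tight x k &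
  if c then tight x k.+1 else forall l, tight x l -> l = k %[mod n]].
Definition arc_start (c : bool) k : R := (if c then phi k.+1 else phi k) + pi / 2.
Definition arc_len (c : bool) k : R := if c then pi - (phi k.+1 - phi k) else pi.
Definition start p c k : R :=
  if pl_ref p then pl_ang p - arc_start c k - arc_len c k else pl_ang p + arc_start c k.

Lemma arc_len_bd c k : 0 < arc_len c k <= pi.
Proof. by have := pg_gap Pg k; have := pi_gt0 R; rewrite /arc_len; case: c; lra. Qed.

Lemma type_uniq x c k k' : has_type x true k -> has_type x c k' -> c = true /\ k' = k.
Proof.
have n1 (a : nat) : ~ a = a.+1 %[mod n].
  by rewrite -addn1; apply: eqmod_small; rewrite /=; apply: leq_trans n4.
have n2 (a : nat) : ~ a = a.+2 %[mod n].
  by rewrite -addn2; apply: eqmod_small; rewrite /=; apply: leq_trans n4.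
move=> [k0 hx h1 h2] [k'0 _ h3]; case: c => h4; last first.
  by case: (n1 k); rewrite (h4 _ h1) (h4 _ h2).
split=> //; case: (corner_tight hx h1 h2 h3) => e.
  by move: e; rewrite !modn_small.
case: (corner_tight hx h1 h2 h4) => e'; have := eqmodS e; rewrite e' => e2.
  by case: (n2 k).
by case: (n1 k.+1).
Qed.

Lemma cos_phi_mod t k l : k = l %[mod n] -> cos (t - phi k) = cos (t - phi l).
Proof.
move=> /phi_eqmod[m ->]; rewrite -[LHS](cos_turn _ m); congr cos; ring.
Qed.

Lemma type_cone x c k t : has_type x c k ->
  (forall l, tight x l -> cos (t - phi l) <= 0) <->
  in_carc turn (arc_start c k) (arc_len c k) t.
Proof.
rewrite /arc_start /arc_len => -[k0 hx h1 h2]; case: c h2 => h2.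
- rewrite -[X in in_carc _ (X + _)](subrKC (phi k)).
  rewrite (_ : phi k + _ = phi k + (phi k.+1 - phi k)); last by ring.
  rewrite -sector_carcP ?(pg_gap Pg) // subrKC; split.
    by move=> h; split; apply: h.
  by move=> [c1 c2] l /(corner_tight hx h1 h2)[] /cos_phi_mod ->.
- split=> [/(_ _ h1) /cos_le0P[m hm]|[m hm] l /h2 /cos_phi_mod ->].
    by exists m; lra.
  by apply/cos_le0P; exists m; lra.
Qed.

Lemma type_cone_open x c k t : has_type x c k ->
  in_oarc turn (arc_start c k) (arc_len c k) t ->
  forall l, tight x l -> cos (t - phi l) < 0.
Proof.
rewrite /arc_start /arc_len => -[k0 hx h1 h2]; case: c h2 => h2.
- rewrite -[X in in_oarc _ (X + _)](subrKC (phi k)).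
  rewrite (_ : phi k + _ = phi k + (phi k.+1 - phi k)); last by ring.
  rewrite -sector_oarcP ?(pg_gap Pg) // subrKC.
  by move=> [c1 c2] l /(corner_tight hx h1 h2)[] /cos_phi_mod ->.
- move=> [m hm] l /h2 /cos_phi_mod ->.
  by apply/cos_lt0P; exists m; lra.
Qed.

Lemma start_carc p c k a : in_carc turn (start p c k) (arc_len c k) a <->
  in_carc turn (arc_start c k) (arc_len c k) (sg p * (a - pl_ang p)).
Proof.
rewrite /start /sg; case: (pl_ref p); rewrite ?expr0 ?expr1 ?mul1r ?mulN1r;
  split=> -[m hm]; [exists (- m)|exists (- m)|exists m|exists m]; rewrite ?mulrNz; lra.
Qed.

Lemma start_oarc p c k a : in_oarc turn (start p c k) (arc_len c k) a <->
  in_oarc turn (arc_start c k) (arc_len c k) (sg p * (a - pl_ang p)).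
Proof.
rewrite /start /sg; case: (pl_ref p); rewrite ?expr0 ?expr1 ?mul1r ?mulN1r;
  split=> -[m hm]; [exists (- m)|exists (- m)|exists m|exists m]; rewrite ?mulrNz; lra.
Qed.

Lemma start_ray p y t a : inside (loc p y + t *: dir (sg p * (a - pl_ang p))) ->
  inside (loc p (y + t *: dir a)).
Proof. by rewrite loc_ray. Qed.

(** Along each ray from [V] some tile occurs arbitrarily close to [V], as only
finitely many tiles come near [V], and inside the sectors only one does; so the
sectors at [V] of the tiles through [V] tile the circle of directions. *)
Lemma vertex_config V T0 k0 : TT T0 -> has_type (loc (pl T0) V) true k0 ->
  exists (I : finType) (F : I -> set 'rV[R]_2) (C : I -> bool) (K : I -> nat),
  [/\ forall i, TT (F i) /\ has_type (loc (pl (F i)) V) (C i) (K i),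
     forall T, TT T -> T V -> exists i, F i = T,
     forall a, exists i, in_carc turn (start (pl (F i)) (C i) (K i)) (arc_len (C i) (K i)) a &
     forall i j a, in_oarc turn (start (pl (F i)) (C i) (K i)) (arc_len (C i) (K i)) a ->
       in_oarc turn (start (pl (F j)) (C j) (K j)) (arc_len (C j) (K j)) a -> i = j].
Proof.
move=> hT0 ty0; have [m [F [FT F_inj Fnear]]] := tiles_near_finite V.
have ray_uniq T T' a : TT T -> TT T' -> pgset (loc (pl T) V) -> pgset (loc (pl T') V) ->
    (forall l, tight (loc (pl T) V) l -> cos (sg (pl T) * (a - pl_ang (pl T)) - phi l) < 0) ->
    (forall l, tight (loc (pl T') V) l -> cos (sg (pl T') * (a - pl_ang (pl T')) - phi l) < 0) ->
    T = T'.
  move=> hT hT' hV hV' /(ray_inside hV)[d d0 hd] /(ray_inside hV')[d' d'0 hd'].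
  have m0 : 0 < Num.min d d' by rewrite lt_min d0.
  have [m1 m2] : Num.min d d' <= d /\ Num.min d d' <= d' by rewrite !ge_min !lexx orbT.
  apply: (@tile_uniq _ _ (V + (Num.min d d' / 2) *: dir a)) => //; apply: start_ray.
    by apply: hd; lra.
  by apply: hd'; lra.
have typed T : TT T -> T V -> exists ck : bool * nat, has_type (loc (pl T) V) ck.1 ck.2.
  move=> hT; rewrite -{1}(plE hT) => TV; case: (tight_cases TV).
  - move=> hin; have [k00 hx0 h01 h02] := ty0.
    have lb := arc_len_bd true k0.
    pose a := start (pl T0) true k0 + arc_len true k0 / 2.
    have /start_oarc ha : in_oarc turn (start (pl T0) true k0) (arc_len true k0) a.
      by exists 0; rewrite mul0r /a; lra.
    have e : T = T0.
      apply: (ray_uniq _ _ a) => //.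
        by move=> l hl; have := hin l; rewrite hl ltxx.
      exact: type_cone_open ty0 ha.
    by have := hin k0; rewrite e h01 ltxx.
  - by move=> [k [kn [h1 h2]]]; exists (false, k); split.
  - by move=> [k [kn [h1 h2]]]; exists (true, k); split.
pose I := {i : 'I_m | `[< F i V >]}.
have FV (i : I) : F (val i) V by apply/asboolP; apply: valP i.
pose ck (i : I) := projT1 (cid (typed _ (FT (val i)) (FV i))).
have ckP (i : I) : has_type (loc (pl (F (val i))) V) (ck i).1 (ck i).2.
  by rewrite /ck; case: (cid _).
exists I, (fun i => F (val i)), (fun i => (ck i).1), (fun i => (ck i).2).
split=> [i|T hT TV|a|i j a hi hj]; first by split.
- have [||i e] := Fnear T V hT TV; rewrite ?subrr ?mxE ?normr0 //.
  have hV : `[< F i V >] by apply/asboolP; rewrite e.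
  by exists (exist _ i hV).
- apply: contrapT => /forallNP h.
  have [i|d d0 hd] := @finite_pos R 'I_m (fun i t => ~ F i (V + t *: dir a)).
    have [|d d0 hd] := @ray_outside (loc (pl (F i)) V) (sg (pl (F i)) * (a - pl_ang (pl (F i)))).
      move=> [hV hc]; have FiV : F i V by rewrite -(plE (FT i)).
      have hV' : `[< F i V >] by apply/asboolP.
      apply: (h (exist _ i hV')); apply/start_carc.
      by apply/(type_cone _ (ckP (exist _ i hV'))).
    exists d => // t ht; rewrite -(plE (FT i)) /tile /= loc_ray.
    exact: hd.
  pose t := Num.min d 1 / 2.
  have m0 : 0 < Num.min d 1 by rewrite lt_min d0 /=.
  have [m1 m2] : Num.min d 1 <= d /\ Num.min d 1 <= 1 by rewrite !ge_min !lexx orbT.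
  have : (\bigcup_(T in TT) T) (V + t *: dir a) by rewrite cover.
  move=> [T hT TV].
  have t1 (u : R) : `|u| <= 1 -> `|t * u| <= 1.
    move=> hu; rewrite normrM; apply: mulr_ile1 => //.
    by rewrite ger0_norm; rewrite /t; lra.
  have [||i e] := Fnear T _ hT TV.
  + by rewrite addrAC subrr add0r !mxE t1 // cos_max.
  + by rewrite addrAC subrr add0r !mxE t1 // sin_max.
  by apply: (hd t) (_ : F i _); rewrite ?e // /t; lra.
- apply/val_inj/F_inj.
  have [_ hVi _ _] := ckP i; have [_ hVj _ _] := ckP j.
  apply: (ray_uniq _ _ a); [exact: FT|exact: FT|exact: hVi|exact: hVj| |].
    by apply: type_cone_open (ckP i) _; apply/start_oarc.
  by apply: type_cone_open (ckP j) _; apply/start_oarc.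
Qed.

(** * Sides and corners *)

Definition corner k := projT1 (cid (pg_corner Pg k)).
Lemma cornerP k : [/\ pgset (corner k), tight (corner k) k & tight (corner k) k.+1].
Proof. by rewrite /corner; case: (cid _). Qed.

Lemma corner_mod k l : k = l %[mod n] -> corner k = corner l.
Proof.
move=> e; have [_ h1 h2] := cornerP k; have [_ h3 h4] := cornerP l.
apply: corner_uniq h1 h2 _ _; first exact: tight_mod h3.
by apply: tight_mod h4; apply: eqmodS.
Qed.

Lemma corner_type k : has_type (corner k) true (k %% n).
Proof.
have [h1 h2 h3] := cornerP k; split; rewrite ?ltn_pmod //.
  by apply: tight_mod h2; rewrite modn_mod.
by apply: tight_mod h3; apply: eqmodS; rewrite modn_mod.
Qed.

Lemma type_corner x k : has_type x true k -> x = corner k.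
Proof.
by move=> [_ _ h1 h2]; have [_ h3 h4] := cornerP k; apply: corner_uniq h1 h2 h3 h4.
Qed.

(** This is the length of the side [k.+1], which joins the corners [k] and [k.+1]. *)
Definition slen k := dot (dir (phi k.+1 + pi / 2)) (corner k.+1 - corner k).

Lemma slen_mod k l : k = l %[mod n] -> slen k = slen l.
Proof.
move=> e; rewrite /slen (corner_mod e) (corner_mod (eqmodS e)).
have [m ->] := phi_eqmod (eqmodS e).
by rewrite (_ : _ + pi / 2 = phi l.+1 + pi / 2 + m%:~R * turn) ?dir_turn //; ring.
Qed.

Lemma corner_next k : corner k.+1 = corner k + slen k *: dir (phi k.+1 + pi / 2).
Proof.
have [_ _ h] := cornerP k; have [_ h' _] := cornerP k.+1.
have h0 : dot (dir (phi k.+1)) (corner k.+1 - corner k) = 0 by rewrite dotBr h h' subrr.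
rewrite -[LHS](subrKC (corner k)) [_ - _](dir_decomp _ (phi k.+1)) h0 scale0r add0r.
by rewrite /slen.
Qed.

Lemma slen_gt0 k : 0 < slen k.
Proof.
have [hk h1 h2] := cornerP k; have [_ _ h3] := cornerP k.+1.
have : dot (dir (phi k.+2)) (corner k) < beta k.+2.
  rewrite lt_neqAle hk andbT; apply/eqP => h4.
  have n1 : (1 < n)%N by apply: leq_trans n4.
  have n2 : (2 < n)%N by apply: leq_trans n4.
  case: (corner_tight hk h1 h2 h4) => /esym; rewrite -[k.+2]addn2.
    by apply: eqmod_small; rewrite n2.
  by rewrite addn2 -[k.+2]addn1; apply: eqmod_small; rewrite n1.
move: h3; rewrite /tight corner_next dot_ray => <-.
rewrite (_ : phi k.+2 - (phi k.+1 + pi / 2) = phi k.+2 - phi k.+1 - pi / 2); last by ring.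
rewrite cosBpihalf; have /sin_gt0_pi := pg_gap Pg k.+1.
by set s := sin _ => s0 h; rewrite -(pmulr_lgt0 _ s0); lra.
Qed.

Lemma side_type k t : 0 < t < slen k ->
  has_type (corner k + t *: dir (phi k.+1 + pi / 2)) false (k.+1 %% n).
Proof.
move=> ht; have [hk h1 h2] := cornerP k; have [hk' h1' h2'] := cornerP k.+1.
have conv l : dot (dir (phi l)) (corner k + t *: dir (phi k.+1 + pi / 2)) <= beta l /\
    (tight (corner k + t *: dir (phi k.+1 + pi / 2)) l -> tight (corner k) l /\ tight (corner k.+1) l).
  have := hk l; have := hk' l; rewrite /tight corner_next !dot_ray.
  by set a := dot _ _; set c := cos _ => ha ha'; split; [nra|move=> e; split; nra].
split; rewrite ?ltn_pmod //.
- by move=> l; case: (conv l).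
- apply: (@tight_mod _ k.+1); first by rewrite modn_mod.
  rewrite /tight dot_ray h2 (_ : phi k.+1 - _ = - (pi / 2)); last by ring.
  by rewrite cosN cos_pihalf mulr0 addr0.
- move=> l hl; case: (conv l) => _ /(_ hl)[hl1 hl2]; rewrite modn_mod.
  case: (corner_tight hk h1 h2 hl1) => // e1; case: (corner_tight hk' h1' h2' hl2) => // e2.
  have [] := @eqmod_small n k 2; first by apply: leq_trans n4.
  by rewrite addn2 -e2 -e1.
Qed.

Lemma side_type_back k t : 0 < t < slen k ->
  has_type (corner k.+1 - t *: dir (phi k.+1 + pi / 2)) false (k.+1 %% n).
Proof.
move=> ht; rewrite corner_next -addrA -scalerBl; apply: side_type; lra.
Qed.

Lemma dirDpi t : dir (t + pi) = - dir t.
Proof. by apply: vecP; rewrite !mxE /= ?cosDpi ?sinDpi. Qed.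

(** Two tiles of an edge-to-edge tiling that share a ray along which both have a
side have sides of the same length there ([next_lens]); this is what one of them
contributes to the comparison. *)
Definition runs p V a l := (forall t, 0 < t < l -> exists k, has_type (loc p (V + t *: dir a)) false k)
  /\ exists k, has_type (loc p (V + l *: dir a)) true k.

(** The lengths of the two sides at the corner [k], in the order in which a
counterclockwise turn meets them; a reflection swaps them. *)
Definition start_len p k := if pl_ref p then slen (k + n.-1) else slen k.
Definition end_len p k := if pl_ref p then slen k else slen (k + n.-1).

Lemma runs_fwd p V k a : has_type (loc p V) true k ->
  sg p * (a - pl_ang p) = phi k.+1 + pi / 2 -> runs p V a (slen k).
Proof.
move=> /type_corner e ea; split=> [t ht|].
  by exists (k.+1 %% n)%N; rewrite loc_ray e ea; apply: side_type.
by exists (k.+1 %% n)%N; rewrite loc_ray e ea -corner_next; apply: corner_type.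
Qed.

Lemma runs_bwd p V k a : has_type (loc p V) true k ->
  sg p * (a - pl_ang p) = phi k + pi / 2 + pi -> runs p V a (slen (k + n.-1)).
Proof.
have e2 : (k + n.-1).+1 = (k + n)%N by rewrite -addnS prednK.
move=> /type_corner e ea; have e3 : corner k = corner (k + n.-1).+1.
  by apply: corner_mod; rewrite e2 modnDr.
have e4 : dir (phi k + pi / 2 + pi) = - dir (phi (k + n.-1).+1 + pi / 2).
  by rewrite dirDpi e2 (pg_phi Pg) -[in RHS](dir_turn _ (-1)); congr (- dir _); rewrite mulrNz mulr1z; ring.
split=> [t ht|].
  exists ((k + n.-1).+1 %% n)%N; rewrite loc_ray e ea e3 e4 scalerN.
  exact: side_type_back.
exists ((k + n.-1) %% n)%N; rewrite loc_ray e ea e3 e4 scalerN corner_next addrK.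
exact: corner_type.
Qed.

Lemma start_runs p V k : has_type (loc p V) true k ->
  runs p V (start p true k) (start_len p k).
Proof.
move=> ty; rewrite /start /start_len; case e: (pl_ref p).
  by apply: runs_bwd => //; rewrite /sg e expr1 /arc_start /arc_len; ring.
by apply: runs_fwd => //; rewrite /sg e expr0 /arc_start; ring.
Qed.

Lemma end_runs p V k : has_type (loc p V) true k ->
  runs p V (start p true k + arc_len true k) (end_len p k).
Proof.
move=> ty; rewrite /start /end_len; case e: (pl_ref p).
  by apply: runs_fwd => //; rewrite /sg e expr1 /arc_start /arc_len; ring.
by apply: runs_bwd => //; rewrite /sg e expr0 /arc_start /arc_len; ring.
Qed.

(** * Relations between the angles at a vertex of the tiling *)

Definition edge_to_edge := forall T k T' k' U, TT T -> TT T' ->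
  has_type (loc (pl T) U) true k -> has_type (loc (pl T') U) false k' -> False.

Lemma next_lens T T' V a l l' : edge_to_edge -> TT T -> TT T' -> 0 < l -> 0 < l' ->
  runs (pl T) V a l -> runs (pl T') V a l' -> l = l'.
Proof.
move=> noT h h' l0 l0' [r1 [k e1]] [r1' [k' e1']].
case: (ltgtP l l') => // ll'; exfalso.
  by have [|k2 e2] := r1' l; [rewrite l0|apply: noT h h' e1 e2].
by have [|k2 e2] := r1 l'; [rewrite l0'|apply: noT h' h e1' e2].
Qed.

Definition corner_angle k : R := pi - (phi k.+1 - phi k).

Section Vertex.
Variables (V : 'rV[R]_2) (T0 : set 'rV[R]_2) (k0 : nat).
Hypotheses (hT0 : TT T0) (ty0 : has_type (loc (pl T0) V) true k0).

(** At most one of the tiles around [V] has [V] in the relative interior of a side,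
because the angle of [T0] is positive; [t] is 1 if there is one, and 2 otherwise.
In the edge to edge case the side that ends the sector of one tile is the side that starts the
next sector, so each length is counted twice. *)
Theorem vertex_relation : exists (m : nat -> nat) (t : nat),
  [/\ (forall k, m (k + n) = m k)%N /\ (0 < m k0)%N, (t = 1)%N \/ (t = 2)%N,
    \sum_(k < n) (m k)%:R * corner_angle k = t%:R * pi :> R,
    ((exists T k, TT T /\ has_type (loc (pl T) V) false k) -> t = 1%N) &
    (edge_to_edge -> forall x : R, ~~ odd (\sum_(k < n) m k * ((slen (k + n.-1) == x) + (slen k == x))))].
Proof.
have [I [F [C [K [hF hall hc hd]]]]] := vertex_config hT0 ty0.
have FT i := (hF i).1; have FV i := (hF i).2.
have p0 := pi_gt0 R.
have [|sumI [nx nxI nxP]] := circle_tiling turn_gt0 _ hc hd.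
  by move=> i; have := arc_len_bd (C i) (K i); rewrite /turn; lra.
have TV0 : T0 V by rewrite -(plE hT0); have [] := ty0.
have [i0 Fi0] := hall _ hT0 TV0.
have [Ci0 Ki0] : C i0 = true /\ K i0 = k0.
  by apply: (type_uniq ty0); have := FV i0; rewrite Fi0.
pose m k := (\sum_i (C i && (K i == k %% n)))%N.
pose H := (\sum_i (~~ C i))%N.
have Kn i : (K i < n)%N by have [] := FV i.
have split_sum (f : nat -> R) : \sum_(i | C i) f (K i) = \sum_(k < n) (m k)%:R * f k.
  rewrite (eq_bigr (fun i => \sum_(k < n) (K i == k)%:R * f k)); last first.
    move=> i _; rewrite (bigD1 (Ordinal (Kn i))) //= eqxx mul1r big1 ?addr0 // => k.
    by rewrite -val_eqE /= eq_sym => /negbTE ->; rewrite mul0r.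
  rewrite exchange_big /=; apply: eq_bigr => k _; rewrite -mulr_suml; congr (_ * _).
  rewrite /m modn_small // natr_sum big_mkcond /=; apply: eq_bigr => i _; by case: (C i).
have sumE : H%:R * pi + \sum_(k < n) (m k)%:R * corner_angle k = 2 * pi :> R.
  rewrite -split_sum -[RHS]sumI [in RHS](bigID C) /= addrC; congr (_ + _).
    rewrite (eq_bigr (fun=> pi)) => [|i /negbTE hi]; last by rewrite /arc_len hi.
    rewrite /H natr_sum mulr_suml [RHS]big_mkcond /=.
    by apply: eq_bigr => i _; case: (C i); rewrite ?mul0r ?mul1r.
  by apply: eq_bigr => i hi; rewrite /arc_len hi.
have k0n : (k0 < n)%N by have [] := ty0.
have m0 : (0 < m k0)%N by rewrite /m (bigD1 i0) //= Ci0 Ki0 modn_small ?eqxx.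
have ca k : 0 < corner_angle k.
  by rewrite /corner_angle; have := pg_gap Pg k; lra.
have S0 : 0 < \sum_(k < n) (m k)%:R * corner_angle k.
  rewrite (bigD1 (Ordinal k0n)) //= ltr_pwDl //; first by rewrite mulr_gt0 ?ltr0n.
  by apply: sumr_ge0 => k _; rewrite mulr_ge0 // ltW.
have H2 : (H < 2)%N.
  rewrite ltnNge; apply/negP => h.
  have : 2%:R <= H%:R :> R by rewrite ler_nat.
  by move: S0 sumE; set S := \sum_(_ < _) _; nra.
exists m, (2 - H)%N; split => //.
- by split=> // k; apply: eq_bigr => i _; rewrite modnDr.
- by case: (H) H2 => [|[|]]; [right|left|].
- rewrite natrB; last by case: (H) H2 => [|[|]].
  by move: sumE; set S := \sum_(_ < _) _; lra.
- move=> [T [k [hT ty]]].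
  have TV : T V by rewrite -(plE hT); have [] := ty.
  have [i Fi] := hall _ hT TV.
  have Ci : C i = false.
    apply/negbTE/negP => Ci; have := FV i; rewrite Fi Ci => ty'.
    by have [] := type_uniq ty' ty.
  suff -> : H = 1%N by [].
  by apply/eqP; rewrite eqn_leq -ltnS H2 /H (bigD1 i) //= Ci.
move=> noT x.
have Call i : C i = true.
  case e: (C i) => //; have := FV i; rewrite e => ty.
  by case: (noT _ _ _ _ _ hT0 (FT i) ty0 ty).
pose Ls i := start_len (pl (F i)) (K i); pose Le i := end_len (pl (F i)) (K i).
have len0 i : 0 < Ls i /\ 0 < Le i.
  by rewrite /Ls /Le /start_len /end_len; case: (pl_ref _); split; apply: slen_gt0.
have LeLs i : Le i = Ls (nx i).
  have ty j : has_type (loc (pl (F j)) V) true (K j) by have := FV j; rewrite Call.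
  have r1 := end_runs (ty i); have r2 := start_runs (ty (nx i)).
  have [k ek] := nxP i; rewrite !Call in ek.
  have er : runs (pl (F (nx i))) V (start (pl (F i)) true (K i) + arc_len true (K i)) (Ls (nx i)).
    by move: r2; rewrite /runs ek dir_turn.
  by apply: (next_lens noT _ _ _ _ r1 er); rewrite ?FT ?(len0 i).2 ?(len0 _).1.
have : (\sum_(k < n) m k * ((slen (k + n.-1) == x) + (slen k == x)) =
    \sum_i ((Ls i == x) + (Le i == x)))%N.
  rewrite [RHS](eq_bigr (fun i => \sum_(k < n) (K i == k) *
      ((slen (k + n.-1) == x) + (slen k == x))))%N; last first.
    move=> i _; rewrite (bigD1 (Ordinal (Kn i))) //= eqxx mul1n big1 ?addn0 => [|k].
      by rewrite /Ls /Le /start_len /end_len; case: (pl_ref _); rewrite // addnC.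
    by rewrite -val_eqE /= eq_sym => /negbTE ->; rewrite mul0n.
  rewrite exchange_big /=; apply: eq_bigr => k _; rewrite -big_distrl /=; congr (_ * _)%N.
  by apply: eq_bigr => i _; rewrite Call modn_small.
move=> ->; rewrite big_split /=.
have -> : (\sum_i (Le i == x) = \sum_i (Ls i == x))%N.
  by rewrite [RHS](reindex_inj nxI) /=; apply: eq_bigr => i _; rewrite LeLs.
by rewrite addnn odd_double.
Qed.
End Vertex.

Definition periodic_nat (m : nat -> nat) := forall k, m (k + n)%N = m k.

Lemma some_corner k0 : (k0 < n)%N ->
  exists T V, TT T /\ has_type (loc (pl T) V) true k0.
Proof.
move=> kn; have : (\bigcup_(T in TT) T) (0 : 'rV[R]_2) by rewrite cover.
move=> [T hT _]; exists T, (glob (pl T) (corner k0)); split=> //.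
by rewrite globK -(modn_small kn); have := corner_type k0; rewrite modn_small.
Qed.

Theorem tiling_relation k0 : (k0 < n)%N -> exists (m : nat -> nat) (t : nat),
  [/\ periodic_nat m, (0 < m k0)%N, (t = 1)%N \/ (t = 2)%N &
    \sum_(k < n) (m k)%:R * corner_angle k = t%:R * pi :> R].
Proof.
move=> /some_corner[T [V [hT ty]]]; have [m [t [[m1 m2] t12 h _ _]]] := vertex_relation hT ty.
by exists m, t; split.
Qed.

(** A corner of one tile inside a side of another would compose a straight angle of
corner angles, so under the hypothesis the tiling is edge to edge. *)
Theorem tiling_parity k0 : (k0 < n)%N ->
  (forall m, periodic_nat m -> (exists2 k, (k < n)%N & (0 < m k)%N) ->
     \sum_(k < n) (m k)%:R * corner_angle k = pi :> R -> False) ->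
  exists m : nat -> nat,
  [/\ periodic_nat m, (0 < m k0)%N,
    \sum_(k < n) (m k)%:R * corner_angle k = 2 * pi :> R &
    forall x : R, ~~ odd (\sum_(k < n) m k * ((slen (k + n.-1) == x) + (slen k == x)))].
Proof.
move=> kn no1; have e2e : edge_to_edge.
  move=> T k T' k' U hT hT' ty ty'; have [kn' _ _ _] := ty.
  have [m [t [[m1 m2] t12 h t1 _]]] := vertex_relation hT ty.
  apply: (no1 m m1); first by exists k.
  by rewrite h t1 ?mul1r //; exists T', k'.
have [T [V [hT ty]]] := some_corner kn.
have [m [t [[m1 m2] [t12|t12] h _ /(_ e2e) par]]] := vertex_relation hT ty.
  by exfalso; apply: (no1 m m1); [exists k0|rewrite h t12 mul1r].
by exists m; split=> //; rewrite h t12.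
Qed.

End Tiling.
End Polygon.
End Plane.

Local Close Scope classical_set_scope.

(** * Angle relations that hold for generic reasons *)

Section Relations.
Variable R : realType.

Lemma sum_shift (n a : nat) (f : nat -> R) : (forall k, f (k + n)%N = f k) ->
  \sum_(k < n) f (k + a)%N = \sum_(k < n) f k.
Proof.
move=> fp; elim: a => [|a IH]; first by apply: eq_bigr => k _; rewrite addn0.
rewrite -IH; case: n fp {IH} => [|n] fp; first by rewrite !big_ord0.
rewrite big_ord_recr big_ord_recl /= addrC add0n; congr (_ + _).
  by rewrite -[RHS]fp addnS addnC addnS.
by apply: eq_bigr => i _; rewrite /bump /= add1n addSnnS.
Qed.

(** Here [phi] lists the angles of the outer normals of the sides of a convex
[n]-gon, and [P k l] says that the sides [k] and [l] lie on parallel facets, so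
that they are parallel in all sections. *)
Record side_angles (n : nat) (phi : nat -> R) (P : nat -> nat -> Prop) : Prop := SideAngles {
  sa_phi : forall k, phi (k + n)%N = phi k + turn R;
  sa_gap : forall k, 0 < phi k.+1 - phi k < pi;
  sa_sym : forall k l, P k l -> P l k;
  sa_per : forall k l, P k l -> P k (l + n)%N;
  sa_perI : forall k l, P k (l + n)%N -> P k l;
  sa_opp : forall k l, P k l -> exists j : int, phi l = phi k + pi + j%:~R * turn R }.

(** Here [m k] counts the corners between the sides [k] and [k.+1], so that
[m k.+1 - m k] is attached to the side [k.+1]. *)
Definition balanced (n : nat) (P : nat -> nat -> Prop) (m : nat -> nat) := forall k,
  ((forall l, ~ P k.+1 l) -> m k.+1 = m k) /\
  (forall l, P k.+1 l.+1 -> (m k.+1 + m l.+1 = m k + m l)%N).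

Definition relation n phi P (m : nat -> nat) (t : nat) :=
  [/\ forall k, m (k + n)%N = m k, balanced n P m, (t = 1)%N \/ (t = 2)%N &
    \sum_(k < n) (m k)%:R * (pi - (phi k.+1 - phi k)) = t%:R * pi :> R].

Section Fixed.
Variables (n : nat) (phi : nat -> R) (P : nat -> nat -> Prop).
Hypothesis SA : side_angles n phi P.

Lemma phi_lt k l : (k < l)%N -> phi k < phi l.
Proof.
elim: l => // l IH; rewrite ltnS leq_eqVlt => /predU1P[->|/IH h].
  by have := sa_gap SA l; lra.
by apply: lt_trans h _; have := sa_gap SA l; lra.
Qed.

Lemma phi_le k l : (k <= l)%N -> phi k <= phi l.
Proof. by rewrite leq_eqVlt => /predU1P[->//|/phi_lt/ltW]. Qed.

Lemma phi_ltE k l : (phi k < phi l) = (k < l)%N.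
Proof.
by case: (ltnP k l) => [/phi_lt //|/phi_le h]; apply/negbTE; rewrite -leNgt.
Qed.

Lemma phi_inj k l : phi k = phi l -> k = l.
Proof. by move=> e; apply/eqP; rewrite eqn_leq leqNgt -phi_ltE e ltxx leqNgt -phi_ltE e ltxx. Qed.

Lemma phi_mul k q : phi (k + q * n)%N = phi k + q%:R * turn R.
Proof.
elim: q => [|q IH]; first by rewrite mul0n addn0 mul0r addr0.
by rewrite mulSn [(n + _)%N]addnC addnA (sa_phi SA) IH -natr1; ring.
Qed.

Lemma P_mul k l q : P k l <-> P k (l + q * n)%N.
Proof.
elim: q => [|q IH]; first by rewrite mul0n addn0.
rewrite mulSn [(n + _)%N]addnC addnA; split=> [/IH|]; first exact: (sa_per SA).
by move=> /(sa_perI SA) /IH.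
Qed.

(** Shifting by the period, a side parallel to [k] is found half a turn after [k]. *)
Lemma P_next k l : (0 < n)%N -> P k l -> exists l', P k l' /\ phi l' = phi k + pi.
Proof.
move=> n0 h; have [j ej] := sa_opp SA h; have p0 := pi_gt0 R.
case: j ej => j ej.
  have e : phi l = phi (k + j * n)%N + pi by rewrite phi_mul ej -pmulrn; ring.
  have le : (j * n <= l)%N.
    rewrite leqNgt; apply/negP => /phi_lt; rewrite e.
    have : phi (j * n)%N <= phi (k + j * n)%N by apply: phi_le; rewrite leq_addl.
    by lra.
  exists (l - j * n)%N; split.
    by apply/(P_mul _ _ j); rewrite subnK.
  by have := phi_mul (l - j * n) j; rewrite subnK // e phi_mul; lra.
exists (l + j.+1 * n)%N; split; first exact: (P_mul k l j.+1).1.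
by rewrite phi_mul ej NegzE mulrNz -pmulrn; ring.
Qed.

Lemma sum_gap m : \sum_(k < n) (m k)%:R * (pi - (phi k.+1 - phi k)) =
  (\sum_(k < n) m k)%:R * pi - \sum_(k < n) (m k)%:R * (phi k.+1 - phi k).
Proof.
by rewrite natr_sum mulr_suml -sumrB; apply: eq_bigr => k _; ring.
Qed.

(** Without parallel sides all corners occur equally often around a vertex, but
the angles of a convex [n]-gon sum to [(n - 2) * pi], which exceeds [2 * pi]. *)
Theorem no_parallel m t : (4 < n)%N -> (forall k l, ~ P k l) -> relation n phi P m t ->
  forall k, m k = 0%N.
Proof.
move=> n4 noP [mper mbal t12 hs].
have mc k : m k = m 0%N.
  by elim: k => // k <-; apply: (mbal k).1 => l; apply: noP.
have : (n%:R - 2) * (m 0%N)%:R = t%:R :> R.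
  have : ((n%:R - 2) * (m 0%N)%:R) * pi = t%:R * pi :> R; last first.
    by apply: mulIf; rewrite gt_eqF ?pi_gt0.
  rewrite -hs sum_gap (eq_bigr (fun=> m 0%N)) // sum_nat_const card_ord.
  rewrite (eq_bigr (fun k : 'I_n => (m 0%N)%:R * (phi k.+1 - phi k))) => [|k _]; last by rewrite mc.
  rewrite -mulr_sumr -(big_mkord xpredT (fun k => phi k.+1 - phi k)) telescope_sumr //.
  by have := sa_phi SA 0; rewrite add0n => ->; rewrite natrM /turn; ring.
move=> e k; rewrite mc; apply/eqP; rewrite -leqn0 leqNgt; apply/negP => m0.
have : 1 <= (m 0%N)%:R :> R by rewrite ler1n.
have : 5%:R <= n%:R :> R by rewrite ler_nat.
by case: t12 e => ->; nra.
Qed.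

(** As the jumps of [m] at parallel sides cancel, the counts for a direction and
for the opposite direction have a constant sum [c], which is [m 0 + m r]. So the
average of [m] over all directions is [c / 2], and the [phi] part of the angle sum
is [c * pi]. The proof sums by parts and pairs off the jumps. *)
Lemma sum_parallel_pair m t r : (0 < r < n)%N -> P 0 r -> phi r = phi 0%N + pi ->
  relation n phi P m t -> (\sum_(k < n) m k = m 0%N + m r + t)%N.
Proof.
move=> /andP[r0 rn] P0r er [mper mbal t12 hs]; have p0 := pi_gt0 R.
have n0 : (0 < n)%N by apply: leq_ltn_trans rn.
have en : phi n = phi 0%N + turn R by have := sa_phi SA 0; rewrite add0n.
pose M k : R := (m k)%:R; pose J k : R := M k - M k.-1.
have abel a b : (a < b)%N -> \sum_(a <= k < b) M k * (phi k.+1 - phi k) =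
    M b.-1 * phi b - M a * phi a - \sum_(a.+1 <= k < b) J k * phi k.
  elim: b => // b IH; rewrite ltnS leq_eqVlt => /predU1P[->|ab].
    by rewrite big_nat1 big_geq //=; ring.
  rewrite big_nat_recr /= ?(ltnW ab) // IH // [in RHS]big_nat_recr //= /J.
  by ring.
have paired k : (0 < k < r)%N -> forall l, P k l ->
    exists l', [/\ (r < l' < n)%N, P k l' & phi l' = phi k + pi].
  move=> /andP[k0 kr] l /(P_next n0)[l' [h e]]; exists l'; split => //.
  have := phi_lt k0; have := phi_lt kr; rewrite -!phi_ltE en er e /turn => ? ?; apply/andP; split; lra.
have pairedr l : (r < l < n)%N -> forall k, P l k ->
    exists k', [/\ (0 < k' < r)%N, P k' l & phi l = phi k' + pi].
  move=> /andP[rl ln] k /(P_next n0)[k' [h e]].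
  have hk : (n < k' < r + n)%N.
    have := phi_lt rl; have := phi_lt ln; rewrite -!phi_ltE (sa_phi SA r) en er e /turn => ? ?.
    by apply/andP; split; lra.
  have ek : k' = (k' - n + 1 * n)%N by lia.
  exists (k' - n)%N; split; first by lia.
    by apply: (sa_sym SA); apply/(P_mul _ _ 1); rewrite -ek.
  by move: e; rewrite {1}ek phi_mul /turn; lra.
have single k : (0 < k)%N -> (forall l, ~ P k l) -> J k = 0.
  by case: k => // k _ h; rewrite /J /M /= ((mbal k).1 h) subrr.
have jump k l : (0 < k)%N -> (0 < l)%N -> P k l -> J l = - J k.
  case: k => // k _; case: l => // l _ /((mbal k).2 l) h.
  rewrite /J /M /=; have : (m k.+1 + m l.+1)%:R = (m k + m l)%:R :> R by rewrite h.
  by rewrite !natrD; lra.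
pose p k l : R := (`[< P k l >] && (phi l == phi k + pi))%:R.
have half : \sum_(r.+1 <= l < n) J l * phi l = - \sum_(1 <= k < r) J k * (phi k + pi).
  have -> : \sum_(1 <= k < r) J k * (phi k + pi) =
      \sum_(1 <= k < r) \sum_(r.+1 <= l < n) p k l * (J k * (phi k + pi)).
    apply: eq_big_nat => k hk; case: (pselect (exists l, P k l)) => [[l /(paired _ hk)[l' [hl' h e]]]|h].
      rewrite (bigD1_seq l') ?mem_index_iota ?iota_uniq //= /p asboolT // e eqxx mul1r.
      rewrite big1 ?addr0 // => l2 ne; case: eqP => [e2|_]; last by rewrite andbF mul0r.
      by case/eqP: ne; apply: phi_inj; rewrite e2 e.
    rewrite single; [|by case/andP: hk|by move=> l hl; apply: h; exists l].
    by rewrite mul0r big1 // => l _; rewrite mulr0.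
  have -> : \sum_(r.+1 <= l < n) J l * phi l =
      \sum_(r.+1 <= l < n) \sum_(1 <= k < r) p k l * (J l * phi l).
    apply: eq_big_nat => l hl; case: (pselect (exists k, P l k)) => [[k /(pairedr _ hl)[k' [hk' h e]]]|h].
      rewrite (bigD1_seq k') ?mem_index_iota ?iota_uniq //= /p asboolT // e eqxx mul1r.
      rewrite big1 ?addr0 // => k2 ne; case: eqP => [e2|_]; last by rewrite andbF mul0r.
      by case/eqP: ne; apply: phi_inj; move: e2; lra.
    rewrite single; [|by lia|by move=> k hk; apply: h; exists k].
    by rewrite mul0r big1 // => k _; rewrite mulr0.
  rewrite exchange_big_nat -sumrN; apply: eq_big_nat => k hk; rewrite -sumrN.
  apply: eq_big_nat => l hl; rewrite /p; case: (asboolP (P k l)) => hp; last by rewrite !mul0r oppr0.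
  case: eqP => [->|_]; last by rewrite !mul0r oppr0.
  rewrite (jump k l) //; [by ring|by lia|by lia].
have Jsum : \sum_(1 <= k < r) J k = M r.-1 - M 0%N.
  by rewrite /J big_add1 /= telescope_sumr //; case: (r) r0.
have J0 : M 0%N + M r = M n.-1 + M r.-1.
  have h := (mbal n.-1).2 r.-1; rewrite !prednK // in h.
  have : P n r by apply: (sa_sym SA); have /(P_mul _ _ 1) := sa_sym SA P0r; rewrite mul1n.
  move=> /h; have := mper 0%N; rewrite add0n => -> e.
  by rewrite /M -!natrD e.
have Sg : \sum_(k < n) M k * (phi k.+1 - phi k) = (M 0%N + M r) * pi.
  rewrite -(big_mkord xpredT (fun k => M k * (phi k.+1 - phi k))) (big_cat_nat _ (n := r)) ?(ltnW rn) //=.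
  rewrite !abel // half.
  have -> : \sum_(1 <= k < r) J k * (phi k + pi) =
      \sum_(1 <= k < r) J k * phi k + (M r.-1 - M 0%N) * pi.
    by rewrite -Jsum mulr_suml -big_split; apply: eq_bigr => k _; rewrite mulrDr.
  rewrite en er /turn; move: J0; set S := \sum_(_ <= _ < _) _ => J0.
  have -> : M n.-1 = M 0%N + M r - M r.-1 by lra.
  by ring.
apply/eqP; rewrite -(eqr_nat R) !natrD.
move: hs; rewrite sum_gap Sg /M => hs.
have : ((\sum_(k < n) m k)%:R - ((m 0%N)%:R + (m r)%:R + t%:R)) * pi = 0 :> R by lra.
by move/eqP; rewrite mulf_eq0 [pi == 0]gt_eqF // orbF subr_eq0.
Qed.

Lemma run_const m i j : balanced n P m -> (i <= j)%N ->
  (forall k, (i < k <= j)%N -> forall l, ~ P k l) -> m j = m i.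
Proof.
move=> mbal; elim: j => [|j IH] ij h; first by move: ij; rewrite leqn0 => /eqP ->.
move: ij; rewrite leq_eqVlt => /predU1P[->//|ij].
rewrite (mbal j).1; last by apply: h; rewrite ij leqnn.
by apply: IH => // k /andP[ik kj]; apply: h; rewrite ik leqW.
Qed.

Lemma sum_run m i j : balanced n P m -> (i <= j)%N ->
  (forall k, (i < k < j)%N -> forall l, ~ P k l) ->
  (\sum_(i <= k < j) m k = (j - i) * m i)%N.
Proof.
move=> mbal ij h; rewrite (eq_big_nat _ _ (F2 := fun=> m i)) ?sum_nat_const_nat // => k /andP[ik kj].
by apply: run_const => // k' /andP[k1 k2]; apply: h; rewrite k1 (leq_ltn_trans k2).
Qed.

End Fixed.

Lemma shift_angles n phi P a : side_angles n phi P ->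
  side_angles n (fun k => phi (k + a)%N) (fun k l => P (k + a)%N (l + a)%N).
Proof.
move=> [h1 h2 h3 h4 h5 h6]; split=> //.
- by move=> k; rewrite addnAC h1.
- by move=> k; rewrite addSn.
- by move=> k l /h3.
- by move=> k l /h4; rewrite addnAC.
- by move=> k l; rewrite addnAC => /h5.
- by move=> k l /h6.
Qed.

Lemma shift_relation n phi P a m t : side_angles n phi P -> relation n phi P m t ->
  relation n (fun k => phi (k + a)%N) (fun k l => P (k + a)%N (l + a)%N)
    (fun k => m (k + a)%N) t.
Proof.
move=> SA [h1 h2 h3 h4]; split=> //.
- by move=> k; rewrite addnAC h1.
- move=> k; split=> [h|l]; rewrite !addSn; last exact: (h2 _).2.
  apply: (h2 _).1 => l hl.
  apply: (h (l + (a * n - a))%N); rewrite addSn.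
  case: n h1 h2 h4 SA hl h => [|n] h1 h2 h4 SA hl h.
    by exfalso; have := sa_phi SA 0; rewrite /turn; have := pi_gt0 R; rewrite addn0; lra.
  by rewrite -addnA subnK ?leq_pmulr //; apply: (P_mul SA _ _ a).1.
- rewrite -h4; apply: (sum_shift a (f := fun k => (m k)%:R * (pi - (phi k.+1 - phi k)))).
  by move=> k; rewrite h1 -addSn !(sa_phi SA); congr (_ * _); ring.
Qed.

(** Two pairs of parallel sides divide the sides into four runs of lengths
[x1.+1, x2.+1, x3.+1, x4.+1], on which the counts are constant; for each run there
is a relation in which it counts. *)
Lemma four_runs x1 x2 x3 x4 (v1 v2 v3 v4 : nat -> nat) t1 t2 t3 t4 :
  let eqn v t := (x1.+1 * v 0 + x2.+1 * v 1 + x3.+1 * v 2 + x4.+1 * v 3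
    = v 0 + v 2 + t /\ t <= 2 /\ v 1 + v 3 = v 0 + v 2)%N in
  eqn v1 t1 -> eqn v2 t2 -> eqn v3 t3 -> eqn v4 t4 ->
  (0 < v1 0)%N -> (0 < v2 1)%N -> (0 < v3 2)%N -> (0 < v4 3)%N -> (x1 + x2 + x3 + x4 <= 2)%N.
Proof.
move=> eqn; rewrite /eqn => {eqn} E1 E2 E3 E4 p1 p2 p3 p4.
have X1 : (x1 <= 1)%N by nia.
have X2 : (x2 <= 1)%N by nia.
have X3 : (x3 <= 1)%N by nia.
have X4 : (x4 <= 1)%N by nia.
move: E1 E2 E3 E4 p1 p2 p3 p4 X1 X2 X3 X4.
generalize (v1 0%N), (v1 1%N), (v1 2%N), (v1 3%N), (v2 0%N), (v2 1%N), (v2 2%N), (v2 3%N).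
generalize (v3 0%N), (v3 1%N), (v3 2%N), (v3 3%N), (v4 0%N), (v4 1%N), (v4 2%N), (v4 3%N).
move=> {v1 v2 v3 v4} ? ? ? ? ? ? ? ? ? ? ? ? ? ? ? ? E1 E2 E3 E4 p1 p2 p3 p4.
case: x1 E1 E2 E3 E4 => [|[|//]] E1 E2 E3 E4 _; case: x2 E1 E2 E3 E4 => [|[|//]] E1 E2 E3 E4 _;
  case: x3 E1 E2 E3 E4 => [|[|//]] E1 E2 E3 E4 _; case: x4 E1 E2 E3 E4 => [|[|//]] E1 E2 E3 E4 _ //; lia.
Qed.

Section ManySides.
Variables (n : nat) (phi : nat -> R) (P : nat -> nat -> Prop).
Hypotheses (SA : side_angles n phi P) (n6 : (6 < n)%N).
Hypothesis rel : forall k, exists m t, relation n phi P m t /\ (0 < m k)%N.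

Let n0 : (0 < n)%N. Proof. by apply: leq_trans n6. Qed.

Lemma pair_sum m t k l : (k < l < n)%N -> P k l -> relation n phi P m t ->
  (\sum_(i < n) m i = m k + m l + t)%N.
Proof.
move=> /andP[kl ln] h rmt.
have el : phi l = phi k + pi.
  have [j ej] := sa_opp SA h; have p0 := pi_gt0 R.
  have h1 := phi_lt SA kl.
  have h2 : phi l < phi k + turn R.
    by rewrite -(sa_phi SA); apply: (phi_lt SA); lia.
  suff j0 : j = 0 by rewrite ej j0 mul0r addr0.
  move: ej; rewrite {1}/turn => ej.
  apply: (@circle_int0 _ _ (turn_gt0 R) _ (pi : R)); rewrite /turn in ej h2 *; lra.
have rs := shift_relation k SA rmt.
have /(_ (l - k)%N) := sum_parallel_pair (shift_angles k SA) _ _ _ rs.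
rewrite add0n subnK ?(ltnW kl) //= => hs; rewrite -hs //; last by lia.
apply/eqP; rewrite -(eqr_nat R) !natr_sum; apply/eqP.
rewrite (sum_shift k (f := fun i => (m i)%:R)) // => i.
by case: rmt => ->.
Qed.

(** The sum of all counts is [c + t], where [c] is the sum of the counts at two
parallel sides, and every count agrees with the count at some such side. *)
Lemma le_pair m t k : relation n phi P m t -> P 0 k -> forall j, (m j + t <= \sum_(i < n) m i)%N.
Proof.
move=> rmt h j.
suff [i [l [hil hP mji]]] : exists i l, [/\ (i < l < n)%N \/ (l < i < n)%N, P i l & m j = m i].
  by rewrite mji; case: hil => hil; [rewrite (pair_sum hil hP rmt)|
    rewrite (pair_sum hil (sa_sym SA hP) rmt)]; lia.
have modP i l : P i l -> P i (l %% n)%N.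
  by rewrite {1}(divn_eq l n) addnC => /(P_mul SA _ _ _).2.
have mper := let: And4 h _ _ _ := rmt in h.
have mbal := let: And4 _ h _ _ := rmt in h.
have Pirr i : ~ P i i.
  move=> /(sa_opp SA)[j' ej]; have p0 := pi_gt0 R.
  have : j' = 0.
    apply: (@circle_int0 _ _ (turn_gt0 R) _ (pi : R)); rewrite /turn in ej *; lra.
  by move=> e; rewrite e mul0r in ej; lra.
have done i l : (i < n)%N -> P i l -> exists i' l', [/\ (i' < l' < n)%N \/ (l' < i' < n)%N, P i' l' & m i = m i'].
  move=> ni /modP hP; exists i, (l %% n)%N; split=> //.
  have ln : (l %% n < n)%N by rewrite ltn_pmod.
  case: (ltngtP i (l %% n)) => e; [by left; rewrite ln|by right; rewrite ni|].
  by case: (Pirr i); rewrite {2}e.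
have -> : m j = m (j %% n)%N.
  rewrite {1}(divn_eq j n) addnC; elim: (j %/ n)%N => [|q IH]; first by rewrite mul0n addn0.
  by rewrite mulSn [(n + _)%N]addnC addnA mper.
have : (j %% n < n)%N by rewrite ltn_pmod.
elim: (j %% n)%N => [|i IH] ni; first exact: done ni h.
case: (pselect (exists l, P i.+1 l)) => [[l hl]|hno]; first exact: done ni hl.
rewrite (mbal i).1; first by apply: IH; apply: ltnW.
by move=> l hl; apply: hno; exists l.
Qed.

Lemma pair_between r d l : (0 < r < n)%N -> phi r = phi 0%N + pi -> (0 < d < n)%N -> d != r ->
  P d l -> exists b b', [/\ (0 < b < r)%N, (r < b' < n)%N, P b b', phi b' = phi b + pi &
    d = b \/ d = b'].
Proof.
move=> /andP[r0 rn] er /andP[d0 dn] dr /(P_next SA n0)[l' [h e]].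
have p0 := pi_gt0 R; have en : phi n = phi 0%N + turn R by have := sa_phi SA 0; rewrite add0n.
have pd := phi_lt SA d0; have pd' := phi_lt SA dn; rewrite /turn in en.
case: (ltngtP d r) dr => // dr _; have := phi_lt SA dr => pdr.
  exists d, l'; split=> //; first by rewrite d0.
    by rewrite -!(phi_ltE SA); apply/andP; split; lra.
  by left.
have hl : (n < l' < r + n)%N.
  by rewrite -!(phi_ltE SA) (sa_phi SA r) /turn; apply/andP; split; lra.
have el : l' = (l' - n + n)%N by lia.
exists (l' - n)%N, d; split; [by lia|by rewrite dr| | |by right].
  by apply/(sa_sym SA)/(sa_perI SA); rewrite -el.
by move: e; rewrite {1}el (sa_phi SA) /turn; lra.
Qed.

Lemma sub_sum (m : nat -> nat) (s : seq nat) : uniq s -> {in s, forall i, i < n}%N ->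
  (\sum_(i <- s) m i <= \sum_(i < n) m i)%N.
Proof.
move=> us hs; rewrite -(big_mkord xpredT m) (perm_big [seq i <- index_iota 0 n | i \in s]) /=.
  by rewrite big_filter big_mkcond; apply: leq_sum => i _; case: ifP.
apply: uniq_perm => // [|i]; first by rewrite filter_uniq ?iota_uniq.
by rewrite mem_filter mem_index_iota; case hi: (i \in s) => //=; rewrite hs.
Qed.

(** All counts sum to [c + t], where each pair of parallel sides has count sum [c]
and [t] is at most 2. Three pairs and a further side that counts already exceed
this, and with one or two pairs the counts are constant on the runs between
them, so that the runs are short. *)
Lemma no_parallel_pair k : P 0 k -> False.
Proof.
move=> /(P_next SA n0)[r [P0r er]]; have p0 := pi_gt0 R.
have en : phi n = phi 0%N + turn R by have := sa_phi SA 0; rewrite add0n.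
have hr : (0 < r < n)%N by rewrite -!(phi_ltE SA) er en /turn; apply/andP; split; lra.
have S0 m t : relation n phi P m t -> [/\ \sum_(i < n) m i = m 0%N + m r + t, t <= 2 & balanced n P m]%N.
  move=> h; split; first exact: pair_sum.
    by case: h => _ _ [] ->.
  by case: h.
case: (pselect (exists b l, [/\ (0 < b < n)%N, b != r & P b l])); last first.
  move=> hno.
  have sg i l : (0 < i < n)%N -> i != r -> ~ P i l by move=> h1 h2 h3; apply: hno; exists i, l.
  have eq m t : relation n phi P m t -> (r * m 0 + (n - r) * m r = m 0 + m r + t /\ t <= 2)%N.
    move=> /S0[<- t2 mbal]; split=> //; rewrite -(big_mkord xpredT m).
    rewrite (big_cat_nat _ (n := r)) /=; [|by lia|by lia].
    by rewrite !(sum_run mbal) ?subn0 //; move=> *; try apply: sg; lia.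
  have [m [t [/eq[e1 e2] m0]]] := rel 0; have [m' [t' [/eq[e1' e2'] m0']]] := rel r.
  have : (r <= 3)%N by nia.
  have : (n - r <= 3)%N by nia.
  by lia.
move=> [b0 [l0 [hb0 b0r /(pair_between hr er hb0 b0r)[b [b' [hb hb' Pb eb _]]]]]].
have Sb m t : relation n phi P m t -> (m b + m b' = m 0 + m r)%N.
  move=> h; have [h1 _ _] := S0 _ _ h; have := pair_sum _ Pb h; rewrite h1 => h2.
  by have := h2 ltac:(lia); lia.
case: (pselect (exists d l, [/\ (0 < d < n)%N, d \notin [:: b; r; b'] & P d l])).
  move=> [d0 [l1 [hd0]]]; rewrite !inE !negb_or => /and3P[d0b dot0r d0b'].
  move=> /(pair_between hr er hd0 dot0r)[d [d' [hd hd' Pd ed dd]]].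
  have db : d != b.
    apply/eqP => e; subst d; have : d' = b' by apply: (phi_inj SA); rewrite eb ed.
    by case: dd d0b d0b' => -> => [|_]; rewrite ?eqxx // => /[swap] ->; rewrite eqxx.
  have db' : d' != b'.
    apply/eqP => e; subst d'; have : d = b by apply: (phi_inj SA); move: ed; rewrite eb; lra.
    by apply/eqP.
  have [j [jn hj]] : exists j, (j < n)%N /\ j \notin [:: 0; r; b; b'; d; d']%N.
    apply: contrapT => hno; have := @uniq_leq_size _ (iota 0 n) [:: 0; r; b; b'; d; d']%N (iota_uniq 0 n).
    rewrite size_iota /= => h; suff : (n <= 6)%N by lia.
    apply: h => i; rewrite mem_iota add0n => /andP[_ hi].
    by apply/negPn/negP => hi'; apply: hno; exists i.
  have [m [t [rmt mj]]] := rel j.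
  have [h1 h2 h3] := S0 _ _ rmt; have h4 := Sb _ _ rmt.
  have h5 := le_pair rmt P0r j.
  have h6 : (\sum_(i < n) m i = m d + m d' + t)%N by apply: pair_sum => //; lia.
  have us : uniq [:: j; 0; r; b; b'; d; d']%N.
    by clear - hj db db' hb hb' hd hd' jn; move: hj; rewrite /= !inE !negb_or => hj;
      do ?[apply/andP; split]; lia.
  have hs : {in [:: j; 0; r; b; b'; d; d']%N, forall i, i < n}%N.
    by clear - jn hb hb' hd hd'; apply/allP; rewrite /=; lia.
  have := sub_sum m us hs; rewrite !big_cons big_nil.
  by clear - mj h1 h2 h4 h5 h6; lia.
move=> hno; have sg i l : (0 < i < n)%N -> i \notin [:: b; r; b'] -> ~ P i l.
  by move=> h1 h2 h3; apply: hno; exists i, l.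
have eq m t : relation n phi P m t -> (b * m 0 + (r - b) * m b + (b' - r) * m r + (n - b') * m b'
    = m 0 + m r + t /\ t <= 2 /\ m b + m b' = m 0 + m r)%N.
{ move=> h; have e := Sb _ _ h; move: h => /S0[<- t2 mbal]; split=> //; rewrite -(big_mkord xpredT m).
  rewrite (big_cat_nat _ (n := r)) /=; [|by lia|by lia].
  rewrite (big_cat_nat _ (n := b)) /=; [|by lia|by lia].
  rewrite [in RHS](big_cat_nat _ (m := r) (n := b')) /=; [|by lia|by lia].
  rewrite !(sum_run mbal) ?subn0; try by lia.
  all: by move=> i hi l; apply: sg; rewrite ?inE; lia. }
have [m1 [t1 [/eq e1 h1]]] := rel 0; have [m2 [t2 [/eq e2 h2]]] := rel b.
have [m3 [t3 [/eq e3 h3]]] := rel r; have [m4 [t4 [/eq e4 h4]]] := rel b'.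
pose x1 := b.-1; pose x2 := (r - b).-1; pose x3 := (b' - r).-1; pose x4 := (n - b').-1.
have E m t : (b * m 0 + (r - b) * m b + (b' - r) * m r + (n - b') * m b'
    = m 0 + m r + t /\ t <= 2 /\ m b + m b' = m 0 + m r)%N ->
    let v i := m (nth 0%N [:: 0; b; r; b']%N i) in
    (x1.+1 * v 0 + x2.+1 * v 1 + x3.+1 * v 2 + x4.+1 * v 3
    = v 0 + v 2 + t /\ t <= 2 /\ v 1 + v 3 = v 0 + v 2)%N.
  by rewrite /= /x1 /x2 /x3 /x4 !prednK; lia.
have := four_runs (E _ _ e1) (E _ _ e2) (E _ _ e3) (E _ _ e4) h1 h2 h3 h4.
by rewrite /x1 /x2 /x3 /x4; lia.
Qed.

End ManySides.

Theorem many_sides n phi P : side_angles n phi P -> (6 < n)%N ->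
  (forall k, exists m t, relation n phi P m t /\ (0 < m k)%N) -> False.
Proof.
move=> SA n6 rel; have n4 : (4 < n)%N by lia.
case: (pselect (exists k l, P k l)) => [[k [l h]]|h]; last first.
  have [m [t [rmt m0]]] := rel 0.
    by rewrite (no_parallel SA n4 _ rmt) // in m0 => i j hP; apply: h; exists i, j.
apply: (@no_parallel_pair n _ _ (shift_angles k SA) n6 _ (l + (k * n - k))%N).
  move=> i; have [m [t [rmt mi]]] := rel (i + k)%N.
  by exists (fun i => m (i + k)%N), t; split=> //; apply: shift_relation.
have kn : (k <= k * n)%N by rewrite leq_pmulr //; lia.
by rewrite add0n -addnA subnK //; apply: (P_mul SA _ _ k).1.
Qed.

Section Hexagon.
Variables (phi : nat -> R) (P : nat -> nat -> Prop).
Hypotheses (SA : side_angles 6 phi P).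
Hypothesis opposite : forall k l, P k l -> l = (k + 3)%N %[mod 6].

(** The counts at opposite corners have a constant sum [c], whether or not the
sides between them are parallel, and the opposite angles are weighted so that the
angle sum becomes [2 * c * pi]. In particular no straight angle occurs. *)
Lemma hexagon_relation m t : relation 6 phi P m t ->
  exists c, [/\ t = (2 * c)%N, m 0 + m 3%N = c, m 1 + m 4%N = c & m 2%N + m 5%N = c]%N.
Proof.
move=> [mper mbal t12 hs].
have opp k l : P k l -> P k (k + 3)%N.
  move=> h; have e := opposite h.
  have h' : P k (l %% 6)%N by move: h; rewrite {1}(divn_eq l 6) addnC => /(P_mul SA _ _ _).2.
  have : P k ((l %% 6) + (k + 3) %/ 6 * 6)%N by apply: (P_mul SA _ _ _).1.
  by rewrite e addnC -divn_eq.
have step k : (m k.+1 + m (k + 4) = m k + m (k + 3))%N /\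
    (m k.+1 = m k \/ phi (k + 4)%N = phi k.+1 + pi).
  have e4 : (k + 4 = k.+1 + 3)%N by rewrite addSnnS.
  case: (pselect (P k.+1 (k + 4)%N)) => h.
    split; first by have := (mbal k).2 (k + 3)%N; rewrite -addnS; apply.
    right; have [j ej] := sa_opp SA h; have p0 := pi_gt0 R.
    have h1 : phi k.+1 < phi (k + 4)%N by apply: (phi_lt SA); lia.
    have h2 : phi (k + 4)%N < phi k.+1 + turn R.
      by rewrite -(sa_phi SA); apply: (phi_lt SA); lia.
    suff j0 : j = 0 by rewrite ej j0 mul0r addr0.
    move: ej; rewrite {1}/turn => ej.
    apply: (@circle_int0 _ _ (turn_gt0 R) _ (pi : R)); rewrite /turn in ej h2 *; lra.
  have n1 l : ~ P k.+1 l by move=> /opp; rewrite -e4.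
  have n2 l : ~ P (k + 3).+1 l.
    move=> /opp h2; apply: h; apply: (sa_sym SA).
    by apply: (sa_perI SA); move: h2; rewrite (_ : ((k + 3).+1 + 3 = k.+1 + 6)%N) ?addnS //; lia.
  have h1 := (mbal k).1 n1; split; last by left.
  by have := (mbal (k + 3)%N).1 n2; rewrite -addnS h1 => ->.
have [s0 t0] := step 0%N; have [s1 t1] := step 1%N; have [s2 t2] := step 2%N.
have {}s0 : (m 1 + m 4 = m 0 + m 3)%N := s0.
have {}s1 : (m 2 + m 5 = m 1 + m 4)%N := s1.
have {}s2 : (m 3 + m 6 = m 2 + m 5)%N := s2.
rewrite ?add0n in t0; rewrite !addSn ?add0n in t1 t2.
have m6 : m 6%N = m 0%N by rewrite -(mper 0%N).
exists (m 0 + m 3%N)%N; split; [| by [] | by lia | by lia].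
have p6 : phi 6%N = phi 0%N + turn R by rewrite -(sa_phi SA).
have e4 : (m 4%N)%:R = (m 0%N)%:R + (m 3%N)%:R - (m 1%N)%:R :> R.
  by rewrite -natrD -(_ : (m 1 + m 4%N = m 0 + m 3%N)%N) ?natrD; [ring|lia].
have e5 : (m 5%N)%:R = (m 0%N)%:R + (m 3%N)%:R - (m 2%N)%:R :> R.
  by rewrite -natrD -(_ : (m 2%N + m 5%N = m 0 + m 3%N)%N) ?natrD; [ring|lia].
have E1 : ((m 1%N)%:R - (m 0%N)%:R) * (phi 4%N - phi 1%N - pi) = 0 :> R.
  by case: t0 => ->; [rewrite subrr mul0r|ring].
have E2 : ((m 2%N)%:R - (m 1%N)%:R) * (phi 5%N - phi 2%N - pi) = 0 :> R.
  by case: t1 => ->; [rewrite subrr mul0r|ring].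
have E3 : ((m 3%N)%:R - (m 2%N)%:R) * (phi 6%N - phi 3%N - pi) = 0 :> R.
  by case: t2 => ->; [rewrite subrr mul0r|ring].
have p0 := pi_gt0 R.
have : t%:R * pi = 2 * ((m 0%N)%:R + (m 3%N)%:R) * pi :> R.
  rewrite -hs !big_ord_recl big_ord0 /= !/bump /= e4 e5; rewrite p6 in E3 *.
  move: E1 E2 E3; rewrite /turn.
  set a0 := (m 0%N)%:R; set a1 := (m 1%N)%:R; set a2 := (m 2%N)%:R; set a3 := (m 3%N)%:R.
  by move=> E1 E2 E3; lra.
move/(mulIf (lt0r_neq0 p0)) => h; apply/eqP; rewrite -(eqr_nat R) h.
by rewrite natrM natrD.
Qed.

(** Of two opposite corners exactly one occurs, once. The corner 0 occurs between
the sides 0 and 1; as no side has the length of the side 0, that side is matched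
with itself, so the corner 5 occurs. Then the corners 1 and 4 are excluded, since
one would leave a side 2 and 5 and the other a side 1 and 4 to be matched. *)
Lemma hexagon_parity m (L : nat -> R) : relation 6 phi P m 2%N -> (0 < m 0)%N ->
  (forall k, L (k + 6)%N = L k) ->
  (forall x : R, ~~ odd (\sum_(k < 6) m k * ((L k == x) + (L k.+1 == x)))) ->
  (forall j, (0 < j < 6)%N -> L 0%N <> L j) -> L 1%N <> L 4%N -> L 2%N <> L 5%N -> False.
Proof.
move=> /hexagon_relation[c [c1 h0 h1 h2]] m0 Lp par d0 d14 d25.
have {}c1 : c = 1%N by lia.
rewrite {}c1 in h0 h1 h2.
have L6 : L 6%N = L 0%N by rewrite -(Lp 0%N).
have [n1 n2 n3 n4 n5] : [/\ L 0%N == L 1%N = false, L 0%N == L 2%N = false, L 0%N == L 3%N = false,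
    L 0%N == L 4%N = false & L 0%N == L 5%N = false].
  by split; apply/eqP; apply: d0.
have n14 : L 1%N == L 4%N = false by apply/eqP.
have n25 : L 2%N == L 5%N = false by apply/eqP.
have par' x := par x; move: {par} par' => par.
have p0 := par (L 0%N); have p5 := par (L 5%N); have p1 := par (L 1%N).
rewrite !big_ord_recl big_ord0 /= !/bump /= !add1n L6 in p0.
rewrite !big_ord_recl big_ord0 /= !/bump /= !add1n L6 in p1.
rewrite !big_ord_recl big_ord0 /= !/bump /= !add1n L6 in p5.
rewrite !(eq_sym _ (L 0%N)) ?eqxx ?n1 ?n2 ?n3 ?n4 ?n5 in p0.
rewrite ?eqxx ?n5 ?n25 in p5; rewrite ?eqxx ?n1 !(eq_sym _ (L 1%N)) ?n14 in p1.
rewrite ?(eq_sym (L 1%N) (L 0%N)) ?n1 ?eqxx in p1.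
have hm0 : m 0%N = 1%N by clear -h0 m0; lia.
have hm3 : m 3%N = 0%N by clear -h0 m0; lia.
have hm5 : m 5%N = 1%N.
  have [e|//] : m 5%N = 0%N \/ m 5%N = 1%N by clear -h2; lia.
  by move: p0; rewrite hm0 hm3 e !(muln0, mul0n, addn0, add0n).
have hm2 : m 2%N = 0%N by clear -h2 hm5; lia.
have [e1|e1] : m 1%N = 0%N \/ m 1%N = 1%N by clear -h1; lia.
  have e4 : m 4%N = 1%N by clear -h1 e1; lia.
  by move: p1; rewrite hm0 hm3 hm5 hm2 e1 e4 !(muln0, mul0n, addn0, add0n, mul1n); case: (_ == _).
have e4 : m 4%N = 0%N by clear -h1 e1; lia.
by move: p5; rewrite hm0 hm3 hm5 hm2 e1 e4 !(muln0, mul0n, addn0, add0n, mul1n); case: (_ == _).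
Qed.

End Hexagon.

End Relations.

(** * Planes in general position *)

Section Generic.
Variable R : realType.
Local Notation C := (complex R).
Implicit Types (z w : C) (t x y : R).

Definition cis t : C := Complex (cos t) (sin t).
Definition rc x : C := Complex x 0.

Lemma cisD s t : cis (s + t) = cis s * cis t.
Proof. by rewrite /cis cosD sinD; congr Complex; rewrite addrC. Qed.
Lemma cis0 : cis 0 = 1. Proof. by rewrite /cis cos0 sin0. Qed.
Lemma conjc_cis t : conjc (cis t) = cis (- t).
Proof. by rewrite /cis /= cosN sinN. Qed.
Lemma cisX t n : cis t ^+ n = cis (n%:R * t).
Proof.
elim: n => [|n IH]; first by rewrite expr0 mul0r cis0.
by rewrite exprS IH -cisD -natr1; congr cis; ring.
Qed.

(** An integer power in which the inverse is replaced by the conjugate, which has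
the same argument and is polynomial. *)
Definition ipow (k : int) z : C := (if 0 <= k then z else conjc z) ^+ `|k|%N.

Lemma ipowM (k : int) z w : ipow k (z * w) = ipow k z * ipow k w.
Proof. by rewrite /ipow; case: ifP => _; rewrite ?rmorphM exprMn. Qed.
Lemma rcX x n : rc x ^+ n = rc (x ^+ n).
Proof. by elim: n => [|n IH]; rewrite ?expr0 // exprS IH /rc exprS /=; congr Complex; ring. Qed.
Lemma rcM x y : rc (x * y) = rc x * rc y.
Proof. by rewrite /rc; congr Complex; ring. Qed.
Lemma rc2 : rc 2 = 2.
Proof. by transitivity (Complex (1 + 1) (0 + 0) : C) => //; rewrite /rc addr0. Qed.
Lemma ipow_rc (k : int) x : ipow k (rc x) = rc (x ^+ `|k|%N).
Proof. by rewrite /ipow -rcX; case: ifP => _ //=; rewrite /rc /= oppr0. Qed.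
Lemma ipow_cis (k : int) t : ipow k (cis t) = cis (k%:~R * t).
Proof.
rewrite /ipow; case: k => n; first by rewrite /= cisX pmulrn.
have -> : (0 <= Negz n) = false by [].
by rewrite conjc_cis cisX /absz NegzE mulrNz -pmulrn; congr cis; ring.
Qed.
Lemma ipow_eq0 (k : int) z : z != 0 -> ipow k z != 0.
Proof.
move=> z0; rewrite /ipow expf_neq0 //; case: ifP => // _.
by rewrite conjc_eq0.
Qed.

Lemma prod_cis (I : finType) (P : pred I) (f : I -> R) :
  \prod_(i | P i) cis (f i) = cis (\sum_(i | P i) f i).
Proof. by apply: (big_ind2 (fun z t => z = cis t)); rewrite ?cis0 // => ? ? ? ? -> ->; rewrite cisD. Qed.

Lemma prod_rc (I : finType) (P : pred I) (f : I -> R) :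
  \prod_(i | P i) rc (f i) = rc (\prod_(i | P i) f i).
Proof. by apply: (big_ind2 (fun z t => z = rc t)) => // ? ? ? ? -> ->; rewrite rcM. Qed.

(** ** Complex-valued polynomial functions of a real variable *)

Definition polc (h : R -> C) := exists p q : {poly R},
  forall t, h t = Complex p.[t] q.[t].

Lemma polc_ext h h' : h =1 h' -> polc h -> polc h'.
Proof. by move=> e [p [q hp]]; exists p, q => t; rewrite -e. Qed.
Lemma polc_cst z : polc (fun=> z).
Proof. by exists (complex.Re z)%:P, (complex.Im z)%:P => t; rewrite !hornerC; case: z. Qed.
Lemma polc_rc : polc rc.
Proof. by exists 'X, 0 => t; rewrite hornerX horner0. Qed.
Lemma polcD h h' : polc h -> polc h' -> polc (fun t => h t + h' t).
Proof. by move=> [p [q e]] [p' [q' e']]; exists (p + p'), (q + q') => t; rewrite e e' !hornerD. Qed.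
Lemma polcM h h' : polc h -> polc h' -> polc (fun t => h t * h' t).
Proof.
move=> [p [q e]] [p' [q' e']]; exists (p * p' - q * q'), (p * q' + q * p') => t.
by rewrite e e' !(hornerD, hornerN, hornerM).
Qed.
Lemma polc_conj h : polc h -> polc (fun t => conjc (h t)).
Proof. by move=> [p [q e]]; exists p, (- q) => t; rewrite e hornerN. Qed.
Lemma polcX h n : polc h -> polc (fun t => h t ^+ n).
Proof.
move=> ph; elim: n => [|n IH]; first exact: polc_ext (polc_cst 1).
by apply: polc_ext (polcM ph IH) => t; rewrite exprS.
Qed.
Lemma polc_ipow h (k : int) : polc h -> polc (fun t => ipow k (h t)).
Proof.
move=> ph; rewrite /ipow; case: (0 <= k); first exact: polcX.
exact: polcX (polc_conj ph).
Qed.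
Lemma polc_prod (I : finType) (P : pred I) (h : I -> R -> C) :
  (forall i, polc (h i)) -> polc (fun t => \prod_(i | P i) h i t).
Proof.
move=> ph; suff : forall s, polc (fun t => \prod_(i <- s | P i) h i t) by apply.
elim=> [|i s IH]; first by apply: polc_ext (polc_cst 1) => t; rewrite big_nil.
case Pi: (P i); last by apply: polc_ext IH => t; rewrite big_cons Pi.
by apply: polc_ext (polcM (ph i) IH) => t; rewrite big_cons Pi.
Qed.

Lemma poly_inf0 (p : {poly R}) : (forall t, t != 0 -> p.[t] = 0) -> p = 0.
Proof.
move=> h; apply/eqP/negPn/negP => p0.
pose s := [seq i.+1%:R : R | i <- iota 0 (size p)].
suff : (size s < size p)%N by rewrite size_map size_iota ltnn.
apply: max_poly_roots => //.
  by apply/allP => _ /mapP[i _ ->]; rewrite rootE h // pnatr_eq0.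
by rewrite map_inj_uniq ?iota_uniq // => i j /eqP; rewrite eqr_nat eqSS => /eqP.
Qed.

Lemma polc_real0 h : polc h -> (forall t, t != 0 -> complex.Im (h t) = 0) ->
  complex.Im (h 0) = 0.
Proof.
move=> [p [q e]] h0; suff q0 : q = 0 by rewrite e q0 horner0.
by apply: poly_inf0 => t /h0; rewrite e.
Qed.

(** ** The isotropic direction of a plane *)

Definition c3 (u : 'rV[R]_3) (i : nat) : R := u 0 (inord i).

(** For a plane with an orthonormal frame [u1], [u2], the vector [u1 + 'i u2] is
isotropic; up to a factor it is [(1 - z ^ 2, 'i (1 + z ^ 2), 2 z)], and the product
of a vector [v] with it, as a complex number, is the projection of [v] to the
plane. *)
Definition qf (v : 'rV[R]_3) z : C :=
  Complex (c3 v 0) (c3 v 1) + rc (2 * c3 v 2) * z - Complex (c3 v 0) (- c3 v 1) * z ^+ 2.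

(** The derivative of [qf v]. *)
Definition dqf (v : 'rV[R]_3) z : C := rc (2 * c3 v 2) - 2 * Complex (c3 v 0) (- c3 v 1) * z.

Lemma qf_taylor v z w : qf v (z + w) =
  qf v z + w * (dqf v z - Complex (c3 v 0) (- c3 v 1) * w).
Proof. by rewrite /qf /dqf; ring. Qed.

Lemma c3P (u v : 'rV[R]_3) : (forall i : 'I_3, c3 u i = c3 v i) -> u = v.
Proof. by move=> h; apply/rowP => i; have := h i; rewrite /c3 inord_val. Qed.

Lemma c3_eq (u v : 'rV[R]_3) : c3 u 0 = c3 v 0 -> c3 u 1 = c3 v 1 -> c3 u 2 = c3 v 2 -> u = v.
Proof. by move=> h0 h1 h2; apply: c3P => -[[|[|[|]]]]. Qed.

Lemma qf_root v : v != 0 -> exists z, qf v z = 0 /\ dqf v z != 0.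
Proof.
move=> v0; case: (eqVneq (Complex (c3 v 0) (c3 v 1)) 0) => [[e0 e1]|g0].
  exists 0; rewrite /qf /dqf e0 e1 oppr0 (_ : Complex 0 0 = 0) // !(mul0r, mulr0, expr0n, addr0, subr0).
  split=> //; apply: contra v0 => /eqP[/eqP]; rewrite mulf_eq0 pnatr_eq0 /= => /eqP e2.
  by apply/eqP/c3_eq; rewrite ?e0 ?e1 ?e2 /c3 mxE.
pose s := Num.sqrt (c3 v 0 ^+ 2 + c3 v 1 ^+ 2 + c3 v 2 ^+ 2).
pose gc : C := Complex (c3 v 0) (- c3 v 1).
have gc0 : gc != 0 by rewrite -(conjc_eq0 gc) /gc /= opprK.
have s2 : s * s = c3 v 0 ^+ 2 + c3 v 1 ^+ 2 + c3 v 2 ^+ 2.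
  by rewrite -expr2 sqr_sqrtr // !addr_ge0 ?sqr_ge0.
exists (rc (c3 v 2 + s) / gc); split.
  have : gc * qf v (rc (c3 v 2 + s) / gc) = 0.
    rewrite /qf -/gc.
    have -> : gc * (Complex (c3 v 0) (c3 v 1) + rc (2 * c3 v 2) * (rc (c3 v 2 + s) / gc) -
        gc * (rc (c3 v 2 + s) / gc) ^+ 2) = gc * Complex (c3 v 0) (c3 v 1) +
        rc (2 * c3 v 2) * rc (c3 v 2 + s) - rc (c3 v 2 + s) ^+ 2 by field.
    rewrite -rcM rcX /rc /gc; apply/eqP; rewrite eq_complex /=; apply/andP; split; apply/eqP.
      by move: s2; lra.
    by ring.
  by move/eqP; rewrite mulf_eq0 (negbTE gc0) => /eqP.
rewrite /dqf -/gc (_ : 2 * gc * _ = 2 * rc (c3 v 2 + s)); last by field.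
have -> : rc (2 * c3 v 2) - 2 * rc (c3 v 2 + s) = rc (- 2 * s).
  by rewrite -[X in _ - X * _]rc2 -rcM /rc; apply/eqP; rewrite eq_complex /=; apply/andP; split; apply/eqP; ring.
apply/eqP => -[] s0; have {}s0 : s = 0 by lra.
have h0 := sqr_ge0 (c3 v 0); have h1 := sqr_ge0 (c3 v 1); have h2 := sqr_ge0 (c3 v 2).
rewrite s0 mul0r in s2; case/eqP: g0; congr Complex; apply/eqP; rewrite -sqrf_eq0; apply/eqP; lra.
Qed.

Definition colinear (u v : 'rV[R]_3) := exists l : R, v = l *: u.

Lemma cross0_colinear u v : u != 0 -> c3 u 0 * c3 v 1 = c3 u 1 * c3 v 0 ->
  c3 u 0 * c3 v 2 = c3 u 2 * c3 v 0 -> c3 u 1 * c3 v 2 = c3 u 2 * c3 v 1 -> colinear u v.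
Proof.
move=> u0 h01 h02 h12.
have [i ui] : exists i : 'I_3, c3 u i != 0.
  apply/existsP; rewrite -negb_forall; apply: contra u0 => /forallP h.
  by apply/eqP/c3P => i; apply/eqP; rewrite {2}/c3 mxE.
exists (c3 v i / c3 u i).
have e j : c3 u i * c3 v j = c3 u j * c3 v i -> c3 v j = c3 (c3 v i / c3 u i *: u) j.
  by move=> h; rewrite /c3 mxE -!/(c3 _ _); apply: (mulfI ui); rewrite h; field.
case: i ui e => [[|[|[|//]]] hi] /= ui e; apply: c3_eq; apply: e => //; lra.
Qed.

(** A common root gives an isotropic complex vector [w] that is orthogonal to [u]
and [v], hence a multiple of their cross product; but a real vector is isotropic
only if it is zero. *)
Lemma qf_common u v z : u != 0 -> qf u z = 0 -> qf v z = 0 -> colinear u v.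
Proof.
move=> u0.
pose w0 : C := 1 - z ^+ 2; pose w1 : C := 'i%C * (1 + z ^+ 2); pose w2 := 2 * z.
have i2 : ('i%C : C) * 'i%C = -1 by rewrite -expr2 sqr_i.
have qe a : qf a z = rc (c3 a 0) * w0 + rc (c3 a 1) * w1 + rc (c3 a 2) * w2.
  rewrite /qf /w0 /w1 /w2 rcM rc2.
  have -> : Complex (c3 a 0) (c3 a 1) = rc (c3 a 0) + 'i%C * rc (c3 a 1).
    by apply/eqP; rewrite eq_complex /=; apply/andP; split; apply/eqP; ring.
  have -> : Complex (c3 a 0) (- c3 a 1) = rc (c3 a 0) - 'i%C * rc (c3 a 1).
    by apply/eqP; rewrite eq_complex /=; apply/andP; split; apply/eqP; ring.
  by ring.
have iso : w0 * w0 + w1 * w1 + w2 * w2 = 0.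
  rewrite /w0 /w1 /w2 (_ : 'i%C * (1 + z ^+ 2) * ('i%C * (1 + z ^+ 2)) = ('i%C * 'i%C) * (1 + z ^+ 2) ^+ 2); last by ring.
  by rewrite i2; ring.
rewrite !qe => hu hv.
pose n0 := c3 u 1 * c3 v 2 - c3 u 2 * c3 v 1.
pose n1 := c3 u 2 * c3 v 0 - c3 u 0 * c3 v 2.
pose n2 := c3 u 0 * c3 v 1 - c3 u 1 * c3 v 0.
have rcB a b : rc (a - b) = rc a - rc b by rewrite /rc; apply/eqP; rewrite eq_complex /= subrr !eqxx.
have e01 : w0 * rc n1 = w1 * rc n0.
  rewrite /n0 /n1 !rcB !rcM.
  set a0 := rc (c3 u 0) in hu *; set a1 := rc (c3 u 1) in hu *; set a2 := rc (c3 u 2) in hu *.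
  set b0 := rc (c3 v 0) in hv *; set b1 := rc (c3 v 1) in hv *; set b2 := rc (c3 v 2) in hv *.
  apply/eqP; rewrite -subr_eq0; apply/eqP; transitivity (a2 * (b0 * w0 + b1 * w1 + b2 * w2) - b2 * (a0 * w0 + a1 * w1 + a2 * w2)); first by ring.
  by rewrite hu hv; ring.
have e12 : w1 * rc n2 = w2 * rc n1.
  rewrite /n2 /n1 !rcB !rcM.
  set a0 := rc (c3 u 0) in hu *; set a1 := rc (c3 u 1) in hu *; set a2 := rc (c3 u 2) in hu *.
  set b0 := rc (c3 v 0) in hv *; set b1 := rc (c3 v 1) in hv *; set b2 := rc (c3 v 2) in hv *.
  apply/eqP; rewrite -subr_eq0; apply/eqP; transitivity (a0 * (b0 * w0 + b1 * w1 + b2 * w2) - b0 * (a0 * w0 + a1 * w1 + a2 * w2)); first by ring.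
  by rewrite hu hv; ring.
have e02 : w0 * rc n2 = w2 * rc n0.
  rewrite /n2 /n0 !rcB !rcM.
  set a0 := rc (c3 u 0) in hu *; set a1 := rc (c3 u 1) in hu *; set a2 := rc (c3 u 2) in hu *.
  set b0 := rc (c3 v 0) in hv *; set b1 := rc (c3 v 1) in hv *; set b2 := rc (c3 v 2) in hv *.
  apply/eqP; rewrite -subr_eq0; apply/eqP; transitivity (b1 * (a0 * w0 + a1 * w1 + a2 * w2) - a1 * (b0 * w0 + b1 * w1 + b2 * w2)); first by ring.
  by rewrite hu hv; ring.
pose N := rc n0 * rc n0 + rc n1 * rc n1 + rc n2 * rc n2.
have hN : w0 ^+ 2 * N = 0 /\ w2 ^+ 2 * N = 0.
  have f0 : w0 * w0 * N = rc n0 * rc n0 * (w0 * w0 + w1 * w1 + w2 * w2).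
    transitivity (w0 * w0 * (rc n0 * rc n0) + (w0 * rc n1) * (w0 * rc n1) + (w0 * rc n2) * (w0 * rc n2)).
      by rewrite /N; ring.
    by rewrite e01 e02; ring.
  have f2 : w2 * w2 * N = rc n2 * rc n2 * (w0 * w0 + w1 * w1 + w2 * w2).
    transitivity (w2 * w2 * (rc n2 * rc n2) + (w2 * rc n1) * (w2 * rc n1) + (w2 * rc n0) * (w2 * rc n0)).
      by rewrite /N; ring.
    by rewrite -e12 -e02; ring.
  by rewrite !expr2 f0 f2 iso !mulr0.
have N0 : N = 0.
  case: hN => /eqP; rewrite mulf_eq0 => /orP[|/eqP //].
  rewrite sqrf_eq0 => /eqP hw0 /eqP; rewrite mulf_eq0 => /orP[|/eqP //].
  rewrite sqrf_eq0 /w2 mulf_eq0 pnatr_eq0 /= => /eqP z0.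
  by move: hw0; rewrite /w0 z0 expr0n subr0 => /eqP; rewrite oner_eq0.
have : n0 * n0 + n1 * n1 + n2 * n2 = 0.
  by move: N0; rewrite /N -!rcM => -[].
have h0 := sqr_ge0 n0; have h1 := sqr_ge0 n1; have h2 := sqr_ge0 n2; rewrite -!expr2 => hn.
have z0 : n0 = 0 by apply/eqP; rewrite -sqrf_eq0; apply/eqP; lra.
have z1 : n1 = 0 by apply/eqP; rewrite -sqrf_eq0; apply/eqP; lra.
have z2 : n2 = 0 by apply/eqP; rewrite -sqrf_eq0; apply/eqP; lra.
by apply: cross0_colinear => //; move: z0 z1 z2; rewrite /n0 /n1 /n2; lra.
Qed.

Lemma qfZ l v z : qf (l *: v) z = rc l * qf v z.
Proof.
have e i : c3 (l *: v) i = l * c3 v i by rewrite /c3 mxE.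
rewrite /qf !e.
have rM a b : Complex (l * a) (l * b) = rc l * Complex a b.
  by apply/eqP; rewrite eq_complex /=; apply/andP; split; apply/eqP; ring.
rewrite -(mulrN l) !rM (_ : 2 * (l * c3 v 2) = l * (2 * c3 v 2)) ?rcM; ring.
Qed.

Lemma polc_qf v h : polc h -> polc (fun t => qf v (h t)).
Proof.
move=> ph; have := polcD (polcD (polc_cst (Complex (c3 v 0) (c3 v 1)))
  (polcM (polc_cst (rc (2 * c3 v 2))) ph)) (polcM (polc_cst (- Complex (c3 v 0) (- c3 v 1))) (polcX 2 ph)).
by apply: polc_ext => t; rewrite /qf mulNr.
Qed.

Section Independence.
Variables (I : finType) (a : I -> 'rV[R]_3).
Hypothesis a0 : forall i, a i != 0.

Definition angle_prod (kv : I -> int) z : C := \prod_i ipow (kv i) (qf (a i) z).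

Lemma Im_rcM x z : complex.Im (rc x * z) = x * complex.Im z.
Proof. by case: z => u v /=; ring. Qed.

(** The argument of [angle_prod kv z] is the combination with coefficients [kv] of
the angles of the projected normals. Near a simple root [r] of [qf (a i)] only the
factors of the class of [i] turn: in the direction [t0] from [r] they contribute
[K * t0], where [K] is the sum of their coefficients, to an argument that must be
a multiple of [pi]. *)
Theorem angle_prod_generic (kv : I -> int) i :
  (forall z, complex.Im (angle_prod kv z) = 0) ->
  \sum_(j | `[< colinear (a i) (a j) >]) kv j = 0.
Proof.
move=> real; have [r [qr dr]] := qf_root (a0 i).
pose cl j := `[< colinear (a i) (a j) >].
pose l j := if pselect (colinear (a i) (a j)) is left h then projT1 (cid h) else 1.
have lP j : cl j -> a j = l j *: a i.
  by move=> /asboolP h; rewrite /l; case: pselect => // h'; case: (cid _).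
have l0 j : l j != 0.
  rewrite /l; case: pselect => [h|_]; last exact: oner_neq0.
  case: (cid _) => /= x e; apply: contra (a0 j) => /eqP x0.
  by rewrite e x0 scale0r.
pose gc : C := Complex (c3 (a i) 0) (- c3 (a i) 1).
pose c1 : C := \prod_(j | ~~ cl j) ipow (kv j) (qf (a j) r).
have c10 : c1 != 0.
  rewrite /c1; apply/prodf_neq0 => j nj; apply: ipow_eq0.
  by apply/eqP => qj; move/negP: nj; apply; apply/asboolP; apply: qf_common qr qj.
pose K := \sum_(j | cl j) kv j.
have key t0 : complex.Im (cis (K%:~R * t0) * c1) = 0.
  pose u : C := cis t0 / dqf (a i) r.
  pose Phi t : C := \prod_(j | cl j) (rc (l j ^+ `|kv j|%N) *
      ipow (kv j) (u * (dqf (a i) r - gc * (rc t * u)))) *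
    \prod_(j | ~~ cl j) ipow (kv j) (qf (a j) (r + rc t * u)).
  have PhiE t : angle_prod kv (r + rc t * u) = rc (\prod_(j | cl j) t ^+ `|kv j|%N) * Phi t.
    rewrite /angle_prod (bigID cl) /= /Phi mulrA; congr (_ * _).
    rewrite -prod_rc -big_split /=; apply: eq_bigr => j cj.
    rewrite (lP j cj) qfZ qf_taylor qr add0r -/gc.
    rewrite (_ : rc t * u * _ = rc t * (u * (dqf (a i) r - gc * (rc t * u)))); last by ring.
    by rewrite !ipowM !ipow_rc; ring.
  have pPhi : polc Phi.
    apply: polcM; apply: polc_prod => j.
      apply: polcM; first exact: polc_cst.
      apply: polc_ipow; apply: polcM; first exact: polc_cst.
      apply: (@polc_ext (fun t => dqf (a i) r + (- gc * u) * rc t)).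
        by move=> t; ring.
      by apply: polcD; [exact: polc_cst|apply: polcM; [exact: polc_cst|exact: polc_rc]].
    apply: polc_ipow; apply: polc_qf; apply: polcD; first exact: polc_cst.
    by apply: polcM; [exact: polc_rc|exact: polc_cst].
  have Phi0 : complex.Im (Phi 0) = 0.
    apply: polc_real0 => // t t0'; have := real (r + rc t * u); rewrite PhiE Im_rcM => /eqP.
    rewrite mulf_eq0 => /orP[/eqP h|/eqP //]; exfalso.
    have : \prod_(j | cl j) t ^+ `|kv j|%N != 0 by apply/prodf_neq0 => j _; rewrite expf_neq0.
    by rewrite h eqxx.
  move: Phi0; rewrite /Phi (_ : rc 0 = 0) // !mul0r mulr0 subr0 addr0 -/c1.
  have -> : u * dqf (a i) r = cis t0 by rewrite /u divfK.
  rewrite big_split /= prod_rc (eq_bigr (fun j => cis ((kv j)%:~R * t0))) => [|j _]; last exact: ipow_cis.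
  rewrite prod_cis -mulr_suml -rmorph_sum /= -/K -mulrA Im_rcM => /eqP.
  rewrite mulf_eq0 => /orP[/eqP h|/eqP //]; exfalso.
  have : \prod_(j | cl j) l j ^+ `|kv j|%N != 0 by apply/prodf_neq0 => j _; rewrite expf_neq0.
  by rewrite h eqxx.
apply/eqP/negPn/negP => K0.
have Kr : K%:~R != 0 :> R by rewrite intr_eq0.
have i0 := key 0; rewrite mulr0 cis0 mul1r in i0.
have i1 := key (pi / 2 / K%:~R).
rewrite (_ : K%:~R * _ = pi / 2) in i1; last by field.
case/eqP: c10; move: i0 i1; rewrite /cis cos_pihalf sin_pihalf; case: (c1) => u v /= -> .
by rewrite mul0r mul1r add0r => ->.
Qed.

End Independence.

(** ** Avoiding countably many polynomial conditions *)

Lemma avoid_countable (A : set R) (x0 : R) (U : set R) : countable A -> nbhs x0 U ->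
  exists2 x, U x & ~ A x.
Proof.
move=> cA /nbhs_ballP[e e0 hU]; apply: contrapT => h.
have sub : (`]x0 - e, x0 + e[ `<=` A)%classic.
  move=> x; rewrite /= in_itv /= => hx; apply: contrapT => nA; apply: h; exists x => //.
  by apply: hU; rewrite /ball /= ltr_distlC; lra.
have := countable_lebesgue_measure0 (sub_countable (subset_card_le sub) cA).
rewrite lebesgue_measure_itv /= lte_fin.
have e0' : 0 < e := e0.
have -> : x0 - e < x0 + e by lra.
by rewrite -EFinD => -[] ; lra.
Qed.

Lemma finite_roots (p : {poly R}) : p != 0 -> finite_set [set x | root p x]%classic.
Proof.
move=> p0; apply: contrapT => /(infinite_set_fset (size p))[B hB].
rewrite leqNgt => /negP; apply; apply: max_poly_roots p0 _ _.
  by apply/allP => x xB; apply: hB.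
exact: finmap.fset_uniq.
Qed.

Lemma avoid_roots (K : countType) (p : K -> {poly R}) (x0 : R) (U : set R) :
  (forall k, p k != 0) -> nbhs x0 U -> exists2 x, U x & forall k, ~~ root (p k) x.
Proof.
move=> p0 hU; have [|x Ux nx] := @avoid_countable (\bigcup_(k in [set: K]%classic) [set x | root (p k) x])%classic x0 U _ hU.
  apply: bigcup_countable => // k _; apply: finite_set_countable; exact: finite_roots.
by exists x => // k; apply/negP => rk; apply: nx; exists k.
Qed.

Definition pol2 (h : R -> R -> R) :=
  (forall y, exists p : {poly R}, forall x, h x y = p.[x]) /\
  (forall x, exists p : {poly R}, forall y, h x y = p.[y]).

(** A nonzero polynomial in two variables is nonzero on some horizontal line. So
[x] can be chosen to avoid countably many roots, and then [y]. *)
Lemma avoid_pol2 (K : countType) (h : K -> R -> R -> R) (x0 y0 : R) (U : set (R * R)) :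
  (forall k, pol2 (h k)) -> (forall k, exists x y, h k x y != 0) -> nbhs (x0, y0) U ->
  exists x y, U (x, y) /\ forall k, h k x y != 0.
Proof.
move=> ph h0 [[U1 U2] /= [n1 n2] hU].
have hy0 k : exists y x, h k x y != 0 by have [x [y hxy]] := h0 k; exists y, x.
pose y1 k := projT1 (cid (hy0 k)).
have y1P k : exists x, h k x (y1 k) != 0 by rewrite /y1; case: (cid _).
pose p k := projT1 (cid ((ph k).1 (y1 k))).
have pE k x : h k x (y1 k) = (p k).[x] by rewrite /p; case: (cid _).
have [|x Ux hx] := @avoid_roots _ p _ _ _ n1.
  move=> k; have [x] := y1P k; rewrite pE; apply: contra => /eqP ->.
  by rewrite horner0.
pose q k := projT1 (cid ((ph k).2 x)).
have qE k y : h k x y = (q k).[y] by rewrite /q; case: (cid _).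
have [|y Uy hy] := @avoid_roots _ q _ _ _ n2.
  by move=> k; have := hx k; rewrite rootE -pE qE; apply: contra => /eqP ->; rewrite horner0.
exists x, y; split; first by apply: hU.
by move=> k; have := hy k; rewrite rootE -qE.
Qed.

(** The product of [e] with the normal vector of the plane that belongs to
[z = x + 'i y]. *)
Definition nz x y (e : 'rV[R]_3) : R :=
  - (2 * x) * c3 e 0 - (2 * y) * c3 e 1 + (1 - x ^+ 2 - y ^+ 2) * c3 e 2.

(** The vectors [e] are arbitrary directions that the plane has to avoid. *)
Theorem generic_plane (I E : finType) (a : I -> 'rV[R]_3) (e : E -> 'rV[R]_3) (x0 y0 : R) (U : set (R * R)) :
  (forall i, a i != 0) -> (forall j, e j != 0) -> nbhs (x0, y0) U ->
  exists x y, [/\ U (x, y), forall j, nz x y (e j) != 0 &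
    forall kv : {ffun I -> int}, complex.Im (angle_prod a kv (Complex x y)) = 0 ->
      forall i, \sum_(j | `[< colinear (a i) (a j) >]) kv j = 0].
Proof.
move=> a0 e0 hU.
pose unb (kv : {ffun I -> int}) := ~~ `[< forall i, \sum_(j | `[< colinear (a i) (a j) >]) kv j = 0 >].
pose h (k : E + {ffun I -> int}) (x y : R) : R := match k with
  | inl j => nz x y (e j)
  | inr kv => if unb kv then complex.Im (angle_prod a kv (Complex x y)) else 1 end.
have pcx y : polc (fun x => Complex x y).
  by exists 'X, y%:P => t; rewrite hornerX hornerC.
have pcy x : polc (fun y => Complex x y).
  by exists x%:P, 'X => t; rewrite hornerX hornerC.
have pa kv f : polc f -> exists p : {poly R}, forall t, complex.Im (angle_prod a kv (f t)) = p.[t].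
  move=> pf; have [|p [q e']] := @polc_prod I xpredT (fun i t => ipow (kv i) (qf (a i) (f t))).
    by move=> i; apply: polc_ipow; apply: polc_qf.
  by exists q => t; rewrite /angle_prod e'.
have [||x [y [Uxy hxy]]] := @avoid_pol2 _ h x0 y0 U _ _ hU.
- case=> [j|kv]; split=> t; rewrite /h.
  + exists (- (2 * c3 (e j) 0) *: 'X + (- (2 * t) * c3 (e j) 1 + (1 - t ^+ 2) * c3 (e j) 2)%:P - c3 (e j) 2 *: 'X^2) => x.
    by rewrite /nz !(hornerD, hornerN, hornerZ, hornerX, hornerXn, hornerC); ring.
  + exists (- (2 * c3 (e j) 1) *: 'X + (- (2 * t) * c3 (e j) 0 + (1 - t ^+ 2) * c3 (e j) 2)%:P - c3 (e j) 2 *: 'X^2) => x.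
    by rewrite /nz !(hornerD, hornerN, hornerZ, hornerX, hornerXn, hornerC); ring.
  + by case: (unb kv); [apply: pa (fun x => Complex x t) (pcx t)|exists 1 => x; rewrite hornerE].
  + by case: (unb kv); [apply: pa (fun y => Complex t y) (pcy t)|exists 1 => x; rewrite hornerE].
- case=> [j|kv]; rewrite /h.
  + have := e0 j; rewrite /nz; case: (eqVneq (c3 (e j) 2) 0) => e2; last first.
      by move=> _; exists 0, 0; rewrite (_ : _ + _ = c3 (e j) 2) //; ring.
    case: (eqVneq (c3 (e j) 1) 0) => e1; last first.
      by move=> _; exists 0, 1; rewrite e2 (_ : _ + _ = - (2 * c3 (e j) 1)) ?oppr_eq0 ?mulf_neq0 ?pnatr_eq0 //; ring.
    case: (eqVneq (c3 (e j) 0) 0) => e3; last first.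
      by move=> _; exists 1, 0; rewrite e2 e1 (_ : _ + _ = - (2 * c3 (e j) 0)) ?oppr_eq0 ?mulf_neq0 ?pnatr_eq0 //; ring.
    by move/eqP; case; apply: c3_eq; rewrite ?e1 ?e2 ?e3 /c3 mxE.
  + case: (boolP (unb kv)) => hk; last by exists 0, 0; apply: oner_neq0.
    apply: contrapT => h'; move/negP: hk; apply; apply/asboolP => i.
    apply: (angle_prod_generic a0) => -[x y]; apply/eqP/negPn/negP => ne.
    by apply: h'; exists x, y.
exists x, y; split=> // [j|kv kv0]; first exact: (hxy (inl j)).
have := hxy (inr kv); rewrite /h; case: (boolP (unb kv)) => [_|]; first by rewrite kv0 eqxx.
by rewrite negbK => /asboolP.
Qed.

End Generic.

(** * Convex polyhedra given by irredundant inequalities *)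

Section Poly.
Variables (R : realType) (n : nat) (I : finType) (a : I -> 'rV[R]_n) (b : I -> R).
Implicit Types (x y d nu : 'rV[R]_n) (i j l : I) (t c : R) (A B : {set I}).

Definition slack i x := b i - dot (a i) x.
Definition inP x := forall i, 0 <= slack i x.
Definition act x : {set I} := [set i | slack i x == 0].

(** A bounded full-dimensional polyhedron in which each inequality has a witness,
a point that is tight for this inequality alone; the indices are then the facets. *)
Record irredundant : Prop := Irredundant {
  ir_bd : exists D, forall x, inP x -> forall k, `|x 0 k| <= D;
  ir_in : exists x, forall i, 0 < slack i x;
  ir_wit : forall i, exists x, slack i x = 0 /\ forall j, j != i -> 0 < slack j x }.
Hypothesis Ir : irredundant.

Lemma actP x i : reflect (slack i x = 0) (i \in act x).
Proof. by rewrite inE; apply: eqP. Qed.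

Lemma slackD i x d : slack i (x + d) = slack i x - dot (a i) d.
Proof. by rewrite /slack dotDr; ring. Qed.

Lemma slack_mid i x y t : slack i ((1 - t) *: x + t *: y) = (1 - t) * slack i x + t * slack i y.
Proof. by rewrite /slack dotDr !dotZr; ring. Qed.

Lemma inP_mid x y t : 0 <= t <= 1 -> inP x -> inP y -> inP ((1 - t) *: x + t *: y).
Proof. by move=> ht hx hy i; rewrite slack_mid; have := hx i; have := hy i; nra. Qed.

Lemma act_mid x y t : 0 < t < 1 -> inP x -> inP y ->
  act ((1 - t) *: x + t *: y) = act x :&: act y.
Proof.
move=> ht hx hy; apply/setP => i; rewrite !inE slack_mid.
have := hx i; have := hy i; set s := slack i x; set s' := slack i y => h h'.
apply/eqP/andP => [e|[/eqP -> /eqP ->]]; last by ring.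
by split; apply/eqP; nra.
Qed.

Lemma a_neq0 i : a i != 0.
Proof.
have [z ho] := ir_in Ir; have [x [hx _]] := ir_wit Ir i.
apply/eqP => e; have := ho i; rewrite -hx /slack e !dot0l; lra.
Qed.

(** The ray leaves the bounded polyhedron through the facet that it reaches
first. *)
Lemma shoot x d : inP x -> d != 0 ->
  exists t j, [/\ 0 <= t, inP (x + t *: d), slack j (x + t *: d) = 0 & 0 < dot (a j) d].
Proof.
move=> hx d0.
have [j0 hj0] : exists j, 0 < dot (a j) d.
  apply: contrapT => /forallNP h; have [D hD] := ir_bd Ir.
  have [k dk] : exists k, d 0 k != 0.
    apply/existsP; rewrite -negb_forall; apply: contra d0 => /forallP h'.
    by apply/eqP/rowP => k; rewrite mxE; apply/eqP.
  have far t : 0 <= t -> inP (x + t *: d).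
    by move=> t0 i; rewrite slackD dotZr; have := hx i; have := h i; nra.
  have D0 : 0 <= D by apply: le_trans (hD x hx k).
  pose T := (2 * D + 1) / `|d 0 k|.
  have T0 : 0 <= T by rewrite divr_ge0 //; lra.
  have := hD _ (far T T0) k; have := hD _ hx k.
  rewrite !mxE => h1; rewrite leNgt => /negP; apply.
  have : `|T * d 0 k| = 2 * D + 1.
    by rewrite normrM ger0_norm // /T divfK // normr_eq0.
  have := ler_normB (x 0 k + T * d 0 k) (x 0 k); rewrite addrAC subrr add0r.
  by move=> h2 h3; lra.
pose r j := slack j x / dot (a j) d.
case: (arg_minP r (P := fun j => 0 < dot (a j) d) hj0) => j hj jmin.
exists (r j), j; split=> //.
- by rewrite divr_ge0 // ltW.
- move=> i; rewrite slackD dotZr; case: (ltP 0 (dot (a i) d)) => hi.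
    have := jmin i hi; rewrite /r ler_pdivlMr // => h; rewrite subr_ge0.
    by rewrite mulrAC; move: h; rewrite mulrAC.
  have : 0 <= r j by rewrite divr_ge0 // ltW.
  by have := hx i; nra.
- by rewrite slackD dotZr /r divfK ?subrr // gt_eqF.
Qed.

End Poly.

Section Linear.
Variable R : realType.

Lemma dot3 (u v : 'rV[R]_3) : dot u v = c3 u 0 * c3 v 0 + c3 u 1 * c3 v 1 + c3 u 2 * c3 v 2.
Proof.
rewrite /dot !big_ord_recl big_ord0 addr0 addrA /c3.
by do 2?[congr (_ + _)]; congr (u _ _ * v _ _); apply: val_inj; rewrite /= inordK.
Qed.

Lemma ortho2 (u v : 'rV[R]_3) : exists2 d : 'rV[R]_3, d != 0 & dot u d = 0 /\ dot v d = 0.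
Proof.
pose M : 'M[R]_(3, 2) := \matrix_(i, j) (if j == 0 then u 0 i else v 0 i).
have : kermx M != 0.
  by rewrite -mxrank_eq0 mxrank_ker -lt0n subn_gt0 (leq_ltn_trans (rank_leq_col M)).
move=> /rowV0Pn[d /sub_kermxP dM d0]; exists d => //; split.
  have := congr1 (fun X : 'rV[R]_2 => X 0 0) dM; rewrite !mxE => h.
  by rewrite -[RHS]h; apply: eq_bigr => i _; rewrite !mxE /= mulrC.
have := congr1 (fun X : 'rV[R]_2 => X 0 1) dM; rewrite !mxE => h.
by rewrite -[RHS]h; apply: eq_bigr => i _; rewrite !mxE /= mulrC.
Qed.

Lemma dependent3 (u v w d : 'rV[R]_3) : d != 0 -> dot u d = 0 -> dot v d = 0 -> dot w d = 0 ->
  exists p q r : R, p *: u + q *: v + r *: w = 0 /\ ~ (p = 0 /\ q = 0 /\ r = 0).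
Proof.
move=> d0 hu hv hw.
pose M : 'M[R]_3 := \matrix_(i, j) (nth u [:: u; v; w] i) 0 j.
have /det0P[z z0 hz] : \det M == 0.
  rewrite -det_tr; apply/det0P; exists d => //; apply/rowP => i.
  transitivity (dot (nth u [:: u; v; w] i) d).
    by rewrite !mxE; apply: eq_bigr => j _; rewrite !mxE mulrC.
  by rewrite mxE; case: i => [[|[|[|//]]]].
exists (z 0 0), (z 0 1), (z 0 2%:R); split; last first.
  move=> [e0 [e1 e2]]; case/eqP: z0; apply/rowP => i; rewrite mxE.
  case: i => [[|[|[|//]]]] hi.
  + by rewrite -[RHS]e0; congr (z _ _); apply: val_inj.
  + by rewrite -[RHS]e1; congr (z _ _); apply: val_inj.
  + by rewrite -[RHS]e2; congr (z _ _); apply: val_inj.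
apply/rowP => k; have := congr1 (fun X : 'rV[R]_3 => X 0 k) hz; rewrite !mxE !big_ord_recl big_ord0 !mxE /=.
move=> <-; rewrite addr0 addrA; congr (_ * _ + _ * _ + _ * _); congr (z _ _); exact: val_inj.
Qed.

End Linear.

Section Space.
Variables (R : realType) (I : finType) (a : I -> 'rV[R]_3) (b : I -> R).
Implicit Types (x y d nu : 'rV[R]_3) (i j l : I) (t c : R) (A B : {set I}).
Hypothesis Ir : irredundant a b.
Local Notation slack := (slack a b).
Local Notation inP := (inP a b).
Local Notation act := (act a b).

(** If three facets contained a line segment, their normals would satisfy a linear
relation; evaluated at the witnesses of the facets, it shows that any two of its
coefficients have opposite signs. *)
Lemma no_common_line x y i j l : inP x -> inP y -> i != j -> j != l -> l != i ->
  [set i; j; l] \subset act x -> [set i; j; l] \subset act y -> x = y.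
Proof.
move=> hx hy ij jl li sx sy; apply/eqP/negPn/negP => xy.
have s0 z : [set i; j; l] \subset act z -> [/\ slack i z = 0, slack j z = 0 & slack l z = 0].
  by move=> /fintype.subsetP s; split; apply/actP/s; rewrite !inE eqxx ?orbT.
have [xi xj xl] := s0 _ sx; have [yi yj yl] := s0 _ sy.
have d0 : x - y != 0 by rewrite subr_eq0.
have dd k : slack k x = 0 -> slack k y = 0 -> dot (a k) (x - y) = 0.
  by rewrite /slack dotBr; lra.
have [p [q [r [dep nz]]]] := dependent3 d0 (dd i xi yi) (dd j xj yj) (dd l xl yl).
have rel z : p * slack i z + q * slack j z + r * slack l z = 0.
  have : dot (p *: a i + q *: a j + r *: a l) (x - z) = 0 by rewrite dep dot0l.
  by rewrite !dotDl !dotZl !dotBr; move: xi xj xl; rewrite /slack; nra.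
have [wi [wi0 hwi]] := ir_wit Ir i; have [wj [wj0 hwj]] := ir_wit Ir j; have [wl [wl0 hwl]] := ir_wit Ir l.
have ji : j != i by rewrite eq_sym.
have lj : l != j by rewrite eq_sym.
have il : i != l by rewrite eq_sym.
have := rel wi; rewrite wi0 mulr0 add0r; move: (hwi j ji) (hwi l li) => p1 p2 ri.
have := rel wj; rewrite wj0 mulr0 addr0; move: (hwj i ij) (hwj l lj) => p3 p4 rj.
have := rel wl; rewrite wl0 mulr0 addr0; move: (hwl i il) (hwl j jl) => p5 p6 rl.
have opp (u v s t : R) : 0 < s -> 0 < t -> u * s + v * t = 0 -> (0 < u -> v < 0) /\ (u < 0 -> 0 < v).
  by move=> s0' t0' e; split=> hu; nra.
have [i1 i2] := opp _ _ _ _ p1 p2 ri; have [j1 j2] := opp _ _ _ _ p3 p4 rj; have [l1 l2] := opp _ _ _ _ p5 p6 rl.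
have p0 : p = 0.
  case: (ltrgtP p 0) => // hp.
    by have q1 := l2 hp; have r1 := i1 q1; have r2 := j2 hp; lra.
  by have q1 := l1 hp; have r1 := i2 q1; have r2 := j1 hp; lra.
rewrite p0 mul0r add0r in rj rl.
have q0 : q = 0 by apply/eqP; move/eqP: rl; rewrite mul0r add0r mulf_eq0 (gt_eqF p6) orbF.
have r0 : r = 0 by apply/eqP; move/eqP: rj; rewrite mulf_eq0 (gt_eqF p4) orbF.
exact: nz.
Qed.

Lemma act3_uniq x y : inP x -> inP y -> (2 < #|act x :&: act y|)%N -> x = y.
Proof.
move=> hx hy; case/card_gt2P => i [j [l [[hi hj hl] [ij jl li]]]].
move: hi hj hl; rewrite !finset.in_setI => /andP[i1 i2] /andP[j1 j2] /andP[l1 l2].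
by apply: (no_common_line hx hy ij jl li); apply/fintype.subsetP => k; rewrite !finset.in_setU !finset.in_set1 => /orP[/orP[]|] /eqP ->.
Qed.

(** ** Vertices, represented by the sets of facets through them *)

Definition verts : {set {set I}} :=
  [set A | `[< exists x, inP x /\ act x = A >] && (2 < #|A|)%N].

Definition vp A : 'rV[R]_3 :=
  if pselect (exists x, inP x /\ act x = A) is left h then projT1 (cid h) else 0.

Lemma vpP A : A \in verts -> [/\ inP (vp A), act (vp A) = A & (2 < #|A|)%N].
Proof.
rewrite inE => /andP[/asboolP h A2]; rewrite /vp; case: pselect => // h'.
by case: (cid _) => /= x [].
Qed.

Lemma vert_act x : inP x -> (2 < #|act x|)%N -> act x \in verts /\ vp (act x) = x.
Proof.
move=> hx h; have hv : act x \in verts.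
  by rewrite inE h andbT; apply/asboolP; exists x.
have [h1 h2 _] := vpP hv; split=> //.
by apply: act3_uniq => //; rewrite h2 finset.setIid.
Qed.

Lemma vp_slack A i : A \in verts -> (slack i (vp A) == 0) = (i \in A).
Proof. by move=> /vpP[_ e _]; rewrite -[in RHS]e inE. Qed.

Lemma vp_slack_gt0 A i : A \in verts -> i \notin A -> 0 < slack i (vp A).
Proof.
move=> hA iA; have [h _ _] := vpP hA.
by rewrite lt_neqAle h andbT eq_sym vp_slack.
Qed.

(** At most two active facets leave a direction free; moving along it, with the
sign that does not decrease the functional, one meets a further facet. *)
Lemma reach x nu : inP x -> exists A, [/\ A \in verts, act x \subset A & dot nu x <= dot nu (vp A)].
Proof.
have [m] := ubnP (#|I| - #|act x|); elim: m x => // m IH x hm hx.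
case: (ltnP 2 #|act x|) => [h|h].
  by have [h1 h2] := vert_act hx h; exists (act x); rewrite h2.
have [d d0 hd] : exists2 d : 'rV[R]_3, d != 0 & forall i, i \in act x -> dot (a i) d = 0.
  have [i [j hij]] : exists i j : option I, forall k, k \in act x -> Some k = i \/ Some k = j.
    case: (finset.set_0Vmem (act x)) => [->|[i hi]]; first by exists None, None => k; rewrite finset.in_set0.
    case: (finset.set_0Vmem (act x :\ i)) => [e|[j hj]].
      exists (Some i), None => k hk; left; case: (eqVneq k i) => [->//|ki].
      by have := finset.in_set0 k; rewrite -e finset.in_setD1 ki hk.
    exists (Some i), (Some j) => k hk; apply: contrapT => /not_orP[ki kj].
    suff : (2 < #|act x|)%N by rewrite ltnNge h.
    apply/card_gt2P; exists i, j, k; split; first by split=> //; case/finset.setD1P: hj.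
    split; [by case/finset.setD1P: hj; rewrite eq_sym|by apply/eqP => e; apply: kj; rewrite e|by apply/eqP => e; apply: ki; rewrite e].
  pose n (i : option I) := if i is Some k then a k else 0.
  have [d d0 [h1 h2]] := ortho2 (n i) (n j); exists d => // k /hij[e|e].
    by move: h1; rewrite -e.
  by move: h2; rewrite -e.
wlog nd : d d0 hd / 0 <= dot nu d.
  move=> H; case: (leP 0 (dot nu d)) => nd; first exact: (H d).
  apply: (H (- d)); rewrite ?oppr_eq0 // ?dotNr; last by lra.
  by move=> i hi; rewrite dotNr hd ?oppr0.
have [t [j [t0 hy hj jd]]] := shoot Ir hx d0.
have sub : act x \subset act (x + t *: d).
  by apply/fintype.subsetP => i hi; apply/actP; rewrite slackD dotZr hd // mulr0 subr0; apply/actP.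
have lt : (#|act x| < #|act (x + t *: d)|)%N.
  apply: proper_card; apply/properP; split=> //; exists j; first exact/actP.
  by apply/negP => /hd e; move: jd; rewrite e ltxx.
have [||A [h1 h2 h3]] := IH (x + t *: d).
- have := max_card (act (x + t *: d)); lia.
- by [].
exists A; split=> //; first exact: (fintype.subset_trans sub).
by apply: le_trans h3; rewrite dotDr dotZr; nra.
Qed.

Lemma vert_inter A B : A \in verts -> B \in verts -> A != B -> (#|A :&: B| <= 2)%N.
Proof.
move=> hA hB; apply: contraR; rewrite -ltnNge => h.
have [a1 a2 _] := vpP hA; have [b1 b2 _] := vpP hB.
by rewrite -a2 -b2 in h *; rewrite (act3_uniq a1 b1 h).
Qed.

Lemma vp_inj A B : A \in verts -> B \in verts -> vp A = vp B -> A = B.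
Proof. by move=> hA hB e; have [_ eA _] := vpP hA; have [_ eB _] := vpP hB; rewrite -eA e eB. Qed.

Lemma ortho_line (u v d d' : 'rV[R]_3) : u != 0 -> ~ colinear u v -> d != 0 ->
  dot u d = 0 -> dot v d = 0 -> dot u d' = 0 -> dot v d' = 0 -> exists t : R, d' = t *: d.
Proof.
move=> u0 nc d0 ud vd ud' vd'.
pose w : 'rV[R]_3 := \row_k nth 0 [:: c3 u 1 * c3 v 2 - c3 u 2 * c3 v 1; c3 u 2 * c3 v 0 - c3 u 0 * c3 v 2; c3 u 0 * c3 v 1 - c3 u 1 * c3 v 0] k.
have w0 : c3 w 0 = c3 u 1 * c3 v 2 - c3 u 2 * c3 v 1 by rewrite {1}/c3 mxE inordK.
have w1 : c3 w 1 = c3 u 2 * c3 v 0 - c3 u 0 * c3 v 2 by rewrite {1}/c3 mxE inordK.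
have w2 : c3 w 2 = c3 u 0 * c3 v 1 - c3 u 1 * c3 v 0 by rewrite {1}/c3 mxE inordK.
have wn : w != 0.
  apply/eqP => e; apply: nc; have z k : c3 w k = 0 by rewrite e /c3 mxE.
  apply: cross0_colinear => //; move: (z 0%N) (z 1%N) (z 2%N); rewrite w0 w1 w2; lra.
have line (x : 'rV[R]_3) : dot u x = 0 -> dot v x = 0 -> colinear w x.
  rewrite !dot3 => h1 h2; apply: cross0_colinear => //; rewrite ?w0 ?w1 ?w2; move: h1 h2;
  move: (c3 u 0) (c3 u 1) (c3 u 2) (c3 v 0) (c3 v 1) (c3 v 2) (c3 x 0) (c3 x 1) (c3 x 2) => u_0 u_1 u_2 v_0 v_1 v_2 x0 x1 x2 h1 h2.
  - by apply/eqP; rewrite -subr_eq0; apply/eqP; transitivity (v_2 * (u_0 * x0 + u_1 * x1 + u_2 * x2) - u_2 * (v_0 * x0 + v_1 * x1 + v_2 * x2)); [ring|rewrite h1 h2; ring].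
  - by apply/eqP; rewrite -subr_eq0; apply/eqP; transitivity (- v_1 * (u_0 * x0 + u_1 * x1 + u_2 * x2) + u_1 * (v_0 * x0 + v_1 * x1 + v_2 * x2)); [ring|rewrite h1 h2; ring].
  - by apply/eqP; rewrite -subr_eq0; apply/eqP; transitivity (v_0 * (u_0 * x0 + u_1 * x1 + u_2 * x2) - u_0 * (v_0 * x0 + v_1 * x1 + v_2 * x2)); [ring|rewrite h1 h2; ring].
have [p hp] := line _ ud vd; have [q hq] := line _ ud' vd'.
have p0 : p != 0 by apply: contra d0 => /eqP e; rewrite hp e scale0r.
by exists (q / p); rewrite hq hp scalerA divfK.
Qed.

(** ** Normals *)

Lemma touch_ncol x i j : i != j -> i \in act x -> j \in act x -> ~ colinear (a i) (a j).
Proof.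
move=> ij /actP hi /actP hj [l e].
have [w [w0 hw]] := ir_wit Ir i; have := hw j; rewrite eq_sym => /(_ ij).
move: hi hj w0; rewrite /slack e !dotZl => hi hj w0 h.
have : dot (a i) x = dot (a i) w by lra.
by move=> e'; move: h; rewrite -e'; lra.
Qed.

Lemma col_neg i j : i != j -> colinear (a i) (a j) -> exists2 l, l < 0 & a j = l *: a i.
Proof.
move=> ij [l e]; exists l => //.
have [w [w0 hw]] := ir_wit Ir i; have [z [z0 hz]] := ir_wit Ir j.
have := hw j; rewrite eq_sym => /(_ ij) h1; have h2 := hz i ij.
rewrite ltNge; apply/negP => l0.
have lp : 0 < l.
  rewrite lt_neqAle l0 andbT; apply/eqP => e0; have := a_neq0 Ir j.
  by rewrite e -e0 scale0r eqxx.
move: h1 h2 w0 z0; rewrite /slack e !dotZl; nra.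
Qed.

Lemma col_sym i j : colinear (a i) (a j) -> colinear (a j) (a i).
Proof.
move=> [l e]; exists l^-1; rewrite e scalerA mulVf ?scale1r //.
by apply/eqP => l0; have := a_neq0 Ir j; rewrite e l0 scale0r eqxx.
Qed.

Lemma col_uniq i j k : i != j -> i != k -> j != k ->
  colinear (a i) (a j) -> colinear (a i) (a k) -> False.
Proof.
move=> ij ik jk cj ck.
have [p p0 ep] := col_neg ij cj; have [q q0 eq_] := col_neg ik ck.
have [r r0 er] : exists2 l, l < 0 & a k = l *: a j.
  by apply: col_neg => //; exists (q / p); rewrite ep eq_ scalerA divfK // lt_eqF.
have : (q - r * p) *: a i = 0 by rewrite scalerBl -scalerA -ep -er -eq_ subrr.
by move=> /eqP; rewrite scaler_eq0 (negbTE (a_neq0 Ir i)) orbF => /eqP; nra.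
Qed.

(** ** Edges *)

(** Three vertices on two common facets would be collinear, but the vertex in the
middle lies only on the facets common to the other two. *)
Lemma edge_uniq A B C i j : A \in verts -> B \in verts -> C \in verts -> i != j ->
  i \in A -> i \in B -> i \in C -> j \in A -> j \in B -> j \in C -> [|| A == B, B == C | A == C].
Proof.
move=> hA hB hC ij iA iB iC jA jB jC.
apply/negPn/negP; rewrite !negb_or => /and3P[AB BC AC].
have nc : ~ colinear (a i) (a j).
  by apply: (@touch_ncol (vp A)) => //; have [_ -> _] := vpP hA.
have orth X Y k : X \in verts -> Y \in verts -> k \in X -> k \in Y -> dot (a k) (vp X - vp Y) = 0.
  move=> hX hY; rewrite -(vp_slack k hX) -(vp_slack k hY) /slack dotBr => /eqP + /eqP; lra.
have d0 : vp B - vp A != 0.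
  by rewrite subr_eq0; apply: contra AB => /eqP e; rewrite (vp_inj hA hB).
have [t ht] := ortho_line (a_neq0 Ir i) nc d0 (orth _ _ _ hB hA iB iA) (orth _ _ _ hB hA jB jA)
  (orth _ _ _ hC hA iC iA) (orth _ _ _ hC hA jC jA).
have btw X Y Z s : X \in verts -> Y \in verts -> Z \in verts -> X != Z -> 0 < s < 1 ->
    vp Y = (1 - s) *: vp X + s *: vp Z -> False.
  move=> hX hY hZ XZ hs e.
  have [iX aX _] := vpP hX; have [iY aY Y3] := vpP hY; have [iZ aZ _] := vpP hZ.
  have := vert_inter hX hZ XZ; rewrite leqNgt => /negP; apply.
  by rewrite -{1}aX -{1}aZ -(act_mid hs iX iZ) -e aY.
have eC : vp C = vp A + t *: (vp B - vp A) by rewrite -ht addrC subrK.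
have t0 : t != 0.
  by apply: contra AC => /eqP e; rewrite (vp_inj hA hC) // eC e scale0r addr0.
have t1 : t != 1.
  by apply: contra BC => /eqP e; rewrite (vp_inj hB hC) // eC e scale1r addrC subrK.
clear d0 ht.
have [tn|tp] := ltP t 0.
  apply: (btw C A B (- t / (1 - t))) => //; first by rewrite eq_sym.
    by rewrite divr_gt0 ?ltr_pdivrMr; lra.
  rewrite eC {eC}; apply/rowP => k; rewrite !mxE; field; lra.
have [tl|tg] := ltP t 1.
  apply: (btw A C B t) => //; first by rewrite tl andbT lt_neqAle eq_sym t0.
  rewrite eC; apply/rowP => k; rewrite !mxE; ring.
have tg' : 1 < t by rewrite lt_neqAle eq_sym t1.
apply: (btw A B C t^-1) => //.
  by rewrite invr_gt0 invf_lt1; lra.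
rewrite eC {eC}; apply/rowP => k; rewrite !mxE; field; lra.
Qed.

(** Start at the witness of [i] and decrease the functional of [j]. *)
Lemma avoid_facet i j : i != j -> exists A, [/\ A \in verts, i \in A & j \notin A].
Proof.
move=> ij; have [w [w0 hw]] := ir_wit Ir i.
have hin : inP w by move=> k; case: (eqVneq k i) => [->|/hw/ltW//]; rewrite w0.
have [A [hA sA mA]] := reach (- a j) hin; exists A; split=> //.
  by apply: (fintype.subsetP sA); apply/actP.
rewrite -(vp_slack j hA) gt_eqF //; have := hw j; rewrite eq_sym => /(_ ij).
by move: mA; rewrite !dotNl /slack; lra.
Qed.

Lemma facet_vert i : exists2 A, A \in verts & i \in A.
Proof.
have [w [w0 hw]] := ir_wit Ir i.
have hin : inP w by move=> k; case: (eqVneq k i) => [->|/hw/ltW//]; rewrite w0.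
have [A [hA sA _]] := reach 0 hin; exists A => //.
by apply: (fintype.subsetP sA); apply/actP.
Qed.

(** ** Planes that avoid the vertices *)

(** Only the values at vertices matter, as the plane is to avoid these; [S] is the
set of the vertices on the upper side. *)
Definition cuts nu c (S : {set {set I}}) := forall A, A \in verts ->
  (A \in S -> c < dot nu (vp A)) /\ (A \notin S -> dot nu (vp A) < c).

Definition separable S := exists nu c, cuts nu c S.

Lemma crossing nu c x y : c < dot nu x -> dot nu y < c -> exists2 t, 0 < t < 1 &
  dot nu ((1 - t) *: x + t *: y) = c.
Proof.
move=> hx hy; exists ((dot nu x - c) / (dot nu x - dot nu y)).
  by rewrite divr_gt0 ?ltr_pdivrMr; lra.
rewrite dotDr !dotZr; field; lra.
Qed.

Lemma separableW nu c0 (S : {set {set I}}) : (forall A, A \in S -> A \in verts -> c0 <= dot nu (vp A)) ->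
  (forall A, A \in verts -> A \notin S -> dot nu (vp A) < c0) -> separable S.
Proof.
move=> h1 h2.
have [|e e0 he] := @finite_pos R {set I} (fun A e => A \in verts -> A \notin S -> dot nu (vp A) < c0 - e).
  move=> A; case: (boolP ((A \in verts) && (A \notin S))) => [/andP[hA hS]|n].
    by exists (c0 - dot nu (vp A)) => [|e he _ _]; have := h2 A hA hS; lra.
  by exists 1 => // e _ hA hS; rewrite hA hS in n.
exists nu, (c0 - e / 2) => A hA; split=> hS; first by have := h1 A hS hA; lra.
by apply: he => //; lra.
Qed.

(** The normals of the facets at a vertex sum to a functional that is maximal
there alone. *)
Lemma peak A B : A \in verts -> B \in verts -> B != A ->
  dot (\sum_(i in A) a i) (vp B) < dot (\sum_(i in A) a i) (vp A).
Proof.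
move=> hA hB BA; have [iB _ _] := vpP hB; have [_ _ A3] := vpP hA.
have split x : dot (\sum_(i in A) a i) x = \sum_(i in A) dot (a i) x.
  exact: (big_morph (fun u => dot u x) (fun u v => dotDl x u v) (dot0l x)).
have eA k : k \in A -> dot (a k) (vp A) = b k.
  by rewrite -(vp_slack k hA) => /eqP; rewrite /slack; lra.
rewrite !split [X in _ < X](eq_bigr b) //.
have /fintype.subsetPn[j jA jB] : ~~ (A \subset B).
  apply/negP => /finset.setIidPl e; have := vert_inter hA hB; rewrite e eq_sym => /(_ BA).
  by rewrite leqNgt A3.
rewrite (bigD1 j) //= [X in _ < X](bigD1 j) //=; apply: ltr_leD.
  by have := vp_slack_gt0 hB jB; rewrite /slack; lra.
by apply: ler_sum => k _; have := iB k; rewrite /slack; lra.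
Qed.

Lemma separable1 A : A \in verts -> separable [set A].
Proof.
move=> hA; apply: (@separableW (\sum_(i in A) a i) (dot (\sum_(i in A) a i) (vp A))) => [B|B hB].
  by rewrite finset.in_set1 => /eqP ->.
by rewrite finset.in_set1; apply: peak.
Qed.

Definition fverts i : {set {set I}} := [set B in verts | i \in B].

(** The plane is that of the facet [i], slightly tilted by the normals of two other
facets through [w] so that [w] becomes the lowest vertex of [i], and then
moved past [w]. *)
Lemma separable_facet i j l w : w \in verts -> i \in w -> j \in w -> l \in w ->
  i != j -> j != l -> l != i -> separable (fverts i :\ w).
Proof.
move=> hw iw jw lw ij jl li.
have only v : v \in verts -> i \in v -> j \in v -> l \in v -> v = w.
  move=> hv iv jv lv; apply/eqP/negPn/negP => vw; have := vert_inter hv hw vw.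
  rewrite leqNgt => /negP; apply; apply/card_gt2P; exists i, j, l.
  by rewrite !finset.in_setI iv jv lv iw jw lw.
pose g v := slack j (vp v) + slack l (vp v).
have g0 v : v \in verts -> i \in v -> v != w -> 0 < g v.
  move=> hv iv vw; have [hin _ _] := vpP hv; rewrite /g.
  case: (boolP (j \in v)) => [jv|/(vp_slack_gt0 hv)]; last by have := hin l; lra.
  case: (boolP (l \in v)) => [lv|/(vp_slack_gt0 hv)]; last by have := hin j; lra.
  by move: vw; rewrite (only v) ?eqxx.
have [|e e0 he] := @finite_pos R {set I} (fun v e => v \in verts -> i \notin v -> e * g v < slack i (vp v)).
  move=> v; case: (boolP ((v \in verts) && (i \notin v))) => [/andP[hv iv]|n].
    have gv : 0 <= g v by have [h _ _] := vpP hv; rewrite addr_ge0.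
    have sv := vp_slack_gt0 hv iv.
    exists (slack i (vp v) / (g v + 1)) => [|e /andP[e1 e2] _ _]; first by rewrite divr_gt0 //; lra.
    by move: e2; rewrite ltr_pdivlMr; nra.
  by exists 1 => // e _ hv iv; rewrite hv iv in n.
have [|m m0 hm] := @finite_pos R {set I} (fun v m => v \in verts -> i \in v -> v != w -> m < (e / 2) * g v).
  move=> v; case: (boolP [&& v \in verts, i \in v & v != w]) => [/and3P[hv iv vw]|n].
    exists (e / 2 * g v) => [|m /andP[] //]; by rewrite mulr_gt0 ?g0 //; lra.
  by exists 1 => // m _ hv iv vw; rewrite hv iv vw in n.
have [|m' m0' hm'] := @finite_pos R {set I} (fun v m => v \in verts -> i \notin v -> (e / 2) * g v + m < slack i (vp v)).
  move=> v; case: (boolP ((v \in verts) && (i \notin v))) => [/andP[hv iv]|n].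
    have h := he (e / 2) _ v hv iv; exists (slack i (vp v) - e / 2 * g v) => [|m' hm' _ _]; last by lra.
    by have := h ltac:(lra); lra.
  by exists 1 => // m1 _ hv iv; rewrite hv iv in n.
pose nu := a i - (e / 2) *: (a j + a l).
have val v : dot nu (vp v) = b i - (e / 2) * (b j + b l) + (e / 2) * g v - slack i (vp v).
  by rewrite /nu /g /slack dotBl dotZl dotDl; ring.
have [p p0 [pm pm']] : exists2 p, 0 < p & p < m /\ p < m'.
  by case: (leP m m') => h; [exists (m / 2)|exists (m' / 2)]; first [split; lra|lra].
apply: (@separableW nu (b i - (e / 2) * (b j + b l) + p)) => [v|v hv].
  rewrite finset.in_setD1 finset.in_set => /andP[vw /andP[hv iv]] _; rewrite val.
  have /eqP -> : slack i (vp v) == 0 by rewrite vp_slack.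
  by have := hm p _ v hv iv vw; rewrite p0 pm => /(_ isT); lra.
rewrite finset.in_setD1 finset.in_set hv /= negb_and negbK => /orP[/eqP ->|iv]; rewrite val.
  have s0 k : k \in w -> slack k (vp w) = 0 by move=> kw; apply/eqP; rewrite vp_slack.
  by rewrite /g !s0 //; lra.
by have := hm' p _ v hv iv; rewrite p0 pm' => /(_ isT); lra.
Qed.

(** Otherwise the ray in this direction would stay in all the facets of the vertex
and leave the polyhedron through another one. *)
Lemma vert_rigid A d : A \in verts -> (forall i, i \in A -> dot (a i) d = 0) -> d = 0.
Proof.
move=> hA hd; apply/eqP/negPn/negP => d0; have [iA aA A3] := vpP hA.
have [t [j [t0 hy hj jd]]] := shoot Ir iA d0.
have e : vp A = vp A + t *: d.
  apply: act3_uniq => //; apply: (leq_trans A3); apply: subset_leq_card.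
  rewrite aA; apply/fintype.subsetP => k kA; rewrite finset.in_setI kA; apply/actP.
  by rewrite slackD dotZr hd // mulr0 subr0; apply/eqP; rewrite vp_slack.
have jA : j \in A by rewrite -(vp_slack j hA) [X in slack j X]e hj.
by rewrite hd ?ltxx in jd.
Qed.

(** At a vertex on three facets the slacks of these are coordinates, in which the
polyhedron lies in the cone of the edges. *)
Lemma simple_cone A i j l U1 U2 U3 x : A \in verts -> A = [set i; j; l] ->
  U1 \in verts -> U2 \in verts -> U3 \in verts -> U1 != A -> U2 != A -> U3 != A ->
  j \in U1 -> l \in U1 -> i \in U2 -> l \in U2 -> i \in U3 -> j \in U3 ->
  [/\ 0 < slack i (vp U1), 0 < slack j (vp U2), 0 < slack l (vp U3) &
  x - vp A = (slack i x / slack i (vp U1)) *: (vp U1 - vp A)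
    + (slack j x / slack j (vp U2)) *: (vp U2 - vp A) + (slack l x / slack l (vp U3)) *: (vp U3 - vp A)].
Proof.
move=> hA eA h1 h2 h3 n1 n2 n3 j1 l1 i2 l2 i3 j3.
have [_ _ A3] := vpP hA.
have pos U k : U \in verts -> U != A -> A :\ k \subset U -> k \in A -> 0 < slack k (vp U).
  move=> hU nU sU kA; apply: vp_slack_gt0 => //; apply/negP => kU.
  have /finset.setIidPr e : A \subset U.
    by apply/fintype.subsetP => z zA; case: (eqVneq z k) => [->//|zk]; apply: (fintype.subsetP sU); rewrite finset.in_setD1 zk.
  by have := vert_inter hU hA nU; rewrite e leqNgt A3.
have iA : i \in A by rewrite eA !inE eqxx.
have jA : j \in A by rewrite eA !inE eqxx !orbT.
have lA : l \in A by rewrite eA !inE eqxx !orbT.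
have s1 : 0 < slack i (vp U1).
  apply: pos => //; apply/fintype.subsetP => z; rewrite eA !inE => /andP[/negbTE -> /orP[] /eqP -> //].
have s2 : 0 < slack j (vp U2).
  apply: pos => //; apply/fintype.subsetP => z; rewrite eA !inE => /andP[/negbTE ->]; rewrite orbF => /orP[] /eqP -> //.
have s3 : 0 < slack l (vp U3).
  apply: pos => //; apply/fintype.subsetP => z; rewrite eA !inE => /andP[/negbTE ->]; rewrite orbF => /orP[] /eqP -> //.
split=> //; apply/eqP; rewrite -subr_eq0; apply/eqP.
have z0 k U : U \in verts -> k \in U -> dot (a k) (vp U) = b k.
  by move=> hU; rewrite -(vp_slack k hU) => /eqP; rewrite /slack; lra.
apply: (vert_rigid hA) => k kA; move: (kA); rewrite {1}eA !finset.in_setU !finset.in_set1 => /orP[/orP[]|] /eqP ->.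
- rewrite !(dotBr, dotDr, dotZr) (z0 i A) // (z0 i U2) // (z0 i U3) //; by move: s1 s2 s3; rewrite /slack; clear => s1 s2 s3; field; rewrite ?gt_eqF.
- rewrite !(dotBr, dotDr, dotZr) (z0 j A) // (z0 j U1) // (z0 j U3) //; by move: s1 s2 s3; rewrite /slack; clear => s1 s2 s3; field; rewrite ?gt_eqF.
- rewrite !(dotBr, dotDr, dotZr) (z0 l A) // (z0 l U1) // (z0 l U2) //; by move: s1 s2 s3; rewrite /slack; clear => s1 s2 s3; field; rewrite ?gt_eqF.
Qed.

(** The facets [j] that share an edge of [i] at the vertex [A]. *)
Definition edge_at A i : {set I} :=
  [set j in A :\ i | [exists B, [&& B \in verts, B != A, i \in B & j \in B]]].

Lemma edge_atP A i j : reflect (exists B, [/\ B \in verts, B != A, i \in B & j \in B])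
  [exists B, [&& B \in verts, B != A, i \in B & j \in B]].
Proof. by apply: (iffP existsP) => [[B /and4P[]]|[B []]] *; exists B => //; apply/and4P. Qed.

(** A plane that cuts off the vertex [A] meets the facet [i] in a segment, and the
edges of [i] at [A] pass through its two ends. *)
Lemma edge_at2 A i : A \in verts -> i \in A -> exists j1 j2, j1 != j2 /\ edge_at A i = [set j1; j2].
Proof.
move=> hA iA; have [iinA aA A3] := vpP hA.
have [nu [c hc]] := separable1 hA.
have cA : c < dot nu (vp A) by have [h _] := hc A hA; apply: h; rewrite finset.in_set1.
have cB B : B \in verts -> B != A -> dot nu (vp B) < c.
  by move=> hB BA; have [_ h] := hc B hB; apply: h; rewrite finset.in_set1.
have [C [hC iC CA]] : exists C, [/\ C \in verts, i \in C & C != A].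
  have : (0 < #|A :\ i|)%N by move: A3; rewrite (cardsD1 i) iA; lia.
  case/card_gt0P => j; rewrite finset.in_setD1 => /andP[ji jA].
  have [C [hC iC jC]] : exists C, [/\ C \in verts, i \in C & j \notin C] by apply: avoid_facet; rewrite eq_sym.
  by exists C; split=> //; apply: contraNneq jC => ->.
have onP x y : inP x -> inP y -> i \in act x -> i \in act y -> c < dot nu x -> dot nu y < c ->
    exists z, [/\ inP z, dot nu z = c, act z = act x :&: act y & i \in act z].
  move=> hx hy ix iy cx cy; have [t ht e] := crossing cx cy.
  exists ((1 - t) *: x + t *: y); split=> //; rewrite ?act_mid // ?finset.in_setI ?ix ?iy //.
  by apply: inP_mid => //; case/andP: ht => /ltW -> /ltW.
have [w [hw cw aw]] : exists w, [/\ inP w, dot nu w = c & act w = [set i]].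
  have [u [u0 hu]] := ir_wit Ir i.
  have hin : inP u by move=> k; case: (eqVneq k i) => [->|/hu/ltW//]; rewrite u0.
  have au : act u = [set i].
    apply/setP => k; rewrite finset.in_set1; apply/actP/eqP => [e|->//].
    by apply/eqP/negPn/negP => /hu; rewrite e ltxx.
  have iu : i \in act u by rewrite au finset.in_set1.
  have [inC aC _] := vpP hC.
  have iA' : i \in act (vp A) by rewrite aA.
  have iC' : i \in act (vp C) by rewrite aC.
  case: (ltrgtP (dot nu u) c) => h; last by exists u.
    have [z [z1 z2 z3 z4]] := onP _ _ iinA hin iA' iu cA h; exists z; split=> //.
    by rewrite z3 aA au; apply/finset.setIidPr; rewrite finset.sub1set.
  have [z [z1 z2 z3 z4]] := onP _ _ hin inC iu iC' h (cB _ hC CA); exists z; split=> //.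
  by rewrite z3 aC au; apply/finset.setIidPl; rewrite finset.sub1set.
have nc : ~ colinear (a i) nu.
  move=> [l e]; have := cB C hC CA; have := cA.
  have iz X : X \in verts -> i \in X -> dot (a i) (vp X) = b i.
    by move=> hX; rewrite -(vp_slack i hX) => /eqP; rewrite /slack; lra.
  by rewrite e !dotZl !iz //; lra.
have ai0 := a_neq0 Ir i.
have [d d0 [id nd]] := ortho2 (a i) nu.
have ends e : e != 0 -> dot (a i) e = 0 -> dot nu e = 0 ->
    exists t j, [/\ 0 < t, inP (w + t *: e), 0 < dot (a j) e, act (w + t *: e) = [set i; j] & j \in edge_at A i].
  move=> e0 ie ne; have [t [j [t0 hy hj je]]] := shoot Ir hw e0.
  have ji : j != i by apply: contraTneq je => ->; rewrite ie ltxx.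
  have iy : i \in act (w + t *: e).
    by apply/actP; rewrite slackD dotZr ie mulr0 subr0; apply/actP; rewrite aw finset.in_set1.
  have jy : j \in act (w + t *: e) by apply/actP.
  have ny : dot nu (w + t *: e) = c by rewrite dotDr dotZr ne mulr0 addr0.
  have tp : 0 < t.
    rewrite lt_neqAle t0 andbT; apply: contraTneq jy => <-.
    by rewrite scale0r addr0 aw finset.in_set1.
  have [X [hX sX]] := reach nu hy; rewrite ny => mX.
  have eX : X = A by apply/eqP/negPn/negP => /(cB _ hX); lra.
  have [Y [hY sY]] := reach (- nu) hy; rewrite !dotNl ny => mY.
  have YA : Y != A by apply: contraTneq cA => <-; rewrite -leNgt; lra.
  rewrite eX in sX; exists t, j; split=> //; last first.
    rewrite finset.in_set finset.in_setD1 ji (fintype.subsetP sX) //=.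
    by apply/edge_atP; exists Y; split=> //; apply: (fintype.subsetP sY).
  apply/eqP; rewrite eq_sym eqEcard; apply/andP; split.
    by apply/fintype.subsetP => k; rewrite !finset.in_set2 => /orP[] /eqP ->.
  rewrite cards2 eq_sym ji; apply: leq_trans (vert_inter hA hY _); last by rewrite eq_sym.
  by apply: subset_leq_card; rewrite finset.subsetI sX.
have [t1 [j1 [t10 y1 jd1 a1 e1]]] := ends d d0 id nd.
have [t2 [j2 [t20 y2 jd2 a2 e2]]] : exists t j, [/\ 0 < t, inP (w + t *: - d), 0 < dot (a j) (- d), act (w + t *: - d) = [set i; j] & j \in edge_at A i].
  by apply: ends; rewrite ?oppr_eq0 // dotNr ?id ?nd oppr0.
have j12 : j1 != j2 by apply: contraTneq jd2 => <-; rewrite dotNr -leNgt; lra.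
exists j1, j2; split=> //; apply/setP => j; rewrite finset.in_set2; apply/idP/orP => [|[] /eqP -> //].
rewrite finset.in_set finset.in_setD1 => /andP[/andP[ji jA] /edge_atP[B [hB BA iB jB]]].
have [inB aB _] := vpP hB.
have [z [z1 z2 z3 z4]] : exists z, [/\ inP z, dot nu z = c, act z = act (vp A) :&: act (vp B) & i \in act z].
  by apply: onP; rewrite ?aA ?aB //; apply: cB.
have jz : j \in act z by rewrite z3 aA aB finset.in_setI jA.
have [t ht] : exists t, z - w = t *: d.
  apply: (ortho_line ai0 nc d0 id nd); rewrite dotBr ?z2 ?cw ?subrr //.
  move/actP: z4; have /actP : i \in act w by rewrite aw finset.in_set1.
  by rewrite /slack; lra.
have ez : z = w + t *: d by rewrite -ht addrC subrK.
have s1 : t <= t1.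
  move: (z1 j1); have /actP : j1 \in act (w + t1 *: d) by rewrite a1 finset.in_set2 eqxx orbT.
  by rewrite ez !slackD !dotZr; nra.
have s2 : - t2 <= t.
  move: (z1 j2); have /actP : j2 \in act (w + t2 *: - d) by rewrite a2 finset.in_set2 eqxx orbT.
  by move: jd2; rewrite ez !slackD !dotZr !dotNr; nra.
have in1 : t = t1 -> j = j1.
  by move=> e; move: jz; rewrite ez e a1 finset.in_set2 (negbTE ji) => /eqP.
have in2 : t = - t2 -> j = j2.
  by move=> e; move: jz; rewrite ez e scaleNr -scalerN a2 finset.in_set2 (negbTE ji) => /eqP.
case: (eqVneq t t1) => [/in1 -> |n1]; first by left.
case: (eqVneq t (- t2)) => [/in2 -> |n2]; first by right.
have lt1 : t < t1 by rewrite lt_neqAle n1.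
have lt2 : - t2 < t by rewrite lt_neqAle eq_sym n2.
pose r := (t1 - t) / (t1 + t2).
have hr : 0 < r < 1 by rewrite divr_gt0 ?ltr_pdivrMr; lra.
have er : z = (1 - r) *: (w + t1 *: d) + r *: (w + t2 *: - d).
  rewrite ez /r; move: t10 t20; clear => t10 t20; apply/rowP => k; rewrite !mxE; field; lra.
move: jz; rewrite er act_mid // a1 a2 finset.in_setI !finset.in_set2 (negbTE ji) /=.
by move=> /andP[/eqP -> /eqP e]; rewrite e eqxx in j12.
Qed.

Lemma simple_edges A i j l : A \in verts -> A = [set i; j; l] -> i != j -> j != l -> l != i ->
  exists U1 U2 U3, [/\ [/\ U1 \in verts, U2 \in verts & U3 \in verts],
    [/\ U1 != A, U2 != A & U3 != A], [/\ j \in U1 & l \in U1],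
    [/\ i \in U2 & l \in U2] & [/\ i \in U3 & j \in U3]].
Proof.
move=> hA eA ij jl li.
have get p q r : A = [set p; q; r] -> p != q -> q != r -> r != p ->
    exists U, [/\ U \in verts, U != A, p \in U & q \in U].
  move=> e pq qr rp; have pA : p \in A by rewrite e !inE eqxx.
  have [j1 [j2 [j12 e12]]] := edge_at2 hA pA.
  have : q \in edge_at A p.
    have sub k : k \in [set j1; j2] -> k = q \/ k = r.
      rewrite -e12 finset.in_set finset.in_setD1 => /andP[/andP[kp]].
      by rewrite e !finset.in_setU !finset.in_set1 (negbTE kp) => /orP[] /eqP ->; [left|right].
    have := sub j1; have := sub j2; rewrite e12 !finset.in_set2 !eqxx orbT => /(_ isT) h2 /(_ isT) h1.
    by case: h1 h2 j12 => -> [] ->; rewrite ?eqxx ?orbT.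
  by rewrite finset.in_set => /andP[_ /edge_atP[U hU]]; exists U.
have perm1 : A = [set j; l; i] by rewrite eA -finset.setUA finset.setUC.
have perm2 : A = [set i; l; j] by rewrite eA finset.setUAC.
have [U1 [u1 n1 j1 l1]] := get _ _ _ perm1 jl li ij.
have [U2 [u2 n2 i2 l2]] := get i l j perm2 ltac:(by rewrite eq_sym) ltac:(by rewrite eq_sym) ltac:(by rewrite eq_sym).
have [U3 [u3 n3 i3 j3]] := get _ _ _ eA ij jl li.
by exists U1, U2, U3.
Qed.

(** The plane through the ends of the three edges at [A]: another vertex on the
same side as [A] would be a convex combination of the four vertices. *)
Lemma separable_star A i j l U1 U2 U3 : A \in verts -> A = [set i; j; l] ->
  U1 \in verts -> U2 \in verts -> U3 \in verts -> U1 != A -> U2 != A -> U3 != A ->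
  j \in U1 -> l \in U1 -> i \in U2 -> l \in U2 -> i \in U3 -> j \in U3 ->
  separable [set A; U1; U2; U3].
Proof.
move=> hA eA h1 h2 h3 n1 n2 n3 j1 l1 i2 l2 i3 j3.
have cone x := simple_cone x hA eA h1 h2 h3 n1 n2 n3 j1 l1 i2 l2 i3 j3.
have [s1 s2 s3 _] := cone 0.
have z0 k U : U \in verts -> k \in U -> slack k (vp U) = 0 by move=> hU kU; apply/eqP; rewrite vp_slack.
have [iA jA lA] : [/\ i \in A, j \in A & l \in A] by rewrite eA !inE !eqxx !orbT.
pose si := slack i (vp U1); pose sj := slack j (vp U2); pose sl := slack l (vp U3).
pose nu := si^-1 *: a i + sj^-1 *: a j + sl^-1 *: a l.
pose K := b i / si + b j / sj + b l / sl.
have val x : dot nu x = K - (slack i x / si + slack j x / sj + slack l x / sl).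
  by rewrite /K /nu /slack !dotDl !dotZl; ring.
apply: (@separableW nu (K - 1)) => [B hB _|B hB nB]; rewrite val.
  have {}hB : [\/ B = A, B = U1, B = U2 | B = U3].
    by move: hB; rewrite !finset.in_setU !finset.in_set1 => /orP[/orP[/orP[]|]|] /eqP ->; [constructor 1|constructor 2|constructor 3|constructor 4].
  case: hB => ->.
  - by rewrite !z0 // !mul0r; lra.
  - by rewrite (z0 j) // (z0 l) // !mul0r divff ?gt_eqF //; lra.
  - by rewrite (z0 i) // (z0 l) // !mul0r divff ?gt_eqF //; lra.
  - by rewrite (z0 i) // (z0 j) // !mul0r divff ?gt_eqF //; lra.
move: nB; rewrite !finset.in_setU !finset.in_set1 !negb_or -!andbA => /and4P[BA B1 B2 B3].
have [_ _ _ e] := cone (vp B); have [iB aB B4] := vpP hB.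
have [iA' _ _] := vpP hA; have [iU1 _ _] := vpP h1; have [iU2 _ _] := vpP h2; have [iU3 _ _] := vpP h3.
have li0 : 0 <= slack i (vp B) / si by rewrite divr_ge0 // ltW.
have lj0 : 0 <= slack j (vp B) / sj by rewrite divr_ge0 // ltW.
have ll0 : 0 <= slack l (vp B) / sl by rewrite divr_ge0 // ltW.
move: e; rewrite -/si -/sj -/sl.
set p := _ / si in li0 *; set q := _ / sj in lj0 *; set r := _ / sl in ll0 * => e.
rewrite ltrD2l ltrN2 ltNge; apply/negP => le1.
have sB k : slack k (vp B) = (1 - (p + q + r)) * slack k (vp A) + p * slack k (vp U1) + q * slack k (vp U2) + r * slack k (vp U3).
  have -> : vp B = vp A + (p *: (vp U1 - vp A) + q *: (vp U2 - vp A) + r *: (vp U3 - vp A)) by rewrite -e addrC subrK.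
  by rewrite slackD !dotDr !dotZr !dotBr /slack; ring.
have sub U s : U \in verts -> B != U -> 0 <= s -> (forall k, k \in B -> s * slack k (vp U) = 0) -> s = 0.
  move=> hU BU s0 h; apply/eqP/negPn/negP => sn.
  have := vert_inter hB hU BU; have -> : B :&: U = B; last by rewrite leqNgt B4.
  apply/finset.setIidPl/fintype.subsetP => k kB; rewrite -(vp_slack k hU).
  by have /eqP := h k kB; rewrite mulf_eq0 (negbTE sn).
have nn k : [/\ 0 <= (1 - (p + q + r)) * slack k (vp A), 0 <= p * slack k (vp U1), 0 <= q * slack k (vp U2) & 0 <= r * slack k (vp U3)].
  by split; apply: mulr_ge0 => //; lra.
have zB k : k \in B -> [/\ p * slack k (vp U1) = 0, q * slack k (vp U2) = 0 & r * slack k (vp U3) = 0].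
  move=> kB; have := sB k; rewrite z0 //; case: (nn k).
  have z4 (x y z w : R) : 0 <= x -> 0 <= y -> 0 <= z -> 0 <= w -> 0 = x + y + z + w -> [/\ y = 0, z = 0 & w = 0].
    by clear; split; lra.
  exact: z4.
have p0 : p = 0 by apply: (sub U1) => // k /zB[].
have q0 : q = 0 by apply: (sub U2) => // k /zB[].
have r0 : r = 0 by apply: (sub U3) => // k /zB[].
move: e; rewrite p0 q0 r0 !scale0r !addr0 => /eqP; rewrite subr_eq0 => /eqP /(vp_inj hB hA) eBA.
by rewrite eBA eqxx in BA.
Qed.

Lemma card3 A : #|A| = 3%N -> exists i j l, [/\ i != j, j != l, l != i & A = [set i; j; l]].
Proof.
move=> A3; have /card_gt2P[i [j [l [[iA jA lA] [ij jl li]]]]] : (2 < #|A|)%N by rewrite A3.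
exists i, j, l; split=> //; apply/esym/eqP; rewrite eqEcard A3; apply/andP; split.
  by apply/fintype.subsetP => k; rewrite !finset.in_setU !finset.in_set1 => /orP[/orP[]|] /eqP ->.
by rewrite finset.setUC cardsU1 cards2 finset.in_set2 negb_or li eq_sym jl ij.
Qed.

(** By the simplex method: among the vertices in [W] take the best one for the
functional with peak [B]; if it is not [B], the functional increases along one of
its edges, whose other end is in [W] too. *)
Lemma verts_connected (W : {set {set I}}) A0 : (forall A, A \in verts -> #|A| = 3%N) ->
  A0 \in W -> (forall A, A \in W -> A \in verts) ->
  (forall A B, A \in W -> B \in verts -> #|A :&: B| = 2%N -> B \in W) ->
  forall B, B \in verts -> B \in W.
Proof.
move=> simple A0W sW cl B hB; apply/negPn/negP => BW.
pose nu := \sum_(i in B) a i.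
case: (arg_maxP (fun A => dot nu (vp A)) A0W) => A AW Amax.
have hA := sW A AW; have BA : A != B by apply: contraNneq BW => <-.
have [i [j [l [ij jl li eA]]]] := card3 (simple A hA).
have [U1 [U2 [U3 [[h1 h2 h3] [n1 n2 n3] [j1 l1] [i2 l2] [i3 j3]]]]] := simple_edges hA eA ij jl li.
have [s1 s2 s3 e] := simple_cone (vp B) hA eA h1 h2 h3 n1 n2 n3 j1 l1 i2 l2 i3 j3.
have lt : dot nu (vp A) < dot nu (vp B) by apply: peak.
have [iB _ _] := vpP hB.
have le U p q : U \in verts -> U != A -> p != q -> p \in U -> q \in U -> p \in A -> q \in A -> dot nu (vp U) <= dot nu (vp A).
  move=> hU UA pq pU qU pA qA; apply: (Amax U); apply: (cl A) => //; apply/eqP.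
  rewrite eqn_leq vert_inter //= 1?eq_sym // -[2%N](_ : #|[set p; q]| = _); last by rewrite cards2 pq.
  apply: subset_leq_card; apply/fintype.subsetP => k; rewrite finset.in_set2 finset.in_setI.
  by case/orP => /eqP ->; rewrite ?pA ?qA.
have [iA jA lA] : [/\ i \in A, j \in A & l \in A] by rewrite eA !inE !eqxx !orbT.
have d1 := le U1 j l h1 n1 jl j1 l1 jA lA; have d2 := le U2 l i h2 n2 li l2 i2 lA iA; have d3 := le U3 i j h3 n3 ij i3 j3 iA jA.
have := congr1 (dot nu) e; rewrite !(dotBr, dotDr, dotZr).
have li0 : 0 <= slack i (vp B) / slack i (vp U1) by rewrite divr_ge0 // ltW.
have lj0 : 0 <= slack j (vp B) / slack j (vp U2) by rewrite divr_ge0 // ltW.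
have ll0 : 0 <= slack l (vp B) / slack l (vp U3) by rewrite divr_ge0 // ltW.
move: li0 lj0 ll0 lt d1 d2 d3; clear; move: (slack i _ / _) (slack j _ / _) (slack l _ / _) => p q r.
move: (dot nu (vp A)) (dot nu (vp B)) (dot nu (vp U1)) (dot nu (vp U2)) (dot nu (vp U3)) => *; nra.
Qed.

End Space.

(** * Irredundant systems in the plane are convex polygons *)

Section Sorting.
Variables (R : realType) (I : finType) (t be : I -> R) (i0 : I).
Hypothesis Ir : irredundant (fun i => dir (t i)) be.
Hypothesis ht : forall i, t i0 <= t i < t i0 + turn R.
Hypothesis I4 : (4 < #|I|)%N.

Let n := #|I|.
Let n0 : (0 < n)%N. Proof. exact: leq_trans I4. Qed.

Lemma angle_inj : injective t.
Proof.
move=> i j e; apply/eqP/negPn/negP => ij.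
have [x [x0 hx]] := ir_wit Ir i; have [y [y0 hy]] := ir_wit Ir j.
have := hx j; rewrite eq_sym => /(_ ij); have := hy i ij.
by move: x0 y0; rewrite /slack e; lra.
Qed.

Definition by_angle : seq I := sort (fun i j => t i <= t j) (enum I).
Definition side k : I := nth i0 by_angle (k %% n).
Definition side_phi k : R := t (side k) + (k %/ n)%:R * turn R.

Lemma size_by_angle : size by_angle = n.
Proof. by rewrite size_sort -cardE. Qed.

Lemma side_ltn k l : (k < l < n)%N -> t (side k) < t (side l).
Proof.
move=> /andP[kl ln]; have kn : (k < n)%N by apply: ltn_trans ln.
have tr : transitive (fun i j : I => t i <= t j) by move=> y x z; apply: le_trans.
have tot : total (fun i j : I => t i <= t j) by move=> x y; apply: le_total.
have so : sorted (fun i j => t i <= t j) by_angle by apply: sort_sorted.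
rewrite lt_neqAle /side !modn_small //; apply/andP; split.
  apply: contraTneq kl => /angle_inj /eqP; rewrite nth_uniq ?size_by_angle //.
    by move=> /eqP ->; rewrite ltnn.
  by rewrite sort_uniq enum_uniq.
apply: (sorted_leq_nth tr (fun x => lexx (t x))) => //; rewrite ?inE ?size_by_angle //.
exact: ltnW.
Qed.

Lemma side_mod k l : k = l %[mod n] -> side k = side l.
Proof. by rewrite /side => ->. Qed.

Lemma side_surj i : exists2 k, (k < n)%N & side k = i.
Proof.
have hi : i \in by_angle by rewrite mem_sort mem_enum.
have hk : (index i by_angle < n)%N by rewrite -size_by_angle index_mem.
by exists (index i by_angle) => //; rewrite /side modn_small // nth_index.
Qed.

Lemma side_inj k l : side k = side l -> k = l %[mod n].
Proof.
move=> e; have e' : side (k %% n) = side (l %% n).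
  by rewrite (side_mod (modn_mod k n)) (side_mod (modn_mod l n)).
have := @side_ltn (k %% n)%N (l %% n)%N; have := @side_ltn (l %% n)%N (k %% n)%N.
rewrite !ltn_pmod // !andbT e' ltxx; case: (ltngtP (k %% n)%N (l %% n)%N) => // _ h1 h2.
  by have := h2 isT.
by have := h1 isT.
Qed.

Lemma side0 : side 0 = i0.
Proof.
have [k kn e] := side_surj i0; case: (posnP k) => [k0|k0]; first by rewrite -e k0.
have := @side_ltn 0 k; rewrite k0 kn => /(_ isT); rewrite e ltNge.
by case/andP: (ht (side 0)) => ->.
Qed.

Lemma side_phiD k : side_phi (k + n) = side_phi k + turn R.
Proof. by rewrite /side_phi (@side_mod (k + n) k) ?modnDr // divnDr // divnn n0 addn1 -natr1; ring. Qed.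

Lemma side_phiS k : side_phi k < side_phi k.+1.
Proof.
rewrite /side_phi; have lt := ltn_pmod k n0.
have -> : (k.+1 %/ n = k %/ n + (k %% n).+1 %/ n)%N by rewrite {1}(divn_eq k n) -addnS divnMDl.
have -> : side k.+1 = side (k %% n).+1 by apply: side_mod; rewrite {1}(divn_eq k n) -addnS modnMDl.
rewrite -(side_mod (modn_mod k n)).
case: (ltngtP (k %% n).+1 n) => [h|h|h].
- by rewrite (divn_small h) addn0 ltrD2r; apply: side_ltn; rewrite ltnSn.
- by have := leq_trans h lt; rewrite ltnn.
rewrite h divnn n0 natrD (@side_mod n 0%N) ?modnn ?mod0n // side0.
have /andP[_ h2] := ht (side (k %% n)); rewrite /= mulrDl mul1r; lra.
Qed.

Lemma side_phi_lt k l : (k < l)%N -> side_phi k < side_phi l.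
Proof.
elim: l => // l IH; rewrite ltnS leq_eqVlt => /predU1P[->|/IH h]; first exact: side_phiS.
exact: lt_trans h (side_phiS l).
Qed.

Lemma side_phi_le k l : (k <= l)%N -> side_phi k <= side_phi l.
Proof. by rewrite leq_eqVlt => /predU1P[->//|/side_phi_lt/ltW]. Qed.

Lemma dir_side k : dir (side_phi k) = dir (t (side k)).
Proof. by rewrite /side_phi (_ : (k %/ n)%:R = (k %/ n)%:Z%:~R) // dir_turn. Qed.

(** The turn that begins after the side [k] contains all sides. *)
Lemma side_after k i : exists l, [/\ (k < l <= k + n)%N & side l = i].
Proof.
have [r rn e] := side_surj i; set q := (k %/ n)%N; set s := (k %% n)%N.
have ek : k = (q * n + s)%N by rewrite /q /s -divn_eq.
have sn : (s < n)%N by rewrite ltn_pmod.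
case: (ltnP s r) => sr.
  exists (q * n + r)%N; split; first by clear -ek sn sr rn; lia.
  by rewrite -e; apply: side_mod; rewrite modnMDl.
exists (q * n + n + r)%N; split; first by clear -ek sn sr rn; lia.
by rewrite -e; apply: side_mod; rewrite -mulSnr modnMDl.
Qed.

(** If [l] is not [k.+1], then the functional of the side [k.+1] between them is a
positive combination of theirs; tightness of [k] and [l] at a common point would
make it redundant. *)
Lemma tight_near y k l : pgset side_phi (be \o side) y ->
  tight side_phi (be \o side) y k -> tight side_phi (be \o side) y l ->
  (k < l)%N -> side_phi l - side_phi k < pi -> l = k.+1.
Proof.
move=> hy hk hl kl lp; apply/eqP; rewrite eqn_leq kl andbT leqNgt; apply/negP => kl1.
have g1 := side_phiS k; have g2 := side_phi_lt kl1.
have ln : (l < k + n)%N.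
  rewrite ltnNge; apply/negP => /side_phi_le; rewrite side_phiD /turn.
  by have := pi_gt0 R; lra.
have [w [w0 hw]] := ir_wit Ir (side k.+1).
have comb z : sin (side_phi l - side_phi k) * dot (dir (side_phi k.+1)) z =
    sin (side_phi l - side_phi k.+1) * dot (dir (side_phi k)) z +
    sin (side_phi k.+1 - side_phi k) * dot (dir (side_phi l)) z.
  rewrite !dot2 !vec0 !vec1 !sinB.
  have := cos2Dsin2 (side_phi k); have := cos2Dsin2 (side_phi k.+1); have := cos2Dsin2 (side_phi l).
  by move=> _ _ _; ring.
have s0 : 0 < sin (side_phi l - side_phi k) by apply: sin_gt0_pi; lra.
have s1 : 0 < sin (side_phi l - side_phi k.+1) by apply: sin_gt0_pi; lra.
have s2 : 0 < sin (side_phi k.+1 - side_phi k) by apply: sin_gt0_pi; lra.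
have hwk : dot (dir (side_phi k)) w < be (side k).
  have : side k != side k.+1.
    apply/eqP => /side_inj; rewrite -[k.+1]addn1; apply: eqmod_small.
    by rewrite (leq_trans _ I4).
  by move=> /hw; rewrite /slack -dir_side; lra.
have hwl : dot (dir (side_phi l)) w < be (side l).
  have : side l != side k.+1.
    apply/eqP => /side_inj /esym.
    have := @eqmod_small n k.+1 (l - k.+1); rewrite subnKC ?(ltnW kl1) // => h; apply: h.
    by clear -kl1 ln; lia.
  by move=> /hw; rewrite /slack -dir_side; lra.
have := comb w; have := comb y; rewrite /tight /= in hk hl; rewrite hk hl.
have := hy k.+1; rewrite /=.
have : dot (dir (side_phi k.+1)) w = be (side k.+1) by move: w0; rewrite /slack -dir_side; lra.
move=> -> hy1 e1 e2.
move: hwk hwl hy1 e1 e2; set A := dot _ w; set B := dot _ w; set Y := dot _ y.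
by nra.
Qed.

Let slackE k y : slack (fun i => dir (t i)) be (side k) y = be (side k) - dot (dir (side_phi k)) y.
Proof. by rewrite /slack dir_side. Qed.

Let pgsetP y : pgset side_phi (be \o side) y <-> inP (fun i => dir (t i)) be y.
Proof.
split=> [h i|h k]; last by have := h (side k); rewrite slackE /=; lra.
by have [k _ <-] := side_surj i; have := h k; rewrite slackE /=; lra.
Qed.

(** Otherwise some ray would not leave the bounded set. *)
Lemma side_gap k : side_phi k.+1 - side_phi k < pi.
Proof.
rewrite ltNge; apply/negP => h.
have [x hx] := ir_in Ir; have hin : inP (fun i => dir (t i)) be x by move=> i; apply/ltW.
have d0 : dir (side_phi k + pi / 2) != 0.
  apply/eqP => e; have := cos2Dsin2 (side_phi k + pi / 2).
  have := congr1 (fun X : 'rV[R]_2 => X 0 0) e; have := congr1 (fun X : 'rV[R]_2 => X 0 1) e.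
  by rewrite vec0 vec1 !mxE => -> ->; rewrite expr0n /= addr0 => /eqP; rewrite eq_sym oner_eq0.
have [r [j [_ _ _]]] := shoot Ir hin d0.
have [l [/andP[kl ln] <-]] := side_after k j; rewrite -dir_side dot_dir.
apply/negP; rewrite -leNgt; apply/cos_le0P; exists 0; rewrite mul0r addr0.
have := side_phi_le ln; rewrite side_phiD /turn; have := side_phi_le kl; lra.
Qed.

Theorem polygon_of_irredundant : polygon n side_phi (be \o side).
Proof.
have pi0 := pi_gt0 R.
split=> //.
- exact: side_phiD.
- by move=> k /=; rewrite (@side_mod (k + n) k) ?modnDr.
- by move=> k; rewrite side_gap subr_gt0 side_phiS.
- move=> k; have [w [w0 hw]] := ir_wit Ir (side k).
  have hin : inP (fun i => dir (t i)) be w by move=> j; case: (eqVneq j (side k)) => [->|/hw/ltW//]; rewrite w0.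
  have dk r : dot (dir (side_phi k)) (w + r *: dir (side_phi k + pi / 2)) = dot (dir (side_phi k)) w.
    by rewrite dotDr dotZr dot_dir (_ : _ - _ = - (pi / 2)) ?cosN ?cos_pihalf ?mulr0 ?addr0 //; ring.
  have d0 : dir (side_phi k + pi / 2) != 0.
    apply/eqP => e; have := cos2Dsin2 (side_phi k + pi / 2).
    have := congr1 (fun X : 'rV[R]_2 => X 0 0) e; have := congr1 (fun X : 'rV[R]_2 => X 0 1) e.
    by rewrite vec0 vec1 !mxE => -> ->; rewrite expr0n /= addr0 => /eqP; rewrite eq_sym oner_eq0.
  have [r [j [r0 hy hj jd]]] := shoot Ir hin d0.
  exists (w + r *: dir (side_phi k + pi / 2)).
  have yk : tight side_phi (be \o side) (w + r *: dir (side_phi k + pi / 2)) k.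
    by rewrite /tight dk /=; move: w0; rewrite slackE; lra.
  have {}hy := (pgsetP _).2 hy.
  have [l [/andP[kl ln] el]] := side_after k j.
  move: jd hj; rewrite -el -dir_side dot_dir slackE => jd /eqP; rewrite subr_eq0 => /eqP/esym yl.
  suff <- : l = k.+1 by [].
  apply: (tight_near hy yk yl kl); rewrite ltNge; apply/negP => h.
  move: jd; apply/negP; rewrite -leNgt; apply/cos_le0P; exists 0; rewrite mul0r addr0.
  have := side_phi_le ln; rewrite side_phiD /turn; lra.
- move=> y k l hy hk hl.
  have [l' [/andP[kl ln] e]] := side_after k (side l).
  have hl' : tight side_phi (be \o side) y l' by move: hl; rewrite /tight !dir_side /= e.
  have el := side_inj e.
  case: (ltngtP l' (k + n)) => [ln'|h|h]; last by constructor 1; rewrite -el h modnDr.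
    2: by have := leq_trans h ln; rewrite ltnn.
  have h1 := side_phi_lt kl; have h2 := side_phi_lt ln'; rewrite side_phiD in h2.
  case: (ltrgtP (side_phi l' - side_phi k) pi) => h.
  + by constructor 3; rewrite -el (tight_near hy hk hl' kl h).
  + have hk' : tight side_phi (be \o side) y (k + n).
      by move: hk; rewrite /tight !dir_side /= (@side_mod (k + n) k) ?modnDr.
    constructor 2; have e2 := tight_near hy hl' hk' ln' _.
    by rewrite -(modnDr k) e2 ?side_phiD ?/turn; [apply: eqmodS|rewrite /turn in h2 *; lra].
  + exfalso; have [x hx] := ir_in Ir.
    have := hx (side k); have := hx (side l'); rewrite !slackE.
    have -> : side_phi l' = side_phi k + pi by lra.
    have ed : dir (side_phi k + pi) = - dir (side_phi k).
      by apply: vecP; rewrite ?mxE /= ?cosDpi ?sinDpi.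
    move: hl' hk; rewrite /tight /=; have -> : side_phi l' = side_phi k + pi by lra.
    by rewrite ed !dotNl; lra.
- have [D hD] := ir_bd Ir; exists (D + D) => y /pgsetP hy.
  by apply: lerD; apply: hD.
- have [x hx] := ir_in Ir; exists x => k; have := hx (side k); rewrite slackE /=; lra.
Qed.

End Sorting.

(** * Isometries and charts of planes *)

Section Isometry.
Variable R : realType.
Implicit Types (u v w : 'rV[R]_2).

Lemma unit_dir u : dot u u = 1 -> exists t, u = dir t.
Proof.
rewrite dot2 => h; have x1 : -1 <= u 0 0 <= 1.
  by have := sqr_ge0 (u 0 1); rewrite expr2; nra.
have s2 : Num.sqrt (1 - u 0 0 ^+ 2) = `|u 0 1|.
  by rewrite -sqrtr_sqr; congr Num.sqrt; rewrite -h; ring.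
case: (leP 0 (u 0 1)) => y0.
  exists (acos (u 0 0)); apply: vecP; first by rewrite vec0 acosK.
  by rewrite vec1 sin_acos // s2 ger0_norm.
exists (- acos (u 0 0)); apply: vecP; first by rewrite vec0 cosN acosK.
by rewrite vec1 sinN sin_acos // s2 ltr0_norm // opprK.
Qed.

(** The angle is taken in the turn that begins with [t0], so that a given vector
can come first. *)
Lemma polar u t0 : u != 0 -> exists r t, [/\ 0 < r, t0 <= t < t0 + turn R & u = r *: dir t].
Proof.
move=> u0; have d0 := dot_sq u0; pose r := Num.sqrt (dot u u).
have r0 : 0 < r by rewrite sqrtr_gt0.
have [t et] : exists t, r^-1 *: u = dir t.
  apply: unit_dir; rewrite dotZl dotZr mulrA -expr2 exprVn sqr_sqrtr ?ltW //.
  by rewrite mulVf // gt_eqF.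
have [k hk] := circle_shift (turn_gt0 R) t0 t.
exists r, (t + k%:~R * turn R); split=> //.
by rewrite dir_turn -et scalerA mulfV ?scale1r // gt_eqF.
Qed.

Lemma edist_dot m n (x y : 'rV[R]_m) (x' y' : 'rV[R]_n) : Defs.edist x y = Defs.edist x' y' ->
  dot (x - y) (x - y) = dot (x' - y') (x' - y').
Proof.
have ge0 k (z : 'rV[R]_k) : 0 <= dot z z by apply: sumr_ge0 => i _; rewrite -expr2 sqr_ge0.
by move=> e; rewrite -[LHS](sqr_sqrtr (ge0 _ _)) -[RHS](sqr_sqrtr (ge0 _ _)); congr (_ ^+ 2).
Qed.

(** The images of three points that form a right angle determine the map, because
the products of [g y - g x0] with the two image vectors are determined by
distances. *)
Lemma isometry_placement (A : set 'rV[R]_2) (g : 'rV[R]_2 -> 'rV[R]_2) x0 r : 0 < r ->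
  A x0 -> A (x0 + r *: vec 1 0) -> A (x0 + r *: vec 0 1) ->
  (forall x y, A x -> A y -> Defs.edist (g x) (g y) = Defs.edist x y) ->
  exists p, forall y, A y -> g y = glob p y.
Proof.
move=> r0 A0 A1 A2 iso; pose G y := g y - g x0.
have GG y z : A y -> A z -> dot (G y) (G z) = dot (y - x0) (z - x0).
  move=> hy hz; have h1 := edist_dot (iso _ _ hy A0); have h2 := edist_dot (iso _ _ hz A0).
  have := edist_dot (iso _ _ hy hz).
  have -> : g y - g z = G y - G z by rewrite /G; apply/rowP => k; rewrite !mxE; ring.
  have -> : y - z = (y - x0) - (z - x0) by apply/rowP => k; rewrite !mxE; ring.
  move: h1 h2; rewrite -/(G y) -/(G z); move: (G y) (G z) (y - x0) (z - x0) => a b c d.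
  by rewrite !(dotBr, dotBl) (dotC b a) (dotC d c); lra.
pose F1 := r^-1 *: G (x0 + r *: vec 1 0); pose F2 := r^-1 *: G (x0 + r *: vec 0 1).
have rn : r != 0 by rewrite gt_eqF.
have addK v : x0 + v - x0 = v :> 'rV[R]_2 by rewrite addrC addKr.
have GF1 y : A y -> dot F1 (G y) = (y - x0) 0 0.
  by move=> hy; rewrite dotZl GG // addK dotZl mulrA mulVf // mul1r dot2 vec0 vec1; ring.
have GF2 y : A y -> dot F2 (G y) = (y - x0) 0 1.
  by move=> hy; rewrite dotZl GG // addK dotZl mulrA mulVf // mul1r dot2 vec0 vec1; ring.
have [t et] : exists t, F1 = dir t.
  by apply: unit_dir; rewrite {2}/F1 dotZr GF1 // addK mxE vec0 mulr1 mulVf.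
have F12 : dot (dir t) F2 = 0.
  by rewrite -et /F2 dotZr GF1 // addK mxE vec0 mulr0 mulr0.
have F22 : dot F2 F2 = 1 by rewrite {2}/F2 dotZr GF2 // addK mxE vec1 mulr1 mulVf.
pose s := dot (dir (t + pi / 2)) F2.
have eF2 : F2 = s *: dir (t + pi / 2) by rewrite [LHS](dir_decomp _ t) F12 scale0r add0r.
have s2 : s ^+ 2 = 1.
  by move: F22; rewrite {1}eF2 dotZl -/s expr2.
pose p0 := Placement 0 t (s == -1).
have sp : sg p0 = s.
  rewrite /sg /=; case: eqVneq => [->|h]; first by rewrite expr1.
  by move/eqP: s2; rewrite sqrf_eq1 (negbTE h) orbF expr0 => /eqP ->.
pose p := Placement (g x0 - mv p0 x0) t (s == -1).
have mvp : mv p =1 mv p0 by [].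
exists p => y hy; rewrite /glob mvp /=.
have eG : G y = (y - x0) 0 0 *: dir t + (s * (y - x0) 0 1) *: dir (t + pi / 2).
  rewrite [LHS](dir_decomp _ t) -{1}et GF1 //; congr (_ + _ *: _).
  rewrite -GF2 // eF2 dotZl mulrA -expr2 s2 mul1r //.
have -> : g y = g x0 + G y by rewrite /G addrC subrK.
rewrite eG /mv /= sp !mxB; apply/rowP => k; rewrite !mxE; ring.
Qed.

End Isometry.

(** The stereographic parameter of a direction gives a frame with polynomial
entries: [fr1], [fr2] and [frN] are pairwise orthogonal and have the same length
[rho]. *)
Section Chart.
Variable R : realType.
Local Notation C := (complex R).

Definition row3 (p q r : R) : 'rV[R]_3 := \row_k nth 0 [:: p; q; r] k.
Lemma row3E p q r : (c3 (row3 p q r) 0 = p) * (c3 (row3 p q r) 1 = q) * (c3 (row3 p q r) 2 = r).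
Proof. by rewrite /c3 !mxE !inordK. Qed.

Lemma c3D (u v : 'rV[R]_3) k : c3 (u + v) k = c3 u k + c3 v k. Proof. by rewrite /c3 mxE. Qed.
Lemma c3N (u : 'rV[R]_3) k : c3 (- u) k = - c3 u k. Proof. by rewrite /c3 mxE. Qed.
Lemma c3Z t (u : 'rV[R]_3) k : c3 (t *: u) k = t * c3 u k. Proof. by rewrite /c3 mxE. Qed.
Definition c3E := (c3D, c3N, c3Z, row3E).

Definition cross3 (u v : 'rV[R]_3) := row3 (c3 u 1 * c3 v 2 - c3 u 2 * c3 v 1)
  (c3 u 2 * c3 v 0 - c3 u 0 * c3 v 2) (c3 u 0 * c3 v 1 - c3 u 1 * c3 v 0).
Definition cross2 (u v : 'rV[R]_2) : R := u 0 0 * v 0 1 - u 0 1 * v 0 0.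

Variables (x y : R).
Definition rho : R := 1 + x ^+ 2 + y ^+ 2.
Definition fr1 := row3 (1 - x ^+ 2 + y ^+ 2) (- (2 * x * y)) (2 * x).
Definition fr2 := row3 (- (2 * x * y)) (1 + x ^+ 2 - y ^+ 2) (2 * y).
Definition frN := row3 (- (2 * x)) (- (2 * y)) (1 - x ^+ 2 - y ^+ 2).

Lemma rho_gt0 : 0 < rho.
Proof. by have := sqr_ge0 x; have := sqr_ge0 y; rewrite /rho; lra. Qed.
Lemma rho_neq0 : rho != 0. Proof. by rewrite gt_eqF // rho_gt0. Qed.

Lemma nzE e : nz x y e = dot frN e.
Proof. by rewrite dot3 /nz !c3E; ring. Qed.

(** The isometric chart of the plane [dot frN z = c]. *)
Definition chart c (u : 'rV[R]_2) : 'rV[R]_3 :=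
  (c / rho ^+ 2) *: frN + (u 0 0 / rho) *: fr1 + (u 0 1 / rho) *: fr2.
Definition planar (v : 'rV[R]_3) : 'rV[R]_2 := vec (dot fr1 v / rho) (dot fr2 v / rho).

Lemma dot_chart v c u : dot v (chart c u) = c / rho ^+ 2 * dot frN v + dot (planar v) u.
Proof. by rewrite /chart !dotDr !dotZr dot2 vec0 vec1 !(dotC v); ring. Qed.

Lemma frNN : dot frN frN = rho ^+ 2.
Proof. by rewrite dot3 !c3E /rho; ring. Qed.

Lemma planarN : planar frN = 0.
Proof.
have r0 := rho_neq0.
by apply: vecP; rewrite ?vec0 ?vec1 mxE dot3 !c3E; rewrite /rho in r0 *; field.
Qed.

Lemma chart_plane c u : dot frN (chart c u) = c.
Proof. by rewrite dot_chart planarN dot0l addr0 frNN divfK // expf_neq0 // rho_neq0. Qed.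

Lemma plane_chart c z : dot frN z = c -> z = chart c (planar z).
Proof.
move=> <-; have r0 := rho_neq0.
by apply: c3_eq; rewrite /chart !c3E vec0 vec1 !dot3 !c3E; rewrite /rho in r0 *; field.
Qed.

Lemma chart_iso c u v : Defs.edist (chart c u) (chart c v) = Defs.edist u v.
Proof.
rewrite /Defs.edist; congr Num.sqrt; have r0 := rho_neq0.
have -> : chart c u - chart c v = ((u 0 0 - v 0 0) / rho) *: fr1 + ((u 0 1 - v 0 1) / rho) *: fr2.
  by apply/rowP => k; rewrite !mxE; ring.
by rewrite dot2 !mxB dot3 !c3E; rewrite /rho in r0 *; field.
Qed.

Lemma qf_planar v : qf v (Complex x y) = rc rho * Complex (planar v 0 0) (planar v 0 1).
Proof.
have r0 := rho_neq0; rewrite vec0 vec1 !dot3 !c3E /qf /rc !expr2.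
by apply/eqP; rewrite eq_complex /=; apply/andP; split; apply/eqP; field.
Qed.

Lemma cross_planar u v : cross2 (planar u) (planar v) = dot frN (cross3 u v) / rho.
Proof.
by have r0 := rho_neq0; rewrite /cross2 !vec0 !vec1 !dot3 !c3E; rewrite /rho in r0 *; field.
Qed.

(** Three facets cut the plane at level [c] in three lines. Up to a factor, the
side of the second line between the other two has length [tri0 + c * tri1], which
is affine in [c] and vanishes when the three lines are concurrent. At the level of
a point [v] it is the product of the normal with the vector [shifted v], which
tells whether [v] lies on the three facets; this makes the vanishing a condition
on the direction of the plane that a generic plane avoids. *)
Section Triple.
Variables (p q r : 'rV[R]_3) (bp bq br : R).

Definition tri0 := bp * cross2 (planar q) (planar r) + bq * cross2 (planar r) (planar p) + br * cross2 (planar p) (planar q).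
Definition tri1 := - (dot frN p * cross2 (planar q) (planar r) + dot frN q * cross2 (planar r) (planar p) +
  dot frN r * cross2 (planar p) (planar q)) / rho ^+ 2.
Definition det3 := dot p (cross3 q r).
Definition shifted (v : 'rV[R]_3) := (bp - dot p v) *: cross3 q r + (bq - dot q v) *: cross3 r p +
  (br - dot r v) *: cross3 p q.

Lemma tri1E : tri1 = - det3 / rho.
Proof.
have r0 := rho_neq0.
by rewrite /tri1 /det3 !cross_planar !dot3 !c3E; rewrite /rho in r0 *; field.
Qed.

Lemma tri_vertex v : tri0 + dot frN v * tri1 = dot frN (shifted v) / rho.
Proof.
have r0 := rho_neq0; rewrite tri1E /tri0 !cross_planar /shifted /det3 !dot3 !c3E /rho in r0 *; field.
exact: r0.
Qed.

Lemma shifted_dot v : (dot p (shifted v) = (bp - dot p v) * det3) *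
  (dot q (shifted v) = (bq - dot q v) * det3) * (dot r (shifted v) = (br - dot r v) * det3).
Proof. by rewrite /shifted /det3 !dot3 !c3E; split; [split|]; ring. Qed.

End Triple.
End Chart.

(** * Plane sections that avoid the vertices *)

Section Plane.
Variables (R : realType) (I : finType) (a : I -> 'rV[R]_3) (b : I -> R).
Hypothesis Ir : irredundant a b.
Local Notation slack := (slack a b).
Local Notation inP := (inP a b).
Local Notation act := (act a b).
Local Notation verts := (verts a b).
Local Notation vp := (vp a b).
Implicit Types (x y z nu : 'rV[R]_3) (i j l : I) (t c : R) (A B : {set I}) (S : {set {set I}}).

(** The facets met by a plane that has the vertices in [S] on one side and the
others on the other side. *)
Definition hits S : {set I} :=
  [set i | [exists A in verts, (A \in S) && (i \in A)] && [exists A in verts, (A \notin S) && (i \in A)]].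

Lemma hitsP S i : reflect ((exists A, [/\ A \in verts, A \in S & i \in A]) /\
  (exists A, [/\ A \in verts, A \notin S & i \in A])) (i \in hits S).
Proof.
rewrite finset.in_set; apply: (iffP andP) => [[/exists_inP[A hA /andP[AS iA]] /exists_inP[B hB /andP[BS iB]]]|[[A [hA AS iA]] [B [hB BS iB]]]].
  by split; [exists A|exists B].
by split; apply/exists_inP; [exists A|exists B] => //; apply/andP.
Qed.

Section Cut.
Variables (nu : 'rV[R]_3) (c : R) (S : {set {set I}}).
Hypothesis hc : cuts a b nu c S.

Lemma sec_reach z : inP z -> dot nu z = c -> exists A B,
  [/\ [/\ A \in verts, A \in S & act z \subset A] & [/\ B \in verts, B \notin S & act z \subset B]].
Proof.
move=> hz nz; have [A [hA sA]] := reach Ir nu hz; have [B [hB sB]] := reach Ir (- nu) hz.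
rewrite !dotNl nz => mB mA; exists A, B; split; split=> //.
  by apply/negPn/negP => AS; have [_ /(_ AS)] := hc hA; lra.
by apply/negP => BS; have [/(_ BS) + _] := hc hB; lra.
Qed.

Lemma sec_act z i : inP z -> dot nu z = c -> i \in act z -> i \in hits S.
Proof.
move=> hz nz iz; have [A [B [[hA AS sA] [hB BS sB]]]] := sec_reach hz nz.
by apply/hitsP; split; [exists A|exists B]; split=> //; [apply: (fintype.subsetP sA)|apply: (fintype.subsetP sB)].
Qed.

(** In the following lemmas a segment between the two sides of the plane crosses it
in a point whose active facets are those of both ends. *)
Lemma sec_mid x y : inP x -> inP y -> c < dot nu x -> dot nu y < c ->
  exists z, [/\ inP z, dot nu z = c & act z = act x :&: act y].
Proof.
move=> hx hy cx cy; have [t ht e] := crossing cx cy.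
exists ((1 - t) *: x + t *: y); split=> //; last exact: act_mid.
by apply: inP_mid => //; case/andP: ht => /ltW -> /ltW.
Qed.

Lemma sec_edge A B : A \in verts -> A \in S -> B \in verts -> B \notin S ->
  exists z, [/\ inP z, dot nu z = c & act z = A :&: B].
Proof.
move=> hA AS hB BS; have [iA aA _] := vpP hA; have [iB aB _] := vpP hB.
rewrite -[in A :&: _]aA -[in _ :&: B]aB.
by apply: sec_mid => //; [have [h _] := hc hA; apply: h|have [_ h] := hc hB; apply: h].
Qed.

Lemma sec_through x A B : inP x -> A \in verts -> A \in S -> B \in verts -> B \notin S ->
  act x \subset A -> act x \subset B -> exists z, [/\ inP z, dot nu z = c & act z = act x].
Proof.
move=> hx hA AS hB BS sA sB; have [iA aA _] := vpP hA; have [iB aB _] := vpP hB.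
have [cA _] := hc hA; have [_ cB] := hc hB.
case: (ltrgtP (dot nu x) c) => h; last by exists x.
  have [z [z1 z2 z3]] := sec_mid iA hx (cA AS) h; exists z; split=> //.
  by rewrite z3 aA; apply/finset.setIidPr.
have [z [z1 z2 z3]] := sec_mid hx iB h (cB BS); exists z; split=> //.
by rewrite z3 aB; apply/finset.setIidPl.
Qed.

Lemma sec_wit i : i \in hits S -> exists z, [/\ inP z, dot nu z = c & act z = [set i]].
Proof.
move=> /hitsP[[A [hA AS iA]] [B [hB BS iB]]].
have [u [u0 hu]] := ir_wit Ir i.
have hin : inP u by move=> k; case: (eqVneq k i) => [->|/hu/ltW//]; rewrite u0.
have au : act u = [set i].
  apply/setP => k; rewrite finset.in_set1; apply/actP/eqP => [e|->//].
  by apply/eqP/negPn/negP => /hu; rewrite e ltxx.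
by have := sec_through hin hA AS hB BS; rewrite au !finset.sub1set => /(_ iA iB).
Qed.

Lemma sec_in A B : A \in verts -> A \in S -> B \in verts -> B \notin S ->
  exists z, [/\ dot nu z = c & forall i, 0 < slack i z].
Proof.
move=> hA AS hB BS; have [u hu] := ir_in Ir.
have hin : inP u by move=> k; apply: ltW.
have au : act u = finset.set0.
  by apply/setP => k; rewrite finset.in_set0; apply/actP => e; have := hu k; rewrite e ltxx.
have := sec_through hin hA AS hB BS; rewrite au !finset.sub0set => /(_ isT isT) [z [z1 z2 z3]].
exists z; split=> // i; rewrite lt_neqAle z1 andbT eq_sym; apply/negP => /eqP/actP.
by rewrite z3 finset.in_set0.
Qed.

(** On the way from the inner point [z0] to [z] the segment would leave the
polyhedron through a facet that meets the plane. *)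
Lemma sec_all z0 z : dot nu z0 = c -> (forall i, 0 < slack i z0) -> dot nu z = c ->
  (forall i, i \in hits S -> 0 <= slack i z) -> inP z.
Proof.
move=> n0 h0 nz hz; case: (eqVneq (z - z0) 0) => [/eqP|d0].
  by rewrite subr_eq0 => /eqP -> i; apply: ltW.
have in0 : inP z0 by move=> i; apply: ltW.
have [t [j [t0 hy hj jd]]] := shoot Ir in0 d0.
have ny : dot nu (z0 + t *: (z - z0)) = c by rewrite dotDr dotZr dotBr n0 nz; ring.
have /hz : j \in hits S by apply: sec_act hy ny _; apply/actP.
move: hj; rewrite slackD dotZr => hj; have ej : slack j z = slack j z0 - dot (a j) (z - z0).
  by rewrite -slackD addrC subrK.
rewrite ej => h; have s0 := h0 j.
have t1 : 1 <= t by nra.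
have ez : z = (1 - t^-1) *: z0 + t^-1 *: (z0 + t *: (z - z0)).
  rewrite scalerDr scalerA mulVf ?scale1r; last by rewrite gt_eqF //; lra.
  by rewrite scalerBl scale1r; apply/rowP => k; rewrite !mxE; ring.
rewrite ez; apply: inP_mid => //; rewrite invr_ge0 t0 /= invf_le1 //; lra.
Qed.

End Cut.

Lemma cutsZ nu c S (l : R) : 0 < l -> cuts a b nu c S -> cuts a b (l *: nu) (l * c) S.
Proof.
move=> l0 h A hA; have [h1 h2] := h A hA; rewrite dotZl !ltr_pM2l //.
Qed.

Lemma cuts_finite (S : {set {set I}}) nu c d e : cuts a b nu c S -> exists2 r, 0 < r &
  forall t, 0 < t < r -> cuts a b (nu + t *: d) (c + t * e) S.
Proof.
move=> h; have [|r r0 hr] := @finite_pos R {set I} (fun A t => A \in verts ->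
    (A \in S -> c + t * e < dot (nu + t *: d) (vp A)) /\ (A \notin S -> dot (nu + t *: d) (vp A) < c + t * e)).
  move=> A; case: (boolP (A \in verts)) => hA; last by exists 1.
  have [h1 h2] := h A hA; pose q := `|e| + `|dot d (vp A)| + 1.
  have q0 : 0 < q by rewrite ltr_wpDl // addr_ge0.
  exists (`|dot nu (vp A) - c| / q) => [|t /andP[t0 tq] _].
    rewrite divr_gt0 // normr_gt0 subr_eq0; apply/eqP => e'.
    by case: (boolP (A \in S)) => [/h1|/h2]; rewrite e' ltxx.
  have : t * q < `|dot nu (vp A) - c| by rewrite -ltr_pdivlMr.
  have := ler_norm e; have := ler_norm (- e); have := ler_norm (dot d (vp A)); have := ler_norm (- dot d (vp A)).
  rewrite !normrN /q dotDl dotZl => n1 n2 n3 n4 lt.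
  split=> [/h1|/h2] h3.
    have : `|dot nu (vp A) - c| = dot nu (vp A) - c by rewrite ger0_norm // subr_ge0 ltW.
    by nra.
  have : `|dot nu (vp A) - c| = - (dot nu (vp A) - c) by rewrite ler0_norm // subr_le0 ltW.
  by nra.
by exists r => // t ht A hA; apply: hr.
Qed.

(** Every direction but one is, up to a positive factor, of the form [frN]; a small
perturbation avoids the exception. *)
Lemma cuts_frN S : separable a b S -> exists (x y c : R), cuts a b (frN x y) c S.
Proof.
move=> [nu0 [c0 h0]].
have [r r0 hr] := cuts_finite (row3 1 0 0) 0 h0.
have [nu [c [hc p0]]] : exists nu c, cuts a b nu c S /\ c3 nu 0 != 0.
  case: (eqVneq (c3 nu0 0) 0) => [e|ne]; last by exists nu0, c0.
  exists (nu0 + (r / 2) *: row3 1 0 0), (c0 + r / 2 * 0); split; first by apply: hr; lra.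
  by rewrite !c3E e; lra.
set p := c3 nu 0 in p0; set q := c3 nu 1; set s := c3 nu 2.
pose L := Num.sqrt (p ^+ 2 + q ^+ 2 + s ^+ 2).
have p2 : 0 < p ^+ 2 by rewrite exprn_even_gt0.
have L2 : L ^+ 2 = p ^+ 2 + q ^+ 2 + s ^+ 2.
  by rewrite sqr_sqrtr //; have := sqr_ge0 q; have := sqr_ge0 s; lra.
have Ls : 0 < L + s.
  have L0 : 0 <= L by apply: sqrtr_ge0.
  by rewrite ltNge; apply/negP => h; have := sqr_ge0 q; nra.
exists (- p / (L + s)), (- q / (L + s)), (2 / (L + s) * c).
have -> : frN (- p / (L + s)) (- q / (L + s)) = (2 / (L + s)) *: nu.
  have n0 : L + s != 0 by rewrite gt_eqF.
  apply: c3_eq; rewrite !c3E -/p -/q -/s; [by field|by field|].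
  have -> : 1 - (- p / (L + s)) ^+ 2 - (- q / (L + s)) ^+ 2 = ((L + s) ^+ 2 - p ^+ 2 - q ^+ 2) / (L + s) ^+ 2 by field.
  have -> : (L + s) ^+ 2 - p ^+ 2 - q ^+ 2 = 2 * s * (L + s).
    by rewrite sqrrD L2; ring.
  by field.
by apply: cutsZ => //; rewrite divr_gt0.
Qed.

Lemma nbhs_cuts S (x y : R) c : cuts a b (frN x y) c S -> nbhs (x, y) [set z : R * R | cuts a b (frN z.1 z.2) c S]%classic.
Proof.
move=> h.
have cont v : continuous (fun z : R * R => dot (frN z.1 z.2) v).
  have -> : (fun z : R * R => dot (frN z.1 z.2) v) = (fun z : R * R => - (2 * z.1) * c3 v 0 - (2 * z.2) * c3 v 1 + (1 - z.1 * z.1 - z.2 * z.2) * c3 v 2).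
    by apply/funext => z; rewrite dot3 !c3E !expr2; ring.
  move=> z; have c1 := @cvg_fst _ _ (nbhs z.1) (nbhs z.2) _; have c2 := @cvg_snd _ _ (nbhs z.1) (nbhs z.2) _.
  apply: cvgD; [apply: cvgB|]; apply: cvgM; try exact: cvg_cst.
  - by apply: cvgN; apply: cvgM; [exact: cvg_cst|exact: c1].
  - by apply: cvgM; [exact: cvg_cst|exact: c2].
  - apply: cvgB; [apply: cvgB; first exact: cvg_cst|]; apply: cvgM; (exact: c1 || exact: c2).
have := @filter_forall (R * R)%type {set I} (fun A => [set z : R * R | A \in verts ->
  (A \in S -> c < dot (frN z.1 z.2) (vp A)) /\ (A \notin S -> dot (frN z.1 z.2) (vp A) < c)]%classic) (nbhs (x, y)) _.
apply=> A.
case: (boolP (A \in verts)) => hA; last by apply: nearW.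
have [h1 h2] := h A hA; case: (boolP (A \in S)) => AS.
  by apply: filterS (cvgr_gt _ (cont (vp A) (x, y)) _ (h1 AS)) => z hz _; split.
by apply: filterS (cvgr_lt _ (cont (vp A) (x, y)) _ (h2 AS)) => z hz _; split.
Qed.

(** The length of the side [j] between [i] and [l] is [side_ratio * tri]
([slen_formula]). *)
Definition side_ratio (x y : R) i j l : R :=
  Num.sqrt (dot (planar x y (a j)) (planar x y (a j))) /
  (cross2 (planar x y (a i)) (planar x y (a j)) * cross2 (planar x y (a j)) (planar x y (a l))).
Definition tri (x y : R) i j l c : R :=
  tri0 x y (a i) (a j) (a l) (b i) (b j) (b l) + c * tri1 x y (a i) (a j) (a l).

(** The direction is generic for the angles and for the vectors [shifted]. The
level is then chosen so that two lengths agree only if they agree as functions of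
the level. In that case they vanish at the same levels; this is excluded if some
vertex lies on the three facets of one side but not on those of the other. *)
Lemma good_plane S : separable a b S -> exists x y c : R, [/\ cuts a b (frN x y) c S,
    forall kv : {ffun I -> int}, complex.Im (angle_prod a kv (Complex x y)) = 0 ->
      forall i, \sum_(j | `[< colinear (a i) (a j) >]) kv j = 0 &
    forall i j l i' j' l' A, A \in verts -> i \in A -> j \in A -> l \in A ->
      ~~ [&& i' \in A, j' \in A & l' \in A] -> tri x y i' j' l' c != 0 -> side_ratio x y i' j' l' != 0 ->
      side_ratio x y i j l * tri x y i j l c != side_ratio x y i' j' l' * tri x y i' j' l' c].
Proof.
move=> /cuts_frN[x0 [y0 [c0 h0]]].
pose sh (k : I * I * I * {set I}) := shifted (a k.1.1.1) (a k.1.1.2) (a k.1.2) (b k.1.1.1) (b k.1.1.2) (b k.1.2) (vp k.2).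
have [|x [y [hc hn hg]]] := @generic_plane R I {k | sh k != 0} a (fun k => sh (val k)) x0 y0 _ (a_neq0 Ir) _ (nbhs_cuts h0).
  by case.
pose F0 (k : (I * I * I) * (I * I * I)) := let: (i, j, l, (i', j', l')) := k in
  side_ratio x y i j l * tri0 x y (a i) (a j) (a l) (b i) (b j) (b l) - side_ratio x y i' j' l' * tri0 x y (a i') (a j') (a l') (b i') (b j') (b l').
pose F1 (k : (I * I * I) * (I * I * I)) := let: (i, j, l, (i', j', l')) := k in
  side_ratio x y i j l * tri1 x y (a i) (a j) (a l) - side_ratio x y i' j' l' * tri1 x y (a i') (a j') (a l').
have [|r1 r10 hr1] := @finite_pos R _ (fun k t => F0 k + (c0 + t) * F1 k = 0 -> F1 k = 0).
  move=> k; case: (eqVneq (F1 k) 0) => [->|f1]; first by exists 1.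
  pose t0 := - F0 k / F1 k - c0.
  have key t : F0 k + (c0 + t) * F1 k = 0 -> t = t0.
    by move=> e; rewrite /t0 (_ : F0 k = - (c0 + t) * F1 k) ?mulNr ?opprK ?mulfK //; [ring|lra].
  case: (ltP 0 t0) => h; first by exists t0 => // t ht /key e; move: ht; rewrite e ltxx andbF.
  by exists 1 => // t ht /key e; lra.
have [r2 r20 hr2] := cuts_finite 0 1 hc.
have [t [t1 t2]] : exists t, 0 < t < r1 /\ 0 < t < r2.
  by case: (leP r1 r2) => h; [exists (r1 / 2)|exists (r2 / 2)]; split; lra.
exists x, y, (c0 + t); split=> //.
  by have := hr2 t t2; rewrite mulr1 scaler0 addr0.
move=> i j l i' j' l' A hA iA jA lA nA' tn kn; apply/eqP => e.
pose k := ((i, j, l), (i', j', l')).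
have eF : F0 k + (c0 + t) * F1 k = 0.
  rewrite /F0 /F1 /=; move: e; rewrite /tri => e; apply/eqP; rewrite -subr_eq0 in e *.
  move: e => /eqP; rewrite -subr_eq0 => /eqP e; rewrite subr0 -[X in _ == X]e; apply/eqP; ring.
have f1 := hr1 t t1 k eF; have f0 : F0 k = 0 by move: eF; rewrite f1 mulr0 addr0.
pose cA := dot (frN x y) (vp A).
have s0 m : m \in A -> b m - dot (a m) (vp A) = 0 by rewrite -(vp_slack m hA) => /eqP.
have z1 : tri x y i j l cA = 0.
  by rewrite /tri tri_vertex /shifted !s0 // !scale0r !addr0 dot0r mul0r.
have z2 : tri x y i' j' l' cA = 0.
  apply: (mulfI kn); rewrite mulr0.
  have : F0 k + cA * F1 k = 0 by rewrite f0 f1 mulr0 addr0.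
  have : side_ratio x y i j l * tri x y i j l cA = 0 by rewrite z1 mulr0.
  by rewrite /F0 /F1 /k /tri => e1 e2; rewrite -[RHS]subr0 -[X in _ = X - _]e1 -[X in _ = _ - X]e2; ring.
have sh0 : shifted (a i') (a j') (a l') (b i') (b j') (b l') (vp A) = 0.
  apply/eqP/negPn/negP => ne; have := hn (exist _ (i', j', l', A) ne); rewrite nzE /= => /negP; apply.
  move/eqP: z2; rewrite /tri tri_vertex mulf_eq0 invr_eq0 (negbTE (rho_neq0 _ _)) orbF; exact.
have [[d1 d2] d3] := shifted_dot (a i') (a j') (a l') (b i') (b j') (b l') (vp A).
rewrite sh0 !dot0r in d1 d2 d3.
have det0 : det3 (a i') (a j') (a l') = 0.
  have nz m : m \notin A -> 0 = (b m - dot (a m) (vp A)) * det3 (a i') (a j') (a l') -> det3 (a i') (a j') (a l') = 0.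
    move=> mA /esym/eqP; rewrite mulf_eq0 => /orP[/eqP h|/eqP //].
    by have := vp_slack_gt0 hA mA; rewrite /slack h ltxx.
  by move: nA'; rewrite !negb_and => /or3P[/nz|/nz|/nz]; apply.
by move/eqP: tn; apply; rewrite -[RHS]z2 /tri tri1E det0 oppr0 mul0r !mulr0.
Qed.

End Plane.

(** * Sections as polygons *)

Section Realize.
Variables (R : realType) (I : finType) (a : I -> 'rV[R]_3) (b : I -> R).
Hypothesis Ir : irredundant a b.
Local Notation slack := (slack a b).
Local Notation inP := (inP a b).
Local Notation act := (act a b).
Local Notation verts := (verts a b).
Local Notation vp := (vp a b).
Local Notation hits := (hits a b).
Implicit Types (z nu : 'rV[R]_3) (i : I) (t : R) (A B : {set I}) (S : {set {set I}}).

Lemma dir_inj (t t' : R) : dir t = dir t' -> exists j : int, t = t' + j%:~R * turn R.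
Proof.
move=> e; have [k hk] := circle_shift (turn_gt0 R) (- pi) (t - t'); have p0 := pi_gt0 R.
set w := t - t' + _ in hk.
have [c1 s1] : cos w = 1 /\ sin w = 0.
  rewrite /w cos_turn sin_turn cosB sinB.
  have -> : cos t = cos t' by rewrite -(vec0 (cos t) (sin t)) -/(dir t) e vec0.
  have -> : sin t = sin t' by rewrite -(vec1 (cos t) (sin t)) -/(dir t) e vec1.
  by split; [rewrite -!expr2 cos2Dsin2|ring].
have w0 : w = 0.
  case: (ltrgtP w 0) => // h.
    case: (eqVneq w (- pi)) => [ew|nw].
      by move: c1; rewrite ew cosN cospi; lra.
    have : - pi < w by rewrite lt_neqAle eq_sym nw; case/andP: hk.
    by move=> h'; have := @sin_gt0_pi R (- w); rewrite sinN s1; lra.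
  by have := @sin_gt0_pi R w; rewrite s1 /turn in hk *; lra.
by exists (- k); rewrite mulrNz; move: w0; rewrite /w; lra.
Qed.

Variables (x y c : R) (S : {set {set I}}).
Hypothesis hc : cuts a b (frN x y) c S.
Hypothesis H4 : (4 < #|hits S|)%N.
Local Notation H := (hits S).
Local Notation n := #|hits S|.
Local Notation pt := (chart x y c).
Local Notation pr := (planar x y).

Lemma planar_chart u : pr (pt u) = u.
Proof.
have r0 := rho_neq0 x y.
by apply: vecP; rewrite ?vec0 ?vec1 dot3 /chart !c3E; rewrite /rho in r0 *; field.
Qed.

Lemma sec_ends : exists A B, [/\ A \in verts, A \in S, B \in verts & B \notin S].
Proof.
have /card_gt0P[i /hitsP[[A [hA AS _]] [B [hB BS _]]]] : (0 < n)%N by apply: leq_trans H4.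
by exists A, B.
Qed.

Lemma slack_chart i u : slack i (pt u) = b i - c / rho x y ^+ 2 * dot (frN x y) (a i) - dot (pr (a i)) u.
Proof. by rewrite /slack dot_chart; ring. Qed.

Lemma hit_planar i : i \in H -> pr (a i) != 0.
Proof.
move=> iH; have [A [B [hA AS hB BS]]] := sec_ends.
have [z [nz hz]] := sec_in Ir hc hA AS hB BS; have [w [_ nw aw]] := sec_wit Ir hc iH.
apply/eqP => e; have := hz i; have /actP : i \in act w by rewrite aw finset.in_set1.
by rewrite (plane_chart nz) (plane_chart nw) !slack_chart e !dot0l => ->; rewrite ltxx.
Qed.

(** The inequalities of the facets that are hit, divided by the lengths [r] of the
projected normals, form an irredundant system in the plane, and [i0] is listed
first. *)
Lemma section_polygon i0 : i0 \in H -> exists (s : nat -> I) (r phi beta : nat -> R),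
  [/\ polygon n phi beta, s 0%N = i0 /\ (forall k, s k \in H), forall k l : nat, s k = s l <-> k = l %[mod n],
    forall i, i \in H -> exists2 k, (k < n)%N & s k = i &
    forall k, [/\ 0 < r k, pr (a (s k)) = r k *: dir (phi k) &
      r k * beta k = b (s k) - c / rho x y ^+ 2 * dot (frN x y) (a (s k))]].
Proof.
move=> iH.
have [r0 [t0 [r00 _ e0]]] := polar 0 (hit_planar iH).
pose J : finType := {i : I | i \in H}; pose j0 : J := exist _ i0 iH.
have pol (j : J) : exists p : R * R, [/\ 0 < p.1, t0 <= p.2 < t0 + turn R & pr (a (val j)) = p.1 *: dir p.2].
  by have [r [t [h1 h2 h3]]] := polar t0 (hit_planar (valP j)); exists (r, t).
pose p (j : J) := if j == j0 then (r0, t0) else projT1 (cid (pol j)).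
have pP (j : J) : [/\ 0 < (p j).1, t0 <= (p j).2 < t0 + turn R & pr (a (val j)) = (p j).1 *: dir (p j).2].
  rewrite /p; case: eqP => [->|_]; last by case: (cid _).
  by split=> //=; rewrite lexx ltrDl turn_gt0.
pose T (j : J) := (p j).2.
pose be (j : J) := (b (val j) - c / rho x y ^+ 2 * dot (frN x y) (a (val j))) / (p j).1.
have sl (j : J) u : Submission.slack (fun j => dir (T j)) be j u = slack (val j) (pt u) / (p j).1.
  have [p0 _ e] := pP j; rewrite slack_chart {1}/Submission.slack /be e dotZl -/(T j); field.
  by rewrite (rho_neq0 x y) andbT; apply: lt0r_neq0.
have [A [B [hA AS hB BS]]] := sec_ends.
have [z0 [nz0 hz0]] := sec_in Ir hc hA AS hB BS.
have inJ u : Submission.inP (fun j => dir (T j)) be u <-> inP (pt u).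
  split=> [h|h j]; last by have [p0 _ _] := pP j; rewrite sl divr_ge0 // ltW.
  apply: (sec_all Ir hc nz0 hz0 (chart_plane x y c u)) => i iH'; have := h (exist _ i iH').
  by have [p0 _ _] := pP (exist _ i iH'); rewrite sl /= ler_pdivlMr // mul0r.
have IrJ : irredundant (fun j => dir (T j)) be.
  split.
  - have [D hD] := ir_bd Ir.
    have D0 : 0 <= D by apply: le_trans (hD z0 (fun i => ltW (hz0 i)) 0).
    have bd (v z : 'rV[R]_3) : (forall k, `|z 0 k| <= D) -> `|dot v z| <= \sum_k `|v 0 k| * D.
      move=> hz; apply: le_trans (ler_norm_sum _ _ _) _; apply: ler_sum => k _.
      by rewrite normrM ler_wpM2l.
    pose M (v : 'rV[R]_3) := (\sum_k `|v 0 k| * D) / rho x y : R.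
    have M0 v : 0 <= M v by apply: divr_ge0; [apply: sumr_ge0 => k _; apply: mulr_ge0|apply: ltW; apply: rho_gt0].
    have bd' v z : (forall k, `|z 0 k| <= D) -> `|dot v z / rho x y| <= M v.
      move=> hz; rewrite normrM normfV (ger0_norm (ltW (rho_gt0 x y))) ler_pM2r ?invr_gt0 ?rho_gt0 //.
      exact: bd.
    exists (M (fr1 x y) + M (fr2 x y)) => u /inJ/hD hu k; rewrite -(planar_chart u).
    have := M0 (fr1 x y); have := M0 (fr2 x y).
    case: k => [[|[|//]]] hk.
      rewrite (_ : Ordinal hk = 0) ?vec0; last exact: val_inj.
      by have := bd' (fr1 x y) _ hu; lra.
    rewrite (_ : Ordinal hk = 1) ?vec1; last exact: val_inj.
    by have := bd' (fr2 x y) _ hu; lra.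
  - exists (pr z0) => j; have [p0 _ _] := pP j.
    by rewrite sl -plane_chart // divr_gt0.
  - move=> j; have [w [hw nw aw]] := sec_wit Ir hc (valP j).
    exists (pr w); rewrite sl -plane_chart //.
    have /actP -> : val j \in act w by rewrite aw finset.in_set1.
    split=> [|k kj]; first by rewrite mul0r.
    have [p0 _ _] := pP k; rewrite sl -plane_chart // divr_gt0 //.
    rewrite lt_neqAle hw andbT eq_sym; apply/negP => /eqP/actP.
    by rewrite aw finset.in_set1 => /eqP /val_inj e; rewrite e eqxx in kj.
have cJ : #|J| = n by rewrite card_sig; apply: eq_card => i; rewrite !inE.
have J4 : (4 < #|J|)%N by rewrite cJ.
have T0 : T j0 = t0 by rewrite /T /p eqxx.
have hT (j : J) : T j0 <= T j < T j0 + turn R by rewrite T0; have [] := pP j.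
have Pg := polygon_of_irredundant IrJ hT J4; rewrite cJ in Pg.
pose s k := side T j0 k.
exists (fun k => val (s k)), (fun k => (p (s k)).1), (side_phi T j0), (be \o s); split=> //.
- split; last by move=> k; apply: valP.
  by rewrite /s (side0 IrJ hT).
- move=> k l; rewrite -cJ; split=> [/val_inj|/(@side_mod _ _ T j0) e]; last by rewrite /s e.
  exact: (side_inj IrJ J4).
- move=> i iH'; have [k kn e] := side_surj T j0 (exist _ i iH' : J).
  by exists k; [rewrite -cJ|rewrite /s e].
- move=> k; have [p0 _ e] := pP (s k); split=> //; first by rewrite e dir_side.
  by rewrite /= /be mulrC divfK // gt_eqF.
Qed.

(** ** The polygon of a section *)

Section OfPolygon.
Variables (s : nat -> I) (r phi beta : nat -> R).
Hypothesis Pg : polygon n phi beta.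
Hypothesis sH : forall k, s k \in H.
Hypothesis sE : forall k l : nat, s k = s l <-> k = l %[mod n].
Hypothesis sI : forall i, i \in H -> exists2 k, (k < n)%N & s k = i.
Hypothesis sP : forall k, [/\ 0 < r k, pr (a (s k)) = r k *: dir (phi k) &
  r k * beta k = b (s k) - c / rho x y ^+ 2 * dot (frN x y) (a (s k))].

Let n0 : (0 < n)%N. Proof. exact: leq_trans H4. Qed.

Lemma slack_side k u : slack (s k) (pt u) = r k * (beta k - dot (dir (phi k)) u).
Proof. by have [_ e1 e2] := sP k; rewrite slack_chart -e2 e1 dotZl; ring. Qed.

Lemma pgset_in u : pgset phi beta u <-> inP (pt u).
Proof.
have [A [B [hA AS hB BS]]] := sec_ends.
have [z0 [nz0 hz0]] := sec_in Ir hc hA AS hB BS.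
split=> [h|h k]; last first.
  by have := h (s k); have [r0 _ _] := sP k; rewrite slack_side pmulr_rge0 // subr_ge0.
apply: (sec_all Ir hc nz0 hz0 (chart_plane x y c u)) => i /sI[k _ <-].
by have [r0 _ _] := sP k; rewrite slack_side pmulr_rge0 // subr_ge0.
Qed.

Lemma tight_act u k : tight phi beta u k <-> s k \in act (pt u).
Proof.
have [r0 _ _] := sP k; split=> [h|/actP]; first by apply/actP; rewrite slack_side h subrr mulr0.
by rewrite slack_side => /eqP; rewrite mulf_eq0 gt_eqF //= subr_eq0 eq_sym => /eqP.
Qed.

(** The edge crosses the plane in a point where both sides are tight. *)
Lemma edge_adjacent A B (k l : nat) : A \in verts -> A \in S -> B \in verts -> B \notin S ->
  s k \in A -> s k \in B -> s l \in A -> s l \in B ->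
  [\/ k = l %[mod n], k = l.+1 %[mod n] | k.+1 = l %[mod n]].
Proof.
move=> hA AS hB BS kA kB lA lB; have [z [z1 z2 z3]] := sec_edge hc hA AS hB BS.
have e := plane_chart z2.
apply: (@pg_tight _ _ _ _ Pg (pr z)); first by apply/pgset_in; rewrite -e.
  by apply/tight_act; rewrite -e z3 finset.in_setI kA.
by apply/tight_act; rewrite -e z3 finset.in_setI lA.
Qed.

(** The parallel sides forced by parallel facets. *)
Definition par_sides (k l : nat) := s k != s l /\ colinear (a (s k)) (a (s l)).

Lemma section_angles : side_angles n phi par_sides.
Proof.
have per k : s (k + n) = s k by apply/sE; rewrite modnDr.
split; [exact: pg_phi Pg|exact: pg_gap Pg| | | |]; rewrite /par_sides.
- by move=> k l [kl /(col_sym Ir)]; rewrite eq_sym.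
- by move=> k l; rewrite per.
- by move=> k l; rewrite per.
move=> k l [kl cl]; have [q q0 e] := col_neg Ir kl cl.
have [rk ek _] := sP k; have [rl el _] := sP l.
have eq1 : pr (a (s l)) = q *: pr (a (s k)).
  by rewrite e; apply: vecP; rewrite ?mxE /= ?vec0 ?vec1 dotZr mulrA.
have ed : dir (phi l) = (q * r k / r l) *: dir (phi k).
  have : r l *: dir (phi l) = (q * r k) *: dir (phi k) by rewrite -el eq1 ek scalerA.
  move=> /(congr1 (fun v => (r l)^-1 *: v)); rewrite !scalerA mulVf ?gt_eqF // scale1r => ->.
  by congr (_ *: _); rewrite mulrC.
set w := q * r k / r l in ed.
have w0 : w < 0 by rewrite /w pmulr_llt0 ?invr_gt0 // nmulr_rlt0.
have w1 : w = -1.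
  have := dot_dir (phi l) (phi l); rewrite {1 2}ed dotZl dotZr dot_dir !subrr cos0; nra.
apply: dir_inj; rewrite ed w1 scaleN1r.
by apply: vecP; rewrite ?mxE /= ?cosDpi ?sinDpi.
Qed.

Hypothesis gen : forall kv : {ffun I -> int}, complex.Im (angle_prod a kv (Complex x y)) = 0 ->
  forall i, \sum_(j | `[< colinear (a i) (a j) >]) kv j = 0.

(** Summed by parts, the relation involves the angles [phi k.+1] with coefficients
[m k.+1 - m k], attached to the facets, up to multiples of [pi]; genericity makes
these coefficients cancel in each class of parallel facets, which consists of at
most two facets. *)
Lemma angle_relation (m : nat -> nat) (t : nat) : (forall k, m (k + n) = m k)%N -> (t = 1)%N \/ (t = 2)%N ->
  \sum_(k < n) (m k)%:R * (pi - (phi k.+1 - phi k)) = t%:R * pi :> R ->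
  relation n phi par_sides m t.
Proof.
move=> mper t12 hs; split=> //.
pose D k : int := (m k.+1)%:Z - (m k)%:Z.
have Dper k l : k = l %[mod n] -> D k = D l.
  move=> e; have h j : m j = m (j %% n)%N.
    rewrite {1}(divn_eq j n) addnC; elim: (j %/ n)%N => [|q IH]; first by rewrite addn0.
    by rewrite mulSn [(n + _)%N]addnC addnA mper.
  by rewrite /D (h k.+1) (h l.+1) (h k) (h l) e (eqmodS e).
have sSE (k l : nat) : s k.+1 = s l.+1 -> D k = D l by move=> /sE/eqmodSI/Dper.
pose kv := [ffun i => \sum_(k < n | s k.+1 == i) D k].
have kvs k : kv (s k.+1) = D k.
  rewrite ffunE (big_pred1 (Ordinal (ltn_pmod k n0))) /=; first by apply: Dper; rewrite modn_mod.
  move=> l; apply/eqP/eqP => [/sE/eqmodSI e|->]; first by apply: val_inj; rewrite /= -e modn_small.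
  by apply/sE; apply: eqmodS; rewrite modn_mod.
have kv0 i : i \notin H -> kv i = 0.
  by move=> iH; rewrite ffunE big_pred0 // => k; apply/negP => /eqP e; move: iH; rewrite -e sH.
have prodE : angle_prod a kv (Complex x y) =
    rc (\prod_(k < n) (rho x y * r k.+1) ^+ `|D k|%N) * cis (\sum_(k < n) (D k)%:~R * phi k.+1).
  rewrite /angle_prod (bigID (fun i => i \in H)) /= [X in _ * X]big1 ?mulr1; last first.
    by move=> i /kv0 ->; rewrite /ipow /= expr0.
  pose g i : 'I_n := odflt (Ordinal n0) [pick k : 'I_n | s k.+1 == i].
  have gs (k : 'I_n) : g (s k.+1) = k.
    rewrite /g; case: pickP => [l /eqP/sE/eqmodSI|/(_ k)]; last by rewrite eqxx.
    by rewrite !modn_small // => /val_inj.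
  have sg i : i \in H -> s (g i).+1 = i.
    move=> /sI[k kn <-]; have e : s (k + n.-1).+1 = s k by apply/sE; rewrite -addnS prednK // modnDr.
    rewrite -e; have : s ((k + n.-1) %% n).+1 = s (k + n.-1).+1 by apply/sE; apply: eqmodS; rewrite modn_mod.
    by move=> <-; have := gs (Ordinal (ltn_pmod (k + n.-1) n0)); rewrite /= => ->.
  rewrite (reindex_onto (fun k : 'I_n => s k.+1) g) //=.
  rewrite (eq_bigl xpredT); last by move=> k; rewrite sH gs eqxx.
  rewrite -prod_rc -prod_cis -big_split /=; apply: eq_bigr => k _.
  rewrite kvs qf_planar; have [_ e _] := sP k.+1.
  have -> : Complex (pr (a (s k.+1)) 0 0) (pr (a (s k.+1)) 0 1) = rc (r k.+1) * cis (phi k.+1).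
    rewrite e mxE [X in Complex _ X]mxE vec0 vec1; rewrite /rc /cis.
    by apply/eqP; rewrite eq_complex /=; apply/andP; split; apply/eqP; ring.
  by rewrite mulrA -rcM ipowM ipow_rc ipow_cis.
have Im0 : complex.Im (angle_prod a kv (Complex x y)) = 0.
  rewrite prodE Im_rcM /=.
  have -> : \sum_(k < n) (D k)%:~R * phi k.+1 = ((t%:Z - (\sum_(k < n) m k)%:Z) + 2 * (m 0)%:Z)%:~R * pi.
    have e1 : \sum_(k < n) (m k.+1)%:R * phi k.+1 = \sum_(k < n) (m k)%:R * phi k + (m 0)%:R * turn R.
      have : \sum_(k < n.+1) (m k)%:R * phi k = \sum_(k < n.+1) (m k)%:R * phi k by [].
      have mn : m n = m 0%N by have := mper 0%N; rewrite add0n.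
      have pn : phi n = phi 0%N + turn R by have := pg_phi Pg 0; rewrite add0n.
      rewrite {1}big_ord_recl big_ord_recr /= mn pn.
      rewrite (eq_bigr (fun k : 'I_n => (m k.+1)%:R * phi k.+1)) //; lra.
    have e2 : \sum_(k < n) (D k)%:~R * phi k.+1 = \sum_(k < n) (m k.+1)%:R * phi k.+1 - \sum_(k < n) (m k)%:R * phi k.+1.
      by rewrite -sumrB; apply: eq_bigr => k _; rewrite /D intrB -!pmulrn; ring.
    have e3 : \sum_(k < n) (m k)%:R * (pi - (phi k.+1 - phi k)) =
        (\sum_(k < n) m k)%:R * pi - \sum_(k < n) (m k)%:R * phi k.+1 + \sum_(k < n) (m k)%:R * phi k :> R.
      by rewrite natr_sum mulr_suml -sumrB -big_split; apply: eq_bigr => k _ /=; ring.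
    rewrite e2 e1 intrD intrB intrM -!pmulrn /turn; move: hs; rewrite e3; lra.
  move: (t%:Z - _ + _) => z; suff -> : sin (z%:~R * pi : R) = 0 by rewrite mulr0.
  have sn (j : nat) : sin (j%:R * pi : R) = 0.
    elim: j => [|j IH]; first by rewrite mul0r sin0.
    by rewrite -natr1 mulrDl mul1r sinDpi IH oppr0.
  case: z => j; first by rewrite -pmulrn sn.
  by rewrite NegzE mulrNz mulNr sinN -pmulrn sn oppr0.
have cl := gen Im0.
have alone k i : i \in H -> colinear (a (s k)) (a i) -> i = s k \/ exists2 l, i = s l & par_sides k l.
  move=> /sI[l _ <-] h; case: (eqVneq (s k) (s l)) => [->|ne]; first by left.
  by right; exists l.
have self i : colinear (a i) (a i) by exists 1; rewrite scale1r.
move=> k; split=> [h|l h].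
  have := cl (s k.+1); rewrite (bigD1 (s k.+1)) /=; last by apply/asboolP.
  rewrite big1 ?addr0 ?kvs /D; first by lia.
  move=> i /andP[/asboolP ci ne]; case: (boolP (i \in H)) => [iH|/kv0//].
  by have [e|[j _ /h//]] := alone _ _ iH ci; rewrite e eqxx in ne.
have [ne co] := h.
have := cl (s k.+1); rewrite (bigD1 (s k.+1)) /=; last by apply/asboolP.
rewrite (bigD1 (s l.+1)) /=; last by apply/andP; split; [apply/asboolP|rewrite eq_sym].
rewrite big1 ?addr0 ?kvs /D; first by lia.
move=> i /andP[/andP[/asboolP ci ne1] ne2]; exfalso.
by apply: (col_uniq Ir ne _ _ co ci); rewrite eq_sym.
Qed.

(** ** Side lengths *)

Lemma slen_formula k : slen Pg k = side_ratio a x y (s k) (s k.+1) (s k.+2) * tri a b x y (s k) (s k.+1) (s k.+2) c.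
Proof.
have [p0 ep bp] := sP k; have [q0 eq_ bq] := sP k.+1; have [w0 ew bw] := sP k.+2.
rewrite /side_ratio /tri ep eq_ ew dotZl dotZr dot_dir subrr cos0 mulr1 -expr2 sqrtr_sqr gtr0_norm //.
have cE (u v t t' : R) : cross2 (u *: dir t) (v *: dir t') = u * v * sin (t' - t).
  by rewrite /cross2 !mxE /= sinB; ring.
have -> : tri0 x y (a (s k)) (a (s k.+1)) (a (s k.+2)) (b (s k)) (b (s k.+1)) (b (s k.+2)) + c * tri1 x y (a (s k)) (a (s k.+1)) (a (s k.+2)) =
    r k * beta k * cross2 (pr (a (s k.+1))) (pr (a (s k.+2))) + r k.+1 * beta k.+1 * cross2 (pr (a (s k.+2))) (pr (a (s k)))
    + r k.+2 * beta k.+2 * cross2 (pr (a (s k))) (pr (a (s k.+1))).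
  rewrite bp bq bw /tri0 /tri1; ring.
rewrite ep eq_ ew !cE.
have [_ t1 t2] := cornerP Pg k; have [_ _ t3] := cornerP Pg k.+1.
have g1 := sin_gt0_pi (pg_gap Pg k); have g2 := sin_gt0_pi (pg_gap Pg k.+1).
have e3 : slen Pg k * sin (phi k.+2 - phi k.+1) = beta k.+2 - dot (dir (phi k.+2)) (corner Pg k).
  move: t3; rewrite /tight corner_next dotDr dotZr dot_dir.
  rewrite (_ : phi k.+2 - (phi k.+1 + pi / 2) = phi k.+2 - phi k.+1 - pi / 2) ?cosBpihalf; [lra|ring].
have e4 : sin (phi k.+2 - phi k.+1) * beta k + sin (phi k - phi k.+2) * beta k.+1 +
    sin (phi k.+1 - phi k) * beta k.+2 = sin (phi k.+1 - phi k) * (beta k.+2 - dot (dir (phi k.+2)) (corner Pg k)).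
  rewrite -t1 -t2 !dot2 !vec0 !vec1 !sinB; ring.
have -> : slen Pg k = (beta k.+2 - dot (dir (phi k.+2)) (corner Pg k)) / sin (phi k.+2 - phi k.+1).
  by rewrite -e3 mulfK // gt_eqF.
have -> : beta k.+2 - dot (dir (phi k.+2)) (corner Pg k) = (sin (phi k.+2 - phi k.+1) * beta k + sin (phi k - phi k.+2) * beta k.+1 +
    sin (phi k.+1 - phi k) * beta k.+2) / sin (phi k.+1 - phi k) by rewrite e4 mulrC mulKf // gt_eqF.
by field; rewrite !gt_eqF.
Qed.

Hypothesis gen_len : forall i j l i' j' l' A, A \in verts -> i \in A -> j \in A -> l \in A ->
  ~~ [&& i' \in A, j' \in A & l' \in A] -> tri a b x y i' j' l' c != 0 -> side_ratio a x y i' j' l' != 0 ->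
  side_ratio a x y i j l * tri a b x y i j l c != side_ratio a x y i' j' l' * tri a b x y i' j' l' c.

Lemma slen_neq (k l : nat) A : A \in verts -> s k \in A -> s k.+1 \in A -> s k.+2 \in A ->
  ~~ [&& s l \in A, s l.+1 \in A & s l.+2 \in A] -> slen Pg k <> slen Pg l.
Proof.
move=> hA h1 h2 h3 hl; have := slen_gt0 Pg l; rewrite !slen_formula => l0.
have /andP[n1 n2] : (side_ratio a x y (s l) (s l.+1) (s l.+2) != 0) && (tri a b x y (s l) (s l.+1) (s l.+2) c != 0).
  by rewrite -negb_or -mulf_eq0 gt_eqF.
by apply/eqP; apply: (gen_len hA).
Qed.

(** ** The tiling by a section *)

Hypothesis tiler : forall C, cross_section [set z | inP z]%classic C -> tiles_plane C.

(** The section is a cross-section, because it contains three points that form a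
right angle. Its copies in the plane are images of the polygon under
distance preserving maps, hence placements. *)
Lemma section_tiling : exists (TT : set (set 'rV[R]_2)) (pl : set 'rV[R]_2 -> placement R),
  [/\ forall T, TT T -> tile phi beta (pl T) = T, (\bigcup_(T in TT) T)%classic = setT &
    trivIset TT (fun T : set 'rV[R]_2 => interior T)].
Proof.
pose C := (hyperplane (frN x y) c `&` [set z | inP z])%classic.
have hC u : pgset phi beta u -> C (pt u).
  by move=> /pgset_in h; split=> //=; apply: chart_plane.
have [z1 ho] := pg_in Pg; have [e e0 he] := inside_margin Pg ho.
have mvI0 d : mvI (Placement 0 0 false) d = d :> 'rV[R]_2.
  by apply: vecP; rewrite ?vec0 ?vec1 /sg /= ?expr0 ?mul1r dot2 ?vec0 ?vec1 ?add0r ?cos0 ?sin0 ?cos_pihalf ?sin_pihalf; ring.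
have near (d : 'rV[R]_2) : `|d 0 0| + `|d 0 1| < e -> pgset phi beta (z1 + d).
  by move=> hd k; apply: ltW; have := he (Placement 0 0 false) d hd k; rewrite mvI0.
have e20 : 0 < e / 2 by lra.
have sE2 (w : R) (v : 'rV[R]_2) k : (w *: v) 0 k = w * v 0 k by rewrite mxE.
have p0 : pgset phi beta z1 by move=> k; apply: ltW.
have p1 : pgset phi beta (z1 + (e / 2) *: vec 1 0).
  by apply: near; rewrite !sE2 vec0 vec1 mulr1 mulr0 normr0 gtr0_norm //; lra.
have p2 : pgset phi beta (z1 + (e / 2) *: vec 0 1).
  by apply: near; rewrite !sE2 vec0 vec1 mulr1 mulr0 normr0 gtr0_norm //; lra.
have : tiles_plane C.
  apply: tiler; split.
    exists (frN x y), c; split=> //; apply/eqP => e'.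
    have := frNN x y; rewrite e' dot0l => /esym/eqP; rewrite expf_eq0 /= (negbTE (rho_neq0 x y)) //.
  have lin d : pt (z1 + d) - pt z1 = (d 0 0 / rho x y) *: fr1 x y + (d 0 1 / rho x y) *: fr2 x y.
    by rewrite /chart; apply/rowP => k; rewrite !mxE; ring.
  pose D1 := pt (z1 + (e / 2) *: vec 1 0) - pt z1; pose D2 := pt (z1 + (e / 2) *: vec 0 1) - pt z1.
  have [d11 d22 d12] : [/\ 0 < dot D1 D1, 0 < dot D2 D2 & dot D1 D2 = 0].
    have s2 : 0 < (e / 2) ^+ 2 by rewrite exprn_gt0.
    have r0 := rho_neq0 x y.
    have -> : dot D1 D1 = (e / 2) ^+ 2.
      by rewrite /D1 lin !dot3 !c3E !sE2 vec0 vec1; rewrite /rho in r0 *; field.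
    have -> : dot D2 D2 = (e / 2) ^+ 2.
      by rewrite /D2 lin !dot3 !c3E !sE2 vec0 vec1; rewrite /rho in r0 *; field.
    by split=> //; rewrite /D1 /D2 !lin !dot3 !c3E !sE2 !vec0 !vec1; rewrite /rho in r0 *; field.
  case=> [C0|[z Cz]|[z [w Czw]]].
  - by have := hC _ p0; rewrite C0.
  - have := hC _ p0; have := hC _ p1; rewrite Cz /= => e1 e2.
    by move: d11; rewrite /D1 e1 e2 subrr dot0l ltxx.
  - have := hC _ p0; have := hC _ p1; have := hC _ p2; rewrite Czw => -[t2 _ e2] [t1 _ e1] [t0 _ e0'].
    have E1 : D1 = (t1 - t0) *: (w - z) by rewrite /D1 -e1 -e0'; apply/rowP => k; rewrite !mxE; ring.
    have E2 : D2 = (t2 - t0) *: (w - z) by rewrite /D2 -e2 -e0'; apply/rowP => k; rewrite !mxE; ring.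
    move: d11 d22 d12; rewrite E1 E2 !dotZl !dotZr; move: (dot (w - z) (w - z)) (t1 - t0) (t2 - t0) => q u v h1 h2 h3.
    have u0 : u != 0 by apply: contraTneq h1 => ->; rewrite mul0r ltxx.
    have v0 : v != 0 by apply: contraTneq h2 => ->; rewrite mul0r ltxx.
    have : q != 0 by apply: contraTneq h1 => ->; rewrite !mulr0 ltxx.
    by move=> q0; move/eqP: h3; rewrite !mulf_eq0 (negbTE u0) (negbTE v0) (negbTE q0).
move=> [TT [hcong hcov htriv]].
have ex T : exists p, TT T -> tile phi beta p = T.
  case: (pselect (TT T)) => hT; last by exists (Placement 0 0 false).
  have [f iso im] := hcong T hT.
  have [|p hp] := @isometry_placement R (pgset phi beta) (f \o pt) z1 (e / 2) e20 p0 p1 p2.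
    by move=> u v hu hv; rewrite /= iso ?chart_iso //; apply: hC.
  exists p => _; apply/seteqP; split=> [w|w].
    rewrite /tile /= => hw; rewrite -im; exists (pt (loc p w)); first exact: hC.
    by have := hp _ hw; rewrite /= locK.
  rewrite -im => -[z [nz hz] <-]; rewrite /tile /=.
  have ez := plane_chart nz; have hz' : pgset phi beta (pr z) by apply/pgset_in; rewrite -ez.
  by have := hp _ hz'; rewrite /= -ez => ->; rewrite globK.
exists TT, (fun T => projT1 (cid (ex T))); split=> // T hT.
by case: (cid _) => /= p; apply.
Qed.

End OfPolygon.
End Realize.

(** * What a universal tiler says about its separable sets of vertices *)

Section Universal.
Variables (R : realType) (I : finType) (a : I -> 'rV[R]_3) (b : I -> R).
Hypothesis Ir : irredundant a b.
Hypothesis tiler : forall C, cross_section [set z | inP a b z]%classic C -> tiles_plane C.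
Local Notation verts := (verts a b).
Local Notation hits := (hits a b).
Implicit Types (A B : {set I}) (S : {set {set I}}).

(** This collects what is known of the section by a good plane that separates [S]:
the facets [s k] in cyclic order, the angles [phi] of the sides, their lengths [L]
and the relations at the vertices of the tiling. *)
Theorem realize S i0 : separable a b S -> i0 \in hits S -> (4 < #|hits S|)%N ->
  exists (s : nat -> I) (phi L : nat -> R),
  [/\ [/\ s 0%N = i0, forall k, s k \in hits S & forall k l : nat, s k = s l <-> k = l %[mod #|hits S|]],
    [/\ side_angles #|hits S| phi (par_sides a s), forall k, L (k + #|hits S|)%N = L k &
      forall i, i \in hits S -> exists2 k, (k < #|hits S|)%N & s k = i],
    forall k0, (k0 < #|hits S|)%N ->
      exists m t, relation #|hits S| phi (par_sides a s) m t /\ (0 < m k0)%N,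
    forall k0, (k0 < #|hits S|)%N -> (forall m, ~ relation #|hits S| phi (par_sides a s) m 1%N) ->
      exists m, [/\ relation #|hits S| phi (par_sides a s) m 2%N, (0 < m k0)%N &
        forall x : R, ~~ odd (\sum_(k < #|hits S|) m k * ((L k == x) + (L k.+1 == x)))] &
    (forall (k l : nat) A, A \in verts -> s k \in A -> s k.+1 \in A -> s k.+2 \in A ->
      ~~ [&& s l \in A, s l.+1 \in A & s l.+2 \in A] -> L k.+1 <> L l.+1) /\
    (forall (k l : nat) A B, A \in verts -> A \in S -> B \in verts -> B \notin S ->
      s k \in A -> s k \in B -> s l \in A -> s l \in B ->
      [\/ k = l %[mod #|hits S|], k = l.+1 %[mod #|hits S|] | k.+1 = l %[mod #|hits S|]])].
Proof.
move=> sep iH H4; have [x [y [c [hc gen glen]]]] := good_plane Ir sep.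
have [s [r [phi [beta [Pg [s0 sH] sE sI sP]]]]] := section_polygon Ir hc H4 iH.
have [TT [pl [plE cov tri]]] := section_tiling Ir hc H4 Pg sI sP tiler.
have n0 : (0 < #|hits S|)%N by apply: leq_trans H4.
have LS k : slen Pg (k.+1 + #|hits S|.-1) = slen Pg k.
  by apply: slen_mod; rewrite addSnnS prednK // modnDr.
exists s, phi, (fun k => slen Pg (k + #|hits S|.-1)); split=> //.
- split=> //; first by apply: (section_angles Ir) sE sP.
  by move=> k; apply: slen_mod; rewrite addnAC modnDr.
- move=> k0 hk; have [m [t [mper mk t12 hs]]] := tiling_relation Pg plE cov tri hk.
  by exists m, t; split=> //; apply: (angle_relation Ir H4 Pg sH sE sI sP gen).
- move=> k0 hk no1; have [|m [mper mk hs par]] := tiling_parity Pg plE cov tri hk.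
    move=> m mper _ hs; apply: (no1 m); apply: (angle_relation Ir H4 Pg sH sE sI sP gen) => //; first by left.
    by rewrite mul1r.
  exists m; split=> //; first by apply: (angle_relation Ir H4 Pg sH sE sI sP gen) => //; right.
  move=> z; have := par z; congr (~~ odd _); apply: eq_bigr => k _.
  by rewrite LS.
split=> [k l A hA h1 h2 h3 hl|k l A B hA AS hB BS kA kB lA lB].
  by rewrite !LS; exact: (@slen_neq _ _ _ _ _ _ _ _ _ _ _ _ Pg sP glen k l A hA h1 h2 h3 hl).
exact: (edge_adjacent Ir hc H4 Pg sI sP hA AS hB BS).
Qed.

Lemma parallel_hits S : separable a b S -> (4 < #|hits S|)%N ->
  (forall i j, i \in hits S -> j \in hits S -> i != j -> ~ colinear (a i) (a j)) -> False.
Proof.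
move=> sep H4 nop; have /card_gt0P[i0 iH] : (0 < #|hits S|)%N by apply: leq_trans H4.
have [s [phi [L [[_ sH _] [SA _ _] rel _ _]]]] := realize sep iH H4.
have [m [t [r m0]]] := rel 0%N (leq_trans (isT : 0 < 5)%N H4).
by move: m0; rewrite (no_parallel SA H4 _ r) // => k l [ne]; apply: nop.
Qed.

Lemma card_hits S : separable a b S -> (#|hits S| <= 6)%N.
Proof.
move=> sep; rewrite leqNgt; apply/negP => H6.
have H4 : (4 < #|hits S|)%N by apply: leq_trans H6.
have /card_gt0P[i0 iH] : (0 < #|hits S|)%N by apply: leq_trans H4.
have [s [phi [L [[_ sH _] [SA _ _] rel _ _]]]] := realize sep iH H4.
apply: (many_sides SA H6) => k.
have [m [t [r mk]]] := rel (k %% #|hits S|)%N (ltn_pmod k (leq_trans (isT : 0 < 5)%N H4)).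
exists m, t; split=> //; have [mper _ _ _] := r.
have -> : m k = m (k %% #|hits S|)%N; last by [].
rewrite {1}(divn_eq k #|hits S|) addnC; elim: (k %/ _)%N => [|q IH]; first by rewrite addn0.
by rewrite mulSn [(#|hits S| + _)%N]addnC addnA mper.
Qed.

(** The vertices [A] and [B] are the ends of a common edge that crosses the plane. *)
Definition crosses S i j := exists A B, [/\ A \in verts, A \in S, B \in verts & B \notin S] /\
  [/\ i \in A, i \in B, j \in A & j \in B].

(** By [good_plane] the sides [h p] and [h q] of a hexagonal section have different
lengths if some vertex lies on one of them and both its neighbours, but not on the
other and both its neighbours. *)
Definition tells (h : nat -> I) p q := exists2 A, A \in verts &
  [&& h (p + 5)%N \in A, h p \in A & h p.+1 \in A] != [&& h (q + 5)%N \in A, h q \in A & h q.+1 \in A].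

Lemma hexagon_hits S (h : nat -> I) : separable a b S ->
  (forall k, h (k + 6)%N = h k) -> (forall k l, (k < 6)%N -> (l < 6)%N -> h k = h l -> k = l) ->
  hits S = [set h k | k : 'I_6] -> (forall k, crosses S (h k) (h k.+1)) ->
  (forall k l, h k != h l -> colinear (a (h k)) (a (h l)) -> l = (k + 3)%N %[mod 6]) ->
  (forall q, (0 < q < 6)%N -> tells h 0 q) -> tells h 1 4 -> tells h 2 5 -> False.
Proof.
move=> sep h6 hinj hH hcr hpar t0 t14 t25.
have hmod k : h k = h (k %% 6)%N.
  rewrite {1}(divn_eq k 6) addnC; elim: (k %/ _)%N => [|q IH]; first by rewrite addn0.
  by rewrite mulSn [(6 + _)%N]addnC addnA h6.
have hE (k l : nat) : h k = h l <-> k = l %[mod 6].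
  split=> [e|e]; last by rewrite hmod e -hmod.
  by apply: hinj; rewrite ?ltn_pmod // -!hmod.
have c6 : #|hits S| = 6%N.
  rewrite hH card_imset ?card_ord // => k l /hE; rewrite !modn_small // => e; exact: val_inj.
have hh k : h k \in hits S.
  by rewrite hH hmod; apply/imsetP; exists (Ordinal (ltn_pmod k (isT : 0 < 6)%N)).
have H4 : (4 < #|hits S|)%N by rewrite c6.
have [s [phi [L [[s0 sH sE] [SA Lper sI] rel par [len adj]]]]] := realize sep (hh 0%N) H4.
rewrite c6 in sE SA Lper sI rel par adj.
have ex k : {p : nat | (p < 6)%N /\ s p = h k}.
  by apply: cid; have [p hp e] := sI _ (hh k); exists p.
pose sg k := projT1 (ex k).
have sgP k : (sg k < 6)%N /\ s (sg k) = h k by rewrite /sg; case: (ex k).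
have sg0 : sg 0%N = 0%N.
  by have [l e] := sgP 0%N; have := (sE (sg 0%N) 0%N).1; rewrite e s0 => /(_ erefl); rewrite modn_small.
have sga k : [\/ sg k = sg k.+1 %[mod 6], sg k = (sg k.+1).+1 %[mod 6] | (sg k).+1 = sg k.+1 %[mod 6]].
  have [A [B [[hA AS hB BS] [i1 i2 j1 j2]]]] := hcr k.
  by have [_ e1] := sgP k; have [_ e2] := sgP k.+1; apply: (adj _ _ A B) => //; rewrite ?e1 ?e2.
have sgn k l : ~ k = l %[mod 6] -> sg k <> sg l.
  by move=> kl e; apply: kl; apply/hE; have [_ <-] := sgP k; have [_ <-] := sgP l; rewrite e.
have l1 := (sgP 1%N).1; have l2 := (sgP 2%N).1; have l3 := (sgP 3%N).1; have l4 := (sgP 4%N).1; have l5 := (sgP 5%N).1.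
have a0 := sga 0%N; have a1 := sga 1%N; have a2 := sga 2%N; have a3 := sga 3%N; have a4 := sga 4%N.
have n01 : sg 0%N <> sg 1%N by apply: sgn.
have n12 : sg 1%N <> sg 2%N by apply: sgn.
have n23 : sg 2%N <> sg 3%N by apply: sgn.
have n34 : sg 3%N <> sg 4%N by apply: sgn.
have n45 : sg 4%N <> sg 5%N by apply: sgn.
have n02 : sg 0%N <> sg 2%N by apply: sgn.
have n13 : sg 1%N <> sg 3%N by apply: sgn.
have n24 : sg 2%N <> sg 4%N by apply: sgn.
have n35 : sg 3%N <> sg 5%N by apply: sgn.
have step u v w : (u < 6)%N -> (v < 6)%N -> (w < 6)%N -> u <> v -> v <> w -> u <> w ->
    [\/ u = v %[mod 6], u = v.+1 %[mod 6] | u.+1 = v %[mod 6]] ->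
    [\/ v = w %[mod 6], v = w.+1 %[mod 6] | v.+1 = w %[mod 6]] -> w = ((v + v + (6 - u)) %% 6)%N.
  by move=> hu hv hw uv vw uw; case=> h1; case=> h2; clear -hu hv hw uv vw uw h1 h2; lia.
have Q : (forall k, s k = h k) \/ (forall k, s k = h (5 * k)%N).
  have l0 : (sg 0%N < 6)%N by rewrite sg0.
  have e2 := step _ _ _ l0 l1 l2 n01 n12 n02 a0 a1.
  have e3 := step _ _ _ l1 l2 l3 n12 n23 n13 a1 a2.
  have e4 := step _ _ _ l2 l3 l4 n23 n34 n24 a2 a3.
  have e5 := step _ _ _ l3 l4 l5 n34 n45 n35 a3 a4.
  have smod k : s k = s (k %% 6)%N by apply/sE; rewrite modn_mod.
  have [e1|e1] : sg 1%N = 1%N \/ sg 1%N = 5%N by move: a0 n01 l1; rewrite sg0; clear; case; lia.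
    left=> k; rewrite smod hmod; move: (ltn_pmod k (isT : 0 < 6)%N); move: (k %% 6)%N => {}k.
    rewrite sg0 e1 /= in e2; rewrite e1 e2 /= in e3; rewrite e2 e3 /= in e4; rewrite e3 e4 /= in e5.
    case: k => [|[|[|[|[|[|//]]]]]] _; [have := (sgP 0%N).2|have := (sgP 1%N).2|have := (sgP 2%N).2|have := (sgP 3%N).2|have := (sgP 4%N).2|have := (sgP 5%N).2];
      by rewrite ?sg0 ?e1 ?e2 ?e3 ?e4 ?e5.
  right=> k; rewrite smod hmod -modnMmr; move: (ltn_pmod k (isT : 0 < 6)%N); move: (k %% 6)%N => {}k.
  rewrite sg0 e1 /= in e2; rewrite e1 e2 /= in e3; rewrite e2 e3 /= in e4; rewrite e3 e4 /= in e5.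
  case: k => [|[|[|[|[|[|//]]]]]] _; [have := (sgP 0%N).2|have := (sgP 5%N).2|have := (sgP 4%N).2|have := (sgP 3%N).2|have := (sgP 2%N).2|have := (sgP 1%N).2];
      by rewrite ?sg0 ?e1 ?e2 ?e3 ?e4 ?e5.
have len' p q A : A \in verts ->
    [&& s (p + 5)%N \in A, s p \in A & s p.+1 \in A] != [&& s (q + 5)%N \in A, s q \in A & s q.+1 \in A] -> L p <> L q.
  have s6 k : s (k + 6)%N = s k by apply/sE; rewrite modnDr.
  move=> hA e.
  have L5 k : L (k + 5).+1 = L k by rewrite -addnS Lper.
  have e6 k : s (k + 5).+1 = s k by rewrite -addnS s6.
  have e7 k : s (k + 5).+2 = s k.+1 by rewrite -addSn -addnS s6.
  rewrite -(L5 p) -(L5 q); move: e; case: (boolP [&& s (p + 5)%N \in A, s p \in A & s p.+1 \in A]) => [/and3P[h1 h2 h3]|h1].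
    by move=> t; apply: (len _ _ A); rewrite ?e6 ?e7 //; move: t; case: [&& _, _ & _].
  case: (boolP [&& s (q + 5)%N \in A, s q \in A & s q.+1 \in A]) => [/and3P[h2 h3 h4] _|//].
  by apply/nesym; apply: (len _ _ A); rewrite ?e6 ?e7.
have no1 m : ~ relation 6 phi (par_sides a s) m 1%N.
  move=> r; have [|c [e12 _ _ _]] := hexagon_relation SA _ r; last by clear -e12; lia.
  move=> k l [ne co]; case: Q => e; rewrite !e in ne co; have := hpar _ _ ne co; clear; lia.
have opp k l : par_sides a s k l -> l = (k + 3)%N %[mod 6].
  by move=> [ne co]; case: Q => e; rewrite !e in ne co; have := hpar _ _ ne co; clear; lia.
have [m [r m0 pm]] := par 0%N isT no1.
pose T p A := [&& h (p + 5)%N \in A, h p \in A & h p.+1 \in A].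
have TE p q A : p = q %[mod 6] -> T p A = T q A.
  move=> e; have e5 : h (p + 5)%N = h (q + 5)%N by apply/hE; rewrite -modnDml e modnDml.
  have e1 : h p.+1 = h q.+1 by apply/hE; apply: eqmodS.
  have e0 : h p = h q by apply/hE.
  by rewrite /T e5 e1 e0.
(* Both hypotheses on the lengths are invariant under reversing the hexagon. *)
have [g [gT g0 g12]] : exists g : nat -> nat, [/\ forall p A, [&& s (p + 5)%N \in A, s p \in A & s p.+1 \in A] = T (g p) A,
    forall q, (0 < q < 6)%N -> exists2 q', (0 < q' < 6)%N & g q = q' %[mod 6] &
    g 0%N = 0%N /\ ((g 1%N = 1 %[mod 6] /\ g 4%N = 4 %[mod 6]) /\ (g 2%N = 2 %[mod 6] /\ g 5%N = 5 %[mod 6]) \/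
    (g 1%N = 5 %[mod 6] /\ g 4%N = 2 %[mod 6]) /\ (g 2%N = 4 %[mod 6] /\ g 5%N = 1 %[mod 6]))].
  case: Q => e.
    exists id; split; [by move=> p A; rewrite !e|by move=> q hq; exists q|by split=> //; left].
  exists (muln 5); split=> [p A|q hq|]; last by split=> //; right.
    have e1 : h (5 * (p + 5))%N = h (5 * p).+1 by apply/hE; clear; lia.
    have e5 : h (5 * p.+1)%N = h (5 * p + 5)%N by apply/hE; clear; lia.
    rewrite !e /T e1 e5.
    by case: (h (5 * p).+1 \in A); case: (h (5 * p)%N \in A); case: (h (5 * p + 5)%N \in A).
  by exists ((5 * q) %% 6)%N; [clear -hq; lia|rewrite modn_mod].
have far p q p' q' : tells h p' q' -> (g p = p' %[mod 6] /\ g q = q' %[mod 6]) \/ (g p = q' %[mod 6] /\ g q = p' %[mod 6]) -> L p <> L q.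
  move=> [A hA t] hg; apply: (len' _ _ A) => //; rewrite !gT.
  by case: hg => -[e1 e2]; rewrite (TE _ _ A e1) (TE _ _ A e2) // eq_sym.
have [g00 g1245] := g12.
apply: (hexagon_parity SA opp r m0 Lper pm).
- move=> q hq; have [q' hq' e] := g0 q hq.
  by apply: (far _ _ _ _ (t0 q' hq')); left; rewrite g00.
- case: g1245 => -[[e1 e4] [e2 e5]]; first by apply: (far _ _ _ _ t14); left.
  by apply: (far _ _ _ _ t25); right.
- case: g1245 => -[[e1 e4] [e2 e5]]; first by apply: (far _ _ _ _ t25); left.
  by apply: (far _ _ _ _ t14); right.
Qed.

End Universal.

(** * Combinatorics of universal tilers *)

Section Comb.
Variables (R : realType) (I : finType) (a : I -> 'rV[R]_3) (b : I -> R).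
Hypothesis Ir : irredundant a b.
Hypothesis tiler : forall C, cross_section [set z | inP a b z]%classic C -> tiles_plane C.
Local Notation verts := (verts a b).
Local Notation hits := (hits a b).
Local Notation edge_at := (edge_at a b).
Local Notation fverts := (fverts a b).
Local Notation crosses := (crosses a b).
Local Notation col i j := (colinear (a i) (a j)).
Implicit Types (A B C D w : {set I}) (S : {set {set I}}) (i j l x y : I).

Lemma uniq_card (s : seq I) A : uniq s -> {subset s <= A} -> (size s <= #|A|)%N.
Proof. by move=> us sA; rewrite cardE; apply: uniq_leq_size => // x /sA; rewrite mem_enum. Qed.

Lemma mem_uniq (s : seq I) A x : uniq s -> {subset s <= A} -> (#|A| <= size s)%N -> x \in A -> x \in s.
Proof.
move=> us sA le xA; apply/negPn/negP => xs.
have : (size (x :: s) <= #|A|)%N.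
  by apply: uniq_card; rewrite /= ?xs // => y; rewrite inE => /predU1P[->|/sA].
by rewrite /= ltnNge le.
Qed.

Lemma touch A x y : A \in verts -> x \in A -> y \in A -> x != y -> ~ col x y.
Proof. by move=> hA xA yA xy; have [_ e _] := vpP hA; apply: (touch_ncol Ir (x := vp a b A)) => //; rewrite e. Qed.

Lemma meet2 A B x y z : A \in verts -> B \in verts -> A != B -> x \in A -> x \in B -> y \in A -> y \in B ->
  x != y -> z \in A -> z != x -> z != y -> z \notin B.
Proof.
move=> hA hB AB xA xB yA yB xy zA zx zy; apply/negP => zB; have := vert_inter Ir hA hB AB.
rewrite leqNgt => /negP; apply; apply: (@uniq_card [:: x; y; z]).
  by rewrite /= !in_cons !in_nil !orbF negb_or xy (eq_sym x) zx (eq_sym y) zy.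
by move=> t; rewrite !inE => /or3P[] /eqP ->; rewrite ?xA ?xB ?yA ?yB ?zA ?zB.
Qed.

Lemma edge2 i x A B C : A \in verts -> B \in verts -> C \in verts -> x != i ->
  i \in A -> i \in B -> i \in C -> x \in A -> x \in B -> x \in C -> A != B -> C = A \/ C = B.
Proof.
move=> hA hB hC xi iA iB iC xA xB xC AB.
have := edge_uniq Ir hA hB hC xi xA xB xC iA iB iC.
by rewrite (negbTE AB) /= => /orP[] /eqP ->; [right|left].
Qed.

Lemma edge_in A i j : j \in edge_at A i -> [/\ j \in A, j != i &
  exists B, [/\ B \in verts, B != A, i \in B & j \in B]].
Proof. by rewrite finset.in_set finset.in_setD1 => /andP[/andP[ji jA] /edge_atP h]. Qed.

Lemma in_edge A B i j : j \in A -> j != i -> B \in verts -> B != A -> i \in B -> j \in B -> j \in edge_at A i.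
Proof.
by move=> jA ji hB BA iB jB; rewrite finset.in_set finset.in_setD1 ji jA; apply/edge_atP; exists B.
Qed.

Lemma edge_sym A i j : i \in A -> j \in edge_at A i -> i \in edge_at A j.
Proof. by move=> iA /edge_in[jA ji [B [hB BA iB jB]]]; apply: (in_edge _ _ hB BA) => //; rewrite eq_sym. Qed.

Lemma in_face i w A : (A \in fverts i :\ w) = [&& A != w, A \in verts & i \in A].
Proof. by rewrite finset.in_setD1 [A \in fverts i]finset.in_set. Qed.

Lemma hits_facetP i w x : w \in verts -> i \in w ->
  reflect (exists A, [/\ A \in verts, A != w, i \in A & x \in A]) (x \in hits (fverts i :\ w)).
Proof.
move=> hw iw; apply: (iffP (hitsP _ _ _ _)) => [[[A [hA + xA]] _]|[A [hA Aw iA xA]]].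
  by rewrite in_face => /and3P[Aw _ iA]; exists A.
split; first by exists A; rewrite in_face Aw hA iA.
case: (eqVneq x i) => [->|xi]; first by exists w; rewrite in_face eqxx.
have [B [hB xB iB]] := avoid_facet Ir xi.
by exists B; rewrite in_face (negbTE iB) !andbF.
Qed.

Lemma separable_facet_but_one i w : w \in verts -> i \in w -> separable a b (fverts i :\ w).
Proof.
move=> hw iw; have [_ _ w3] := vpP hw; have [j [l [jl ew]]] := edge_at2 Ir hw iw.
have : j \in edge_at w i by rewrite ew finset.in_set2 eqxx.
have : l \in edge_at w i by rewrite ew finset.in_set2 eqxx orbT.
move=> /edge_in[lw li _] /edge_in[jw ji _].
by apply: (separable_facet Ir hw iw jw lw) => //; rewrite eq_sym.
Qed.

Lemma around_facet i w (s : seq I) : w \in verts -> i \in w -> uniq s ->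
  (forall x, x \in s -> exists A, [/\ A \in verts, A != w, i \in A & x \in A]) -> (size s <= 6)%N.
Proof.
move=> hw iw us h; apply: leq_trans (card_hits Ir tiler (separable_facet_but_one hw iw)).
by apply: uniq_card => // x /h hx; apply/hits_facetP.
Qed.

(** Cutting off the vertex gives a polygon with a side on each of its facets, and
facets with a common vertex are not parallel. *)
Lemma vert_le4 A : A \in verts -> (#|A| <= 4)%N.
Proof.
move=> hA; rewrite leqNgt; apply/negP => A4.
have eH : hits [set A] = A.
  apply/setP => i; apply/hitsP/idP => [[[B [_ + iB]] _]|iA].
    by rewrite finset.in_set1 => /eqP <-.
  split; first by exists A; rewrite finset.in_set1.
  have : (0 < #|A :\ i|)%N by move: A4; rewrite (cardsD1 i) iA; lia.
  case/card_gt0P => j; rewrite finset.in_setD1 => /andP[ji jA].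
  have [B [hB iB jB]] : exists B, [/\ B \in verts, i \in B & j \notin B] by apply: (avoid_facet Ir); rewrite eq_sym.
  by exists B; rewrite finset.in_set1; split=> //; apply: contraNneq jB => ->.
apply: (@parallel_hits _ _ _ _ Ir tiler [set A]); rewrite ?eH //; first exact: separable1.
by move=> i j iA jA ij; apply: (touch hA).
Qed.

(** ** The hexagon criterion *)

(** Since a vertex lies on at most four facets, it cannot lie on three consecutive
facets and on the three opposite ones; so [v1] and [v2] tell opposite sides apart,
while [v0] tells the side [i0] from all others. *)
Lemma hexagon_criterion S i0 i1 i2 i3 i4 i5 v0 v1 v2 : separable a b S -> uniq [:: i0; i1; i2; i3; i4; i5] ->
  {subset hits S <= [:: i0; i1; i2; i3; i4; i5]} ->
  [/\ crosses S i0 i1, crosses S i1 i2 & crosses S i2 i3] ->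
  [/\ crosses S i3 i4, crosses S i4 i5 & crosses S i5 i0] ->
  [/\ ~ col i0 i2, ~ col i1 i3 & ~ col i2 i4] -> [/\ ~ col i3 i5, ~ col i4 i0 & ~ col i5 i1] ->
  [/\ v0 \in verts, v1 \in verts & v2 \in verts] -> [/\ i5 \in v0, i0 \in v0 & i1 \in v0] ->
  i2 \notin v0 -> i4 \notin v0 ->
  [/\ i0 \in v1, i1 \in v1 & i2 \in v1] \/ [/\ i3 \in v1, i4 \in v1 & i5 \in v1] ->
  [/\ i1 \in v2, i2 \in v2 & i3 \in v2] \/ [/\ i4 \in v2, i5 \in v2 & i0 \in v2] -> False.
Proof.
move=> sep us sub [c01 c12 c23] [c34 c45 c50] [n02 n13 n24] [n35 n40 n51] [h0 h1 h2] [a5 a0 a1] a2 a4 t1 t2.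
pose s := [:: i0; i1; i2; i3; i4; i5]; pose h k := nth i0 s (k %% 6).
have hit i j : crosses S i j -> i \in hits S.
  by move=> [A [B [[hA AS hB BS] [iA iB _ _]]]]; apply/hitsP; split; [exists A|exists B].
have ntouch i j : crosses S i j -> i != j -> ~ col i j.
  by move=> [A [B [[hA _ _ _] [iA _ jA _]]]]; apply: (touch hA).
have crs k : crosses S (h k) (h k.+1).
  have -> : h k.+1 = h (k %% 6).+1 by rewrite /h -addn1 -modnDml addn1.
  rewrite /h; have := ltn_pmod k (isT : 0 < 6)%N.
  by move: (k %% 6)%N => {}k; case: k => [|[|[|[|[|[|//]]]]]].
have v4 v : v \in verts -> ~~ [&& i0 \in v, i1 \in v, i2 \in v, i3 \in v & i4 \in v] /\ ~~ [&& i1 \in v, i2 \in v, i3 \in v, i4 \in v & i5 \in v].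
  move=> hv; have := vert_le4 hv; rewrite leqNgt => le.
  split; apply: contra le => /and5P[p1 p2 p3 p4 p5].
    apply: (@uniq_card [:: i0; i1; i2; i3; i4]); last by move=> t; rewrite !inE => /or4P[| | |/orP[]] /eqP ->.
    by apply: subseq_uniq us; rewrite /= !eqxx.
  apply: (@uniq_card [:: i1; i2; i3; i4; i5]); last by move=> t; rewrite !inE => /or4P[| | |/orP[]] /eqP ->.
  by case/andP: us.
apply: (@hexagon_hits _ _ _ _ Ir tiler S h sep).
- by move=> k; rewrite /h modnDr.
- move=> k l k6 l6; rewrite /h !modn_small // => /eqP; rewrite nth_uniq // => /eqP //.
- apply/setP => i; apply/idP/imsetP => [/sub iH|[k _ ->]]; last exact: hit (crs k).
  have iH' : (index i s < 6)%N by rewrite -[6%N]/(size s) index_mem.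
  by exists (Ordinal iH') => //; rewrite /h /= modn_small // nth_index.
- exact: crs.
- move=> k l; rewrite /h -(modn_mod l) -(modnDml k 3); have := ltn_pmod k (isT : 0 < 6)%N; have := ltn_pmod l (isT : 0 < 6)%N.
  move: (k %% 6)%N (l %% 6)%N => {}k {}l l6 k6; rewrite (modn_small l6) => ne c.
  have c' := col_sym Ir c.
  have ne' := ne; rewrite eq_sym in ne'.
  have q01 := ntouch _ _ c01; have q12 := ntouch _ _ c12; have q23 := ntouch _ _ c23.
  have q34 := ntouch _ _ c34; have q45 := ntouch _ _ c45; have q50 := ntouch _ _ c50.
  case: k ne ne' c c' k6 => [|[|[|[|[|[|//]]]]]] ne ne' c c' _; case: l ne ne' c c' l6 => [|[|[|[|[|[|//]]]]]] ne ne' c c' _ //=; exfalso; rewrite /= in ne ne' c c';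
    first [by rewrite eqxx in ne | exact: n02 c | exact: n02 c' | exact: n13 c | exact: n13 c' | exact: n24 c | exact: n24 c'
      | exact: n35 c | exact: n35 c' | exact: n40 c | exact: n40 c' | exact: n51 c | exact: n51 c'
      | exact: q01 ne c | exact: q01 ne' c' | exact: q12 ne c | exact: q12 ne' c' | exact: q23 ne c | exact: q23 ne' c'
      | exact: q34 ne c | exact: q34 ne' c' | exact: q45 ne c | exact: q45 ne' c' | exact: q50 ne c | exact: q50 ne' c'].
- move=> q hq; exists v0 => //; rewrite /h /= a5 a0 a1 /=.
  by case: q hq => [|[|[|[|[|[|//]]]]]] //= _; rewrite ?(negbTE a2) ?(negbTE a4) ?andbF.
- exists v1 => //; rewrite /h /=; have [w1 w2] := v4 _ h1.
  by case: t1 => -[p1 p2 p3]; rewrite p1 p2 p3 /= in w1 w2 *; [move: w1|move: w2]; do ![case: (_ \in v1) => //=].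
- exists v2 => //; rewrite /h /=; have [w1 w2] := v4 _ h2.
  by case: t2 => -[p1 p2 p3]; rewrite p1 p2 p3 /= in w1 w2 *; [move: w1|move: w2]; do ![case: (_ \in v2) => //=].
Qed.

(** This is the hexagon cut out by the plane that separates the vertices of the
facet [i] other than [w]; its sides lie on [i] and on the facets that meet [i] in
these vertices. *)
Lemma facet_hexagon i w i1 i2 i3 i4 i5 A12 A23 A34 A45 : w \in verts ->
  [/\ i \in w, i1 \in w & i5 \in w] -> i2 \notin w -> i4 \notin w ->
  uniq [:: i; i1; i2; i3; i4; i5] ->
  (forall A x, A \in verts -> A != w -> i \in A -> x \in A -> x \in [:: i; i1; i2; i3; i4; i5]) ->
  [/\ A12 \in verts, A12 != w, i \in A12 & i1 \in A12] -> i2 \in edge_at A12 i1 ->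
  [/\ A23 \in verts, A23 != w, i \in A23 & i2 \in A23] -> i3 \in edge_at A23 i2 ->
  [/\ A34 \in verts, A34 != w, i \in A34 & i3 \in A34] -> i4 \in edge_at A34 i3 ->
  [/\ A45 \in verts, A45 != w, i \in A45 & i4 \in A45] -> i5 \in edge_at A45 i4 ->
  [/\ ~ col i1 i3, ~ col i2 i4 & ~ col i3 i5] -> False.
Proof.
move=> hw [iw i1w i5w] i2w i4w us sub h12 e12 h23 e23 h34 e34 h45 e45 [n13 n24 n35].
have out A p q : [/\ A \in verts, A != w, i \in A & p \in A] -> p != i -> q != i -> q \in edge_at A p ->
    crosses (fverts i :\ w) p q.
  move=> [hA Aw iA pA] pi qi /edge_in[qA qp [B [hB BA pB qB]]]; exists A, B.
  rewrite !in_face hA Aw iA /=; split; split=> //.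
  rewrite hB /= negb_and negbK; apply/orP; right.
  by apply: (@meet2 A B p q i) => //; rewrite 1?eq_sym // eq_sym.
have side A p : [/\ A \in verts, A != w, i \in A & p \in A] -> p \in w -> crosses (fverts i :\ w) i p.
  by move=> [hA Aw iA pA] pw; exists A, w; rewrite !in_face hA Aw iA eqxx.
have csym i' j : crosses (fverts i :\ w) i' j -> crosses (fverts i :\ w) j i'.
  by move=> [A [B [hAB [p1 p2 p3 p4]]]]; exists A, B.
have [i2A [i3A [i4A i5A]]] : i2 \in A12 /\ i3 \in A23 /\ i4 \in A34 /\ i5 \in A45.
  by have [? _ _] := edge_in e12; have [? _ _] := edge_in e23; have [? _ _] := edge_in e34; have [? _ _] := edge_in e45.
have n i' j A : A \in verts -> i' \in A -> j \in A -> i' != j -> ~ col i' j by apply: touch.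
have neq : [/\ i1 != i, i2 != i, i3 != i, i4 != i & i5 != i] /\ i1 != i5.
  move: us; rewrite /= !in_cons !in_nil !orbF !negb_or => /and5P[/and5P[u1 u2 u3 u4 u5] /and4P[_ _ _ u15] _ _ _].
  by rewrite ![_ == i]eq_sym u1 u2 u3 u4 u5.
have [[u1 u2 u3 u4 u5] u15] := neq.
have [hA12 _ iA12 iA12'] := h12; have [hA45 _ iA45 iA45'] := h45.
apply: (@hexagon_criterion (fverts i :\ w) i i1 i2 i3 i4 i5 w A12 A45) => //.
- exact: separable_facet_but_one.
- by move=> x /(hits_facetP x hw iw)[A [hA Aw iA xA]]; apply: (sub A).
- by split; [apply: (side A12)|apply: (out A12)|apply: (out A23)].
- by split; [apply: (out A34)|apply: (out A45)|apply/csym/(side A45); last by []; have [? ? ? _] := h45; split].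
- by split=> //; apply: (n _ _ A12) => //; rewrite eq_sym.
- split=> //; first by apply: (n _ _ A45).
  by apply: (n _ _ w) => //; rewrite eq_sym.
- by left.
- by right.
Qed.

(** ** The boundary of a facet *)

(** The boundary of the facet [i], listed periodically so that a cycle can start at
any vertex: the edge on the facet [j q] joins the vertices [A q] and [A q.+1]. *)
Record cyc i k (A : nat -> {set I}) (j : nat -> I) : Prop := Cyc {
  cy_A : forall q, A (q + k)%N = A q;
  cy_j : forall q, j (q + k)%N = j q;
  cy_v : forall q, A q \in verts;
  cy_i : forall q, i \in A q;
  cy_l : forall q, j q \in A q;
  cy_r : forall q, j q \in A q.+1;
  cy_n : forall q, j q != i;
  cy_Ai : forall p q, A p = A q -> p = q %[mod k];
  cy_ji : forall p q, j p = j q -> p = q %[mod k];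
  cy_all : forall B, B \in verts -> i \in B -> exists q, B = A q }.

Lemma cyc_shift i k (A : nat -> {set I}) (j : nat -> I) r : (0 < k)%N -> cyc i k A j -> cyc i k (fun q => A (q + r)%N) (fun q => j (q + r)%N).
Proof.
move=> k0 [h1 h2 h3 h4 h5 h6 h7 h8 h9 h10]; split=> //.
- by move=> q; rewrite addnAC h1.
- by move=> q; rewrite addnAC h2.
- by move=> p q /h8/eqP; rewrite eqn_modDr => /eqP.
- by move=> p q /h9/eqP; rewrite eqn_modDr => /eqP.
move=> B hB /(h10 _ hB)[q ->]; exists (q + (r * k - r))%N.
have rk : (r <= r * k)%N by rewrite leq_pmulr.
rewrite -addnA subnK //; elim: r {rk} => [|r IH]; first by rewrite addn0.
by rewrite mulSn addnCA addnC h1 IH.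
Qed.

Lemma cyc_mod i k (A : nat -> {set I}) (j : nat -> I) p q : cyc i k A j -> p = q %[mod k] -> A p = A q /\ j p = j q.
Proof.
move=> h; have mA r : A r = A (r %% k)%N /\ j r = j (r %% k)%N.
  rewrite {1 3}(divn_eq r k) addnC; elim: (r %/ k)%N => [|m [e1 e2]]; first by rewrite addn0.
  by rewrite mulSn [(k + _)%N]addnC addnA (cy_A h) (cy_j h).
by move=> e; have [-> ->] := mA p; have [-> ->] := mA q; rewrite e.
Qed.

(** A closed walk along the edges of [i] passes through all its vertices: another
vertex [B] and its neighbour [D] would contribute three further facets around [i],
and with [i] itself and three facets of the walk a plane that cuts off the
remaining vertices would meet seven facets. *)
Lemma close_cycle i (As : seq {set I}) (js : seq I) : size As = size js -> (2 < size js)%N ->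
  uniq As -> uniq js -> i \notin js ->
  (forall q, (q < size js)%N -> [/\ nth finset.set0 As q \in verts, i \in nth finset.set0 As q,
     nth i js q \in nth finset.set0 As q & nth i js q \in nth finset.set0 As (q.+1 %% size js)%N]) ->
  (forall B x, B \in As -> x \in edge_at B i -> x \in js) ->
  exists (A : nat -> {set I}) (j : nat -> I), cyc i (size js) A j /\ forall q, (q < size js)%N -> A q = nth finset.set0 As q /\ j q = nth i js q.
Proof.
move=> sA k3 uA uj ij hq hE; set k := size js in sA k3 hq *; have k0 : (0 < k)%N by apply: leq_trans k3.
exists (fun q => nth finset.set0 As (q %% k)), (fun q => nth i js (q %% k)); split; last by move=> q qk; rewrite modn_small.
have lt q : (q %% k < k)%N by rewrite ltn_pmod.
split=> [q|q|q|q|q|q|q|p q /eqP|p q /eqP|].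
- by rewrite modnDr.
- by rewrite modnDr.
- by have [] := hq _ (lt q).
- by have [] := hq _ (lt q).
- by have [] := hq _ (lt q).
- have [_ _ _] := hq _ (lt q); suff -> : (q.+1 %% k = (q %% k).+1 %% k)%N by [].
  by rewrite -addn1 -modnDml addn1.
- by apply: contraNneq ij => <-; rewrite mem_nth.
- by rewrite nth_uniq ?sA // => /eqP.
- by rewrite nth_uniq // => /eqP.
move=> B hB iB; suff /nthP-/(_ finset.set0)[q qk <-] : B \in As.
  by exists q; rewrite modn_small // -sA.
apply/negPn/negP => BA.
have onlyA x C : x \in js -> C \in verts -> i \in C -> x \in C -> C \in As.
  move=> /(nthP i)[q qk <-] hC iC xC.
  have [h1 h2 h3 h4] := hq q qk; have [h1' h2' _ _] := hq _ (lt q.+1).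
  have ne : nth finset.set0 As q != nth finset.set0 As (q.+1 %% k).
    rewrite nth_uniq ?sA //; apply/eqP => e.
    have k1 : (0 < 1 < k)%N by clear -k3; lia.
    by case: (@eqmod_small k q 1 k1); rewrite addn1 {1}e modn_mod.
  have xi : nth i js q != i by apply: contraNneq ij => <-; rewrite mem_nth.
  by have [->|->] := edge2 h1 h1' hC xi h2 h2' iC h3 h4 xC ne; rewrite mem_nth ?sA.
have [d1 [d2 [d12 eB]]] := edge_at2 Ir hB iB.
have e1 : d1 \in edge_at B i by rewrite eB finset.in_set2 eqxx.
have e2 : d2 \in edge_at B i by rewrite eB finset.in_set2 eqxx orbT.
have [d1B d1i [D [hD DB iD d1D]]] := edge_in e1; have [d2B d2i _] := edge_in e2.
have j1 : d1 \notin js by apply: contra BA => /onlyA; apply.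
have j2 : d2 \notin js by apply: contra BA => /onlyA; apply.
have DA : D \notin As.
  by apply: contra j1 => DAs; apply: (hE D) => //; apply: (in_edge _ _ hB); rewrite // eq_sym.
have [d3 [d3e d31]] : exists d3, d3 \in edge_at D i /\ d3 != d1.
  have [x [y [xy ->]]] := edge_at2 Ir hD iD.
  case: (eqVneq x d1) xy => [->|xd] xy; [exists y|exists x]; by rewrite finset.in_set2 eqxx ?orbT // eq_sym.
have [d3D d3i _] := edge_in d3e.
have j3 : d3 \notin js by apply: contra DA => /onlyA; apply.
have d3B : d3 \notin B by apply: (@meet2 D B i d1 d3) => //; rewrite eq_sym.
have d32 : d3 != d2 by apply: contraNneq d3B => ->.
have [w0 iw0 _ _] := hq 0%N k0.
have inA : nth finset.set0 As 0 \in As by rewrite mem_nth ?sA.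
have := @around_facet i _ [:: i, d1, d2, d3 & js] w0 iw0; rewrite /= !in_cons !negb_or uj ij j1 j2 j3 d12.
rewrite ![i == _]eq_sym d1i d2i d3i (eq_sym d1) d31 (eq_sym d2) d32 => /(_ isT).
have far x : x \in js -> exists C, [/\ C \in verts, C != nth finset.set0 As 0, i \in C & x \in C].
  move=> /(nthP i)[q qk <-]; have [h1 h2 h3 h4] := hq q qk; have [h1' h2' _ _] := hq _ (lt q.+1).
  case: (posnP q) => [q0|q0]; last first.
    by exists (nth finset.set0 As q); split=> //; rewrite nth_uniq ?sA // -lt0n.
  exists (nth finset.set0 As (q.+1 %% k)); split=> //; rewrite nth_uniq ?sA //.
  by rewrite q0 modn_small //; apply: leq_trans k3.
have nB C : C \notin As -> C != nth finset.set0 As 0 by apply: contraNneq => ->.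
move=> h; have : (4 + k <= 6)%N.
  apply: h => x; rewrite !in_cons => /or4P[/eqP->|/eqP->|/eqP->|/predU1P[->|/far //]].
  - by exists B; split=> //; apply: nB.
  - by exists B; split=> //; apply: nB.
  - by exists B; split=> //; apply: nB.
  - by exists D; split=> //; apply: nB.
by have := k3; rewrite /k; clear; lia.
Qed.

Lemma mem_neq A x y : x \in A -> y \notin A -> (x != y) * (y != x).
Proof. by move=> xA yA; split; [apply: contraNneq yA => <-|apply: contraNneq yA => ->]. Qed.

Lemma third i x A B C : A \in verts -> B \in verts -> C \in verts -> x != i ->
  i \in A -> i \in B -> i \in C -> x \in A -> x \in B -> A != B -> A != C -> B != C -> x \notin C.
Proof.
move=> hA hB hC xi iA iB iC xA xB AB AC BC; apply/negP => xC.
by have [e|e] := edge2 hA hB hC xi iA iB iC xA xB xC AB; rewrite e eqxx in AC BC.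
Qed.

Lemma walk i x A : A \in verts -> i \in A -> x \in edge_at A i -> exists B y,
  [/\ B \in verts, B != A, i \in B & x \in B] /\ [/\ y \in B, y != i, y != x & y \notin A] /\
  forall z, z \in edge_at B i -> z = x \/ z = y.
Proof.
move=> hA iA /edge_in[xA xi [B [hB BA iB xB]]].
have xe : x \in edge_at B i by apply: (in_edge _ _ hA) => //; rewrite eq_sym.
have [y [ye [yx eB]]] : exists y, y \in edge_at B i /\ y != x /\ forall z, z \in edge_at B i -> z = x \/ z = y.
  have [u [v [uv e]]] := edge_at2 Ir hB iB; move: xe; rewrite e finset.in_set2 => /orP[] /eqP xE.
    exists v; rewrite finset.in_set2 eqxx orbT xE eq_sym uv; split=> //; split=> // z.
    by rewrite finset.in_set2 => /orP[] /eqP ->; [left|right].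
  exists u; rewrite finset.in_set2 eqxx xE uv; split=> //; split=> // z.
  by rewrite finset.in_set2 => /orP[] /eqP ->; [right|left].
have [yB yi _] := edge_in ye; exists B, y; split=> //; split=> //; split=> //.
by apply: (@meet2 B A i x y) => //; rewrite eq_sym.
Qed.

(** Walk along the edges of [i] from [A0], turning away from the facet [p], until the
walk reaches [p] again. If it passes more than five vertices, there are too many
facets around [i]. *)
Theorem facet_cycle i A0 : A0 \in verts -> i \in A0 -> exists k (A : nat -> {set I}) (j : nat -> I),
  [/\ (2 < k < 6)%N, cyc i k A j & A 0%N = A0].
Proof.
move=> h0 i0; have [p [j0 [pj e0]]] := edge_at2 Ir h0 i0.
have pe : p \in edge_at A0 i by rewrite e0 finset.in_set2 eqxx.
have je : j0 \in edge_at A0 i by rewrite e0 finset.in_set2 eqxx orbT.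
have {}e0 z : z \in edge_at A0 i -> z = p \/ z = j0 by rewrite e0 finset.in_set2 => /orP[] /eqP ->; [left|right].
have [pA0 pi [P [hP P0 iP pP]]] := edge_in pe; have [jA0 ji0 _] := edge_in je.
have other B C x : B \in verts -> C \in verts -> i \in C -> B != C -> x \in B -> x != i -> x \in C -> x \in edge_at B i.
  by move=> hB hC iC BC xB xi xC; apply: (in_edge _ _ hC) => //; rewrite eq_sym.
have [A1 [j1 [[h1 n10 i1 j0A1] [[j1A1 ji1 j10 j1A0] e1]]]] := walk h0 i0 je.
have n01 : A0 != A1 by rewrite eq_sym.
have pA1 : p \notin A1.
  apply/negP => pA1; have [e|e] := e1 p (other A1 A0 p h1 h0 i0 n10 pA1 pi pA0); first by rewrite e eqxx in pj.
  by rewrite -e pA0 in j1A0.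
have st1 : j1 \in edge_at A1 i.
  have [u [v [uv eA]]] := edge_at2 Ir h1 i1.
  have [eu|eu] := e1 u ltac:(by rewrite eA finset.in_set2 eqxx); last by rewrite -eu eA finset.in_set2 eqxx.
  have [ev|ev] := e1 v ltac:(by rewrite eA finset.in_set2 eqxx orbT); last by rewrite -ev eA finset.in_set2 eqxx orbT.
  by rewrite eu ev eqxx in uv.
have step B x y : B \in verts -> i \in B -> (forall z, z \in edge_at B i -> z = x \/ z = y) -> y \in edge_at B i.
  move=> hB iB e; have [u [v [uv eA]]] := edge_at2 Ir hB iB.
  have [eu|eu] := e u ltac:(by rewrite eA finset.in_set2 eqxx); last by rewrite -eu eA finset.in_set2 eqxx.
  have [ev|ev] := e v ltac:(by rewrite eA finset.in_set2 eqxx orbT); last by rewrite -ev eA finset.in_set2 eqxx orbT.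
  by rewrite eu ev eqxx in uv.
have [A2 [j2 [[h2 n21 i2 j1A2] [[j2A2 ji2 j21 j2A1] e2]]]] := walk h1 i1 st1.
have n12 : A1 != A2 by rewrite eq_sym.
have n02 : A0 != A2 by apply: contraNneq j1A0 => ->.
have j0A2 : j0 \notin A2 by apply: (third h0 h1 h2 ji0).
case: (boolP (p \in A2)) => pA2.
  have ep : j2 = p.
    have [e|e] // := e2 p (other A2 A0 p h2 h0 i0 ltac:(by rewrite eq_sym) pA2 pi pA0).
    by rewrite -e pA0 in j1A0.
  have [//|//||||||A [j [cy hA]]] := @close_cycle i [:: A0; A1; A2] [:: j0; j1; p].
  - by rewrite /= !in_cons !in_nil !orbF negb_or n01 n02 n12.
  - by rewrite /= !in_cons !in_nil !orbF negb_or eq_sym j10 eq_sym pj (mem_neq pA0 j1A0).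
  - by rewrite !in_cons !in_nil !orbF !negb_or ![i == _]eq_sym ji0 ji1 pi.
  - by case=> [|[|[|//]]] _ /=.
  - move=> B x; rewrite !in_cons in_nil orbF => /or3P[] /eqP -> hx.
    + by case: (e0 x hx) => ->; rewrite eqxx ?orbT.
    + by case: (e1 x hx) => ->; rewrite eqxx ?orbT.
    + by case: (e2 x hx) => ->; rewrite ?ep eqxx ?orbT.
  by exists 3%N, A, j; split=> //; have [] := hA 0%N isT.
have st2 := step _ _ _ h2 i2 e2.
have [A3 [j3 [[h3 n32 i3 j2A3] [[j3A3 ji3 j32 j3A2] e3]]]] := walk h2 i2 st2.
have n23 : A2 != A3 by rewrite eq_sym.
have n13 : A1 != A3 by apply: contraNneq j2A1 => ->.
have j2p : j2 != p by rewrite (mem_neq j2A2 pA2).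
have j20 : j2 != j0 by rewrite (mem_neq j2A2 j0A2).
have j2A0 : j2 \notin A0.
  apply/negP => h; have [e|e] := e0 j2 (other A0 A2 j2 h0 h2 i2 n02 h ji2 j2A2).
    by rewrite e eqxx in j2p.
  by rewrite e eqxx in j20.
have n03 : A0 != A3 by apply: contraNneq j2A0 => ->.
have j0A3 : j0 \notin A3 by apply: (third h0 h1 h3 ji0).
have j1A3 : j1 \notin A3 by apply: (third h1 h2 h3 ji1).
case: (boolP (p \in A3)) => pA3.
  have ep : j3 = p.
    have [e|e] // := e3 p (other A3 A0 p h3 h0 i0 ltac:(by rewrite eq_sym) pA3 pi pA0).
    by rewrite e eqxx in j2p.
  have [//|//||||||A [j [cy hA]]] := @close_cycle i [:: A0; A1; A2; A3] [:: j0; j1; j2; p].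
  - by rewrite /= !in_cons !in_nil !orbF !negb_or n01 n02 n12 n03 n13 n23.
  - by rewrite /= !in_cons !in_nil !orbF !negb_or (eq_sym j0) j10 (eq_sym j0) j20 (eq_sym j0) pj (mem_neq pA0 j1A0) (eq_sym j1) j21 j2p.
  - by rewrite !in_cons !in_nil !orbF !negb_or ![i == _]eq_sym ji0 ji1 ji2 pi.
  - by case=> [|[|[|[|//]]]] _ /=.
  - move=> B x; rewrite !in_cons in_nil orbF => /or4P[] /eqP -> hx.
    + by case: (e0 x hx) => ->; rewrite eqxx ?orbT.
    + by case: (e1 x hx) => ->; rewrite eqxx ?orbT.
    + by case: (e2 x hx) => ->; rewrite eqxx ?orbT.
    + by case: (e3 x hx) => ->; rewrite ?ep eqxx ?orbT.
  by exists 4%N, A, j; split=> //; have [] := hA 0%N isT.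
have st3 := step _ _ _ h3 i3 e3.
have [A4 [j4 [[h4 n43 i4 j3A4] [[j4A4 ji4 j43 j4A3] e4]]]] := walk h3 i3 st3.
have n34 : A3 != A4 by rewrite eq_sym.
have n24 : A2 != A4 by apply: contraNneq j3A2 => ->.
have j3p : j3 != p by rewrite (mem_neq j3A3 pA3).
have j30 : j3 != j0 by rewrite (mem_neq j3A3 j0A3).
have j31 : j3 != j1 by rewrite (mem_neq j3A3 j1A3).
have j3A0 : j3 \notin A0.
  apply/negP => h; have [e|e] := e0 j3 (other A0 A3 j3 h0 h3 i3 n03 h ji3 j3A3).
    by rewrite e eqxx in j3p.
  by rewrite e eqxx in j30.
have j3A1 : j3 \notin A1.
  apply/negP => h; have [e|e] := e1 j3 (other A1 A3 j3 h1 h3 i3 n13 h ji3 j3A3).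
    by rewrite e eqxx in j30.
  by rewrite e eqxx in j31.
have n04 : A0 != A4 by apply: contraNneq j3A0 => ->.
have n14 : A1 != A4 by apply: contraNneq j3A1 => ->.
have j0A4 : j0 \notin A4 by apply: (third h0 h1 h4 ji0).
have j1A4 : j1 \notin A4 by apply: (third h1 h2 h4 ji1).
have j2A4 : j2 \notin A4 by apply: (third h2 h3 h4 ji2).
have up : uniq [:: j0; j1; j2; j3; p].
  by rewrite /= !in_cons !in_nil !orbF !negb_or (eq_sym j0) j10 (eq_sym j0) j20 (eq_sym j0) j30 (eq_sym j0) pj
   (mem_neq pA0 j1A0) (eq_sym j1) j21 (eq_sym j1) j31 j2p (eq_sym j2) j32 j3p.
have ij : i \notin [:: j0; j1; j2; j3; p].
  by rewrite !in_cons !in_nil !orbF !negb_or ![i == _]eq_sym ji0 ji1 ji2 ji3 pi.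
case: (boolP (p \in A4)) => pA4.
  have ep : j4 = p.
    have [e|e] // := e4 p (other A4 A0 p h4 h0 i0 ltac:(by rewrite eq_sym) pA4 pi pA0).
    by rewrite e eqxx in j3p.
  have [//|//||//|//|||A [j [cy hA]]] := @close_cycle i [:: A0; A1; A2; A3; A4] [:: j0; j1; j2; j3; p].
  - by rewrite /= !in_cons !in_nil !orbF !negb_or n01 n02 n12 n03 n13 n23 n04 n14 n24 n34.
  - by case=> [|[|[|[|[|//]]]]] _ /=.
  - move=> B x; rewrite !in_cons in_nil orbF => /or4P[|||/orP[]] /eqP -> hx.
    + by case: (e0 x hx) => ->; rewrite eqxx ?orbT.
    + by case: (e1 x hx) => ->; rewrite eqxx ?orbT.
    + by case: (e2 x hx) => ->; rewrite eqxx ?orbT.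
    + by case: (e3 x hx) => ->; rewrite eqxx ?orbT.
    + by case: (e4 x hx) => ->; rewrite ?ep eqxx ?orbT.
  by exists 5%N, A, j; split=> //; have [] := hA 0%N isT.
have := @around_facet i A0 [:: i, j4 & [:: j0; j1; j2; j3; p]] h0 i0.
rewrite [uniq _]/= -/(uniq [:: j0; j1; j2; j3; p]).
have j4n : j4 \notin [:: j0; j1; j2; j3; p].
  rewrite !in_cons !in_nil !orbF !negb_or (mem_neq j4A4 j0A4) (mem_neq j4A4 j1A4) (mem_neq j4A4 j2A4) j43.
  by rewrite (mem_neq j4A4 pA4).
have ij4 : i \notin j4 :: [:: j0; j1; j2; j3; p] by rewrite in_cons negb_or eq_sym ji4.
have u7 : uniq [:: i, j4 & [:: j0; j1; j2; j3; p]].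
  by rewrite cons_uniq ij4 cons_uniq j4n.
move=> H; suff : (7 <= 6)%N by [].
apply: (H u7) => x; rewrite !in_cons in_nil orbF.
move=> /or4P[|||/or4P[]] /eqP ->; [exists A1|exists A4|exists A1|exists A1|exists A2|exists A3|exists P]; by split=> //; rewrite eq_sym.
Qed.

(** ** Pentagons and quadrilaterals *)

Lemma edge_third A x u v z : A \in verts -> x \in A -> u != v -> u \in edge_at A x -> v \in edge_at A x ->
  z \in edge_at A x -> z = u \/ z = v.
Proof.
move=> hA xA; have [p [q [_ ->]]] := edge_at2 Ir hA xA.
rewrite !finset.in_set2 => uv hu hv hz.
by move: hu hv hz uv; do 3![case/orP => /eqP ->]; rewrite ?eqxx //; tauto.
Qed.

Lemma sub_card A (s : seq I) : {subset A <= s} -> (#|A| <= size s)%N.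
Proof. by move=> h; rewrite cardE; apply: uniq_leq_size (enum_uniq _) _ => x; rewrite mem_enum => /h. Qed.

Lemma simple_edge A p q r : A \in verts -> #|A| = 3%N -> p \in A -> q \in A -> r \in A ->
  p != q -> q != r -> r != p -> q \in edge_at A p.
Proof.
move=> hA A3 pA qA rA pq qr rp; have [u [v [uv e]]] := edge_at2 Ir hA pA.
have sub z : z \in edge_at A p -> z = q \/ z = r.
  move=> /edge_in[zA zp _]; have : z \in [:: p; q; r].
    apply: (mem_uniq _ _ _ zA); rewrite ?A3 //=; first by rewrite !in_cons !in_nil !orbF negb_or pq (eq_sym p) rp qr.
    by move=> t; rewrite !in_cons in_nil orbF => /or3P[] /eqP ->.
  by rewrite !in_cons in_nil orbF (negbTE zp) /= => /orP[] /eqP ->; [left|right].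
have ue : u \in edge_at A p by rewrite e finset.in_set2 eqxx.
have ve : v \in edge_at A p by rewrite e finset.in_set2 eqxx orbT.
have [eu|eu] := sub u ue; first by rewrite -eu.
have [ev|ev] := sub v ve; first by rewrite -ev.
by rewrite eu ev eqxx in uv.
Qed.

(** The edges at a vertex form a graph on its four facets in which all degrees are
two, hence a quadrilateral, and [e] is opposite to [i]. *)
Lemma four_edges A i p q e : A \in verts -> uniq [:: i; p; q; e] -> {subset A <= [:: i; p; q; e]} ->
  i \in A -> p \in edge_at A i -> q \in edge_at A i -> e \in A -> e \in edge_at A p.
Proof.
move=> hA; rewrite /= !in_cons !in_nil !orbF !negb_or => /and4P[/and3P[ip iq ie] /andP[pq pe] qe _] sub iA pi qi eA.
have [pA _ _] := edge_in pi; have [qA _ _] := edge_in qi.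
have ip' := edge_sym iA pi; have iq' := edge_sym iA qi.
have [u [v [uv eu]]] := edge_at2 Ir hA pA.
have cases z x : z \in edge_at A x -> [\/ z = i, z = p, z = q | z = e].
  move=> /edge_in[/sub + _ _]; rewrite !in_cons in_nil orbF => /or4P[] /eqP ->;
  [constructor 1|constructor 2|constructor 3|constructor 4] => //.
have self x : x \notin edge_at A x by apply/negP => /edge_in[_ /eqP].
case: (boolP (q \in edge_at A p)) => [qp|nqp]; last first.
  have ue : u \in edge_at A p by rewrite eu finset.in_set2 eqxx.
  have ve : v \in edge_at A p by rewrite eu finset.in_set2 eqxx orbT.
  case: (cases _ _ ue) => e1; rewrite e1 in ue; rewrite ?ue // ?(negbTE (self _)) ?(negbTE nqp) // in ue *.
  case: (cases _ _ ve) => e2; rewrite e2 in ve; rewrite ?ve // ?(negbTE (self _)) ?(negbTE nqp) // in ve *.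
  by rewrite e1 e2 eqxx in uv.
have pq' := edge_sym pA qp.
have no x : x \in A -> x \in [:: i; p; q] -> e \notin edge_at A x.
  move=> xA; rewrite !in_cons in_nil orbF => /or3P[] /eqP ->; apply/negP => h.
  - by have [e1|e1] := edge_third hA iA pq pi qi h; [rewrite e1 eqxx in pe|rewrite e1 eqxx in qe].
  - by have [e1|e1] := edge_third hA pA iq ip' qp h; [rewrite e1 eqxx in ie|rewrite e1 eqxx in qe].
  - by have [e1|e1] := edge_third hA qA ip iq' pq' h; [rewrite e1 eqxx in ie|rewrite e1 eqxx in pe].
have [z [z' [_ ez]]] := edge_at2 Ir hA eA.
have ze : z \in edge_at A e by rewrite ez finset.in_set2 eqxx.
have ez' := edge_sym eA ze.
case: (cases _ _ ze) => e1; rewrite e1 in ez' ze.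
- by rewrite (negbTE (no i iA _)) // !in_cons eqxx in ez'.
- by rewrite (negbTE (no p pA _)) // !in_cons eqxx ?orbT in ez'.
- by rewrite (negbTE (no q qA _)) // !in_cons eqxx ?orbT in ez'.
- by rewrite (negbTE (self _)) in ze.
Qed.

Lemma cyc_in i k (A : nat -> {set I}) (j : nat -> I) q r : (1 < k)%N -> cyc i k A j -> j r \in A q ->
  q = r %[mod k] \/ q = r.+1 %[mod k].
Proof.
move=> k1 h jA; have ne : A r != A r.+1.
  by apply/eqP => /(cy_Ai h); rewrite -[r.+1]addn1; apply: eqmod_small; rewrite k1.
have [e|e] := edge2 (cy_v h r) (cy_v h r.+1) (cy_v h q) (cy_n h r) (cy_i h r) (cy_i h r.+1) (cy_i h q)
  (cy_l h r) (cy_r h r) jA ne; [left|right]; exact: (cy_Ai h).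
Qed.

(** A plane that cuts off all vertices of [i] but [A r] meets [i], its [k] neighbours
and the facets in [s]. *)
Lemma cyc_extra i k (A : nat -> {set I}) (j : nat -> I) r (s : seq I) : (2 < k)%N -> cyc i k A j -> uniq s ->
  (forall x, x \in s -> [/\ x != i, forall q, j q != x & exists2 q, x \in A q & A q != A r]) ->
  (size s + k < 6)%N.
Proof.
move=> k3 h us hs; have k0 : (0 < k)%N by apply: leq_trans k3.
pose js := [seq j q | q <- iota 0 k].
have uj : uniq js.
  rewrite map_inj_in_uniq ?iota_uniq // => p q; rewrite !mem_iota => /andP[_ pk] /andP[_ qk] /(cy_ji h).
  by rewrite !modn_small.
have u : uniq (i :: s ++ js).
  rewrite cons_uniq mem_cat negb_or cat_uniq us uj andbT; apply/andP; split.
    apply/andP; split; first by apply/negP => /hs[]; rewrite eqxx.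
    by apply/mapP => -[q _ e]; have := cy_n h q; rewrite -e eqxx.
  by apply/hasPn => x /mapP[q _ ->]; apply/negP => /hs[_ /(_ q)]; rewrite eqxx.
have := around_facet (cy_v h r) (cy_i h r) u; rewrite /= size_cat size_map size_iota; apply.
have near x : (exists2 q, x \in A q & A q != A r) -> exists B, [/\ B \in verts, B != A r, i \in B & x \in B].
  by move=> [q xA ne]; exists (A q); split=> //; [apply: (cy_v h)|apply: (cy_i h)].
have nxt q : A q != A q.+1.
  by apply/eqP => /(cy_Ai h); rewrite -[q.+1]addn1; apply: eqmod_small; rewrite /= (ltn_trans _ k3).
move=> x; rewrite in_cons mem_cat => /predU1P[->|/orP[/hs[_ _ hx]|/mapP[q _ ->]]]; apply: near => //.
  by exists r.+1; rewrite ?(cy_i h) // eq_sym.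
case: (eqVneq (A q) (A r)) => [e|ne]; last by exists q; rewrite ?(cy_l h).
by exists q.+1; rewrite ?(cy_r h) // -e eq_sym.
Qed.

Lemma cyc_fresh i k (A : nat -> {set I}) (j : nat -> I) q x : (1 < k)%N -> cyc i k A j -> x \in A q.+1 ->
  x \notin [:: i; j q; j q.+1] -> x != i /\ forall r, j r != x.
Proof.
move=> k1 h xA; rewrite !in_cons in_nil orbF !negb_or => /and3P[xi xq xq1]; split=> // r.
apply/eqP => e; rewrite -e in xA xq xq1; have [e1|e1] := cyc_in k1 h xA.
  by have [_ e2] := cyc_mod h e1; rewrite e2 eqxx in xq1.
by have [_ e2] := cyc_mod h (eqmodSI e1); rewrite e2 eqxx in xq.
Qed.

(** A further facet at a vertex of the pentagon would be the seventh one met by the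
plane that cuts off the vertices other than a neighbour of this vertex. *)
Lemma pentagon_corner i (A : nat -> {set I}) (j : nat -> I) q : cyc i 5 A j -> {subset A q.+1 <= [:: i; j q; j q.+1]}.
Proof.
move=> h x xA; apply/negPn/negP => nx; have [xi xj] := cyc_fresh (isT : 1 < 5)%N h xA nx.
have := @cyc_extra i 5 A j q [:: x] isT h isT; rewrite /= => H; suff : (6 < 6)%N by [].
apply: H => y; rewrite in_cons in_nil orbF => /eqP ->; split=> //; exists q.+1 => //.
apply/eqP => /(cy_Ai h) /esym; rewrite -[q.+1]addn1; exact: eqmod_small.
Qed.

Lemma simple_corner i k (A : nat -> {set I}) (j : nat -> I) q : (2 < k)%N -> cyc i k A j -> {subset A q.+1 <= [:: i; j q; j q.+1]} ->
  [/\ #|A q.+1| = 3%N, j q.+1 \in edge_at (A q.+1) (j q) & j q \in edge_at (A q.+1) (j q.+1)].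
Proof.
move=> k3 h sub; have hA := cy_v h q.+1; have [_ _ A3] := vpP hA.
have e3 : #|A q.+1| = 3%N by apply/eqP; rewrite eqn_leq A3 andbT; apply: sub_card sub.
have qq : j q != j q.+1.
  by apply/eqP => /(cy_ji h); rewrite -[q.+1]addn1; apply: eqmod_small; rewrite /= (ltn_trans _ k3).
have i1 := cy_i h q.+1; have l1 := cy_l h q.+1; have r1 := cy_r h q.
have n1 := cy_n h q; have n2 := cy_n h q.+1.
by split=> //; apply: (simple_edge (r := i) hA e3); rewrite // eq_sym.
Qed.

(** The plane that cuts off all vertices but [A 0] meets the pentagon and its five
neighbours; without these parallel pairs it would be an excluded hexagon. *)
Lemma pentagon_parallel i (A : nat -> {set I}) (j : nat -> I) : cyc i 5 A j ->
  ~ col (j 0%N) (j 2%N) -> ~ col (j 1%N) (j 3%N) -> ~ col (j 2%N) (j 4%N) -> False.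
Proof.
move=> h n02 n13 n24.
have sub q : {subset A q.+1 <= [:: i; j q; j q.+1]} by apply: pentagon_corner h.
have e5 : A 0%N = A 5%N by rewrite -(cy_A h 0).
have j5 : j 5%N = j 0%N by rewrite -(cy_j h 0).
have ed q : j q.+1 \in edge_at (A q.+1) (j q) by have [] := simple_corner (isT : 2 < 5)%N h (sub q).
have nA q : (0 < q < 5)%N -> A q != A 0%N.
  by move=> hq; apply/eqP => /(cy_Ai h) /esym; apply: (@eqmod_small 5 0 q).
have nj p q : (p < 5)%N -> (q < 5)%N -> p != q -> j p != j q.
  by move=> p5 q5; apply: contraNneq => /(cy_ji h); rewrite !modn_small // => ->.
have out q : (0 < q < 4)%N -> j q \notin A 0%N.
  by move=> hq; apply/negP => /(cyc_in (isT : 1 < 5)%N h); clear -hq; lia.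
have four q : (0 < q < 5)%N -> [/\ A q \in verts, A q != A 0%N, i \in A q & j q.-1 \in A q].
  by case: q => // q hq; split; [apply: (cy_v h)|apply: nA|apply: (cy_i h)|apply: (cy_r h)].
apply: (@facet_hexagon i (A 0%N) (j 0%N) (j 1%N) (j 2%N) (j 3%N) (j 4%N) (A 1%N) (A 2%N) (A 3%N) (A 4%N)).
- exact: (cy_v h).
- by split; [apply: (cy_i h)|apply: (cy_l h)|rewrite e5; apply: (cy_r h)].
- exact: out.
- exact: out.
- by rewrite /= !in_cons !in_nil !orbF !negb_or ![i == _]eq_sym !(cy_n h) !nj.
- move=> B x hB BA iB xB; have [q eq] := cy_all h hB iB.
  have : x \in A (q + 4).+1 by rewrite -addnS (cy_A h) -eq.
  move=> /(sub (q + 4)%N); rewrite -addnS (cy_j h) !in_cons in_nil orbF.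
  have jm p : j p = j (p %% 5)%N by apply: (cyc_mod h _).2; rewrite modn_mod.
  have jl p : j p \in [:: j 0%N; j 1%N; j 2%N; j 3%N; j 4%N].
    by rewrite jm; have := ltn_pmod p (isT : 0 < 5)%N; move: (p %% 5)%N; move=> [|[|[|[|[|//]]]]] _; rewrite !in_cons eqxx ?orbT.
  have j1 := jl (q + 4)%N; have j2 := jl q; rewrite !in_cons in_nil in j1 j2.
  by case/or3P => /eqP ->; rewrite ?eqxx ?j1 ?j2 ?orbT.
- exact: four 1%N isT.
- exact: ed.
- exact: four 2%N isT.
- exact: ed.
- exact: four 3%N isT.
- exact: ed.
- exact: four 4%N isT.
- exact: ed.
- by [].
Qed.

Lemma no_pentagon i (A : nat -> {set I}) (j : nat -> I) : cyc i 5 A j -> False.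
Proof.
move=> h.
(* A facet has at most one parallel facet, so the parallel pairs form a matching in
   the 5-cycle of the neighbours at distance two; it has at most two edges and
   misses three consecutive ones. *)
have mt q : col (j q) (j (q + 2)%N) -> ~ col (j (q + 2)%N) (j (q + 4)%N).
  move=> c1 c2; have n p r : (0 < r < 5)%N -> j p != j (p + r)%N.
    by move=> hr; apply/eqP => /(cy_ji h); apply: eqmod_small.
  apply: (col_uniq Ir (i := j (q + 2)%N) _ _ _ (col_sym Ir c1) c2).
  - by rewrite eq_sym n.
  - by rewrite -[(q + 4)%N]/(q + (2 + 2))%N addnA n.
  - exact: n.
have no r : col (j (0 + r)) (j (2 + r)%N) \/ col (j (1 + r)%N) (j (3 + r)%N) \/ col (j (2 + r)%N) (j (4 + r)%N).
  apply: contrapT => /not_orP[n1 /not_orP[n2 n3]].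
  by apply: (pentagon_parallel (cyc_shift r (isT : 0 < 5)%N h)).
have m0 := mt 0%N; have m1 := mt 1%N; have m2 := mt 2%N; have m3 := mt 3%N; have m4 := mt 4%N.
have r0 := no 0%N; have r1 := no 1%N; have r2 := no 2%N; have r3 := no 3%N; have r4 := no 4%N.
rewrite /= ?(cy_j h 0) ?(cy_j h 1) ?(cy_j h 2) ?(cy_j h 3) in m0 m1 m2 m3 m4 r0 r1 r2 r3 r4.
have p5 : j 5%N = j 0%N by apply: (cy_j h 0).
have p6 : j 6%N = j 1%N by apply: (cy_j h 1).
have p7 : j 7%N = j 2%N by apply: (cy_j h 2).
have p8 : j 8%N = j 3%N by apply: (cy_j h 3).
rewrite !(add0n, add1n, add2n, addn0, addn1, addn2, addn3, addn4, p5, p6, p7, p8) in m0 m1 m2 m3 m4 r0 r1 r2 r3 r4.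
tauto.
Qed.

(** At a vertex other than [A 0] only neighbours of [i] occur, as there are at most
six facets around [i]. The plane that cuts off all vertices but one, which can be
[A 1], [A 2] or [A 3], meets the hexagon of [i], its neighbours and [e]; one of
these choices is free of parallel sides that are not opposite, depending on which
neighbour, if any, is parallel to [e]. *)
Lemma no_quad_extra i (A : nat -> {set I}) (j : nat -> I) e : cyc i 4 A j -> e \in A 0%N ->
  e \notin [:: i; j 3%N; j 0%N] -> False.
Proof.
move=> h eA ne.
have e4 : A 4%N = A 0%N by apply: (cy_A h 0).
have j4 : j 4%N = j 0%N by apply: (cy_j h 0).
have [ei ej] : e != i /\ forall r, j r != e.
  by apply: (@cyc_fresh i 4 A j 3) => //; [rewrite e4|rewrite j4].
have nA p q : (p < 4)%N -> (q < 4)%N -> p != q -> A p != A q.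
  by move=> p4 q4; apply: contraNneq => /(cy_Ai h); rewrite !modn_small // => ->.
have nj p q : (p < 4)%N -> (q < 4)%N -> p != q -> j p != j q.
  by move=> p4 q4; apply: contraNneq => /(cy_ji h); rewrite !modn_small // => ->.
have eout q : (0 < q < 4)%N -> e \notin A q.
  move=> hq; apply/negP => eq; have hq4 : (q < 4)%N by case/andP: hq.
  have q0 : (q != 0)%N by rewrite -lt0n; case/andP: hq.
  have : e \in edge_at (A 0%N) i.
    by apply: (in_edge eA ei (cy_v h q) _ (cy_i h q) eq); apply: nA.
  have h30 : j 3%N != j 0%N by apply: nj.
  have ed0 : j 0%N \in edge_at (A 0%N) i.
    by apply: (in_edge (cy_l h 0) (cy_n h 0) (cy_v h 1) _ (cy_i h 1) (cy_r h 0)); apply: nA.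
  have ed3 : j 3%N \in edge_at (A 0%N) i.
    by apply: (in_edge _ (cy_n h 3) (cy_v h 3) _ (cy_i h 3) (cy_l h 3)); [rewrite -e4; apply: (cy_r h)|apply: nA].
  move=> /(edge_third (cy_v h 0) (cy_i h 0) h30 ed3 ed0)[e1|e1]; [have := ej 3%N|have := ej 0%N]; by rewrite e1 eqxx.
have one q x : x \in A q.+1 -> x \notin [:: i; j q; j q.+1] -> x = e.
  move=> xA nx; have [xi xj] := cyc_fresh (isT : 1 < 4)%N h xA nx.
  apply/eqP/negPn/negP => xe.
  have [r [r4 r0 rq]] : exists r, [/\ (r < 4)%N, r != 0%N & A q.+1 != A r].
    case: (eqVneq (A q.+1) (A 1%N)) => [e1|n1]; last by exists 1%N.
    by exists 2%N; rewrite e1; split=> //; apply: nA.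
  suff : (6 < 6)%N by [].
  apply: (@cyc_extra i 4 A j r [:: x; e] isT h) => [|y]; first by rewrite /= in_cons in_nil orbF xe.
  rewrite !in_cons in_nil orbF => /orP[] /eqP ->; split=> //; first by exists q.+1.
  by exists 0%N => //; apply: nA => //; rewrite eq_sym.
have sub q : (0 < q < 4)%N -> {subset A q <= [:: i; j q.-1; j q]}.
  case: q => // q hq x xA; apply/negPn/negP => nx; have xe := one q x xA nx.
  by have := eout q.+1 hq; rewrite -xe xA.
have sub0 : {subset A 0%N <= [:: i; j 3%N; j 0%N; e]}.
  move=> x xA; apply/negPn/negP => nx.
  have xe : x = e by apply: (one 3%N); rewrite ?e4 ?j4 //; apply: contra nx; rewrite !in_cons !in_nil !orbF => /or3P[] ->; rewrite ?orbT.
  by move: nx; rewrite xe !in_cons eqxx ?orbT.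
have ed q : (0 < q < 4)%N -> j q \in edge_at (A q) (j q.-1) /\ j q.-1 \in edge_at (A q) (j q).
  by case: q => // q hq; have [_ h1 h2] := simple_corner (isT : 2 < 4)%N h (sub q.+1 hq).
have v q := cy_v h q; have iA q := cy_i h q.
have a0 : j 0%N \in A 0%N by apply: (cy_l h).
have a3 : j 3%N \in A 0%N by rewrite -e4; apply: (cy_r h).
have hed0 : j 0%N \in edge_at (A 0%N) i.
  by apply: (in_edge a0 (cy_n h 0) (v 1%N) _ (iA 1%N) (cy_r h 0)); apply: nA.
have hed3 : j 3%N \in edge_at (A 0%N) i.
  by apply: (in_edge a3 (cy_n h 3) (v 3%N) _ (iA 3%N) (cy_l h 3)); apply: nA.
have u0 : uniq [:: i; j 3%N; j 0%N; e].
  by rewrite /= !in_cons !in_nil !orbF !negb_or ![i == _]eq_sym !(cy_n h) ei !ej nj.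
have e3 : e \in edge_at (A 0%N) (j 3%N) by apply: (four_edges (v 0%N) u0 sub0).
have e0 : e \in edge_at (A 0%N) (j 0%N).
  apply: (@four_edges (A 0%N) i (j 0%N) (j 3%N) e) => //.
    by rewrite /= !in_cons !in_nil !orbF !negb_or ![i == _]eq_sym !(cy_n h) ei !ej nj.
  by move=> x /sub0; rewrite !in_cons in_nil !orbF => /or4P[] ->; rewrite ?orbT.
have e3' := edge_sym a3 e3; have e0' := edge_sym a0 e0.
have l q := cy_l h q; have r q := cy_r h q.
have allq B x : B \in verts -> i \in B -> x \in B -> x \in [:: i; j 0%N; j 1%N; j 2%N; j 3%N; e].
  move=> hB iB xB; have [q eq] := cy_all h hB iB.
  have : x \in A (q %% 4)%N by rewrite -(cyc_mod h (modn_mod q 4)).1 in eq; rewrite -eq.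
  have := ltn_pmod q (isT : 0 < 4)%N; move: (q %% 4)%N => [|[|[|[|//]]]] _.
  - by move=> /sub0; rewrite !in_cons !in_nil !orbF => /or4P[] ->; rewrite ?orbT.
  - by move=> /(sub 1%N isT); rewrite !in_cons !in_nil !orbF => /or3P[] ->; rewrite ?orbT.
  - by move=> /(sub 2%N isT); rewrite !in_cons !in_nil !orbF => /or3P[] ->; rewrite ?orbT.
  - by move=> /(sub 3%N isT); rewrite !in_cons !in_nil !orbF => /or3P[] ->; rewrite ?orbT.
have out q p : (q < 4)%N -> (p < 4)%N -> q != p -> (q != p.+1 %% 4)%N -> j p \notin A q.
  move=> q4 p4 n1 n2; apply/negP => /(cyc_in (isT : 1 < 4)%N h); rewrite !(modn_small q4) (modn_small p4).
  by case=> e1; [rewrite e1 eqxx in n1|rewrite e1 eqxx in n2].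
have tac (s t : seq I) : uniq s -> size t = size s -> {subset s <= t} -> uniq t.
  by move=> us st sst; apply: (leq_size_uniq us sst); rewrite st.
have u6 : uniq [:: i; j 0%N; j 1%N; j 2%N; j 3%N; e].
  by rewrite /= !in_cons !in_nil !orbF !negb_or ![i == _]eq_sym !(cy_n h) ei !ej !nj.
have ec : forall p q, (p < 4)%N -> (q < 4)%N -> p != q -> col e (j p) -> ~ col e (j q).
  by move=> p q p4 q4 pq c1 c2; apply: (col_uniq Ir _ _ _ c1 c2); rewrite ?(eq_sym e) ?ej // nj.
have jc : forall p q, (p < 4)%N -> (q < 4)%N -> p != q -> col e (j p) -> ~ col (j p) (j q).
  by move=> p q p4 q4 pq c1 c2; apply: (col_uniq Ir _ _ _ (col_sym Ir c1) c2); rewrite ?ej ?nj // eq_sym ej.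
have fl p q : (p < 4)%N -> (q < 4)%N -> p != q -> [/\ A p \in verts, A p != A q, i \in A p & j p \in A p].
  by move=> p4 q4 pq; split=> //; apply: nA.
have fr p q : (p.+1 < 4)%N -> (q < 4)%N -> p.+1 != q -> [/\ A p.+1 \in verts, A p.+1 != A q, i \in A p.+1 & j p \in A p.+1].
  by move=> p4 q4 pq; split=> //; apply: nA.
have f0 q x : (0 < q < 4)%N -> x \in A 0%N -> [/\ A 0%N \in verts, A 0%N != A q, i \in A 0%N & x \in A 0%N].
  by move=> /andP[q0 q4] xA; split=> //; apply: nA => //; rewrite eq_sym -lt0n.
have t30 : ~ col (j 3%N) (j 0%N) by apply: (touch (v 0%N)) => //; apply: nj.
have cs x y : ~ col x y -> ~ col y x by move=> n c; apply/n/(col_sym Ir).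
have perm s : size s = 6%N -> {subset [:: i; j 0%N; j 1%N; j 2%N; j 3%N; e] <= s} -> uniq s.
  by move=> s6 ss; apply: (tac _ _ u6 s6).
case: (pselect (col e (j 1%N))) => [c1|c1].
  apply: (@facet_hexagon i (A 1%N) (j 0%N) e (j 3%N) (j 2%N) (j 1%N) (A 0%N) (A 0%N) (A 3%N) (A 2%N)) => //.
  - exact: eout.
  - exact: out.
  - by apply: perm => // x; rewrite !in_cons !in_nil !orbF => /or4P[|||/or3P[]] ->; rewrite ?orbT.
  - by move=> B x hB _ iB /(allq B x hB iB); rewrite !in_cons !in_nil !orbF => /or4P[|||/or3P[]] ->; rewrite ?orbT.
  - exact: f0.
  - exact: f0.
  - exact: fl.
  - by have [] := ed 3%N isT.
  - exact: fl.
  - by have [] := ed 2%N isT.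
  - by split; [exact: cs|exact: (ec 1%N)|exact/cs/(jc 1%N)].
case: (pselect (col e (j 2%N))) => [c2|c2].
  apply: (@facet_hexagon i (A 3%N) (j 3%N) e (j 0%N) (j 1%N) (j 2%N) (A 0%N) (A 0%N) (A 1%N) (A 2%N)) => //.
  - exact: eout.
  - exact: out.
  - by apply: perm => // x; rewrite !in_cons !in_nil !orbF => /or4P[|||/or3P[]] ->; rewrite ?orbT.
  - by move=> B x hB _ iB /(allq B x hB iB); rewrite !in_cons !in_nil !orbF => /or4P[|||/or3P[]] ->; rewrite ?orbT.
  - exact: f0.
  - exact: f0.
  - exact: (fr 0%N).
  - by have [] := ed 1%N isT.
  - exact: (fr 1%N).
  - by have [] := ed 2%N isT.
  - by split=> //; exact/cs/(jc 2%N).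
apply: (@facet_hexagon i (A 2%N) (j 2%N) (j 3%N) e (j 0%N) (j 1%N) (A 3%N) (A 0%N) (A 0%N) (A 1%N)) => //.
- exact: out.
- exact: out.
- by apply: perm => // x; rewrite !in_cons !in_nil !orbF => /or4P[|||/or3P[]] ->; rewrite ?orbT.
- by move=> B x hB _ iB /(allq B x hB iB); rewrite !in_cons !in_nil !orbF => /or4P[|||/or3P[]] ->; rewrite ?orbT.
- exact: (fr 2%N).
- by have [] := ed 3%N isT.
- exact: f0.
- exact: f0.
- exact: (fr 0%N).
- by have [] := ed 1%N isT.
- by split=> //; exact: cs.
Qed.

(** ** All vertices are simple *)

Lemma tri_meet i (A : nat -> {set I}) (j : nat -> I) X Y : cyc i 3 A j -> X \in verts -> Y \in verts ->
  i \in X -> i \in Y -> X != Y -> exists x, [/\ x != i, x \in X & x \in Y].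
Proof.
move=> h hX hY iX iY; have [p ->] := cy_all h hX iX; have [q ->] := cy_all h hY iY => XY.
have pq : p <> q %[mod 3] by move=> /(cyc_mod h)[e _]; rewrite e eqxx in XY.
have [e|e] : q = p.+1 %[mod 3] \/ p = q.+1 %[mod 3] by clear -pq; lia.
  by exists (j p); rewrite (cy_n h) (cy_l h) (cyc_mod h e).1 (cy_r h).
by exists (j q); rewrite (cy_n h) (cy_l h) (cyc_mod h e).1 (cy_r h).
Qed.

Lemma tri_or_quad i A0 : A0 \in verts -> i \in A0 -> exists k (A : nat -> {set I}) (j : nat -> I),
  [/\ k = 3%N \/ k = 4%N, cyc i k A j & A 0%N = A0].
Proof.
move=> h0 i0; have [k [A [j [hk cy e]]]] := facet_cycle h0 i0.
exists k, A, j; split=> //; have [e3|[e4|e5]] : (k = 3 \/ k = 4 \/ k = 5)%N by clear -hk; lia.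
- by left.
- by right.
- by rewrite e5 in cy; case: (no_pentagon cy).
Qed.

Lemma tri_at4 i A0 : A0 \in verts -> #|A0| = 4%N -> i \in A0 -> exists (A : nat -> {set I}) (j : nat -> I),
  cyc i 3 A j /\ A 0%N = A0.
Proof.
move=> h0 A4 i0; have [k [A [j [[->|->] cy e]]]] := tri_or_quad h0 i0; first by exists A, j.
exfalso; have /subsetPn[x xA nx] : ~~ (A0 \subset [set i; j 3%N; j 0%N]).
  apply/negP => /subset_leq_card; rewrite A4 leqNgt => /negP; apply.
  rewrite ltnS; apply: (@sub_card _ [:: i; j 3%N; j 0%N]) => x.
  by rewrite !finset.in_setU !finset.in_set1 !in_cons in_nil orbF -orbA.
apply: (no_quad_extra cy (e := x)); first by rewrite e.
by move: nx; rewrite !finset.in_setU !finset.in_set1 !in_cons in_nil orbF -orbA.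
Qed.

(** By [no_quad_extra] all facets at a vertex [A 0] on four facets are triangles. Let
[i] be one of them, and [B], [C] its other vertices. If [B] lies on three facets,
the plane that separates [A 0] and [B] from [C] meets five facets, no two of them
parallel as each pair has a common vertex; otherwise it meets six facets in an
excluded hexagon. *)
Lemma vert_card3 A0 : A0 \in verts -> #|A0| = 3%N.
Proof.
move=> h0; have [_ _ A3] := vpP h0; apply/eqP; rewrite eqn_leq A3 andbT leqNgt; apply/negP => A4.
have {A3}A4 : #|A0| = 4%N by apply/eqP; rewrite eqn_leq vert_le4.
have [i i0] : exists i, i \in A0 by apply/card_gt0P; rewrite A4.
have [A [j [h eA]]] := tri_at4 h0 A4 i0.
have v q := cy_v h q; have iA q := cy_i h q.
have nA p q : (p < 3)%N -> (q < 3)%N -> p != q -> A p != A q.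
  by move=> p4 q4; apply: contraNneq => /(cy_Ai h); rewrite !modn_small // => ->.
have nj p q : (p < 3)%N -> (q < 3)%N -> p != q -> j p != j q.
  by move=> p4 q4; apply: contraNneq => /(cy_ji h); rewrite !modn_small // => ->.
have e3 : A 3%N = A 0%N by apply: (cy_A h 0).
have ji q := cy_n h q.
have jA0 : j 0%N \in A 0%N by apply: (cy_l h).
have jB : j 0%N \in A 1%N by apply: (cy_r h).
have mB : j 1%N \in A 1%N by apply: (cy_l h).
have mC : j 1%N \in A 2%N by apply: (cy_r h).
have lC : j 2%N \in A 2%N by apply: (cy_l h).
have lA0 : j 2%N \in A 0%N by rewrite -e3; apply: (cy_r h).
set B := A 1%N in jB mB *; set C := A 2%N in mC lC *.
have hB : B \in verts := v 1%N; have hC : C \in verts := v 2%N.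
have iB : i \in B := iA 1%N; have iC : i \in C := iA 2%N.
have BA : B != A 0%N by apply: nA. have CA : C != A 0%N by apply: nA. have BC : B != C by apply: nA.
rewrite -eA in h0 A4 i0.
have [e [eA0 ei ej el]] : exists e, [/\ e \in A 0%N, e != i, e != j 0%N & e != j 2%N].
  have /subsetPn[x xA nx] : ~~ (A 0%N \subset [set i; j 2%N; j 0%N]).
    apply/negP => /subset_leq_card; rewrite A4 leqNgt => /negP; apply.
    rewrite ltnS; apply: (@sub_card _ [:: i; j 2%N; j 0%N]) => x.
    by rewrite !finset.in_setU !finset.in_set1 !in_cons in_nil orbF -orbA.
  by move: nx; rewrite !finset.in_setU !finset.in_set1 !negb_or => /andP[/andP[n1 n2] n3]; exists x.
have u4 : uniq [:: i; j 0%N; j 2%N; e].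
  by rewrite /= !in_cons !in_nil !orbF !negb_or ![i == _]eq_sym !ji ei nj // ![_ == e]eq_sym ej el.
have sub0 x : x \in A 0%N -> x \in [:: i; j 0%N; j 2%N; e].
  apply: mem_uniq => //; last by rewrite A4.
  by move=> y; rewrite !in_cons in_nil orbF => /or4P[] /eqP ->.
have edj : j 0%N \in edge_at (A 0%N) i by apply: (in_edge jA0 (ji 0%N) hB).
have edl : j 2%N \in edge_at (A 0%N) i by apply: (in_edge lA0 (ji 2%N) hC).
have eej : e \in edge_at (A 0%N) (j 0%N) by apply: (four_edges h0 u4).
have eel : e \in edge_at (A 0%N) (j 2%N).
  apply: (@four_edges (A 0%N) i (j 2%N) (j 0%N) e) => //.
    by rewrite /= !in_cons !in_nil !orbF !negb_or ![i == _]eq_sym !ji ei nj // ![_ == e]eq_sym ej el.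
  by move=> x /sub0; rewrite !in_cons in_nil !orbF => /or4P[] ->; rewrite ?orbT.
have eB : e \notin B by apply: (@meet2 (A 0%N) B i (j 0%N)) => //; rewrite eq_sym.
have eC : e \notin C by apply: (@meet2 (A 0%N) C i (j 2%N)) => //; rewrite eq_sym.
have mA0 : j 1%N \notin A 0%N by apply: (third hB hC h0 (ji 1%N)).
(* The facet [j 0] is a triangle too, so its two other vertices share an edge. *)
have [D [hD DA jD eD]] : exists D, [/\ D \in verts, D != A 0%N, j 0%N \in D & e \in D] by have [_ _ //] := edge_in eej.
have [x [xj xB xD]] : exists x, [/\ x != j 0%N, x \in B & x \in D].
  have [A' [j' [h' eA']]] := tri_at4 h0 A4 jA0.
  by apply: (tri_meet h') => //; apply: contraNneq eB => ->.
have DB : D != B by apply: contraNneq eB => <-.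
have iD : i \notin D by apply: (third hB h0 hD _ jB jA0 jD iB i0 BA); rewrite 1?eq_sym // eq_sym.
have xi : x != i by apply: contraNneq iD => <-.
have xe : x != e by rewrite (mem_neq xB eB).
have xA0 : x \notin A 0%N by apply: (@meet2 B (A 0%N) i (j 0%N)) => //; rewrite eq_sym.
have only X : X \in verts -> X != C -> i \in X -> X = A 0%N \/ X = B.
  move=> hX XC iX; have [q eq] := cy_all h hX iX; rewrite -(cyc_mod h (modn_mod q 3)).1 in eq.
  move: XC; rewrite eq; have := ltn_pmod q (isT : 0 < 3)%N; move: (q %% 3)%N => [|[|[|//]]] _; [by left|by right|].
  by rewrite eqxx.
have [_ _ B3] := vpP hB.
have m0 : j 1%N != e by rewrite (mem_neq mB eB).
have um : uniq [:: i; j 2%N; e; j 0%N; j 1%N].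
  by rewrite /= !in_cons !in_nil !orbF !negb_or ![i == _]eq_sym !ji ei !nj // ![_ == e]eq_sym el ej eq_sym m0.
case: (leqP #|B| 3) => [B3'|B4].
  have Bsub : {subset B <= [:: i; j 0%N; j 1%N]}.
    move=> z; apply: mem_uniq => //=; first by rewrite !in_cons !in_nil !orbF !negb_or ![i == _]eq_sym !ji nj.
    by move=> y; rewrite !in_cons in_nil orbF => /or3P[] /eqP ->.
  have exm : x = j 1%N.
    by have := Bsub _ xB; rewrite !in_cons in_nil orbF (negbTE xi) (negbTE xj) => /eqP.
  rewrite exm in xD.
  have sep := separable_facet_but_one hC iC.
  have Hs z : z \in hits (fverts i :\ C) -> z \in [:: i; j 2%N; e; j 0%N; j 1%N].
    move=> /(hits_facetP z hC iC)[X [hX XC iX zX]]; have [eX|eX] := only X hX XC iX; rewrite eX in zX.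
      by move: (sub0 z zX); rewrite !in_cons !in_nil !orbF => /or4P[] ->; rewrite ?orbT.
    by move: (Bsub z zX); rewrite !in_cons !in_nil !orbF => /or3P[] ->; rewrite ?orbT.
  have H4 : (4 < #|hits (fverts i :\ C)|)%N.
    apply: (uniq_card um) => z; rewrite !in_cons in_nil orbF => hz; apply/(hits_facetP z hC iC).
    case/or4P: hz => [/eqP->|/eqP->|/eqP->|/orP[]/eqP->]; [exists B|exists (A 0%N)|exists (A 0%N)|exists B|exists B] => //;
      by split=> //; rewrite eq_sym.
  apply: (parallel_hits Ir tiler sep H4) => z z' /Hs hz /Hs hz' zz'.
  have tA y y' : y \in A 0%N -> y' \in A 0%N -> y != y' -> ~ col y y' by apply: touch.
  have mt y : y \in [:: i; j 2%N; e; j 0%N] -> ~ col y (j 1%N).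
    rewrite !in_cons in_nil orbF => /or4P[] /eqP ->.
    - by apply: (touch hB) => //; rewrite eq_sym.
    - by apply: (touch hC) => //; apply: nj.
    - by apply: (touch hD) => //; rewrite eq_sym.
    - by apply: (touch hB) => //; apply: nj.
  have inA y : y \in [:: i; j 2%N; e; j 0%N] -> y \in A 0%N by rewrite !in_cons in_nil orbF => /or4P[] /eqP ->.
  have spl y : y \in [:: i; j 2%N; e; j 0%N; j 1%N] -> y \in [:: i; j 2%N; e; j 0%N] \/ y = j 1%N.
    by rewrite !in_cons in_nil !orbF => /or4P[/eqP->|/eqP->|/eqP->|/orP[]/eqP->]; rewrite ?eqxx ?orbT; [left|left|left|left|right].
  have [s1|e1] := spl z hz; have [s2|e2] := spl z' hz'.
  - by apply: tA => //; apply: inA.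
  - by rewrite e2; apply: mt.
  - by rewrite e1 => /(col_sym Ir); apply: mt.
  - by rewrite e1 e2 eqxx in zz'.
have {}B4 : #|B| = 4%N by apply/eqP; rewrite eqn_leq vert_le4.
have [e' [e'B e'i e'j e'm]] : exists e, [/\ e \in B, e != i, e != j 0%N & e != j 1%N].
  have /subsetPn[z zB nz] : ~~ (B \subset [set i; j 0%N; j 1%N]).
    apply/negP => /subset_leq_card; rewrite B4 leqNgt => /negP; apply.
    rewrite ltnS; apply: (@sub_card _ [:: i; j 0%N; j 1%N]) => z.
    by rewrite !finset.in_setU !finset.in_set1 !in_cons in_nil orbF -orbA.
  by move: nz; rewrite !finset.in_setU !finset.in_set1 !negb_or => /andP[/andP[n1 n2] n3]; exists z.
have v4 : uniq [:: i; j 0%N; j 1%N; e'].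
  by rewrite /= !in_cons !in_nil !orbF !negb_or ![i == _]eq_sym !ji e'i nj // ![_ == e']eq_sym e'j e'm.
have subB z : z \in B -> z \in [:: i; j 0%N; j 1%N; e'].
  apply: mem_uniq => //; last by rewrite B4.
  by move=> y; rewrite !in_cons in_nil orbF => /or4P[] /eqP ->.
have fdj : j 0%N \in edge_at B i by apply: (in_edge jB (ji 0%N) h0); rewrite // eq_sym.
have fdm : j 1%N \in edge_at B i by apply: (in_edge mB (ji 1%N) hC); rewrite // eq_sym.
have fej : e' \in edge_at B (j 0%N) by apply: (four_edges hB v4).
have fem : e' \in edge_at B (j 1%N).
  apply: (@four_edges B i (j 1%N) (j 0%N) e') => //.
    by rewrite /= !in_cons !in_nil !orbF !negb_or ![i == _]eq_sym !ji e'i nj // ![_ == e']eq_sym e'j e'm.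
  by move=> z /subB; rewrite !in_cons in_nil !orbF => /or4P[] ->; rewrite ?orbT.
have xe' : x = e'.
  have xe1 : x \in edge_at B (j 0%N) by apply: (in_edge xB xj hD).
  have ie' : i != e' by rewrite eq_sym.
  by have [e1|//] := edge_third hB jB ie' (edge_sym iB fdj) fej xe1; rewrite e1 eqxx in xi.
rewrite {}xe' in xj xB xD xi xe xA0.
have e'C : e' \notin C by apply: (@meet2 B C i (j 1%N)) => //; rewrite eq_sym.
have e'l : e' != j 2%N by rewrite (mem_neq lA0 xA0).
apply: (@facet_hexagon i C (j 2%N) e (j 0%N) e' (j 1%N) (A 0%N) (A 0%N) B B) => //.
- by rewrite /= !in_cons !in_nil !orbF !negb_or ![i == _]eq_sym !ji ei e'i (eq_sym (j 2%N) e) el (eq_sym (j 2%N) e') e'l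
    ej (eq_sym e e') xe (eq_sym e (j 1%N)) m0 (eq_sym (j 0%N) e') e'j e'm !nj.
- move=> X z hX XC iX zX; have [eX|eX] := only X hX XC iX; rewrite eX in zX.
    by move: (sub0 z zX); rewrite !in_cons !in_nil !orbF => /or4P[] ->; rewrite ?orbT.
  by move: (subB z zX); rewrite !in_cons !in_nil !orbF => /or4P[] ->; rewrite ?orbT.
- by split=> //; rewrite eq_sym.
- by split=> //; rewrite eq_sym.
- exact: edge_sym.
- exact: edge_sym.
- by split; [apply: (touch h0)|apply: (touch hD)|apply: (touch hB)] => //; rewrite ?nj // eq_sym.
Qed.

(** ** Closing up to a tetrahedron or a prism *)

Lemma mem3 A x y z t : A \in verts -> x \in A -> y \in A -> z \in A -> x != y -> y != z -> z != x ->
  t \in A -> [\/ t = x, t = y | t = z].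
Proof.
move=> hA xA yA zA xy yz zx tA; have : t \in [:: x; y; z].
  apply: (mem_uniq _ _ _ tA); rewrite ?(vert_card3 hA) //=.
    by rewrite !in_cons !in_nil !orbF negb_or xy (eq_sym x) zx yz.
  by move=> s; rewrite !in_cons in_nil orbF => /or3P[] /eqP ->.
by rewrite !in_cons in_nil orbF => /or3P[] /eqP ->; [constructor 1|constructor 2|constructor 3].
Qed.

(** The neighbours [U] and [U'] of the vertex [A 0] on the quadrilateral [i] have the
common neighbour [X], opposite to [A 0]; the facets [u] and [u'] carry the two edges
at [X]. *)
Lemma quad_opp i (A : nat -> {set I}) (j : nat -> I) p q U U' : cyc i 4 A j ->
  p \in A 0%N -> q \in A 0%N -> p != i -> q != i -> p != q ->
  [/\ U \in verts, U != A 0%N, i \in U & p \in U] -> [/\ U' \in verts, U' != A 0%N, i \in U' & q \in U'] ->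
  exists X u u', [/\ X \in verts, i \in X, u \in X & u' \in X] /\
    [/\ u \in U, u \notin A 0%N, u' \in U', u' \notin A 0%N & u != u'].
Proof.
move=> h pA qA pi qi pq [hU UA iU pU] [hU' UA' iU' qU'].
have v r := cy_v h r; have iA r := cy_i h r; have ji r := cy_n h r.
have nA r s : (r < 4)%N -> (s < 4)%N -> r != s -> A r != A s.
  by move=> p4 q4; apply: contraNneq => /(cy_Ai h); rewrite !modn_small // => ->.
have nj r s : (r < 4)%N -> (s < 4)%N -> r != s -> j r != j s.
  by move=> p4 q4; apply: contraNneq => /(cy_ji h); rewrite !modn_small // => ->.
have e4 : A 4%N = A 0%N by apply: (cy_A h 0).
have a0 : j 0%N \in A 0%N by apply: (cy_l h).
have a3 : j 3%N \in A 0%N by rewrite -e4; apply: (cy_r h).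
have out r : (0 < r < 3)%N -> j r \notin A 0%N.
  by move=> hr; apply/negP => /(cyc_in (isT : 1 < 4)%N h); clear -hr; lia.
have who t : t \in A 0%N -> t != i -> t = j 0%N \/ t = j 3%N.
  move=> tA ti; have := mem3 (v 0%N) (iA 0%N) a0 a3 _ _ _ tA.
  rewrite eq_sym ji nj // ji => /(_ isT isT isT)[e|e|e]; [by rewrite e eqxx in ti|by left|by right].
have W1 W : W \in verts -> W != A 0%N -> i \in W -> j 0%N \in W -> W = A 1%N.
  move=> hW WA iW jW; have [e|//] := edge2 (v 0%N) (v 1%N) hW (ji 0%N) (iA 0%N) (iA 1%N) iW a0 (cy_r h 0) jW (nA 0%N 1%N isT isT isT).
  by rewrite e eqxx in WA.
have W3 W : W \in verts -> W != A 0%N -> i \in W -> j 3%N \in W -> W = A 3%N.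
  move=> hW WA iW jW; have [e|//] := edge2 (v 0%N) (v 3%N) hW (ji 3%N) (iA 0%N) (iA 3%N) iW a3 (cy_l h 3) jW (nA 0%N 3%N isT isT isT).
  by rewrite e eqxx in WA.
have r1 : j 1%N \in A 2%N := cy_r h 1. have l2 : j 2%N \in A 2%N := cy_l h 2.
have l1 : j 1%N \in A 1%N := cy_l h 1. have r2 : j 2%N \in A 3%N := cy_r h 2.
have [ep|ep] := who p pA pi; have [eq|eq] := who q qA qi; rewrite ep in pU; rewrite eq in qU'; rewrite ?ep ?eq ?eqxx // in pq.
  exists (A 2%N), (j 1%N), (j 2%N); rewrite (W1 U) // (W3 U') //; split; split=> //; [exact: out|exact: out|exact: nj].
exists (A 2%N), (j 2%N), (j 1%N); rewrite (W3 U) // (W1 U') //; split; split=> //; [exact: out|exact: out|exact: nj].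
Qed.

Definition triangle i := exists (A : nat -> {set I}) (j : nat -> I), cyc i 3 A j.

Lemma not_triangle i V : V \in verts -> i \in V -> ~ triangle i ->
  exists (A : nat -> {set I}) (j : nat -> I), cyc i 4 A j /\ A 0%N = V.
Proof.
move=> hV iV nt; have [k [A [j [[->|->] cy e]]]] := tri_or_quad hV iV; last by exists A, j.
by case: nt; exists A, j.
Qed.

Lemma opp_corner i V p q U U' : V \in verts -> i \in V -> ~ triangle i ->
  p \in V -> q \in V -> p != i -> q != i -> p != q ->
  [/\ U \in verts, U != V, i \in U & p \in U] -> [/\ U' \in verts, U' != V, i \in U' & q \in U'] ->
  exists X u u', [/\ X \in verts, i \in X, u \in X & u' \in X] /\
    [/\ u \in U, u \notin V, u' \in U', u' \notin V & u != u'].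
Proof.
move=> hV iV nt pV qV pi qi pq HU HU'; have [A [j [cy e]]] := not_triangle hV iV nt.
by rewrite -e in pV qV HU HU' *; exact: (quad_opp cy pV qV pi qi pq HU HU').
Qed.

(** Suppose that three quadrilaterals meet in [V]. A plane that separates [V] and its
three neighbours from the other vertices meets these quadrilaterals, and between
them the three further facets at the neighbours. This hexagon is excluded. *)
Lemma triangle_at_vertex V : V \in verts -> exists2 i, i \in V & triangle i.
Proof.
move=> hV; apply: contrapT => no; have nt i : i \in V -> ~ triangle i by move=> iV t; apply: no; exists i.
have [i [j [l [ij jl li eV]]]] := card3 (vert_card3 hV).
have [U1 [U2 [U3 [[h1 h2 h3] [n1 n2 n3] [j1 l1] [i2 l2] [i3 j3]]]]] := simple_edges Ir hV eV ij jl li.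
have [iV jV lV] : [/\ i \in V, j \in V & l \in V] by rewrite eV !finset.in_setU !finset.in_set1 !eqxx !orbT.
have ji : j != i by rewrite eq_sym. have lj : l != j by rewrite eq_sym. have il : i != l by rewrite eq_sym.
have [Xi [h3' [h2' [[hXi iXi x1 x2] [y1 y2 y3 y4 y5]]]]] : exists X u u', [/\ X \in verts, i \in X, u \in X & u' \in X] /\
    [/\ u \in U3, u \notin V, u' \in U2, u' \notin V & u != u'] by apply: (opp_corner hV iV (nt i iV) jV lV).
have [Xj [h1' [h3'' [[hXj jXj x3 x4] [y6 y7 y8 y9 y10]]]]] : exists X u u', [/\ X \in verts, j \in X, u \in X & u' \in X] /\
    [/\ u \in U1, u \notin V, u' \in U3, u' \notin V & u != u'] by apply: (opp_corner hV jV (nt j jV) lV iV).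
have [Xl [h2'' [h1'' [[hXl lXl x5 x6] [z1 z2 z3 z4 z5]]]]] : exists X u u', [/\ X \in verts, l \in X, u \in X & u' \in X] /\
    [/\ u \in U2, u \notin V, u' \in U1, u' \notin V & u != u'] by apply: (opp_corner hV lV (nt l lV) iV jV).
have uniqout U p q u u' : U \in verts -> p \in U -> q \in U -> p != q -> p \in V -> q \in V ->
    u \in U -> u' \in U -> u \notin V -> u' \notin V -> u' = u.
  move=> hU pU qU pq pV qV uU u'U uV u'V.
  have qu : q != u by rewrite (mem_neq qV uV). have up : u != p by rewrite (mem_neq pV uV).
  by have [e|e|//] := mem3 hU pU qU uU pq qu up u'U; rewrite e ?pV ?qV in u'V.
have e1 : h1'' = h1' by apply: (uniqout U1 j l).
have e2 : h2'' = h2' by apply: (uniqout U2 i l).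
have e3 : h3'' = h3' by apply: (uniqout U3 i j).
rewrite {}e1 {}e2 {}e3 in x4 x5 x6 y8 y9 y10 z1 z2 z3 z4 z5.
have out x h : x \in V -> h \notin V -> (x != h) * (h != x) by apply: mem_neq.
have sub U p q u z : U \in verts -> p \in U -> q \in U -> p != q -> p \in V -> q \in V -> u \in U -> u \notin V ->
    z \in U -> [\/ z = p, z = q | z = u].
  by move=> hU pU qU pq pV qV uU uV; apply: mem3 => //; rewrite ?(out q) // (out p).
have u6 : uniq [:: h1'; l; h2'; i; h3'; j].
  rewrite /= !in_cons !in_nil !orbF !negb_or (eq_sym h1' h2') z5 y10 (eq_sym h2' h3') y5 li lj ij.
  by rewrite !(out i) // !(out j) // !(out l).
have S1 : U1 \in [set V; U1; U2; U3] by rewrite !finset.in_setU !finset.in_set1 eqxx !orbT.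
have S2 : U2 \in [set V; U1; U2; U3] by rewrite !finset.in_setU !finset.in_set1 eqxx !orbT.
have S3 : U3 \in [set V; U1; U2; U3] by rewrite !finset.in_setU !finset.in_set1 eqxx !orbT.
have notS X h h' : X \in verts -> h \in X -> h' \in X -> h != h' -> h \notin V -> h' \notin V ->
    X \notin [set V; U1; U2; U3].
  move=> hX hh hh' ne hV' hV''; apply/negP; rewrite !finset.in_setU !finset.in_set1 -!orbA.
  case/or4P => /eqP e; rewrite e in hh hh'.
  - by rewrite hh in hV'.
  - by rewrite (uniqout U1 j l h h') ?eqxx in ne.
  - by rewrite (uniqout U2 i l h h') ?eqxx in ne.
  - by rewrite (uniqout U3 i j h h') ?eqxx in ne.
have nXi := notS _ _ _ hXi x1 x2 y5 y2 y4.
have nXj := notS _ _ _ hXj x3 x4 y10 y7 y9.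
have nXl := notS _ _ _ hXl x5 x6 z5 z2 z4.
have tc X x y : X \in verts -> x \in X -> y \in X -> x != y -> ~ col x y by apply: touch.
apply: (@hexagon_criterion [set V; U1; U2; U3] h1' l h2' i h3' j U1 Xl U2) => //.
- exact: (separable_star Ir hV eV).
- move=> x /hitsP[[B [hB + xB]] _]; rewrite !finset.in_setU !finset.in_set1 -!orbA !in_cons in_nil orbF.
  case/or4P => /eqP e; rewrite e in xB.
  + by have [->|->|->] := mem3 hV iV jV lV ij jl li xB; rewrite eqxx ?orbT.
  + by have [->|->|->] := sub U1 j l h1' x h1 j1 l1 jl jV lV y6 y7 xB; rewrite eqxx ?orbT.
  + by have [->|->|->] := sub U2 i l h2' x h2 i2 l2 il iV lV y3 y4 xB; rewrite eqxx ?orbT.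
  + by have [->|->|->] := sub U3 i j h3' x h3 i3 j3 ij iV jV y1 y2 xB; rewrite eqxx ?orbT.
- by split; [exists U1, Xl|exists U2, Xl|exists U2, Xi].
- by split; [exists U3, Xi|exists U3, Xj|exists U1, Xj].
- by split; [apply: (tc Xl)|apply: (tc V)|apply: (tc Xi)] => //; rewrite eq_sym.
- by split; [apply: (tc V)|apply: (tc Xj)|apply: (tc V)] => //; rewrite eq_sym.
- by apply/negP => h; move: z5; rewrite (uniqout U1 j l h1' h2') ?eqxx.
- by apply/negP => h; move: y10; rewrite (uniqout U1 j l h1' h3') ?eqxx.
- by left.
- by left.
Qed.

(** A set of vertices that is closed under following edges contains all vertices,
by connectedness, and each facet has a vertex. *)
Lemma closed_card (W : seq {set I}) (F : seq I) : (0 < size W)%N -> uniq F ->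
  (forall A, A \in W -> A \in verts /\ {subset A <= F}) ->
  (forall A x y, A \in W -> x \in A -> y \in A -> x != y -> exists B, [/\ B \in W, B != A, x \in B & y \in B]) ->
  #|I| = size F.
Proof.
move=> W0 uF sW cl; have all : forall B, B \in verts -> B \in [set A in W].
  have hW A : (A \in [set A in W]) = (A \in W) by rewrite finset.in_set.
  apply: (verts_connected Ir (A0 := nth finset.set0 W 0)); first exact: vert_card3.
  - by rewrite hW mem_nth.
  - by move=> A; rewrite hW => /sW[].
  move=> A B; rewrite !hW => AW hB AB; have [hA _] := sW A AW.
  have /card_gt1P[x [y [xAB yAB xy]]] : (1 < #|A :&: B|)%N by rewrite AB.
  move: xAB yAB; rewrite !finset.in_setI => /andP[xA xB] /andP[yA yB].
  have [C [CW CA xC yC]] := cl A x y AW xA yA xy; have [hC _] := sW C CW.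
  have yx : y != x by rewrite eq_sym.
  have [e|->//] := edge2 hA hC hB yx xA xC xB yA yC yB ltac:(by rewrite eq_sym).
  by rewrite e.
rewrite -(card_uniqP uF); apply: eq_card => x; rewrite inE; apply/esym.
have [A hA xA] := facet_vert Ir x; have := all A hA; rewrite finset.in_set => /sW[_]; exact.
Qed.

(** Two adjacent triangles share an edge from [A 0] to [A 1]. The third vertex [D] of
the second one lies on the third facets through [A 0] and [A 1], so the three
vertices of [i] and [D] are closed under edges. *)
Lemma tetra i (A : nat -> {set I}) (j : nat -> I) : cyc i 3 A j -> triangle (j 0%N) -> #|I| = 4%N.
Proof.
move=> h [A' [j' h']].
have v r := cy_v h r; have iA r := cy_i h r; have ji r := cy_n h r.
have nA r s : (r < 3)%N -> (s < 3)%N -> r != s -> A r != A s.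
  by move=> p4 q4; apply: contraNneq => /(cy_Ai h); rewrite !modn_small // => ->.
have nj r s : (r < 3)%N -> (s < 3)%N -> r != s -> j r != j s.
  by move=> p4 q4; apply: contraNneq => /(cy_ji h); rewrite !modn_small // => ->.
have e3 : A 3%N = A 0%N by apply: (cy_A h 0).
have l0 := cy_l h 0; have l1 := cy_l h 1; have l2 := cy_l h 2.
have r0 := cy_r h 0; have r1 := cy_r h 1; have r2 : j 2%N \in A 0%N by rewrite -e3; apply: (cy_r h).
have n01 : A 0%N != A 1%N by apply: nA.
have [D [hD aD D0 D1]] : exists D, [/\ D \in verts, j 0%N \in D, D != A 0%N & D != A 1%N].
  apply: contrapT => no; have al q : A' q = A 0%N \/ A' q = A 1%N.
    apply: contrapT => /not_orP[q0 q1]; apply: no; exists (A' q); split; [exact: (cy_v h')|exact: (cy_i h')|exact/eqP|exact/eqP].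
  have n' r s : (r < 3)%N -> (s < 3)%N -> r != s -> A' r <> A' s.
    by move=> p4 q4 ne /(cy_Ai h') e; move: ne; rewrite -(modn_small p4) -(modn_small q4) e eqxx.
  have := n' 0%N 1%N isT isT isT; have := n' 1%N 2%N isT isT isT; have := n' 0%N 2%N isT isT isT.
  by have [->|->] := al 0%N; have [->|->] := al 1%N; have [->|->] := al 2%N.
have aj : i != j 0%N by rewrite eq_sym.
have iD : i \notin D by apply: (third (v 0%N) (v 1%N) hD aj l0 r0 aD (iA 0%N) (iA 1%N) n01); rewrite eq_sym.
have cD : j 2%N \in D.
  have [x [xa x0 xD]] := tri_meet h' (v 0%N) hD l0 aD ltac:(by rewrite eq_sym).
  have [e|e|<-//] := mem3 (v 0%N) (iA 0%N) l0 r2 aj (nj 0%N 2%N isT isT isT) (ji 2%N) x0.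
    by rewrite -e xD in iD.
  by rewrite e eqxx in xa.
have bD : j 1%N \in D.
  have [x [xa x0 xD]] := tri_meet h' (v 1%N) hD r0 aD ltac:(by rewrite eq_sym).
  have [e|e|<-//] := mem3 (v 1%N) (iA 1%N) r0 l1 aj (nj 0%N 1%N isT isT isT) (ji 1%N) x0.
    by rewrite -e xD in iD.
  by rewrite e eqxx in xa.
have D2 : D != A 2%N by apply: contraNneq iD => ->.
have n02 : A 0%N != A 2%N by apply: nA. have n12 : A 1%N != A 2%N by apply: nA.
have u01 : j 0%N != j 1%N by apply: nj. have u12 : j 1%N != j 2%N by apply: nj. have u20 : j 2%N != j 0%N by apply: nj.
have m0 := mem3 (v 0%N) (iA 0%N) l0 r2 aj (nj 0%N 2%N isT isT isT) (ji 2%N).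
have m1 := mem3 (v 1%N) (iA 1%N) r0 l1 aj u01 (ji 1%N).
have m2 := mem3 (v 2%N) (iA 2%N) r1 l2 ltac:(by rewrite eq_sym ji) u12 (ji 2%N).
have mD := mem3 hD aD bD cD u01 u12 u20.
apply: (@closed_card [:: A 0%N; A 1%N; A 2%N; D] [:: i; j 0%N; j 1%N; j 2%N]) => //.
- by rewrite /= !in_cons !in_nil !orbF !negb_or ![i == _]eq_sym !ji u01 u12 (eq_sym (j 0%N)) u20.
- move=> B; rewrite !in_cons in_nil orbF => /or4P[] /eqP ->; split=> // x.
  + by case/m0 => ->; rewrite !in_cons eqxx ?orbT.
  + by case/m1 => ->; rewrite !in_cons eqxx ?orbT.
  + by case/m2 => ->; rewrite !in_cons eqxx ?orbT.
  + by case/mD => ->; rewrite !in_cons eqxx ?orbT.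
have pick B (X Y Z : {set I}) p q r : X \in verts -> (forall t, t \in B -> [\/ t = p, t = q | t = r]) ->
    [/\ X != B, p \in X & q \in X] -> [/\ Y != B, q \in Y & r \in Y] -> [/\ Z != B, r \in Z & p \in Z] ->
    X \in [:: A 0%N; A 1%N; A 2%N; D] -> Y \in [:: A 0%N; A 1%N; A 2%N; D] -> Z \in [:: A 0%N; A 1%N; A 2%N; D] ->
    forall x y, x \in B -> y \in B -> x != y -> exists C, [/\ C \in [:: A 0%N; A 1%N; A 2%N; D], C != B, x \in C & y \in C].
  move=> _ m [X1 X2 X3] [Y1 Y2 Y3] [Z1 Z2 Z3] hX hY hZ x y /m[]-> /m[]->; rewrite ?eqxx // => _;
    by [exists X|exists Y|exists Z].
have in0 : A 0%N \in [:: A 0%N; A 1%N; A 2%N; D] by rewrite !in_cons eqxx.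
have in1 : A 1%N \in [:: A 0%N; A 1%N; A 2%N; D] by rewrite !in_cons eqxx ?orbT.
have in2 : A 2%N \in [:: A 0%N; A 1%N; A 2%N; D] by rewrite !in_cons eqxx ?orbT.
have inD : D \in [:: A 0%N; A 1%N; A 2%N; D] by rewrite !in_cons eqxx ?orbT.
move=> B x y; rewrite [B \in _]in_cons [B \in _]in_cons [B \in _]in_cons [B \in _]in_cons in_nil orbF => /or4P[] /eqP ->.
- by apply: (pick _ (A 1%N) D (A 2%N) i (j 0%N) (j 2%N)) => //; split=> //; rewrite eq_sym.
- by apply: (pick _ (A 0%N) D (A 2%N) i (j 0%N) (j 1%N)) => //; split=> //; rewrite eq_sym.
- by apply: (pick _ (A 1%N) D (A 0%N) i (j 1%N) (j 2%N)) => //; split=> //; rewrite eq_sym.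
- by apply: (pick _ (A 1%N) (A 2%N) (A 0%N) (j 0%N) (j 1%N) (j 2%N)) => //; split=> //; rewrite eq_sym.
Qed.

(** The two quadrilaterals next to the triangle [i] share an edge, and their edges
opposite to [i] lie on a common facet [d]; this facet also carries the edge of the
third neighbour, and the three vertices of [i] with the other ends [X0], [X], [X2] of
the edges from them are closed under edges. *)
Lemma prism i (A : nat -> {set I}) (j : nat -> I) : cyc i 3 A j -> ~ triangle (j 0%N) -> ~ triangle (j 1%N) -> #|I| = 5%N.
Proof.
move=> h nt0 nt1.
have v r := cy_v h r; have iA r := cy_i h r; have ji r := cy_n h r.
have nA r s : (r < 3)%N -> (s < 3)%N -> r != s -> A r != A s.
  by move=> p4 q4; apply: contraNneq => /(cy_Ai h); rewrite !modn_small // => ->.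
have nj r s : (r < 3)%N -> (s < 3)%N -> r != s -> j r != j s.
  by move=> p4 q4; apply: contraNneq => /(cy_ji h); rewrite !modn_small // => ->.
have e3 : A 3%N = A 0%N by apply: (cy_A h 0).
have l0 := cy_l h 0; have l1 := cy_l h 1; have l2 := cy_l h 2.
have r0 := cy_r h 0; have r1 := cy_r h 1; have r2 : j 2%N \in A 0%N by rewrite -e3; apply: (cy_r h).
have n01 : A 0%N != A 1%N by apply: nA. have n02 : A 0%N != A 2%N by apply: nA. have n12 : A 1%N != A 2%N by apply: nA.
have n10 : A 1%N != A 0%N by apply: nA. have n20 : A 2%N != A 0%N by apply: nA. have n21 : A 2%N != A 1%N by apply: nA.
have u01 : j 0%N != j 1%N by apply: nj. have u12 : j 1%N != j 2%N by apply: nj. have u20 : j 2%N != j 0%N by apply: nj.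
have u02 : j 0%N != j 2%N by apply: nj.
have ij r : i != j r by rewrite eq_sym.
have m0 := mem3 (v 0%N) (iA 0%N) l0 r2 (ij 0%N) u02 (ji 2%N).
have m1 := mem3 (v 1%N) (iA 1%N) r0 l1 (ij 0%N) u01 (ji 1%N).
have m2 := mem3 (v 2%N) (iA 2%N) r1 l2 (ij 1%N) u12 (ji 2%N).
have [_ _ [X0 [hX0 X0A aX0 cX0]]] := edge_in (simple_edge (v 0%N) (vert_card3 (v 0%N)) l0 r2 (iA 0%N) u02 (ji 2%N) (ij 0%N)).
have [X [b' [d [[hX aX bX dX] [b1 b2 d1 d2 bd]]]]] := opp_corner (v 0%N) l0 nt0 (iA 0%N) r2 (ij 0%N) u20 (ij 2%N)
  (And4 (v 1%N) n10 r0 (iA 1%N)) (And4 hX0 X0A aX0 cX0).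
have eb : b' = j 1%N by have [e|e|//] := m1 _ b1; rewrite e ?iA ?l0 in b2.
rewrite {}eb {b1 b2} in bX bd.
have di : i != d by rewrite (mem_neq (iA 0%N) d2).
have da : j 0%N != d by rewrite (mem_neq l0 d2).
have dc : j 2%N != d by rewrite (mem_neq r2 d2).
have dA1 : d \notin A 1%N by apply/negP => /m1[e|e|e]; rewrite e eqxx in di da bd.
have XA1 : A 1%N != X by apply: contraNneq dA1 => ->.
have ad := da; rewrite eq_sym in ad. have db := bd; rewrite eq_sym in db.
have b0 : j 1%N != j 0%N by rewrite eq_sym.
have [_ _ [X2 [hX2 X2X bX2 dX2]]] := edge_in (simple_edge hX (vert_card3 hX) bX dX aX bd ad u01).
have [Y [i' [c' [[hY bY iY cY] [i1 i2 c1 c2 ic]]]]] := opp_corner hX bX nt1 aX dX u01 db da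
  (And4 (v 1%N) XA1 l1 r0) (And4 hX2 X2X bX2 dX2).
have ei : i' = i by have [//|e|e] := m1 _ i1; rewrite e ?aX ?bX in i2.
rewrite {}ei {i1} in iY i2 ic.
have eY : Y = A 2%N.
  have [e|//] := edge2 (v 1%N) (v 2%N) hY (ji 1%N) (iA 1%N) (iA 2%N) iY l1 r1 bY n12.
  by rewrite e in cY; have [e'|e'|e'] := m1 _ cY; rewrite e' ?eqxx ?aX ?bX in ic c2.
have ec : c' = j 2%N.
  by rewrite eY in cY; have [e'|e'|//] := m2 _ cY; rewrite e' ?eqxx ?bX in ic c2.
rewrite {}ec {cY} in c1 c2 ic.
have mX0 := mem3 hX0 aX0 cX0 d1 u02 dc ad.
have mX := mem3 hX aX bX dX u01 bd ad.
have mX2 := mem3 hX2 bX2 c1 dX2 u12 dc db.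
have bX0 : j 1%N \notin X0 by apply/negP => /mX0[e|e|e]; rewrite e eqxx in u01 u12 bd.
have aX2 : j 0%N \notin X2 by apply/negP => /mX2[e|e|e]; rewrite e eqxx in u01 u20 da.
have iX2 : i \notin X2 by apply/negP => /mX2[e|e|e]; have := ij 1%N; have := ij 2%N; rewrite -?e ?eqxx // e eqxx in di *.
have N1 : X0 != X2 by apply: contraNneq bX0 => ->.
have N2 : X0 != X by apply: contraNneq bX0 => ->.
have N3 : X != X2 by apply: contraNneq aX2 => <-.
have N4 : A 2%N != X2 by apply: contraNneq iX2 => <-.
pose W := [:: A 0%N; A 1%N; A 2%N; X0; X; X2].
have pick B (X' Y' Z : {set I}) p q r : (forall t, t \in B -> [\/ t = p, t = q | t = r]) ->
    [/\ X' != B, p \in X' & q \in X'] -> [/\ Y' != B, q \in Y' & r \in Y'] -> [/\ Z != B, r \in Z & p \in Z] ->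
    X' \in W -> Y' \in W -> Z \in W ->
    forall x y, x \in B -> y \in B -> x != y -> exists C, [/\ C \in W, C != B, x \in C & y \in C].
  move=> m [? ? ?] [? ? ?] [? ? ?] hX' hY' hZ x y /m[]-> /m[]->; rewrite ?eqxx // => _;
    by [exists X'|exists Y'|exists Z].
have W0 : A 0%N \in W by rewrite !in_cons eqxx.
have W1 : A 1%N \in W by rewrite !in_cons eqxx ?orbT.
have W2 : A 2%N \in W by rewrite !in_cons eqxx ?orbT.
have W3 : X0 \in W by rewrite !in_cons eqxx ?orbT.
have W4 : X \in W by rewrite !in_cons eqxx ?orbT.
have W5 : X2 \in W by rewrite !in_cons eqxx ?orbT.
have caseW B : B \in W -> (B = A 0%N \/ B = A 1%N \/ B = A 2%N) \/ (B = X0 \/ B = X \/ B = X2).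
  by rewrite !in_cons in_nil orbF => /or4P[/eqP|/eqP|/eqP|/or3P[]/eqP] ->; tauto.
apply: (@closed_card W [:: i; j 0%N; j 1%N; j 2%N; d]) => //.
- by rewrite /= !in_cons !in_nil !orbF !negb_or !ij di u01 u02 da u12 bd dc.
- move=> B /caseW[[|[|]]|[|[|]]] ->; split=> // x.
  + by case/m0 => ->; rewrite !in_cons eqxx ?orbT.
  + by case/m1 => ->; rewrite !in_cons eqxx ?orbT.
  + by case/m2 => ->; rewrite !in_cons eqxx ?orbT.
  + by case/mX0 => ->; rewrite !in_cons eqxx ?orbT.
  + by case/mX => ->; rewrite !in_cons eqxx ?orbT.
  + by case/mX2 => ->; rewrite !in_cons eqxx ?orbT.
move=> B x y /caseW[[|[|]]|[|[|]]] ->.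
- by apply: (pick _ (A 1%N) X0 (A 2%N) i (j 0%N) (j 2%N)) => //; split=> //; rewrite eq_sym.
- by apply: (pick _ (A 0%N) X (A 2%N) i (j 0%N) (j 1%N)) => //; split=> //; rewrite eq_sym.
- by apply: (pick _ (A 1%N) X2 (A 0%N) i (j 1%N) (j 2%N)) => //; split=> //; rewrite eq_sym.
- by apply: (pick _ (A 0%N) X2 X (j 0%N) (j 2%N) d) => //; split=> //; rewrite eq_sym.
- by apply: (pick _ (A 1%N) X2 X0 (j 0%N) (j 1%N) d) => //; split=> //; rewrite eq_sym.
- by apply: (pick _ (A 2%N) X0 X (j 1%N) (j 2%N) d) => //; split=> //; rewrite eq_sym.
Qed.

Theorem four_or_five_facets : #|I| = 4%N \/ #|I| = 5%N.
Proof.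
have [z hz] := ir_in Ir; have [V [hV _ _]] := reach Ir 0 (fun i => ltW (hz i)).
have [i iV [A [j h]]] := triangle_at_vertex hV.
have rot r : cyc i 3 (fun q => A (q + r)%N) (fun q => j (q + r)%N) by apply: cyc_shift.
case: (pselect (triangle (j 0%N))) => t0; first by left; exact: (tetra h t0).
case: (pselect (triangle (j 1%N))) => t1; first by left; exact: (tetra (rot 1%N) t1).
by right; exact: (prism h t0 t1).
Qed.

End Comb.

(** * Facets of a polyhedron *)

Section Facets.
Variables (R : realType) (I : finType) (a : I -> 'rV[R]_3) (b : I -> R).
Hypothesis Ir : irredundant a b.
Local Notation slack := (slack a b).
Local Notation inP := (inP a b).
Local Notation act := (act a b).
Local Notation P := ([set z | inP z]%classic).
Implicit Types (x y u p : 'rV[R]_3) (i j : I) (F : set 'rV[R]_3).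

Definition facet i : set 'rV[R]_3 := (hyperplane (a i) (b i) `&` P)%classic.

Lemma facetP i x : facet i x <-> slack i x = 0 /\ inP x.
Proof.
by split=> -[h hx]; split=> //; move: h; rewrite /hyperplane /slack /= => h; lra.
Qed.

(** The slack inequalities remain satisfied for a while. *)
Lemma small_step x u : (forall j, slack j x = 0 -> dot (a j) u <= 0) -> inP x ->
  exists2 t, 0 < t & inP (x + t *: u).
Proof.
move=> h hx; pose N := 1 + \sum_(j | slack j x != 0) `|dot (a j) u| / slack j x.
have S j : slack j x != 0 -> `|dot (a j) u| / slack j x <= N.
  move=> hj; rewrite /N (bigD1 j) //= addrCA lerDl addr_ge0 // sumr_ge0 // => k _.
  by rewrite divr_ge0 // hx.
have N0 : 0 < N.
  by rewrite ltr_wpDr // sumr_ge0 // => k _; rewrite divr_ge0 // hx.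
exists N^-1 => [|j]; rewrite ?invr_gt0 // slackD dotZr subr_ge0 mulrC ler_pdivrMr //.
case: (eqVneq (slack j x) 0) => [e|/[dup] s0 /S]; first by rewrite e mul0r h.
rewrite ler_pdivrMr; last by rewrite lt_neqAle eq_sym s0 hx.
by have := ler_norm (dot (a j) u); rewrite mulrC; lra.
Qed.

Lemma mulmx_tr_rV u x : u *m x^T = (dot u x)%:M.
Proof.
apply/matrixP => i j; rewrite !ord1 !mxE eqxx mulr1n.
by apply: eq_bigr => k _; rewrite !mxE.
Qed.

Lemma kermx_trP u x : reflect (dot u x = 0) (u <= kermx x^T)%MS.
Proof.
apply: (iffP sub_kermxP); rewrite mulmx_tr_rV; last by move=> ->; rewrite raddf0.
by move=> /matrixP/(_ 0 0); rewrite !mxE eqxx mulr1n.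
Qed.

(** A lower bound for the dimension of a flat that contains [F] comes from the
directions in which one can move inside [F]. *)
Lemma flat_dir F p (U : 'M[R]_3) x t u :
  (F `<=` flat p U)%classic -> F x -> 0 < t -> F (x + t *: u) -> (u <= U)%MS.
Proof.
move=> FU /FU xU t0 /FU; rewrite /flat /= addrAC => h.
have : ((x - p + t *: u) - (x - p) <= U)%MS by rewrite addmx_sub // eqmx_opp.
by rewrite addrAC subrr add0r; apply: submx_trans; rewrite eqmx_scale // gt_eqF.
Qed.

Lemma rank_kermx_tr u : u != 0 -> \rank (kermx u^T) = 2%N.
Proof. by move=> u0; rewrite mxrank_ker mxrank_tr rank_rV u0. Qed.

(** From the witness one can move inside the facet in all directions of its plane. *)
Lemma facet_dim i : has_affine_dim (facet i) 2.
Proof.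
have [w [wi wj]] := ir_wit Ir i.
have hw : inP w by move=> j; case: (eqVneq j i) => [->|/wj/ltW //]; rewrite wi.
split; first exists w, (kermx (a i)^T); first split; last 1 first.
- move=> p U FU; apply: leq_trans (_ : (\rank (kermx (a i)^T) <= _)%N); first by rewrite rank_kermx_tr // (a_neq0 Ir).
  apply/mxrankS/rV_subP => u.
  move=> /kermx_trP; rewrite dotC => u0.
  have [j|t t0 ht] := @small_step w u _ hw.
    by case: (eqVneq j i) => [->|/wj h e]; [rewrite u0|rewrite e ltxx in h].
  apply: (flat_dir FU _ t0); apply/facetP; split=> //; first exact: wi.
  by rewrite slackD dotZr wi u0; ring.
- move=> x [hx _]; apply/kermx_trP; rewrite dotC dotBr hx.
  by move: wi; rewrite /slack; lra.
- by rewrite rank_kermx_tr // (a_neq0 Ir).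
Qed.

Lemma facet_inj : injective facet.
Proof.
move=> i j e; have [w [wi wj]] := ir_wit Ir i.
have : facet i w by apply/facetP; split=> // k; case: (eqVneq k i) => [->|/wj/ltW //]; rewrite wi.
by rewrite e => /facetP[h _]; apply: contrapT => /eqP; rewrite eq_sym => /wj; rewrite h ltxx.
Qed.

(** A point of the face with the fewest active inequalities lies on some facet, as
the supporting functional is maximal there, and by minimality, applied to
midpoints, this facet contains the whole face. If its plane were not the supporting
plane, the face would lie in a line. *)
Lemma face_facet F : face P F -> has_affine_dim F 2 -> exists i, F = facet i.
Proof.
move=> [al [be [hP ->]]] [[p [U [FU rU]]] dimF]; set F0 := (_ `&` _)%classic in FU dimF *.
have [z sz] := ir_in Ir; have hz : inP z by move=> i; apply: ltW.
have free u : exists2 t, 0 < t & inP (z + t *: u).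
  by apply: small_step => // j e; have := sz j; rewrite e ltxx.
have F0n : (F0 !=set0)%classic.
  apply/set0P/eqP => e.
  by have := dimF 0 0; rewrite e mxrank0 => /(_ (@sub0set _ _)).
have al0 : al != 0.
  apply/eqP => e; have [x [hx _]] := F0n.
  have F0P y : inP y -> F0 y by split=> //; move: hx; rewrite /hyperplane /= e !dot0l.
  have : (1%:M <= U)%MS.
    apply/rV_subP => u _; have [t t0 ht] := free u.
    exact: (flat_dir FU (F0P _ hz) t0 (F0P _ ht)).
  by move=> /mxrankS; rewrite rU mxrank1.
have [n [x [Fx nx]] nmin] : exists2 n, exists x, F0 x /\ #|act x| = n &
    forall y, F0 y -> (n <= #|act y|)%N.
  have ex : exists n, `[< exists x, F0 x /\ #|act x| = n >].
    by have [x Fx] := F0n; exists #|act x|; apply/asboolP; exists x.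
  case: (ex_minnP ex) => n /asboolP[x hx] h; exists n; first by exists x.
  by move=> y Fy; apply: h; apply/asboolP; exists y.
have [Hx Px] := Fx; rewrite /hyperplane /= in Hx.
have actF y : F0 y -> act x \subset act y.
  move=> Fy; have [Hy Py] := Fy; rewrite /hyperplane /= in Hy.
  have h2 : 0 < (2^-1 : R) < 1 by lra.
  have e := act_mid h2 Px Py; set m := (_ *: x + _) in e.
  have Fm : F0 m.
    split; last by apply: inP_mid => //; lra.
    by rewrite /hyperplane /= dotDr !dotZr Hx Hy; ring.
  apply/finset.setIidPl/eqP.
  by rewrite eqEcard finset.subsetIl -e nx nmin.
have [i ix] : exists i, i \in act x.
  apply/set0Pn/eqP => e; have [j|t t0 ht] := @small_step x al _ Px.
    by move=> /actP; rewrite e finset.in_set0.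
  by have := hP _ ht; rewrite /halfspace /= dotDr dotZr Hx; have := dot_sq al0; nra.
have si : slack i x = 0 by apply/actP.
have Fi : (F0 `<=` flat x (kermx (col_mx al (a i))^T))%classic.
  move=> y Fy; have [Hy Py] := Fy; rewrite /hyperplane /= in Hy.
  have /actP yi := fintype.subsetP (actF y Fy) _ ix.
  apply/sub_kermxP; rewrite tr_col_mx mul_mx_row !mulmx_tr_rV !(dotC (y - x)) !dotBr Hx Hy subrr.
  by move: si yi; rewrite /slack => si yi; rewrite (_ : _ - _ = 0) ?raddf0 ?row_mx0 //; lra.
have := dimF _ _ Fi; rewrite mxrank_ker mxrank_tr => rk.
have rk1 : (\rank (col_mx al (a i)) <= 1)%N by move: rk; lia.
have : (al <= a i)%MS.
  have s : (a i <= col_mx al (a i))%MS by rewrite -addsmxE addsmxSr.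
  have [_] := mxrank_leqif_sup s; rewrite rank_rV (a_neq0 Ir) eqn_leq rk1.
  have -> : (true <= \rank (col_mx al (a i)))%N.
    by have := mxrankS s; rewrite rank_rV (a_neq0 Ir).
  by move=> /esym; apply: submx_trans; rewrite -addsmxE addsmxSl.
move=> /sub_rVP[c ec]; have c0 : c != 0 by apply: contra_neq al0 => c0; rewrite ec c0 scale0r.
exists i; apply/predeqP => y; rewrite /facet /F0 /hyperplane /=.
have e : dot al y - be = c * (dot (a i) y - b i).
  by rewrite -Hx ec !dotZl; move: si; rewrite /slack => si; rewrite (_ : b i = dot (a i) x); [ring|lra].
split=> -[h hy]; split=> //; apply/eqP; rewrite -subr_eq0.
  by move/eqP: h; rewrite -subr_eq0 e mulf_eq0 (negPf c0).
by rewrite e h subrr mulr0.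
Qed.

Theorem card_facets : (facets P #= `I_#|I|)%card.
Proof.
have -> : facets P = (facet @` setT)%classic.
  apply/predeqP => F; split=> [[hF dF]|[i _ <-]].
    by have [i ->] := face_facet hF dF; exists i.
  split; last exact: facet_dim.
  exists (a i), (b i); split=> // x hx.
  by have := hx i; rewrite /slack /halfspace /= subr_ge0.
apply: card_eq_trans (inj_card_eq _) _; first by move=> i j _ _; apply: facet_inj.
rewrite card_eq_sym; apply: card_eq_trans card_II _.
rewrite card_eq_sym -(_ : enum_rank @` setT = setT)%classic.
  by rewrite card_eq_sym; apply: inj_card_eq => i j _ _; apply: enum_rank_inj.
by apply/predeqP => i; split=> // _; exists (enum_val i); rewrite ?enum_valK.
Qed.

End Facets.

Lemma bounded_coord (R : realType) n (A : set 'rV[R]_n) : bounded_set A ->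
  exists D, forall x, A x -> forall k, `|x 0 k| <= D.
Proof.
move=> [D [_ /(_ (D + 1))]]; rewrite ltrDl => /(_ ltr01) hD; exists (D + 1) => x /hD h k; apply: le_trans h.
rewrite [leRHS]mx_normrE; exact: (le_bigmax _ (fun i : 'I_1 * 'I_n => `|x i.1 i.2|) (0, k)).
Qed.

Lemma interior_step (R : realType) n (A : set 'rV[R]_n) x u : interior A x ->
  exists2 t, 0 < t & A (x + t *: u).
Proof.
move=> /nbhs_ballP[e /= e0 he].
have n0 : 0 < 1 + `|u| by rewrite ltr_pwDl.
exists (e / (1 + `|u|) / 2); first by rewrite !divr_gt0.
apply: he; rewrite -ball_normE /ball_ /= opprD addrA subrr add0r normrN normrZ.
rewrite gtr0_norm ?divr_gt0 //.
rewrite mulrAC ltr_pdivrMr // mulrAC ltr_pdivrMr //.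
by have := normr_ge0 u; nra.
Qed.

Section Irredundant.
Variables (R : realType) (n : nat) (I0 : finType) (a : I0 -> 'rV[R]_n) (b : I0 -> R).
Implicit Types (J : {set I0}).

Definition sub_system J x := forall i, i \in J -> 0 <= slack a b i x.

(** Take a minimal set of inequalities that imply all others. A point that violates
only the inequality [i] exists by minimality, and the segment to it from an inner
point crosses the plane of [i] in a witness. *)
Lemma irredundant_subset : (forall i, a i != 0) ->
  bounded_set [set x | inP a b x]%classic -> (interior [set x | inP a b x] !=set0)%classic ->
  exists (I : finType) (f : I -> I0), irredundant (a \o f) (b \o f) /\
    forall x, inP (a \o f) (b \o f) x <-> inP a b x.
Proof.
move=> a0 /bounded_coord bd [z hz].
have ex : exists J, `[< forall x, sub_system J x -> inP a b x >].
  by exists [set: I0]; apply/asboolP => x h i; apply: h; rewrite finset.inE.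
have [J0 hJ0] := ex.
pose good J := `[< forall x, sub_system J x -> inP a b x >].
case: (@arg_minnP _ J0 good (fun J => #|J|) hJ0) => J /asboolP hJ Jmin.
have sz i : 0 < slack a b i z.
  have [t t0 /(_ i)] := interior_step (a i) hz.
  by rewrite slackD dotZr; have := dot_sq (a0 i); nra.
pose f (i : {i | i \in J}) := val i; exists {i | i \in J}, f; have inJ x : inP (a \o f) (b \o f) x <-> inP a b x.
  by split=> [h|h i]; [apply: hJ => i iJ; exact: (h (exist _ i iJ))|apply: (h (f i))].
split=> //; split.
- by have [D hD] := bd; exists D => x /inJ; apply: hD.
- by exists z => i; apply: sz.
move=> [i iJ].
have [y [yJ yi]] : exists y, sub_system (J :\ i) y /\ slack a b i y < 0.
  apply: contrapT => /forallNP h.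
  have : (#|J| <= #|J :\ i|)%N.
    apply: Jmin; apply/asboolP => x hx; apply: hJ => j jJ.
    case: (eqVneq j i) => [->|ji]; last by apply: hx; rewrite finset.in_setD1 ji.
    by rewrite leNgt; apply/negP => hi; apply: (h x).
  by rewrite (cardsD1 i J) iJ ltnn.
pose t := slack a b i z / (slack a b i z - slack a b i y).
have t01 : 0 < t < 1.
  have := sz i => s0; rewrite /t divr_gt0 ?ltr_pdivrMr ?mul1r; lra.
exists ((1 - t) *: z + t *: y); split=> [|[j jJ] ji]; rewrite [LHS]slack_mid || rewrite [ltRHS]slack_mid.
  have : t * (slack a b i z - slack a b i y) = slack a b i z.
    by rewrite /t divfK // gt_eqF //; have := sz i; lra.
  by rewrite /slack /=; lra.
have : 0 <= slack a b j y by apply: yJ; rewrite finset.in_setD1 jJ andbT; apply: contraNneq ji => e; apply/eqP/val_inj.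
by move: (sz j); rewrite /slack /=; nra.
Qed.

End Irredundant.

Local Open Scope classical_set_scope.
Local Open Scope ring_scope.

Theorem theorem4p1 (R : realType) (P : set 'rV[R]_3)
  (hP : convex_polyhedron P) (hU : universal_tiler P) :
  tetrahedron P \/ pentahedron P.
Proof.
have [[k [a [b [a0 eP]]]] bP iP] := hP.
have PE : P = [set x | inP a b x].
  rewrite eP; apply/predeqP => x; split=> [h i|h i _].
    by rewrite subr_ge0; apply: h.
  by have := h i; rewrite subr_ge0.
have [I [f [Ir fP]]] : exists (I : finType) (f : I -> 'I_k),
    irredundant (a \o f) (b \o f) /\ forall x, inP (a \o f) (b \o f) x <-> inP a b x.
  by apply: irredundant_subset => //; rewrite -PE.
have {}PE : P = [set x | inP (a \o f) (b \o f) x].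
  by rewrite PE; apply/predeqP => x; have [h h'] := fP x; split.
have F := card_facets Ir; rewrite -PE in F.
have T : forall C, cross_section [set x | inP (a \o f) (b \o f) x] C -> tiles_plane C.
  by rewrite -PE; have [_] := hU.
by have [e|e] := four_or_five_facets Ir T; [left|right]; split=> //; rewrite -e.
Qed.
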